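(* Let $n\ge 1$, let $D\subset\mathbb{R}^n$ be a bounded $C^2$-domain, let $H>0$, and let $u\in H_0^1(D)\cap C(\bar D)$ satisfy $u\ge -H$ in $D$ and be such that $\Omega(u)$ has the segment property. Let $\sigma\in C(\bar D\times[-H-1,-H])$ with $\min\sigma>0$, and let $h_b\in C^2(\bar D\times[-H-1,-H]\times[-H,\infty))$ and $h\in C^2(\bar D\times[-H,\infty)\times[-H,\infty))$ be real-valued functions satisfying, for all $(x,w)\in D\times[-H,\infty)$, $$h_b(x,-H,w)=h(x,-H,w),\qquad \sigma(x,-H)\,\partial_z h_b(x,-H,w)=\partial_z h(x,-H,w).$$ Fix $M\ge \|u\|_{L_\infty(D)}+H$ and set $\Omega_M:=D\times(-H-1,M)$. Let $G_\delta$ ($\delta\in(0,1)$) and $G$ be the functionals $L_2(\Omega_M)\to[0,\infty]$ defined in the context. Then $$\Gamma\text{-}\lim_{\delta\to0}G_\delta=G\quad\text{in } L_2(\Omega_M),$$ i.e. $(G_\delta)_{\delta\in(0,1)}$ $\Gamma$-converges to $G$ as $\delta\to 0$ with respect to the (norm) topology of $L_2(\Omega_M)$.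
   Context: Geometry: $\mathcal{R}_\delta:=D\times(-H-\delta,-H)$; $\Omega(u):=\{(x,z)\in D\times\mathbb{R}: -H<z<u(x)\}$; $\Omega_\delta(u):=\{(x,z)\in D\times\mathbb{R}: -H-\delta<z<u(x)\}$; coincidence set $\mathcal{C}(u):=\{x\in D: u(x)=-H\}$ (possibly non-empty, and $\Omega(u)$ need be neither connected nor Lipschitz). Segment property: an open set $\Omega\subset\mathbb{R}^N$ has the segment property if for every $y_0\in\partial\Omega$ there are a neighbourhood $U$ of $y_0$ and a nonzero vector $v\in\mathbb{R}^N$ such that $y+tv\in\Omega$ for all $y\in\overline{\Omega}\cap U$ and $t\in(0,1)$. Permittivity: for $\delta\in(0,1)$, $\sigma_\delta:=\delta\sigma$ in $\mathcal{R}_\delta$ and $\sigma_\delta:=1$ in $\Omega(u)$. Boundary data: variables of $h_b,h$ are $(x,z,w)$. Set $h_\delta(x,z,w):=h_b\big(x,-H+\tfrac{z+H}{\delta},w\big)$ for $z\in[-H-\delta,-H)$ and $h_\delta(x,z,w):=h(x,z,w)$ for $z\ge -H$. Put $h_{u,\delta}(x,z):=h_\delta(x,z,u(x))$ on $\Omega_\delta(u)$, $h_u(x,z):=h(x,z,u(x))$ on $\Omega(u)$ (with $h_u(x,-H):=h(x,-H,u(x))$ for $x\in D$), and $\mathfrak{h}_u(x,-H):=h_b(x,-H-1,u(x))$ for $x\in\bar D$. Function space: $H_B^1(\Omega(u))$ is the closure in $H^1(\Omega(u))$ of $C_B^1(\overline{\Omega(u)})$, the set of all $\vartheta\in C^1(\overline{\Omega(u)})$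 with $\vartheta(x,u(x))=0$ for $x\in D$ and $\vartheta(x,z)=0$ for $(x,z)\in\partial D\times(-H,0]$. For $\vartheta\in H_B^1(\Omega(u))$, $\vartheta(\cdot,-H)\in L_2(D)$ denotes the trace on $\{z=-H\}$, i.e. the continuous extension to $H_B^1(\Omega(u))$ of the map $\vartheta\mapsto\vartheta(\cdot,-H)$ on $C_B^1(\overline{\Omega(u)})$, with the convention $\vartheta(x,-H):=0$ for $x\in\mathcal{C}(u)$. Functions in $H_0^1(\Omega_\delta(u))$ and $H_B^1(\Omega(u))$ are regarded as elements of $L_2(\Omega_M)$ through extension by zero. Functionals: $G_\delta[\vartheta]:=\frac12\int_{\Omega_\delta(u)}\sigma_\delta|\nabla(\vartheta+h_{u,\delta})|^2\,d(x,z)$ if $\vartheta\in H_0^1(\Omega_\delta(u))$, and $G_\delta[\vartheta]:=\infty$ if $\vartheta\in L_2(\Omega_M)\setminus H_0^1(\Omega_\delta(u))$. $G[\vartheta]:=\frac12\int_{\Omega(u)}|\nabla(\vartheta+h_u)|^2\,d(x,z)+\frac12\int_D\sigma(x,-H)\,\big|\vartheta(x,-H)+h_u(x,-H)-\mathfrak{h}_u(x,-H)\big|^2\,dx$ if $\vartheta\in H_B^1(\Omega(u))$, and $G[\vartheta]:=\infty$ if $\vartheta\in L_2(\Omega_M)\setminus H_B^1(\Omega(u))$. *)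

(* Defs.v *)
From HB Require Import structures.
From mathcomp Require Import all_boot all_order all_algebra.
From mathcomp Require Import all_classical all_reals all_analysis.

Set Implicit Arguments.
Unset Strict Implicit.
Unset Printing Implicit Defensive.

Import Order.TTheory GRing.Theory Num.Theory.
Import numFieldNormedType.Exports.

Local Open Scope classical_set_scope.
Local Open Scope ring_scope.

(** * Lebesgue measure on R^n, realised as ['rV[R]_n] *)

Definition rV_display : measure_display. Proof. exact. Qed.

Section measurable_rV.
Context (R : realType) (n : nat).

Let coord (i : 'I_n) (x : 'rV[R]_n) : R := x 0 i.

Let rV_set0 : g_sigma_preimage coord set0.
Proof. exact: sigma_algebra0. Qed.

Let rV_setC A : g_sigma_preimage coord A -> g_sigma_preimage coord (~` A).
Proof. exact: sigma_algebraC. Qed.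

Let rV_bigcup (F : (set 'rV[R]_n)^nat) :
  (forall i, g_sigma_preimage coord (F i)) ->
  g_sigma_preimage coord (\bigcup_i (F i)).
Proof. exact: sigma_algebra_bigcup. Qed.

(* The sigma-algebra generated by the coordinates, i.e. the Borel sets. Every
   Lebesgue class of functions has a Borel representative. *)
HB.instance Definition _ := @isMeasurable.Build rV_display 'rV[R]_n
  (g_sigma_preimage coord) rV_set0 rV_setC rV_bigcup.

Lemma measurable_coord (i : 'I_n) :
  measurable_fun [set: 'rV[R]_n] (fun x => x 0 i).
Proof.
move=> _ Y mY; rewrite setTI; apply: sub_sigma_algebra => /=.
rewrite -bigcup_seq/=; exists i => /=; first by rewrite mem_index_enum.
by exists Y => //; rewrite setTI.
Qed.

Lemma measurable_fun_coordP d (T : measurableType d) (f : T -> 'rV[R]_n) :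
  (forall i, measurable_fun [set: T] (fun x => f x 0 i)) ->
  measurable_fun [set: T] f.
Proof.
move=> mf.
have : g_sigma_preimage (fun i => coord i \o f) `<=` measurable.
  apply: smallest_sub; first exact: sigma_algebra_measurable.
  rewrite -bigcup_seq; apply: bigcup_sub => i _.
  by move=> A [B mB <-]; exact: mf.
by rewrite g_sigma_preimage_comp => prefS _ A mA; apply: prefS; exists A.
Qed.

End measurable_rV.

Section lebesgue_rV.
Context (R : realType).

Section step.
Variables (n : nat) (m : {sigma_finite_measure set 'rV[R]_n -> \bar R}).

Definition consrV (p : R * 'rV[R]_n) : 'rV[R]_n.+1 :=
  \row_i (if unlift ord0 i is Some j then p.2 0 j else p.1).

Definition unconsrV (y : 'rV[R]_n.+1) : R * 'rV[R]_n :=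
  (y 0 ord0, \row_j y 0 (lift ord0 j)).

Lemma consrVK : cancel consrV unconsrV.
Proof.
case=> a x; congr pair; first by rewrite mxE unlift_none.
by apply/rowP => j; rewrite !mxE liftK.
Qed.

Lemma unconsrVK : cancel unconsrV consrV.
Proof.
by move=> y; apply/rowP => i; rewrite !mxE; case: unliftP => [j|] -> //=; rewrite mxE.
Qed.

Lemma measurable_consrV : measurable_fun [set: R * 'rV[R]_n] consrV.
Proof.
apply: measurable_fun_coordP => i; case: (unliftP ord0 i) => [j|] ->.
  rewrite (_ : (fun _ => _) = (fun y : 'rV[R]_n => y 0 j) \o snd).
    by apply: measurableT_comp => //; exact: measurable_coord.
  by apply/funext => p /=; rewrite mxE liftK.
rewrite (_ : (fun _ => _) = fst) //.
by apply/funext => p /=; rewrite mxE unlift_none.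
Qed.

Lemma measurable_unconsrV : measurable_fun [set: 'rV[R]_n.+1] unconsrV.
Proof.
apply/measurable_fun_pairP; split; first exact: measurable_coord.
apply: measurable_fun_coordP => j.
rewrite (_ : (fun _ => _) = (fun y : 'rV[R]_n.+1 => y 0 (lift ord0 j))).
  exact: measurable_coord.
by apply/funext => y /=; rewrite mxE.
Qed.

Definition leb_step : set 'rV[R]_n.+1 -> \bar R :=
  pushforward (@lebesgue_measure R \x m)%E consrV.

Let leb_step0 : leb_step set0 = 0%E.
Proof. by rewrite /leb_step /pushforward preimage_set0 measure0. Qed.

Let measurable_preimage_consrV (A : set 'rV[R]_n.+1) :
  measurable A -> measurable (consrV @^-1` A).
Proof. by move=> mA; rewrite -[X in measurable X]setTI; exact: measurable_consrV. Qed.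

Let leb_step_ge0 A : (0 <= leb_step A)%E.
Proof. by rewrite /leb_step /pushforward; exact: (measure_ge0 (@lebesgue_measure R \x m)%E). Qed.

Let leb_step_sigma_additive : semi_sigma_additive leb_step.
Proof.
move=> F mF tF mUF; rewrite /leb_step /pushforward preimage_bigcup.
apply: measure_semi_sigma_additive.
- by move=> k; exact: measurable_preimage_consrV.
- apply/trivIsetP => /= i j _ _ ij; rewrite -preimage_setI.
  by move/trivIsetP : tF => /(_ _ _ _ _ ij) ->//; rewrite preimage_set0.
- by rewrite -preimage_bigcup; exact: measurable_preimage_consrV.
Qed.

HB.instance Definition _ := isMeasure.Build _ _ _ leb_step
  leb_step0 leb_step_ge0 leb_step_sigma_additive.

Let leb_step_sigma_finite : sigma_finite setT leb_step.
Proof.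
have /sigma_finiteP[F [TF ndF Foo]] := sigma_finiteT (@lebesgue_measure R).
have /sigma_finiteP[G [TG ndG Goo]] := sigma_finiteT m.
exists (fun k => unconsrV @^-1` (F k `*` G k)).
  rewrite -preimage_bigcup (_ : \bigcup_k _ = setT) ?preimage_setT//.
  apply/seteqP; split => // -[x y] _.
  have [i _ Fx] : (\bigcup_i F i) x by rewrite -TF.
  have [j _ Gy] : (\bigcup_i G i) y by rewrite -TG.
  exists (maxn i j) => //; split.
    by move: Fx; exact/subsetPset/ndF/leq_maxl.
  by move: Gy; exact/subsetPset/ndG/leq_maxr.
move=> k; have [mF Fk] := Foo k; have [mG Gk] := Goo k; split.
  by rewrite -[X in measurable X]setTI; apply: measurable_unconsrV => //;
    exact: measurableX.
rewrite /leb_step /pushforward -comp_preimage (_ : _ \o _ = id); last first.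
  by apply/funext => p /=; rewrite consrVK.
by rewrite preimage_id product_measure1E// lte_mul_pinfty// ge0_fin_numE.
Qed.

HB.instance Definition _ := @Measure_isSigmaFinite.Build _ _ _ leb_step
  leb_step_sigma_finite.

End step.

Definition dirac0 : set 'rV[R]_0 -> \bar R := \d_(0 : 'rV[R]_0).
HB.instance Definition _ := Measure.on dirac0.
Let dirac0_sigma_finite : sigma_finite setT dirac0.
Proof.
exists (fun=> setT); first by rewrite bigcup_const.
by move=> _; split; rewrite // /dirac0 diracT ltry.
Qed.
HB.instance Definition _ := @Measure_isSigmaFinite.Build _ _ _ dirac0
  dirac0_sigma_finite.

Fixpoint leb n : {sigma_finite_measure set 'rV[R]_n -> \bar R} :=
  if n is n'.+1 then leb_step (leb n') else dirac0.

End lebesgue_rV.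

Arguments leb {R} n.

(** * Classes C^k *)

Section differentiability.
Context (R : realType) (N : nat).
Implicit Types (A : set 'rV[R]_N) (f : 'rV[R]_N -> R).

Definition basis_vec (i : 'I_N) : 'rV[R]_N := delta_mx 0 i.

Fixpoint Ck (k : nat) f : Prop :=
  continuous f /\
  if k is k'.+1 then
    forall i, (forall x, derivable f x (basis_vec i)) /\
              Ck k' ('D_(basis_vec i) f)
  else True.

(* For A open: f is C^k in A and its derivatives up to order k extend
   continuously to [closure A]. Values of f outside [closure A] are
   irrelevant. *)
Fixpoint Ck_closure (k : nat) A f : Prop :=
  {within closure A, continuous f} /\
  if k is k'.+1 then
    forall i, (forall x, A x -> derivable f x (basis_vec i)) /\
      exists g, (forall x, A x -> g x = 'D_(basis_vec i) f x) /\
                Ck_closure k' A g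
  else True.

(* value at a point x of [closure A] of the continuous extension of the i-th
   partial derivative of a function that is C^1 up to the boundary of A *)
Definition pderiv_closure A (i : 'I_N) f (x : 'rV[R]_N) : R :=
  lim ('D_(basis_vec i) f @ within A (nbhs x)).

Definition boundary A : set 'rV[R]_N := closure A `\` interior A.

Definition segment_property A : Prop :=
  forall y0, boundary A y0 ->
    exists (U : set 'rV[R]_N) (v : 'rV[R]_N),
      [/\ nbhs y0 U, v != 0 &
        forall y t, (closure A `&` U) y -> 0 < t < 1 -> A (y + t *: v)].

End differentiability.

(* A nonempty connected open set which near each boundary point is, up to
   relabelling and reorienting the coordinate axes, the region above the graph
   of a C^2 function of the other n - 1 coordinates. *)
Definition C2_domain (R : realType) (n : nat) (D : set 'rV[R]_n) : Prop :=
  [/\ open D, connected D, D !=set0 &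
    forall x0, boundary D x0 ->
      exists (i : 'I_n) (s : bool) (g : 'rV[R]_(n.-1) -> R)
             (U : set 'rV[R]_n),
        [/\ Ck 2 g, nbhs x0 U &
          forall x, U x -> (D x <-> g (col' i x) < (-1) ^+ s * x 0 i)]].

(** * Sobolev spaces *)

Section sobolev.
Context (R : realType) (N : nat).
Implicit Types (A : set 'rV[R]_N) (f g : 'rV[R]_N -> R).

Definition L2 A f : Prop := (f \_ A) \in Lfun (leb N) 2%:E.

Definition L2norm A f : \bar R := 'N[leb N]_(2%:E)[EFin \o (f \_ A)]%E.

Definition test_function A f : Prop :=
  (forall k, Ck k f) /\
  exists K, [/\ compact K, K `<=` A & forall x, ~ K x -> f x = 0].

Definition is_weak_pderiv A (i : 'I_N) f g : Prop :=
  L2 A g /\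
  forall phi, test_function A phi ->
    \int[leb N]_(x in A) (f x * 'D_(basis_vec R i) phi x) =
    - \int[leb N]_(x in A) (g x * phi x).

Definition H1 A f : Prop :=
  L2 A f /\ forall i, exists g, is_weak_pderiv A i f g.

(* a representative of the weak partial derivative, unique a.e. in A *)
Definition weak_pderiv A (i : 'I_N) f : 'rV[R]_N -> R :=
  xget (fun=> 0) [set g | is_weak_pderiv A i f g].

Definition grad_sq A f (x : 'rV[R]_N) : R :=
  \sum_(i < N) weak_pderiv A i f x ^+ 2.

Definition H1norm A f : \bar R :=
  ((\int[leb N]_(x in A) (f x ^+ 2 + grad_sq A f x)%:E) `^ 2^-1)%E.

Definition H10 A f : Prop :=
  H1 A f /\ forall e : R, 0 < e ->
    exists phi, test_function A phi /\ (H1norm A (f \- phi)%R < e%:E)%E.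

Definition L2_nbhs A f : set_system ('rV[R]_N -> R) :=
  [set U | exists2 e : R, 0 < e &
    [set g | L2 A g /\ (L2norm A (g \- f)%R < e%:E)%E] `<=` U].

End sobolev.

(** * Gamma-convergence *)

(* [N x] is the neighbourhood system of the point x; the parameter of the
   family of functionals tends to 0 from the right. *)
Section gamma_convergence.
Context (R : realType) (X : Type) (N : X -> set_system X).
Implicit Types (F : R -> X -> \bar R) (x : X).

Definition gamma_liminf F x : \bar R :=
  ereal_sup [set limf_einf (fun d : R => ereal_inf (F d @` U)) (0 : R)^'+
            | U in N x].

Definition gamma_limsup F x : \bar R :=
  ereal_sup [set limf_esup (fun d : R => ereal_inf (F d @` U)) (0 : R)^'+
            | U in N x].

Definition gamma_cvg (P : set X) F (F0 : X -> \bar R) : Prop :=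
  forall x, P x -> gamma_liminf F x = F0 x /\ gamma_limsup F x = F0 x.

End gamma_convergence.

(** * The functionals *)

(* [pt x z] is the point (x, z) of R^m x R = R^(m+1) and [pt (pt x z) w] the
   point (x, z, w); [init] and [final] are the projections of R^m x R. *)
Section points.
Context (R : realType) (m : nat).
Definition pt (x : 'rV[R]_m) (z : R) : 'rV[R]_(m + 1) := row_mx x z%:M.
Definition init (y : 'rV[R]_(m + 1)) : 'rV[R]_m := lsubmx y.
Definition final (y : 'rV[R]_(m + 1)) : R := rsubmx y 0 0.
End points.

Section functionals.
Context (R : realType) (n : nat) (D : set 'rV[R]_n) (H : R).

Definition Omega_M (M : R) : set 'rV[R]_(n + 1) :=
  [set y | D (init y) /\ - H - 1 < final y < M].

(* the closed layer on which sigma is given *)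
Definition layer_closed : set 'rV[R]_(n + 1) :=
  [set y | closure D (init y) /\ - H - 1 <= final y <= - H].

(* interiors of the domains of h_b and h, in the variables (x, z, w) *)
Definition dom_hb : set 'rV[R]_(n + 1 + 1) :=
  [set y | [/\ D (init (init y)), - H - 1 < final (init y) < - H &
               - H < final y]].
Definition dom_h : set 'rV[R]_(n + 1 + 1) :=
  [set y | [/\ D (init (init y)), - H < final (init y) & - H < final y]].

(* index of the variable z among the coordinates (x, z, w) *)
Definition idx_z : 'I_(n + 1 + 1) := lshift 1 (rshift n ord0).

Variable u : 'rV[R]_n -> R.

Definition Omega : set 'rV[R]_(n + 1) :=
  [set y | D (init y) /\ - H < final y < u (init y)].

Definition Omega_ (d : R) : set 'rV[R]_(n + 1) :=
  [set y | D (init y) /\ - H - d < final y < u (init y)].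

(* C^1_B of the closure of Omega. The condition theta(x, u(x)) = 0 is imposed
   for all x in D; where u(x) = -H it encodes the convention
   theta(x, -H) = 0 (the point may lie outside [closure Omega]). *)
Definition C1_B (theta : 'rV[R]_(n + 1) -> R) : Prop :=
  [/\ Ck_closure 1 Omega theta,
      forall x, D x -> theta (pt x (u x)) = 0 &
      forall x z, boundary D x -> - H < z <= 0 -> theta (pt x z) = 0].

Definition H1_B (theta : 'rV[R]_(n + 1) -> R) : Prop :=
  H1 Omega theta /\ forall e : R, 0 < e ->
    exists phi, C1_B phi /\ (H1norm Omega (theta \- phi)%R < e%:E)%E.

(* t is the value at theta of the continuous extension, from C^1_B (with the
   H^1-norm) to H^1_B, of phi |-> phi(., -H) with values in L_2(D) *)
Definition is_trace (theta : 'rV[R]_(n + 1) -> R) (t : 'rV[R]_n -> R) : Prop :=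
  L2 D t /\ forall e : R, 0 < e -> exists2 r : R, 0 < r &
    forall phi, C1_B phi -> (H1norm Omega (theta \- phi)%R < r%:E)%E ->
      (L2norm D (fun x => phi (pt x (- H)) - t x)%R < e%:E)%E.

Definition trace (theta : 'rV[R]_(n + 1) -> R) (x : 'rV[R]_n) : R :=
  if u x == - H then 0
  else xget (fun=> 0) [set t | is_trace theta t] x.

Variables (sigma : 'rV[R]_(n + 1) -> R) (hb h : 'rV[R]_(n + 1 + 1) -> R).

(* only used on Omega_ d; on the null set {z = -H} the value is immaterial *)
Definition sigma_ (d : R) (y : 'rV[R]_(n + 1)) : R :=
  if final y < - H then d * sigma y else 1.

Definition h_ (d : R) (x : 'rV[R]_n) (z w : R) : R :=
  if z < - H then hb (pt (pt x (- H + (z + H) / d)) w) else h (pt (pt x z) w).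

Definition hu_ (d : R) (y : 'rV[R]_(n + 1)) : R :=
  h_ d (init y) (final y) (u (init y)).

Definition hu (y : 'rV[R]_(n + 1)) : R := h (pt y (u (init y))).

Definition frak_hu (x : 'rV[R]_n) : R := hb (pt (pt x (- H - 1)) (u x)).

Variable M : R.

(* theta, an element of L_2(Omega_M), vanishes off A: together with membership
   of a space of functions on A this says that theta is the extension by zero
   of an element of that space *)
Definition zero_off (A : set 'rV[R]_(n + 1)) (theta : 'rV[R]_(n + 1) -> R) :=
  {ae leb (n + 1), forall y, (Omega_M M `\` A) y -> theta y = 0}.

Definition G_ (d : R) (theta : 'rV[R]_(n + 1) -> R) : \bar R :=
  (if `[< H10 (Omega_ d) theta /\ zero_off (Omega_ d) theta >] then
    (2^-1)%:E * \int[leb (n + 1)]_(y in Omega_ d)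
      (sigma_ d y * grad_sq (Omega_ d) (theta \+ hu_ d)%R y)%:E
  else +oo)%E.

Definition G (theta : 'rV[R]_(n + 1) -> R) : \bar R :=
  (if `[< H1_B theta /\ zero_off Omega theta >] then
    (2^-1)%:E * \int[leb (n + 1)]_(y in Omega)
      (grad_sq Omega (theta \+ hu)%R y)%:E
    + (2^-1)%:E * \int[leb n]_(x in D)
      (sigma (pt x (- H)) *
       `|trace theta x + hu (pt x (- H)) - frak_hu x| ^+ 2)%:E
  else +oo)%E.

End functionals.

(* Main.v *)
(** Writing [g] in [H^1_0(Omega_delta)] as a limit of test functions, Cauchy-Schwarz on
each vertical segment of the layer bounds [\int delta sigma (d_z (g + h_delta))^2] from
below by [sigma (x, -H)] times the squared increment of [g + h_delta], which is
[(g + h_u - h_b(., -H - 1, u)) (x, -H)]: up to factors tending to 1 the energy [G_delta g]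
dominates [G] evaluated at the restriction of [g] to [Omega u].  This gives the lower bound,
once the limit functional is known to be lower semicontinuous in [L_2]: near-minimisers on
small [L_2]-balls form a Cauchy sequence in [H^1] by the parallelogram identity, and the
bottom trace is controlled by the [H^1]-norm on [Omega u], whatever its regularity.

For the upper bound, functions in [C^1_B] are truncated near zero and mollified by one-sided
kernels, so that test functions of [{x in D, z < u x}] are dense in [H^1_B].  Such a [Psi] is
multiplied in the layer by a smooth cut-off of [(z + H) / delta], and a test function [b] of the
unit layer, rescaled to thickness [delta], is added.  The derivative [d_s b] is chosen
[L_2]-close to the one which makes the vertical slope of the sum constant, i.e. which
gives equality in Cauchy-Schwarz; this profile need not be differentiable in [x],
because horizontal derivatives contribute only [O(delta)]. *)
Require Import Defs.
From HB Require Import structures.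
From mathcomp Require Import all_boot all_order all_algebra.
From mathcomp Require Import all_classical all_reals all_analysis.
From mathcomp Require Import measurable_realfun ess_sup_inf ring lra.

Set Implicit Arguments.
Unset Strict Implicit.
Unset Printing Implicit Defensive.

Import Order.TTheory GRing.Theory Num.Theory.
Import numFieldNormedType.Exports.

Local Open Scope classical_set_scope.
Local Open Scope ring_scope.

(** * Square-integrable functions *)

(** The obstacle is the shape of [Omega D H u]: it may be disconnected and have cusps where [u]
    comes down to [- H], so neither a trace theorem nor compactness up to the boundary is at hand.
    Everything is therefore read off vertical segments, on which the functions vanish at the top,
    and weak compactness is replaced by convexity of the quadratic energy.

    A second obstacle is that [u] is only continuous and in H^1_0, while the data contain [u x] in
    the slot [w]. Weak derivatives of such compositions are obtained from difference quotients: it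
    suffices that, on every compact subset, they come close in L^2 along some arbitrarily small
    steps. The quotients of [u] itself converge in L^2 because its extension by zero is controlled
    by test functions.

    Third, test functions must reach a C^1_B function up to the lateral and upper boundary without
    moving its values at the bottom. Truncation near zero detaches the support from those parts of
    the boundary, provided that [u] vanishes pointwise on the boundary of [D]; this is where the
    local graph representation of [D] enters. *)

Lemma measurable_sqr d (T : measurableType d) (R : realType) (A : set T) (f : T -> R) :
  measurable_fun A f -> measurable_fun A (fun x => (f x ^+ 2)%:E).
Proof. by move=> mf; apply/measurable_EFinP; exact: measurable_funX. Qed.

Section square_integrable.
Context d (T : measurableType d) (R : realType).
Variable mu : {measure set T -> \bar R}.
Implicit Types (A : set T) (f g : T -> R).

(** Squared L^2 norms are handled as real numbers [rsq], which makes them accessible to real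
    arithmetic; [sqint] is the side condition under which they are faithful. [L2P] and [L2norm_lt]
    translate to [L2] and [L2norm]. *)
Definition sqint A f :=
  measurable_fun A f /\ (\int[mu]_(x in A) (f x ^+ 2)%:E < +oo)%E.

Definition rsq A f : R := \int[mu]_(x in A) (f x ^+ 2).

Lemma rsq_ge0 A f : 0 <= rsq A f.
Proof. by apply: Rintegral_ge0 => x _; exact: sqr_ge0. Qed.

Lemma eq_rsq A f g : (forall x, A x -> f x = g x) -> rsq A f = rsq A g.
Proof. by move=> fg; apply: eq_Rintegral => x /set_mem /fg ->. Qed.

Lemma sqint_sqr A f : sqint A f -> mu.-integrable A (EFin \o (fun x => f x ^+ 2)).
Proof.
move=> [mf foo]; apply/integrableP; split.
  exact: measurable_sqr.
rewrite (le_lt_trans _ foo)// le_eqVlt; apply/orP; left; apply/eqP.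
by apply: eq_integral => x _ /=; rewrite ger0_norm ?sqr_ge0.
Qed.

Lemma rsqE A f : sqint A f -> (\int[mu]_(x in A) (f x ^+ 2)%:E)%E = (rsq A f)%:E.
Proof.
move=> fA; rewrite /rsq /Rintegral fineK// ge0_fin_numE; first by case: fA.
by apply: integral_ge0 => x _; rewrite lee_fin sqr_ge0.
Qed.

Lemma eq_sqint A f g : (forall x, A x -> f x = g x) -> sqint A f -> sqint A g.
Proof.
move=> fg [mf foo]; split.
  by apply: eq_measurable_fun mf => x /set_mem /fg.
by rewrite (_ : integral _ _ _ = \int[mu]_(x in A) (f x ^+ 2)%:E)%E//;
  apply: eq_integral => x /set_mem /fg ->.
Qed.

Section fixed_domain.
Variables (A : set T) (mA : measurable A).

Lemma sqint_dom f g : measurable_fun A f -> sqint A g ->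
  (forall x, A x -> f x ^+ 2 <= g x ^+ 2) -> sqint A f.
Proof.
move=> mf [mg goo] fg; split=> //; apply: le_lt_trans goo.
apply: ge0_le_integral => //=.
- by move=> x _; rewrite lee_fin sqr_ge0.
- exact: measurable_sqr.
- exact: measurable_sqr.
Qed.

Lemma sqintZ c f : sqint A f -> sqint A (fun x => c * f x).
Proof.
move=> fA; have [mf foo] := fA; split; first exact: measurable_funM.
rewrite (_ : integral _ _ _ = \int[mu]_(x in A) ((c ^+ 2)%:E * (f x ^+ 2)%:E))%E.
  rewrite ge0_integralZl_EFin ?sqr_ge0//.
  - by rewrite rsqE// -EFinM ltry.
  - by move=> x _; rewrite lee_fin sqr_ge0.
  - exact: measurable_sqr.
by apply: eq_integral => x _; rewrite exprMn EFinM.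
Qed.

Lemma rsqZ c f : sqint A f -> rsq A (fun x => c * f x) = c ^+ 2 * rsq A f.
Proof.
move=> fA; rewrite /rsq -RintegralZl//; last exact: sqint_sqr.
by apply: eq_Rintegral => x _; rewrite exprMn.
Qed.

Lemma sqintD f g : sqint A f -> sqint A g -> sqint A (f \+ g).
Proof.
move=> fA gA; have [mf foo] := fA; have [mg goo] := gA.
split; first exact: measurable_funD.
have i2 : mu.-integrable A ((EFin \o (fun x => 2 * f x ^+ 2)%R) \+ (EFin \o (fun x => 2 * g x ^+ 2)%R))%E.
  exact: (integrableD mA (integrableZl mA 2 (sqint_sqr fA)) (integrableZl mA 2 (sqint_sqr gA))).
apply: le_lt_trans (integrable_lty mA i2).
apply: ge0_le_integral => //=.
- by move=> x _; rewrite lee_fin sqr_ge0.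
- by apply: measurable_sqr; exact: measurable_funD.
- exact: measurable_int i2.
- by move=> x _; rewrite lee_fin; have := sqr_ge0 (f x - g x); nra.
Qed.

Lemma sqintN f : sqint A f -> sqint A (fun x => - f x).
Proof. by move=> /(sqintZ (-1)); apply: eq_sqint => x _; rewrite mulN1r. Qed.

Lemma sqintB f g : sqint A f -> sqint A g -> sqint A (f \- g).
Proof. by move=> fA /sqintN gA; exact: sqintD fA gA. Qed.

Lemma sqint_bounded f (C : R) : (mu A < +oo)%E -> measurable_fun A f ->
  (forall x, A x -> `|f x| <= C) -> sqint A f.
Proof.
move=> Aoo mf fC; split=> //.
have i2 : mu.-integrable A (EFin \o cst (C ^+ 2)).
  apply/integrableP; split; first by apply/measurable_EFinP; exact: measurable_cst.
  by rewrite (_ : (fun _ => _) = cst `|(C ^+ 2)%:E|%E)// integral_cst// lte_mul_pinfty.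
apply: le_lt_trans (integrable_lty mA i2).
apply: ge0_le_integral => //=.
- by move=> x _; rewrite lee_fin sqr_ge0.
- exact: measurable_sqr.
- by apply/measurable_EFinP; exact: measurable_cst.
- by move=> x Ax; rewrite lee_fin -real_normK ?num_real// ler_pXn2r ?nnegrE//;
    [exact: fC|exact: le_trans (fC x Ax)].
Qed.

Lemma sqint_cst C : (mu A < +oo)%E -> sqint A (cst C).
Proof. by move=> Aoo; apply: (@sqint_bounded _ `|C|). Qed.

Lemma sqint_mul f g : sqint A f -> sqint A g ->
  mu.-integrable A (EFin \o (fun x => f x * g x)).
Proof.
move=> fA gA; have [mf foo] := fA; have [mg goo] := gA.
have i2 : mu.-integrable A ((EFin \o (fun x => f x ^+ 2)%R) \+ (EFin \o (fun x => g x ^+ 2)%R))%E.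
  by apply: integrableD => //=; exact: sqint_sqr.
apply: le_integrable i2 => //.
  by apply/measurable_EFinP; exact: measurable_funM.
move=> x _ /=; rewrite lee_fin normrM [leRHS]ger0_norm ?addr_ge0 ?sqr_ge0//.
rewrite -[f x ^+ 2]real_normK ?num_real// -[g x ^+ 2]real_normK ?num_real//.
by have := sqr_ge0 (`|f x| - `|g x|); have := normr_ge0 (f x);
  have := normr_ge0 (g x); nra.
Qed.

Lemma sqint_integrable f : (mu A < +oo)%E -> sqint A f -> mu.-integrable A (EFin \o f).
Proof.
move=> Aoo fA; have := sqint_mul fA (sqint_cst 1 Aoo).
by apply: eq_integrable => // x _ /=; rewrite mulr1.
Qed.

Lemma le_rsq f g : measurable_fun A f -> sqint A g ->
  (forall x, A x -> f x ^+ 2 <= g x ^+ 2) -> rsq A f <= rsq A g.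
Proof.
move=> mf gA fg; apply: le_Rintegral => //; first exact/sqint_sqr/(sqint_dom mf gA).
exact: sqint_sqr.
Qed.

(** The two integrands differ by a perfect square. The free weight [e] is what later allows energies
    to be compared up to a factor tending to 1. *)
Lemma rsqD_le e f g : 0 < e -> sqint A f -> sqint A g ->
  rsq A (f \+ g) <= (1 + e) * rsq A f + (1 + e^-1) * rsq A g.
Proof.
move=> e0 fA gA; have [mf foo] := fA; have [mg goo] := gA.
have If := sqint_sqr fA; have Ig := sqint_sqr gA.
rewrite /rsq -RintegralZl// -RintegralZl// -RintegralD//; last 2 first.
- exact: (integrableZl mA (1 + e) If).
- exact: (integrableZl mA (1 + e^-1) Ig).
apply: le_Rintegral => //.
- exact/sqint_sqr/sqintD.
- apply: (integrableD mA (integrableZl mA (1 + e) If) (integrableZl mA (1 + e^-1) Ig)).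
move=> x _ /=; rewrite -subr_ge0.
have -> : (1 + e) * f x ^+ 2 + (1 + e^-1) * g x ^+ 2 - (f x + g x) ^+ 2 =
  e * (f x - e^-1 * g x) ^+ 2 by field; rewrite gt_eqF.
by rewrite mulr_ge0 ?sqr_ge0 ?ltW.
Qed.

Lemma rsqD2 f g : sqint A f -> sqint A g ->
  rsq A (f \+ g) <= 2 * rsq A f + 2 * rsq A g.
Proof. by move=> fA gA; have := rsqD_le ltr01 fA gA; rewrite invr1; lra. Qed.

Lemma rsqN f : rsq A (fun x => - f x) = rsq A f.
Proof. by apply: eq_Rintegral => x _; rewrite sqrrN. Qed.

Lemma rsqB2 f g : sqint A f -> sqint A g ->
  rsq A (f \- g) <= 2 * rsq A f + 2 * rsq A g.
Proof. by move=> fA gA; have := rsqD2 fA (sqintN gA); rewrite rsqN. Qed.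

Lemma rsqC f g : rsq A (f \- g) = rsq A (g \- f).
Proof. by apply: eq_Rintegral => x _; rewrite -sqrrN opprB. Qed.

Lemma rsq_tri h f g : sqint A f -> sqint A g -> sqint A h ->
  rsq A (f \- g) <= 2 * rsq A (f \- h) + 2 * rsq A (h \- g).
Proof.
move=> fA gA hA; have := rsqD2 (sqintB fA hA) (sqintB hA gA).
by rewrite (@eq_rsq _ ((f \- h) \+ (h \- g)) (f \- g))// => x _ /=; lra.
Qed.

Lemma rsq_parallelogram f g : sqint A f -> sqint A g ->
  rsq A (fun x => (f x + g x) / 2) + rsq A (fun x => (f x - g x) / 2) =
  (rsq A f + rsq A g) / 2.
Proof.
move=> fA gA; have If := sqint_sqr fA; have Ig := sqint_sqr gA.
have -> : rsq A (fun x => (f x + g x) / 2) = 2^-1 ^+ 2 * rsq A (f \+ g).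
  rewrite -rsqZ; last exact: sqintD.
  by apply: eq_rsq => x _; rewrite mulrC.
have -> : rsq A (fun x => (f x - g x) / 2) = 2^-1 ^+ 2 * rsq A (f \- g).
  rewrite -rsqZ; last exact: sqintB.
  by apply: eq_rsq => x _; rewrite mulrC.
have : rsq A (f \+ g) + rsq A (f \- g) = 2 * rsq A f + 2 * rsq A g; last by lra.
rewrite /rsq -!RintegralZl// -!RintegralD//; last 4 first.
- exact: (integrableZl mA 2 If).
- exact: (integrableZl mA 2 Ig).
- exact/sqint_sqr/sqintD.
- exact/sqint_sqr/sqintB.
by apply: eq_Rintegral => x _ /=; ring.
Qed.

(** Cauchy-Schwarz in additive form, with a weight to be optimised by the caller; no square root
    appears. *)
Lemma rsq_mul_le e f g : 0 < e -> sqint A f -> sqint A g ->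
  `|\int[mu]_(x in A) (f x * g x)| <= e * rsq A f + e^-1 * rsq A g.
Proof.
move=> e0 fA gA; have If := sqint_sqr fA; have Ig := sqint_sqr gA.
have Ifg := sqint_mul fA gA.
apply: le_trans (le_normr_Rintegral mA Ifg) _.
rewrite /rsq -!RintegralZl// -!RintegralD//; last 2 first.
- exact: (integrableZl mA e If).
- exact: (integrableZl mA e^-1 Ig).
apply: le_Rintegral => //.
- exact: integrable_norm.
- apply: (integrableD mA (integrableZl mA e If) (integrableZl mA e^-1 Ig)).
move=> x _ /=; rewrite normrM -[f x ^+ 2]real_normK ?num_real//.
rewrite -[g x ^+ 2]real_normK ?num_real//.
have := normr_ge0 (g x); have := normr_ge0 (f x).
move: `|f x| `|g x| => a b a0 b0.
rewrite -subr_ge0 (_ : _ - _ = e * (a - e^-1 * b) ^+ 2 + a * b); last first.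
  by field; rewrite gt_eqF.
apply: addr_ge0; apply: mulr_ge0 => //; [exact: ltW|exact: sqr_ge0].
Qed.

Lemma sqint_ae0 f : sqint A f -> rsq A f = 0 -> {ae mu, forall x, A x -> f x = 0}.
Proof.
move=> fA f0; have If := sqint_sqr fA.
have [+ _] := ae_eq_integral_abs mu mA (measurable_int mu If).
move=> /(_ _)[].
  rewrite (eq_integral (fun x => (f x ^+ 2)%:E)).
    by rewrite rsqE// f0.
  by move=> x _ /=; rewrite ger0_norm ?sqr_ge0.
move=> N [mN N0 sN]; exists N; split => // x /= nx; apply: sN => /= h; apply: nx => Ax.
by have [/eqP] := h Ax; rewrite sqrf_eq0 => /eqP.
Qed.

Lemma ae_rsq0 f : {ae mu, forall x, A x -> f x = 0} -> measurable_fun A f -> rsq A f = 0.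
Proof.
move=> f0 mf; rewrite /rsq /Rintegral.
rewrite (ae_eq_integral (cst 0%E))//.
- by rewrite integral0.
- exact: measurable_sqr.
- move: f0 => [N [mN N0 sN]]; exists N; split => // x /= nx; apply: sN => /= h.
  by apply: nx => Ax; rewrite h// expr0n.
Qed.

Lemma ae_rsq f g : {ae mu, forall x, A x -> f x = g x} -> measurable_fun A f ->
  measurable_fun A g -> rsq A f = rsq A g.
Proof.
move=> fg mf mg; rewrite /rsq /Rintegral; congr fine.
apply: ae_eq_integral => //.
- exact: measurable_sqr.
- exact: measurable_sqr.
- move: fg => [N [mN N0 sN]]; exists N; split => // x /= nx; apply: sN => /= h.
  by apply: nx => Ax; rewrite h.
Qed.

Lemma rsq_dct (f : nat -> T -> R) g :
  (forall k, measurable_fun A (f k)) -> sqint A g ->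
  (forall k x, A x -> `|f k x| <= `|g x|) ->
  {ae mu, forall x, A x -> f k x @[k --> \oo] --> 0} ->
  rsq A (f k) @[k --> \oo] --> 0.
Proof.
move=> mf gA fg f0.
have [] := @dominated_convergence _ _ _ mu A mA (fun k x => (f k x ^+ 2)%:E) (cst 0%E)
    (fun x => (g x ^+ 2)%:E).
- by move=> k; exact: measurable_sqr.
- exact: measurable_cst.
- move: f0 => [N [mN N0 sN]]; exists N; split => // x /= nx; apply: sN => /= h.
  apply: nx => Ax; apply: cvg_EFin; first by near=> k.
  rewrite (_ : _ \o _ = (fun k => f k x * f k x)); last by apply/funext => k /=; rewrite expr2.
  by rewrite -(mulr0 0); apply: cvgM; exact: h.
- exact: sqint_sqr.
- apply: aeW => x k Ax; rewrite /= lee_fin normrX -[g x ^+ 2]real_normK ?num_real//.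
  by rewrite ler_pXn2r ?nnegrE// fg.
move=> _ _; rewrite integral_cst// mul0e.
by move/fine_cvgP => [_].
Unshelve. all: by end_near.
Qed.

End fixed_domain.

Lemma sqint_subset A B f : measurable A -> measurable B -> A `<=` B ->
  sqint B f -> sqint A f.
Proof.
move=> mA mB AB [mf foo]; split; first exact: measurable_funS mf.
apply: le_lt_trans foo; apply: ge0_subset_integral => //.
  exact: measurable_sqr.
by move=> x _; rewrite lee_fin sqr_ge0.
Qed.

Lemma rsq_subset A B f : measurable A -> measurable B -> A `<=` B ->
  sqint B f -> rsq A f <= rsq B f.
Proof.
move=> mA mB AB fB; rewrite -lee_fin -!rsqE//; last exact: sqint_subset fB.
case: fB => mf _; apply: ge0_subset_integral => //.
  exact: measurable_sqr.
by move=> x _; rewrite lee_fin sqr_ge0.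
Qed.

Lemma sqint_setU A B f : measurable A -> measurable B ->
  sqint A f -> sqint B f -> sqint (A `|` B) f.
Proof.
move=> mA mB [mf foo] [mg goo]; split; first exact/measurable_funU.
have <- : A `|` (A `|` B) `\` A = A `|` B by rewrite setDUK// => x; left.
have mBA : measurable ((A `|` B) `\` A) by apply: measurableD => //; exact: measurableU.
have mfU : measurable_fun (A `|` B) f by exact/measurable_funU.
rewrite ge0_integral_setU//.
- rewrite lte_add_pinfty//; apply: le_lt_trans goo; apply: ge0_subset_integral => //.
  + exact: measurable_sqr.
  + by move=> x _; rewrite lee_fin sqr_ge0.
  + by move=> x [[]].
- apply: measurable_sqr.
  by apply: measurable_funS mfU => //; [exact: measurableU|move=> x [|[]]//; left].
- by move=> x _; rewrite lee_fin sqr_ge0.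
- by apply/disj_setPS => x [? []].
Qed.

Lemma rsq_setU A B f : measurable A -> measurable B -> [disjoint A & B] ->
  sqint (A `|` B) f -> rsq (A `|` B) f = rsq A f + rsq B f.
Proof.
move=> mA mB AB fAB; rewrite /rsq Rintegral_setU//; exact: sqint_sqr.
Qed.

(** Riesz-Fischer: a fast subsequence converges almost everywhere, and Fatou's lemma turns the
    pointwise limit into an L^2 limit of the whole sequence. *)
Lemma sqint_complete A (f : nat -> T -> R) : measurable A ->
  (forall k, sqint A (f k)) ->
  (forall e, 0 < e -> exists K, forall j k, (K <= j)%N -> (K <= k)%N ->
    rsq A (f j \- f k) <= e) ->
  exists g, sqint A g /\ rsq A (f k \- g) @[k --> \oo] --> 0.
Proof.
move=> mA fA Cf.
have /choice[K KP] : forall i, exists K, forall j k, (K <= j)%N -> (K <= k)%N ->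
    rsq A (f j \- f k) <= (8 ^+ i)^-1.
  by move=> i; apply: Cf; rewrite invr_gt0 exprn_gt0.
pose N i := (\sum_(j < i.+1) (K j).+1)%N.
have KN i : (K i <= N i)%N by rewrite /N big_ord_recr /= addnS ltnW// ltnS leq_addl.
have Nlt i : (N i < N i.+1)%N by rewrite /N [ltnRHS]big_ord_recr /= addnS ltnS leq_addr.
have NS i : (N i <= N i.+1)%N by exact: ltnW.
have NS0 i j : (i <= j)%N -> (N i <= N j)%N.
  by move/subnKC => <-; elim: (j - i)%N => [|m ih]; rewrite ?addn0// addnS (leq_trans ih).
pose g i := f (N i).
have gA i : sqint A (g i) by exact: fA.
have mgA i : measurable_fun A (g i) by case: (gA i).
pose D i x := g i.+1 x - g i x.
have DA i : sqint A (D i) by exact: sqintB.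
have mDA i : measurable_fun A (D i) by case: (DA i).
have rD i : rsq A (D i) <= (8 ^+ i)^-1.
  by apply: KP => //; exact: leq_trans (KN i) (NS i).
(* The increments satisfy [rsq A (D i) <= 8^-i], so the weights [2 ^+ i] leave a series with
   integral at most the sum of [4^i / 8^i]. Where [S x] is finite, [D i x] is bounded by a constant
   times [2^-i] and the subsequence converges. *)
pose S x := (\sum_(0 <= i <oo) ((2 ^+ i * D i x) ^+ 2)%:E)%E.
have S0 x i : (0%:E <= ((2 ^+ i * D i x) ^+ 2)%:E)%E by rewrite lee_fin sqr_ge0.
have mS i : measurable_fun A (fun x => ((2 ^+ i * D i x) ^+ 2)%:E).
  by apply: measurable_sqr; exact: measurable_funM.
have Soo : (\int[mu]_(x in A) S x < +oo)%E.
  rewrite integral_nneseries//.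
  apply: (@le_lt_trans _ _ (\sum_(0 <= i <oo) (2^-1 ^+ i)%:E)%E).
    apply: lee_nneseries => i.
      by move=> _ _; apply: integral_ge0 => x _; exact: S0.
    move=> _; rewrite rsqE; last exact: sqintZ.
    rewrite rsqZ// -exprM mulnC exprM -natrX lee_fin.
    apply: (@le_trans _ _ (4 ^+ i * (8 ^+ i)^-1)).
      by rewrite ler_wpM2l ?exprn_ge0.
    by rewrite -exprVn -exprMn (_ : 4 / 8 = 2^-1)//; lra.
  have h2 : `|2^-1 : R| < 1 by rewrite ger0_norm; lra.
  have h : (fun n => (\sum_(0 <= i < n) (2^-1 ^+ i)%:E)%E) @ \oo --> (1 / (1 - 2^-1) : R)%:E.
    have -> : (fun n => (\sum_(0 <= i < n) (2^-1 ^+ i)%:E)%E) =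
              (fun n => (\sum_(0 <= i < n) geometric (1 : R) 2^-1 i)%:E).
      by apply/funext => n; rewrite -sumEFin; apply: eq_bigr => i _; rewrite /= mul1r.
    apply: cvg_EFin; first by near=> k.
    exact: cvg_geometric_series.
  rewrite (cvg_lim (@ereal_hausdorff R) h).
  exact: ltry.
have aeS : {ae mu, forall x, A x -> S x \is a fin_num}.
  apply: integrable_ae => //; apply/integrableP; split.
    by apply: ge0_emeasurable_sum => // i x _ _.
  apply: le_lt_trans Soo; rewrite le_eqVlt; apply/orP; left; apply/eqP.
  by apply: eq_integral => x _; rewrite gee0_abs//; apply: nneseries_ge0 => i _ _; exact: S0.
have cvgx x : S x \is a fin_num -> cvgn (g ^~ x).
  move=> Sx; pose C := fine (S x) + 1.
  have DC i : `|D i x| <= C * 2^-1 ^+ i.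
    have h : (2 ^+ i * D i x) ^+ 2 <= fine (S x).
      rewrite -lee_fin fineK//.
      apply: le_trans (nneseries_lim_ge i.+1 _); last by move=> j _ _; exact: S0.
      rewrite big_nat_recr//= leeDr//; apply: sume_ge0 => j _; exact: S0.
    have h2 : `|2 ^+ i * D i x| <= C.
      rewrite /C; have := normr_ge0 (2 ^+ i * D i x).
      move: h; rewrite -[_ ^+ 2]real_normK ?num_real//; move: `|_| => a; nra.
    by rewrite exprVn ler_pdivlMr ?exprn_gt0// mulrC -[leLHS]ger0_norm ?mulr_ge0 ?exprn_ge0// normrM normr_id -normrM.
  have : cvgn (series (D ^~ x)).
    apply: normed_cvg; apply: (@series_le_cvg _ _ (geometric C 2^-1)) => //.
    - by move=> i /=; exact: normr_ge0.
    - by move=> i /=; rewrite mulr_ge0 ?exprn_ge0 ?invr_ge0// /C addr_ge0// fine_ge0//;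
        apply: nneseries_ge0 => j _ _; exact: S0.
    - by apply: is_cvg_geometric_series; rewrite ger0_norm; lra.
  have -> : series (D ^~ x) = (fun n => g n x - g 0%N x).
    by apply/funext => n; rewrite /series /= telescope_sumr.
  move=> /(is_cvgD (is_cvg_cst (g 0%N x))) /=.
  rewrite (_ : (fun=> g 0%N x) + _ = g ^~ x)//; apply/funext => n /=.
  by rewrite fctE addrC subrK.
(* The upper limit is measurable on all of [A], including the null set on which the subsequence may
   diverge. *)
pose h x := fine (limn_esup (fun i => (g i x)%:E)).
have aeh : {ae mu, forall x, A x -> g i x @[i --> \oo] --> h x}.
  apply: filterS aeS => x Sx /Sx /cvgx cg.
  have cE : (g i x)%:E @[i --> \oo] --> (limn (g ^~ x))%:E.
    by apply: cvg_EFin => //; near=> k.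
  have [_ hl] := cvg_limn_einf_sup cE.
  by rewrite /h hl /=.
have mh : measurable_fun A h.
  apply: (@measurableT_comp _ _ _ _ _ _ fine) => //.
  by apply: measurable_fun_limn_esup => i; exact/measurable_EFinP.
(* Fatou's lemma applied to the squares of [f k - g i] as [i] grows, with [k] fixed. *)
have key k e i0 : (forall i, (i0 <= i)%N -> rsq A (f k \- g i) <= e) ->
   (\int[mu]_(x in A) ((f k x - h x) ^+ 2)%:E <= e%:E)%E.
  move=> ke.
  have m1 i : measurable_fun A (fun x => ((f k x - g i x) ^+ 2)%:E).
    apply: measurable_sqr; apply: measurable_funB => //.
    by case: (fA k).
  have -> : (\int[mu]_(x in A) ((f k x - h x) ^+ 2)%:E =
      \int[mu]_(x in A) limn_einf (fun i => ((f k x - g i x) ^+ 2)%:E))%E.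
    apply: ae_eq_integral => //.
    - apply: measurable_sqr; apply: measurable_funB => //.
      by case: (fA k).
    - apply: (@measurableT_comp _ _ _ _ _ _ -%E) => //.
      apply: measurable_fun_limn_esup => i.
      exact: (@measurableT_comp _ _ _ _ _ _ -%E).
    - apply: filterS aeh => x hx Ax.
      have : ((f k x - g i x) ^+ 2)%:E @[i --> \oo] --> ((f k x - h x) ^+ 2)%:E.
        apply: cvg_EFin; first by near=> i.
        rewrite (_ : _ \o _ = (fun i => (f k x - g i x) * (f k x - g i x))); last first.
          by apply/funext => i /=; rewrite expr2.
        by rewrite expr2; apply: cvgM; apply: cvgB (hx Ax); exact: cvg_cst.
      by case/cvg_limn_einf_sup => ->.
  apply: le_trans (fatou mu mA m1 _) _.
    by move=> i x _; rewrite lee_fin sqr_ge0.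
  rewrite -[X in (X <= _)%E]/(limf_einf (fun n => \int[mu]_(x in A) ((f k x - g n x) ^+ 2)%:E)%E \oo).
  rewrite limf_einfE; apply: ge_ereal_sup => _ [V [m _ mV] <-].
  apply: le_trans (ereal_inf_lbound _) _; first by exists (maxn m i0) => //; apply: mV => /=; exact: leq_maxl.
  rewrite rsqE ?lee_fin//; last exact: sqintB.
  by apply: ke; exact: leq_maxr.
have hA : sqint A h.
  have h0 : sqint A (f (N 0%N) \- h).
    split; first by apply: measurable_funB => //; case: (fA (N 0%N)).
    apply: (@le_lt_trans _ _ (8 ^+ 0)^-1%:E); last exact: ltry.
    apply: (key _ _ 0%N) => i _; apply: KP => //.
      exact: leq_trans (KN 0%N) (NS0 _ _ (leq0n i)).
  have := sqintB mA (fA (N 0%N)) h0.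
  by apply: eq_sqint => x _ /=; rewrite opprB addrC subrK.
exists h; split => //.
apply/cvgrPdist_le => e e0; have [m mP] := Cf _ e0.
near=> k; rewrite sub0r normrN ger0_norm ?rsq_ge0//.
rewrite -lee_fin -rsqE; last exact: sqintB.
apply: (key _ _ m) => i mi; apply: mP; first by near: k; exists m.
by apply: leq_trans mi _; elim: i => // i ih; exact: leq_ltn_trans ih (Nlt i).
Unshelve. all: by end_near.
Qed.

End square_integrable.

(** * Lebesgue measure on row vectors *)

Section rV_points.
Context (R : realType) (n : nat).

Lemma init_pt (x : 'rV[R]_n) z : init (pt x z) = x.
Proof. by rewrite /init /pt row_mxKl. Qed.

Lemma final_pt (x : 'rV[R]_n) z : final (pt x z) = z.
Proof. by rewrite /final /pt row_mxKr mxE eqxx mulr1n. Qed.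

Lemma pt_init_final (y : 'rV[R]_(n + 1)) : pt (init y) (final y) = y.
Proof.
rewrite /pt /init /final -[RHS]hsubmxK; congr row_mx.
by apply/rowP => i; rewrite mxE !ord1 eqxx mulr1n.
Qed.

Lemma pt_lshift (x : 'rV[R]_n) z i : pt x z 0 (lshift 1 i) = x 0 i.
Proof. by rewrite /pt row_mxEl. Qed.

Lemma pt_rshift (x : 'rV[R]_n) z i : pt x z 0 (rshift n i) = z.
Proof. by rewrite /pt row_mxEr mxE !ord1 eqxx mulr1n. Qed.

Lemma measurable_init : measurable_fun setT (@init R n).
Proof.
apply: measurable_fun_coordP => i.
rewrite (_ : (fun _ => _) = (fun y : 'rV[R]_(n + 1) => y 0 (lshift 1 i))).
  exact: measurable_coord.
by apply/funext => y; rewrite /init mxE.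
Qed.

Lemma measurable_final : measurable_fun setT (@final R n).
Proof.
rewrite (_ : @final R n = (fun y : 'rV[R]_(n + 1) => y 0 (rshift n ord0))).
  exact: measurable_coord.
by apply/funext => y; rewrite /final mxE.
Qed.

Lemma measurable_pt : measurable_fun setT (fun p : 'rV[R]_n * R => pt p.1 p.2).
Proof.
apply: measurable_fun_coordP => i; case: (split_ordP i) => j ->.
  rewrite (_ : (fun _ => _) = (fun y : 'rV[R]_n => y 0 j) \o fst).
    by apply: measurableT_comp => //; exact: measurable_coord.
  by apply/funext => p /=; rewrite pt_lshift.
rewrite (_ : (fun _ => _) = snd) //.
by apply/funext => p /=; rewrite pt_rshift.
Qed.

End rV_points.

Section topology_rV.
Context (R : realType) (N : nat).
Implicit Types (A : set 'rV[R]_N) (f : 'rV[R]_N -> R).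

Lemma ball_rVE (x y : 'rV[R]_N) e :
  0 < e -> ball x e y <-> forall i, `|x 0 i - y 0 i| < e.
Proof.
move=> e0; split.
  by move=> [_ h] i; have := h 0 i; rewrite -ball_normE.
by move=> h; split => // i j; rewrite ord1 -ball_normE; exact: h.
Qed.

Lemma measurable_box (c : 'rV[R]_N) (r : R) :
  measurable [set x : 'rV[R]_N | forall i, `|c 0 i - x 0 i| < r].
Proof.
rewrite (_ : [set _ | _] =
    \bigcap_(i : 'I_N) ((fun x : 'rV[R]_N => x 0 i) @^-1` [set t | `|c 0 i - t| < r])); last first.
  by apply/seteqP; split => x /= h i; [move=> _; exact: h|exact: (h i I)].
apply: fin_bigcap_measurable => // i _; rewrite -[X in measurable X]setTI.
apply: measurable_coord => //; rewrite (_ : [set t | _] = ball (c 0 i) r).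
  exact: measurable_ball.
by rewrite -ball_normE.
Qed.

(** The sigma-algebra is generated by the coordinates, so an open set is exhibited as the countable
    union of the boxes with rational centre and radius that it contains. *)
Lemma open_measurable_rV A : open A -> measurable A.
Proof.
move=> oA.
pose F (p : 'rV[rat]_N * rat) : set 'rV[R]_N :=
  [set x | forall i, `|(map_mx ratr p.1 : 'rV[R]_N) 0 i - x 0 i| < ratr p.2].
pose G p := if `[< F p `<=` A >] then F p else set0.
have -> : A = \bigcup_p G p.
  apply/seteqP; split => x; last first.
    by case=> p _; rewrite /G; case: asboolP => // FA Fx; exact: FA.
  move=> Ax; have /nbhs_ballP[e /= e0 eA] := oA _ Ax.
  have [r] : exists r : rat, ratr r \in `]0, (e / 2)[.
    by apply/rat_in_itvoo; rewrite divr_gt0.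
  rewrite in_itv /= => /andP[r0 re].
  have /choice[q qP] : forall i, exists q : rat, `|ratr q - x 0 i| < ratr r.
    move=> i; have [q] : exists q : rat, ratr q \in `](x 0 i), (x 0 i + ratr r)[.
      by apply/rat_in_itvoo; rewrite ltrDl.
    by rewrite in_itv /= => /andP[q1 q2]; exists q; rewrite ger0_norm; lra.
  exists (\row_i q i, r) => //; rewrite /G asboolT; first by move=> i /=; rewrite !mxE.
  move=> y Fy; apply: eA; apply/ball_rVE => // i.
  have := Fy i; have := qP i; rewrite /= !mxE !ltr_norml; lra.
apply: countable_bigcupT_measurable; first exact: countableP.
by move=> p; rewrite /G; case: asboolP => // _; exact: measurable_box.
Qed.

Lemma within_continuousP A f : {within A, continuous f} <->
  forall x, A x -> f y @[y --> within A (nbhs x)] --> f x.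
Proof. exact: subspace_continuousP. Qed.

Lemma within_continuous_measurable A f : measurable A ->
  {within A, continuous f} -> measurable_fun A f.
Proof.
move=> mA /within_continuousP cf.
apply: (measurability _ (RGenOInfty.measurableE R)) => _ [_ [r ->] <-].
pose O := interior [set y | A y -> r < f y].
rewrite (_ : _ `&` _ = A `&` O).
  by apply: measurableI => //; apply: open_measurable_rV; exact: open_interior.
apply/seteqP; split => x [Ax /=].
  rewrite in_itv /= andbT => rx; split => //.
  have h : \forall y \near within A (nbhs x), r < f y by apply: (cvgr_gt (f x)) => //; exact: cf.
  exact: h.
by move=> /nbhs_singleton h; split => //; rewrite /= in_itv /= andbT h.
Qed.

Lemma continuous_measurable_rV f : continuous f -> measurable_fun setT f.
Proof.
move=> cf; apply: within_continuous_measurable => //.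
by apply/within_continuousP => x _; apply: cvg_within_filter; exact: cf.
Qed.

End topology_rV.

Section lebesgue_affine.
Context (R : realType).
Local Notation mu := (@lebesgue_measure R).

Let affine_itv (a c x y : R) : 0 < c ->
  (fun z => a + c * z) @^-1` `]x, y] = `](x - a) / c, (y - a) / c]%classic.
Proof.
move=> c0; apply/seteqP; split => z /=; rewrite !in_itv /=;
  rewrite ltr_pdivrMr// ler_pdivlMr// => /andP[h1 h2]; apply/andP; split; lra.
Qed.

(** Both sides are measures in [A], and they agree on half-open intervals; Lebesgue measure is
    determined by these. *)
Lemma lebesgue_measure_affine (a c : R) (A : set R) : 0 < c -> measurable A ->
  (c%:E * mu ((fun z => (a + c * z)%R) @^-1` A) = mu A)%E.
Proof.
move=> c0 mA.
have mphi : measurable_fun setT (fun z : measurableTypeR R => (a + c * z)%R : measurableTypeR R).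
  by apply: measurable_funD => //; exact: measurable_funM.
pose nu := mscale (NngNum (ltW c0)) (pushforward mu (fun z : measurableTypeR R => (a + c * z)%R : measurableTypeR R)).
have -> : (c%:E * mu ((fun z => (a + c * z)%R) @^-1` A) = nu mphi A)%E by [].
apply/esym; apply: lebesgue_measure_unique => //= _ [[x y]] _ <-.
rewrite /mscale /pushforward /=.
rewrite [pushforward _ _ _](_ : _ = mu ((fun z => (a + c * z)%R) @^-1` `]x, y]))// affine_itv// !lebesgue_measure_itv /= !lte_fin.
rewrite ltr_pM2r ?invr_gt0// ltrD2r.
by case: ifP => _; rewrite ?mule0// -EFinD -EFinM; congr EFin; field; rewrite gt_eqF.
Qed.

Lemma ge0_integral_affine (a c : R) (f : R -> \bar R) : 0 < c ->
  measurable_fun setT f -> (forall z, 0 <= f z)%E ->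
  (c%:E * \int[mu]_z f (a + c * z)%R = \int[mu]_z f z)%E.
Proof.
move=> c0 mf f0.
have mphi : measurable_fun setT (fun z : measurableTypeR R => (a + c * z)%R : measurableTypeR R).
  by apply: measurable_funD => //; exact: measurable_funM.
have := @ge0_integral_pushforward _ _ _ _ R _ mphi mu setT f measurableT mf.
rewrite preimage_setT => <-; last by move=> z _; exact: f0.
have cE : c%:E = (NngNum (ltW c0))%:num%:E by [].
rewrite cE -ge0_integral_mscale//.
by apply: eq_measure_integral => A mA _; exact: lebesgue_measure_affine.
Qed.

Lemma ge0_integral_shift (a : R) (f : R -> \bar R) :
  measurable_fun setT f -> (forall z, 0 <= f z)%E ->
  (\int[mu]_z f (z + a)%R = \int[mu]_z f z)%E.
Proof.
move=> mf f0; rewrite -(@ge0_integral_affine a 1 f)// mul1e.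
by apply: eq_integral => z _; rewrite mul1r addrC.
Qed.

End lebesgue_affine.

Section lebesgue_rV.
Context (R : realType).

Lemma integral_leb_succ N (f : 'rV[R]_N.+1 -> \bar R) : measurable_fun setT f ->
  (forall y, 0 <= f y)%E ->
  (\int[leb N.+1]_y f y = \int[@lebesgue_measure R]_a \int[leb N]_x f (consrV (a, x)))%E.
Proof.
move=> mf f0.
have mc : measurable_fun [set: (measurableTypeR R * 'rV[R]_N)%type] (@consrV R N) := @measurable_consrV R N.
have := @ge0_integral_pushforward _ _ _ _ R _ mc (@lebesgue_measure R \x leb N)%E setT f measurableT mf.
move=> -> //; rewrite preimage_setT fubini_tonelli1//=.
exact: measurableT_comp mf mc.
Qed.

Lemma measurable_integral_leb_succ N (f : 'rV[R]_N.+1 -> \bar R) : measurable_fun setT f ->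
  (forall y, 0 <= f y)%E ->
  measurable_fun setT (fun a => \int[leb N]_x f (consrV (a, x)))%E.
Proof.
move=> mf f0; have mc := @measurable_consrV R N.
apply: (@measurable_fun_fubini_tonelli_F _ _ _ _ R (leb N) (f \o @consrV R N)) => //=.
exact: measurableT_comp mf mc.
Qed.

Lemma measurable_consrV_snd N a : measurable_fun setT (fun x : 'rV[R]_N => consrV (a, x)).
Proof.
apply: (@measurableT_comp _ _ _ _ _ _ (@consrV R N) _ (fun x => (a, x))).
  exact: measurable_consrV.
exact: pair1_measurable.
Qed.

Lemma integral_leb0 (f : 'rV[R]_0 -> \bar R) : measurable_fun setT f ->
  (\int[leb 0]_y f y = f (0%R : 'rV[R]_0))%E.
Proof. by move=> mf; rewrite integral_dirac// diracT mul1e. Qed.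

Lemma integral_leb_translate N (v : 'rV[R]_N) (f : 'rV[R]_N -> \bar R) :
  measurable_fun setT f -> (forall y, 0 <= f y)%E ->
  (\int[leb N]_y f (y + v)%R = \int[leb N]_y f y)%E.
Proof.
elim: N v f => [|N ih] v f mf f0.
  rewrite (_ : (fun y => _) = f)//; apply/funext => y; congr f.
  by apply/rowP => -[].
have mt : measurable_fun setT (fun y : 'rV[R]_N.+1 => (y + v)%R).
  apply: measurable_fun_coordP => i.
  rewrite (_ : (fun _ => _) = (fun y : 'rV[R]_N.+1 => y 0 i + v 0 i)); last first.
    by apply/funext => y; rewrite mxE.
  by apply: measurable_funD => //; exact: measurable_coord.
rewrite integral_leb_succ//; last exact: measurableT_comp mf mt.
rewrite [RHS]integral_leb_succ//.
rewrite -(@ge0_integral_shift R (v 0 ord0) (fun a => \int[leb N]_x f (consrV (a, x)))%E); last 2 first.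
- exact: measurable_integral_leb_succ.
- by move=> a; apply: integral_ge0.
apply: eq_integral => a _.
have -> : (\int[leb N]_x f (consrV (a, x) + v)%R = \int[leb N]_x
    f (consrV (a + v 0 ord0, x + \row_j v 0 (lift ord0 j))%R))%E.
  apply: eq_integral => y _; congr f; apply/rowP => i.
  by case: (unliftP ord0 i) => [j|] ->; rewrite !mxE ?liftK ?unlift_none /= ?mxE.
apply: (ih _ (fun x => f (consrV (a + v 0 ord0, x)%R))) => //.
by apply: measurableT_comp mf _; exact: measurable_consrV_snd.
Qed.

(** [leb] grows by prepending a coordinate, whereas [pt] appends one. The induction carries the last
    coordinate through the successive Tonelli integrals over the first ones. *)
Lemma integral_leb_pt n (f : 'rV[R]_(n + 1) -> \bar R) :
  measurable_fun setT f -> (forall y, 0 <= f y)%E ->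
  (\int[leb (n + 1)]_y f y = \int[leb n]_x \int[@lebesgue_measure R]_z f (pt x z))%E.
Proof.
elim: n f => [|n ih] f mf f0.
  rewrite (@integral_leb_succ 0 f)// integral_leb0; last first.
    apply: (@measurable_fun_fubini_tonelli_F _ _ _ _ R (@lebesgue_measure R) (fun p : 'rV[R]_0 * R => f (pt p.1 p.2))) => //.
    exact: measurableT_comp mf (@measurable_pt R 0).
  apply: eq_integral => z _; rewrite integral_leb0.
    congr f; apply/rowP => i.
    have -> : i = rshift 0 (ord0 : 'I_1) by apply: val_inj; case: i => -[].
    by rewrite pt_rshift mxE; case: unliftP => [[]|].
  by apply: measurableT_comp mf _; exact: measurable_consrV_snd.
rewrite (@integral_leb_succ (n + 1) f)//.
have mpt := @measurable_pt R n.+1.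
rewrite (@integral_leb_succ n (fun x => \int[@lebesgue_measure R]_z f (pt x z))%E); last 2 first.
- apply: (@measurable_fun_fubini_tonelli_F _ _ _ _ R (@lebesgue_measure R) (fun p : 'rV[R]_n.+1 * R => f (pt p.1 p.2))) => //.
  exact: measurableT_comp mf mpt.
- by move=> x; exact: integral_ge0.
apply: eq_integral => a _.
rewrite (ih (fun x => f (consrV (a, x)))); last 2 first.
- by apply: measurableT_comp mf _; exact: measurable_consrV_snd.
- by move=> y.
apply: eq_integral => x _; apply: eq_integral => z _; congr f.
apply/rowP => i; case: (unliftP ord0 i) => [j|] ->.
  case: (split_ordP j) => k ->.
    rewrite mxE liftK /= pt_lshift (_ : lift ord0 _ = lshift 1 (lift ord0 k)); last exact/val_inj.
    by rewrite pt_lshift mxE liftK.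
  rewrite mxE liftK /= pt_rshift (_ : lift ord0 _ = rshift n.+1 k); last exact/val_inj.
  by rewrite pt_rshift.
rewrite mxE unlift_none /= (_ : ord0 = lshift 1 ord0); last exact/val_inj.
by rewrite pt_lshift mxE unlift_none.
Qed.

Lemma leb_box N (c : 'rV[R]_N) (r : R) : 0 < r ->
  leb N [set x : 'rV[R]_N | forall i, `|c 0 i - x 0 i| < r] = ((2 * r) ^+ N)%:E.
Proof.
move=> r0; elim: N c => [|N ih] c.
  rewrite /= /Defs.dirac0 (_ : [set x : 'rV[R]_0 | _] = setT) ?diracT ?expr0//.
  by apply/seteqP; split => // x _ /= -[].
rewrite /= /leb_step /pushforward.
rewrite (_ : _ @^-1` _ = (ball (c 0 ord0) r) `*` [set x : 'rV[R]_N | forall i,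
    `|(\row_j c 0 (lift ord0 j)) 0 i - x 0 i| < r]); last first.
  apply/seteqP; split => -[a x] /=.
    move=> h; split; first by have := h ord0; rewrite mxE unlift_none /= -ball_normE.
    by move=> i; have := h (lift ord0 i); rewrite !mxE liftK.
  move=> [ha h] i; rewrite !mxE; case: unliftP => [j|] -> /=; last by move: ha; rewrite -ball_normE.
  by have := h j; rewrite !mxE.
rewrite product_measure1E//; last exact: measurable_box.
rewrite ih [X in (X * _)%E](_ : _ = lebesgue_measure (ball (c 0 ord0) r))//.
rewrite lebesgue_measure_ball ?ltW// -EFinM exprS; congr EFin; congr (_ * _).
  by rewrite mulr2n mulrDl !mul1r.
exact: measurable_ball.
Qed.

Lemma leb_open_gt0 N (A : set 'rV[R]_N) : open A -> A !=set0 -> (0 < leb N A)%E.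
Proof.
move=> oA [x Ax]; have /nbhs_ballP[e /= e0 eA] := oA _ Ax.
apply: (@lt_le_trans _ _ (leb N [set y : 'rV[R]_N | forall i, `|x 0 i - y 0 i| < e])).
  by rewrite leb_box// lte_fin exprn_gt0// mulr_gt0.
apply: le_measure; rewrite ?inE.
- exact: measurable_box.
- exact: open_measurable_rV.
- by move=> y h; apply: eA; exact/ball_rVE.
Qed.

Lemma leb_bounded_lty N (A : set 'rV[R]_N) C : measurable A ->
  (forall x i, A x -> `|x 0 i| <= C) -> (leb N A < +oo)%E.
Proof.
move=> mA AC.
apply: (@le_lt_trans _ _ (leb N [set y : 'rV[R]_N | forall i, `|(0 : 'rV[R]_N) 0 i - y 0 i| < `|C| + 1])).
  apply: le_measure; rewrite ?inE//; first exact: measurable_box.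
  move=> x Ax i; rewrite mxE sub0r normrN.
  by rewrite (le_lt_trans (AC _ _ Ax))// (le_lt_trans (ler_norm _))// ltrDl.
by rewrite leb_box ?ltry// ltr_wpDl.
Qed.

Lemma leb_final_null n (c : R) : leb (n + 1) [set y | final y = c] = 0%E.
Proof.
have mA : measurable [set y : 'rV[R]_(n + 1) | final y = c].
  by rewrite -[X in measurable X]setTI; exact: (@measurable_final R n measurableT [set c]).
rewrite -(setIT [set y | _]) -integral_indic// integral_leb_pt//; last first.
  by apply/measurable_EFinP; exact: measurable_indic.
apply: integral0_eq => x _.
rewrite (_ : (fun z => _) = (fun z => (\1_[set c] z)%:E)).
  by rewrite integral_indic// setIT; exact: lebesgue_measure_set1.
apply/funext => z; rewrite !indicE; congr ((_ : bool)%:R%:E).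
by apply/idP/idP; rewrite !inE /= final_pt.
Qed.

Lemma leb_translate N (v : 'rV[R]_N) (A : set 'rV[R]_N) : measurable A ->
  leb N ((fun y => y + v) @^-1` A) = leb N A.
Proof.
move=> mA.
have mt : measurable_fun setT (fun y : 'rV[R]_N => (y + v)%R).
  apply: measurable_fun_coordP => i.
  rewrite (_ : (fun _ => _) = (fun y : 'rV[R]_N => y 0 i + v 0 i)); last first.
    by apply/funext => y; rewrite mxE.
  by apply: measurable_funD => //; exact: measurable_coord.
have mB : measurable ((fun y => y + v) @^-1` A).
  by rewrite -[X in measurable X]setTI; exact: mt.
have := @integral_leb_translate N v (fun x => (\1_A x)%:E).
rewrite (_ : (fun y => (\1_A (y + v))%:E) = (fun y => (\1_((fun y => y + v) @^-1` A) y)%:E))//.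
rewrite !integral_indic// !setIT; apply.
  by apply/measurable_EFinP; exact: measurable_indic.
by move=> y; rewrite lee_fin.
Qed.

Lemma measurable_translate N (v : 'rV[R]_N) :
  measurable_fun setT (fun y : 'rV[R]_N => (y + v)%R).
Proof.
apply: measurable_fun_coordP => i.
rewrite (_ : (fun _ => _) = (fun y : 'rV[R]_N => y 0 i + v 0 i)); last first.
  by apply/funext => y; rewrite mxE.
by apply: measurable_funD => //; exact: measurable_coord.
Qed.

Lemma integrable_translate N (v : 'rV[R]_N) (f : 'rV[R]_N -> R) :
  (leb N).-integrable setT (EFin \o f) ->
  (leb N).-integrable setT (EFin \o (fun y => f (y + v))).
Proof.
move=> /integrableP[mf foo]; have mt := measurable_translate v.
apply/integrableP; split.
  exact: (measurableT_comp mf mt).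
rewrite (@integral_leb_translate _ v (fun x => `|(f x)%:E|%E))//.
exact: measurableT_comp.
Qed.

Lemma Rintegral_translate N (v : 'rV[R]_N) (f : 'rV[R]_N -> R) :
  (leb N).-integrable setT (EFin \o f) ->
  \int[leb N]_y f (y + v) = \int[leb N]_y f y.
Proof.
move=> fi; have /integrableP[mf _] := fi; have mt := measurable_translate v.
rewrite /Rintegral; congr fine.
have := @integral_pushforward _ _ _ _ R _ mt (leb N) setT (EFin \o f) mf.
rewrite preimage_setT => <-//; last exact: integrable_translate.
by apply: eq_measure_integral => A mA _; exact: leb_translate.
Qed.

Lemma rsq_translate N (v : 'rV[R]_N) (f : 'rV[R]_N -> R) : measurable_fun setT f ->
  rsq (leb N) setT (fun y => f (y + v)) = rsq (leb N) setT f.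
Proof.
move=> mf; rewrite /rsq /Rintegral; congr fine.
apply: (@integral_leb_translate _ v (fun y => (f y ^+ 2)%:E)) => [|y]; last first.
  by rewrite lee_fin sqr_ge0.
exact: measurable_sqr.
Qed.

End lebesgue_rV.

(** * Derivatives along lines *)

Section directional_derivative.
Context (R : realType) (V : normedModType R).
Implicit Types (f : V -> R) (x y v e : V).

(** A formulation without quotients: it also makes sense at [t = 0] and composes well, and
    [derive_eps] is its converse. *)
Lemma is_derive_eps f y e (c : R) :
  (forall eta, 0 < eta -> exists2 d, 0 < d & forall t, `|t| < d ->
    `|f (y + t *: e) - f y - t * c| <= eta * `|t|) -> is_derive y e f c.
Proof.
move=> h.
have hc : h^-1 *: (f (h *: e + y) - f y) @[h --> 0^'] --> c.
  apply/cvgrPdist_le => eta eta0; have [d d0 dP] := h _ eta0.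
  near=> t; have t0 : t != 0 by near: t; exact: nbhs_dnbhs_neq.
  have td : `|t| < d by near: t; apply: dnbhs0_lt.
  have tP := dP _ td; rewrite (addrC (t *: e)).
  rewrite -[_ *: _]/(t^-1 * (f (y + t *: e) - f y)).
  have -> : c - t^-1 * (f (y + t *: e) - f y) = - (t^-1 * (f (y + t *: e) - f y - t * c)).
    by field.
  by rewrite normrN normrM normfV ler_pdivrMl ?normr_gt0// [leRHS]mulrC.
by apply: DeriveDef; [exact: cvgP hc|exact: cvg_lim hc].
Unshelve. all: by end_near. Qed.

Lemma derive_eps f y e : derivable f y e ->
  forall eta, 0 < eta -> exists2 d, 0 < d & forall t, `|t| < d ->
    `|f (y + t *: e) - f y - t * 'D_e f y| <= eta * `|t|.
Proof.
move=> df eta eta0; have /cvgrPdist_le/(_ _ eta0) := df.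
move=> /nbhs_ballP[d /= d0 dP].
exists d => // t td; have [->|t0] := eqVneq t 0.
  by rewrite scale0r addr0 subrr mul0r subr0 normr0 mulr0.
have := dP t; rewrite -ball_normE /= sub0r normrN => /(_ td t0).
rewrite -/('D_e f y) (addrC (t *: e)) -[_ *: _]/(t^-1 * (f (y + t *: e) - f y)).
have -> : 'D_e f y - t^-1 * (f (y + t *: e) - f y) = - (t^-1 * (f (y + t *: e) - f y - t * 'D_e f y)).
  by field.
by rewrite normrN normrM normfV ler_pdivrMl ?normr_gt0// [_ * eta]mulrC.
Qed.

Lemma is_derive_line f x v t : derivable f (x + t *: v) v ->
  is_derive t (1 : R) (fun s => f (x + s *: v)) ('D_v f (x + t *: v)).
Proof.
move=> df.
have E : (fun h : R => h^-1 *: (f (x + (h *: 1 + t) *: v) - f (x + t *: v))) =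
         (fun h : R => h^-1 *: (f (h *: v + (x + t *: v)) - f (x + t *: v))).
  apply/funext => h; congr (_ *: (f _ - _)).
  by rewrite scalerDl -scalerA scale1r addrCA.
apply: DeriveDef; first by rewrite /derivable /= E.
by rewrite /derive /= E.
Qed.

Lemma mvt_line f x v t : 0 <= t ->
  (forall s, 0 <= s <= t -> derivable f (x + s *: v) v) ->
  exists2 c, 0 <= c <= t & f (x + t *: v) - f x = t * 'D_v f (x + c *: v).
Proof.
move=> t0 df.
have [| |c] := @MVT_segment _ (fun s => f (x + s *: v)) (fun s => 'D_v f (x + s *: v)) 0 t t0.
- by move=> s; rewrite in_itv /= => /andP[s0 st]; apply: is_derive_line; apply: df; rewrite !ltW.
- apply: derivable_within_continuous => s; rewrite in_itv /= => sI.
  by have [] := is_derive_line (df s sI).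
rewrite in_itv /= scale0r addr0 subr0 => cI ->; exists c => //; exact: mulrC.
Qed.

(** Comparing with an arbitrary slope [c] makes one estimate serve two purposes: first-order
    expansions, with [eta] small, and Lipschitz bounds, with [c = 0]. *)
Lemma mvt_abs f x v t (c eta : R) :
  (forall s, `|s| <= `|t| -> derivable f (x + s *: v) v) ->
  (forall s, `|s| <= `|t| -> `|'D_v f (x + s *: v) - c| <= eta) ->
  `|f (x + t *: v) - f x - t * c| <= eta * `|t|.
Proof.
move=> df dc; have [t0|/ltW t0] := leP 0 t.
  have df' s : 0 <= s <= t -> derivable f (x + s *: v) v.
    by move=> sI; apply: df; rewrite !ger0_norm//; lra.
  have [s sI ->] := mvt_line t0 df'.
  rewrite -mulrBr normrM mulrC ler_wpM2r//; apply: dc.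
  by rewrite !ger0_norm//; lra.
have nt : 0 <= - t by rewrite oppr_ge0.
have [s|s sI] := @mvt_line f (x + t *: v) v (- t) nt.
  by move=> sI; rewrite -addrA -scalerDl; apply: df; rewrite !ler0_norm//; lra.
rewrite -addrA -scalerDl subrr scale0r addr0 -addrA -scalerDl => E.
have -> : f (x + t *: v) - f x - t * c = t * ('D_v f (x + (t + s) *: v) - c).
  by rewrite -(opprB (f x)) E; ring.
by rewrite normrM mulrC ler_wpM2r//; apply: dc; rewrite !ler0_norm//; lra.
Qed.

End directional_derivative.

Section lines.
Context (R : realType) (N : nat).
Implicit Types (f : 'rV[R]_N -> R) (x y v e : 'rV[R]_N).

(* The two-parameter approximation handles points of the boundary from which
   [A] is reached in the direction [v]. *)
Lemma is_derive_boundary (A : set 'rV[R]_N) f g y e v (r : R) : 0 < r ->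
  {within closure A, continuous f} -> {within closure A, continuous g} ->
  (forall x, A x -> derivable f x e) -> (forall x, A x -> g x = 'D_e f x) ->
  (forall t s, `|t| < r -> 0 < s < r -> A (y + t *: e + s *: v)) ->
  is_derive y e f (g y).
Proof.
move=> r0 /within_continuousP cf /within_continuousP cg df dg Ay.
have cl t : `|t| < r -> closure A (y + t *: e).
  move=> tr B /nbhs_ballP[d /= d0 dB].
  pose s := Num.min (r / 2) (d / (2 * (`|v| + 1))).
  have v1 : 0 < `|v| + 1 by rewrite ltr_wpDl.
  have s0 : 0 < s by rewrite lt_min !divr_gt0// mulr_gt0.
  exists (y + t *: e + s *: v); split.
    by apply: Ay => //; rewrite s0 gt_min; apply/orP; left; lra.
  apply: dB; rewrite -ball_normE /= opprD addrA subrr sub0r normrN normrZ gtr0_norm//.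
  apply: (@le_lt_trans _ _ (d / (2 * (`|v| + 1)) * (`|v| + 1))).
    by apply: ler_pM => //; [exact: ltW|rewrite ge_min lexx orbT|lra].
  by rewrite invfM mulrA -mulrA mulVf ?gt_eqF// mulr1 ltr_pdivrMr//; lra.
have y0 : closure A y by have := cl 0; rewrite normr0 scale0r addr0; apply.
apply: is_derive_eps => eta eta0.
have : \forall z \near within (closure A) (nbhs y), `|g y - g z| <= eta.
  by have /cvgrPdist_le := cg _ y0; exact.
move=> /nbhs_ballP[d /= d0 dP].
have e1 : 0 < `|e| + 1 by rewrite ltr_wpDl.
have v1 : 0 < `|v| + 1 by rewrite ltr_wpDl.
exists (Num.min r (d / (2 * (`|e| + 1)))); first by rewrite lt_min r0 divr_gt0// mulr_gt0.
move=> t; rewrite lt_min => /andP[tr td].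
have near0 t' : `|t'| < r -> f (y + t' *: e + s *: v) @[s --> 0^'+] --> f (y + t' *: e).
  move=> t'r; apply: (@cvg_comp _ _ _ (fun s => y + t' *: e + s *: v) f _ (within (closure A) (nbhs (y + t' *: e)))); last exact/cf/cl.
  move=> B /nbhs_ballP[q /= q0 qB]; near=> s.
  apply: qB.
    rewrite -ball_normE /= opprD addrA subrr sub0r normrN normrZ gtr0_norm//.
    have : s < q / (`|v| + 1) by near: s; apply: nbhs_right_lt; rewrite divr_gt0.
    rewrite ltr_pdivlMr//; apply: le_lt_trans; rewrite ler_wpM2l//; lra.
  by apply: subset_closure; apply: Ay => //; apply/andP; split.
have r00 : `|0 : R| < r by rewrite normr0.
have n0 := near0 0 r00; rewrite scale0r addr0 in n0.
have lim : `|f (y + t *: e + s *: v) - f (y + s *: v) - t * g y| @[s --> 0^'+] -->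
           `|f (y + t *: e) - f y - t * g y|.
  apply: cvg_norm; apply: cvgB; last exact: cvg_cst.
  by apply: cvgB => //; exact: near0.
(* The estimate is proved on the segment pushed into [A] by [s *: v], where [f] is differentiable,
   and [s] then tends to 0 from the right. *)
apply: (ler_cvg_to lim (@cvg_cst _ (eta * `|t|) _ _ _)); near=> s.
have sI : 0 < s < r by apply/andP; split.
have dyn t' : `|t'| <= `|t| -> ball y d (y + t' *: e + s *: v).
  move=> t't; rewrite -ball_normE /= -addrA opprD addrA subrr sub0r normrN.
  apply: le_lt_trans (ler_normD _ _) _; rewrite !normrZ (gtr0_norm (proj1 (andP sI))).
  have h1 : `|t'| * `|e| < d / 2.
    move: td; rewrite invfM mulrA ltr_pdivlMr// => h; apply: le_lt_trans h.
    by apply: ler_pM => //; lra.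
  have h2 : s * `|v| < d / 2.
    have : s < d / 2 / (`|v| + 1) by near: s; apply: nbhs_right_lt; rewrite !divr_gt0.
    have s0 : 0 <= s by case/andP: sI => /ltW.
    rewrite ltr_pdivlMr//; apply: le_lt_trans; rewrite ler_wpM2l//.
    by rewrite lerDl.
  by lra.
have := @mvt_abs R _ f (y + s *: v) e t (g y) eta; rewrite [_ + s *: v + _]addrAC; apply.
  by move=> t' t't; rewrite addrAC; apply: df; apply: Ay => //; exact: le_lt_trans tr.
move=> t' t't; rewrite addrAC.
have At : A (y + t' *: e + s *: v) by apply: Ay => //; exact: le_lt_trans tr.
by rewrite -dg// distrC; apply: dP; [exact: dyn|exact: subset_closure].
Unshelve. all: by end_near. Qed.

End lines.

(** * One-dimensional integral inequalities on a segment *)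

Section fundamental_theorem.
Context (R : realType).
Local Notation mu := (@lebesgue_measure R).

Section fixed_interval.
Variables (F f : R -> R) (a b : R).
Hypotheses (ab : a < b) (cf : {within `[a, b], continuous f})
  (cF : {within `[a, b], continuous F})
  (dF : forall x, x \in `]a, b[ -> is_derive x 1 F (f x)).

Lemma Rintegral_derive : \int[mu]_(x in `[a, b]) f x = F b - F a.
Proof.
have [_ cFa cFb] := (continuous_within_itvP _ ab).1 cF.
rewrite /Rintegral (continuous_FTC2 ab cf (And3 (fun x xI => @ex_derive _ _ _ _ _ _ _ (dF xI)) cFa cFb)
  (fun x xI => etrans (derive1E _ _) (@derive_val _ _ _ _ _ _ _ (dF xI))))//.
Qed.

Let within_integrable (g : R -> R) : {within `[a, b], continuous g} ->
  mu.-integrable `[a, b] (EFin \o g).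
Proof. by move=> cg; apply: continuous_compact_integrable => //; exact: segment_compact. Qed.

Lemma within_sqint_itv (g : R -> R) : {within `[a, b], continuous g} -> sqint mu `[a, b] g.
Proof.
move=> cg; have mg : measurable_fun `[a, b] g by exact: subspace_continuous_measurable_fun.
split => //.
have cg2 : {within `[a, b], continuous (fun x => g x ^+ 2)}.
  move=> x; rewrite (_ : (fun x => _) = g \* g); last by apply/funext => y; rewrite expr2.
  by apply: continuousM; exact: cg.
have /integrableP[_] := within_integrable cg2; apply: le_lt_trans.
rewrite le_eqVlt; apply/orP; left; apply/eqP; apply: eq_integral => x _ /=.
by rewrite ger0_norm ?sqr_ge0.
Qed.

(** Cauchy-Schwarz as positivity of a variance: the square of [f - l] is integrated, [l] being the
    mean slope. Equality holds for constant [f], which is what the upper bound aims at. *)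
Lemma sqr_increment_le : (F b - F a) ^+ 2 <= (b - a) * rsq mu `[a, b] f.
Proof.
have ba : 0 < b - a by rewrite subr_gt0.
have sf := within_sqint_itv cf.
pose l := (F b - F a) / (b - a).
have i1 : mu.-integrable `[a, b] (EFin \o f) by exact: within_integrable.
have i2 := sqint_sqr sf.
have ic : mu.-integrable `[a, b] (EFin \o cst (l ^+ 2)).
  by apply: within_integrable; apply: continuous_subspaceT => x; exact: cvg_cst.
have i1' : mu.-integrable `[a, b] (EFin \o (fun x => - (2 * l) * f x)).
  exact: (integrableZl _ (- (2 * l)) i1).
have i12 : mu.-integrable `[a, b] (EFin \o (fun x => f x ^+ 2 - 2 * l * f x)).
  have : mu.-integrable `[a, b] ((EFin \o (fun x => f x ^+ 2)%R) \+ (EFin \o (fun x => - (2 * l) * f x)%R))%E.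
    exact: integrableD.
  by apply: eq_integrable => // x _ /=; rewrite mulNr.
have E : rsq mu `[a, b] (fun x => f x - l) =
   rsq mu `[a, b] f - 2 * l * (F b - F a) + l ^+ 2 * (b - a).
  have -> : l ^+ 2 * (b - a) = \int[mu]_(x in `[a, b]) cst (l ^+ 2) x.
    rewrite Rintegral_cst//; congr (_ * _); have := lebesgue_measure_itv `[a, b].
    by rewrite /= lte_fin ab => h; exact: (esym (congr1 fine h)).
  rewrite -Rintegral_derive -RintegralZl// -RintegralB//; last first.
    exact: (integrableZl _ (2 * l) i1).
  rewrite -RintegralD//; apply: eq_Rintegral => x _ /=; ring.
have := rsq_ge0 mu `[a, b] (fun x => f x - l); rewrite E.
have -> : rsq mu `[a, b] f - 2 * l * (F b - F a) + l ^+ 2 * (b - a) =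
  rsq mu `[a, b] f - (F b - F a) ^+ 2 / (b - a) by rewrite /l; field; rewrite gt_eqF.
by rewrite subr_ge0 ler_pdivrMr// mulrC.
Qed.

End fixed_interval.

(** As [F b = 0], the value [F a ^+ 2] is the integral of [- 2 F f]. The bound is independent of the
    length of the segment, hence uniform over segments of [Omega] shrinking to the contact set. *)
Lemma sqr_endpoint_le (F f : R -> R) (a b : R) : a < b ->
  {within `[a, b], continuous f} -> {within `[a, b], continuous F} ->
  (forall x, x \in `]a, b[ -> is_derive x 1 F (f x)) -> F b = 0 ->
  F a ^+ 2 <= rsq mu `[a, b] F + rsq mu `[a, b] f.
Proof.
move=> ab cf cF dF Fb.
have sf := within_sqint_itv cf; have sF := within_sqint_itv cF.
have cFf : {within `[a, b], continuous (fun x => 2 * (F x * f x))}.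
  move=> x; apply: (@continuousM _ _ (cst 2 : subspace `[a, b] -> R) (F \* f)).
    exact: cst_continuous.
  by apply: continuousM; [exact: cF|exact: cf].
have cFF : {within `[a, b], continuous (fun x => F x * F x)}.
  by move=> x; apply: continuousM; exact: cF.
have dFF x : x \in `]a, b[ -> is_derive x 1 (fun x => F x * F x) (2 * (F x * f x)).
  move=> /dF dFx; apply: is_derive_eq (is_deriveM dFx dFx) _.
  by rewrite /GRing.scale /=; ring.
have := Rintegral_derive ab cFf cFF dFF; rewrite Fb mul0r sub0r => E.
have i1 := sqint_sqr sF; have i2 := sqint_sqr sf.
have -> : F a ^+ 2 = \int[mu]_(x in `[a, b]) (- (2 * (F x * f x))).
  rewrite -[LHS]opprK expr2 -E.
  rewrite -[LHS]mulN1r -RintegralZl//; first by apply: eq_Rintegral => x _; rewrite mulN1r.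
  by apply: continuous_compact_integrable => //; exact: segment_compact.
rewrite /rsq -RintegralD//; apply: le_Rintegral => //.
- have : mu.-integrable `[a, b] (EFin \o (fun x => 2 * (F x * f x))).
    by apply: continuous_compact_integrable => //; exact: segment_compact.
  by move/integrableN; apply: eq_integrable.
- have : mu.-integrable `[a, b] ((EFin \o (fun x => F x ^+ 2)%R) \+ (EFin \o (fun x => f x ^+ 2)%R))%E.
    exact: integrableD.
  by apply: eq_integrable.
- by move=> x _; have := sqr_ge0 (F x + f x); lra.
Qed.

End fundamental_theorem.

(** * Functions of class C^k on the whole space *)

Section Ck_algebra.
Context (R : realType) (N : nat).
Implicit Types (f g : 'rV[R]_N -> R).

Lemma Ck_ext k f g : f =1 g -> Ck k f -> Ck k g.
Proof. by move=> /funext ->. Qed.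

Lemma Ck_continuous k f : Ck k f -> continuous f.
Proof. by case: k => [|k] []. Qed.

Lemma CkS k f : Ck k.+1 f -> Ck k f.
Proof.
elim: k f => [|k ih] f [cf h]; first by [].
by split => // i; have [df /ih] := h i.
Qed.

Lemma Ck_derivable k f : Ck k.+1 f -> forall i x, derivable f x (basis_vec R i).
Proof. by move=> [_ h] i; case: (h i). Qed.

Lemma Ck_derive k f : Ck k.+1 f -> forall i, Ck k ('D_(basis_vec R i) f).
Proof. by move=> [_ h] i; case: (h i). Qed.

Lemma Ck_cst k (c : R) : Ck k (fun _ : 'rV[R]_N => c).
Proof.
elim: k c => [|k ih] c; split => //=; first exact: cst_continuous.
  exact: cst_continuous.
move=> i; split; first by move=> x; exact: derivable_cst.
by apply: Ck_ext (ih 0) => x; rewrite derive_cst.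
Qed.

Lemma CkD k f g : Ck k f -> Ck k g -> Ck k (f \+ g).
Proof.
elim: k f g => [|k ih] f g [cf df] [cg dg]; split => //=.
- by move=> x; apply: continuousD; [exact: cf|exact: cg].
- by move=> x; apply: continuousD; [exact: cf|exact: cg].
move=> i; have [df1 df2] := df i; have [dg1 dg2] := dg i.
split; first by move=> x; exact: derivableD.
by apply: Ck_ext (ih _ _ df2 dg2) => x; rewrite deriveD.
Qed.

Lemma CkM k f g : Ck k f -> Ck k g -> Ck k (f \* g).
Proof.
elim: k f g => [|k ih] f g Cf Cg; have [cf df] := Cf; have [cg dg] := Cg; split => //=.
- by move=> x; apply: continuousM; [exact: cf|exact: cg].
- by move=> x; apply: continuousM; [exact: cf|exact: cg].
move=> i; have [df1 df2] := df i; have [dg1 dg2] := dg i.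
split; first by move=> x; exact: derivableM.
apply: Ck_ext (CkD (ih _ _ (CkS Cf) dg2) (ih _ _ (CkS Cg) df2)) => x.
by rewrite deriveM.
Qed.

Lemma CkZ k (c : R) f : Ck k f -> Ck k (fun x => c * f x).
Proof. exact: (CkM (Ck_cst k c)). Qed.

Lemma CkN k f : Ck k f -> Ck k (fun x => - f x).
Proof. by move=> /(CkZ (-1)); apply: Ck_ext => x; rewrite mulN1r. Qed.

Lemma Ck_prod k (I : Type) (r : seq I) (F : I -> 'rV[R]_N -> R) :
  (forall i, Ck k (F i)) -> Ck k (fun x => \prod_(i <- r) F i x).
Proof.
move=> CF; elim: r => [|i r ih].
  by apply: Ck_ext (Ck_cst k 1) => x; rewrite big_nil.
by apply: Ck_ext (CkM (CF i) ih) => x; rewrite big_cons.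
Qed.

(** Translations, coordinate reflections and the rescaling of the layer are all of this form, so one
    chain rule serves them all. *)
Definition diag_affine (a b : 'I_N -> R) (x : 'rV[R]_N) : 'rV[R]_N :=
  \row_i (a i * x 0 i + b i).

Lemma diag_affine_line a b x i t :
  diag_affine a b (x + t *: basis_vec R i) = diag_affine a b x + (a i * t) *: basis_vec R i.
Proof.
apply/rowP => j; rewrite !mxE eqxx /=; have [->|] := eqVneq j i.
  by rewrite !mulr1; ring.
by rewrite !mulr0 !addr0.
Qed.

Lemma is_derive_diag_affine a b f x i :
  derivable f (diag_affine a b x) (basis_vec R i) ->
  is_derive x (basis_vec R i) (f \o diag_affine a b)
    (a i * 'D_(basis_vec R i) f (diag_affine a b x)).
Proof.
move=> df; apply: is_derive_eps => eta eta0.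
have a1 : 0 < `|a i| + 1 by rewrite ltr_wpDl.
have [d d0 dP] := derive_eps df (divr_gt0 eta0 a1).
exists (d / (`|a i| + 1)); first by rewrite divr_gt0.
move=> t td /=; rewrite diag_affine_line mulrA (mulrC t).
apply: le_trans (dP _ _) _.
  move: td; rewrite normrM ltr_pdivlMr// mulrC; apply: le_lt_trans.
  by rewrite ler_wpM2r// lerDl.
have h : (`|a i| + 1)^-1 * `|a i| <= 1 by rewrite ler_pdivrMl// mulr1 lerDl.
by rewrite normrM mulrA ler_wpM2r// -mulrA -[leRHS]mulr1 ler_wpM2l// ltW.
Qed.

Lemma continuous_diag_affine a b : continuous (diag_affine a b).
Proof.
move=> x B /nbhs_ballP[e /= e0 eB].
pose C := 1 + \sum_i `|a i|.
have C0 : 0 < C by rewrite ltr_pwDl// sumr_ge0.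
apply/nbhs_ballP; exists (e / C) => /=; first by rewrite divr_gt0.
move=> y /ball_rVE; rewrite divr_gt0// => /(_ isT) h; apply: eB.
apply/ball_rVE => // i; rewrite !mxE opprD addrACA subrr addr0 -mulrBr normrM.
have := h i; rewrite ltr_pdivlMr// mulrC; apply: le_lt_trans.
by rewrite ler_wpM2r// /C (bigD1 i)//= addrCA lerDl addr_ge0// sumr_ge0.
Qed.

Lemma Ck_diag_affine k a b f : Ck k f -> Ck k (f \o diag_affine a b).
Proof.
elim: k f => [|k ih] f [cf df]; have cL := @continuous_diag_affine a b.
  by split => // x; apply: continuous_comp; [exact: cL|exact: cf].
split; first by move=> x; apply: continuous_comp; [exact: cL|exact: cf].
move=> i; have [df1 df2] := df i.
split; first by move=> x; have [] := is_derive_diag_affine (df1 (diag_affine a b x)).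
apply: Ck_ext (CkZ (a i) (ih _ df2)) => x /=.
by have [_ ->] := is_derive_diag_affine (df1 (diag_affine a b x)).
Qed.

End Ck_algebra.

(** * Mollification *)

Section flat_function.
Context (R : realType).

(* The derivatives of [t |-> exp (- 1 / t)] are combinations of the [flat m]. *)
Definition flat (m : nat) (t : R) : R := if 0 < t then t ^- m * expR (- t^-1) else 0.

Lemma flat_ge0 m t : 0 <= flat m t.
Proof. by rewrite /flat; case: ltP => // t0; rewrite mulr_ge0 ?expR_ge0// invr_ge0 exprn_ge0// ltW. Qed.

Lemma flat_gt0 m t : (0 < flat m t) = (0 < t).
Proof.
rewrite /flat; have [t0|t0] := ltP 0 t; last by rewrite ltxx.
by rewrite mulr_gt0 ?expR_gt0// invr_gt0 exprn_gt0.
Qed.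

(** The term of order [m + 2] in the expansion of [expR t^-1] absorbs the factor [t ^- m] and leaves
    [t ^+ 2]; a quadratic bound is what gives derivative 0 at the origin. *)
Lemma flat_le m t : flat m t <= (m.+2)`!%:R * t ^+ 2.
Proof.
rewrite /flat; case: ltP => [t0|_]; last by rewrite mulr_ge0 ?sqr_ge0.
have ti0 : 0 <= t^-1 by rewrite invr_ge0 ltW.
have h := expR_ge1Dxn m.+1 ti0.
have {}h : t^-1 ^+ m.+2 / (m.+2)`!%:R <= expR t^-1 by apply: le_trans h; rewrite lerDr.
have f0 : 0 < (m.+2)`!%:R :> R by rewrite ltr0n fact_gt0.
rewrite expRN ler_pdivrMr ?expR_gt0//.
apply: (@le_trans _ _ ((m.+2)`!%:R * t ^+ 2 * (t^-1 ^+ m.+2 / (m.+2)`!%:R))).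
  rewrite le_eqVlt; apply/orP; left; apply/eqP.
  rewrite exprVn -addn2 exprD; field; rewrite !expf_neq0 ?gt_eqF//.
by rewrite ler_wpM2l// mulr_ge0 ?sqr_ge0.
Qed.

Lemma is_derive_flat m (t : R) :
  is_derive t (1 : R) (flat m) (flat m.+2 t - m%:R * flat m.+1 t).
Proof.
have [t0|t0|<-] := ltgtP 0 t; last first.
- rewrite {2 3}/flat ltxx mulr0 subr0; apply: is_derive_eps => eta eta0.
  have f0 : 0 < (m.+2)`!%:R :> R by rewrite ltr0n fact_gt0.
  exists (eta / (m.+2)`!%:R); first by rewrite divr_gt0.
  move=> s; rewrite ltr_pdivlMr// => sd.
  rewrite mulr0 subr0 {2}/flat ltxx subr0 add0r -[s *: 1]/(s * 1) mulr1.
  rewrite ger0_norm ?flat_ge0//; apply: le_trans (flat_le m s) _.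
  by rewrite -real_normK ?num_real// expr2 mulrA ler_wpM2r// mulrC ltW.
- rewrite /flat !ltNge (ltW t0) /= mulr0 subr0.
  apply: (@near_eq_is_derive _ _ _ (cst 0)); last first.
    near=> s; rewrite /flat ltNge (_ : s <= 0)//; apply: ltW.
    by near: s; exact: lt_nbhsl.
- rewrite /flat t0.
  apply: (@near_eq_is_derive _ _ _ (fun s : R => (s ^+ m)^-1 * expR (- s^-1))).
    near=> s; rewrite (_ : 0 < s)//; near: s; exact: lt_nbhsr.
  have tn : t != 0 by rewrite gt_eqF.
  have d1 : is_derive t (1 : R) (fun s : R => (s ^+ m)^-1) (- m%:R * t ^- m.+1).
    have dm : is_derive t (1 : R) (fun s : R => s ^+ m) (m%:R * t ^+ m.-1).
      apply: DeriveDef; first exact: exprn_derivable.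
      by rewrite exp_derive -[_ *: _]/(_ * 1) mulr1.
    have tmn : t ^+ m != 0 by rewrite expf_neq0.
    apply: is_derive_eq (@is_deriveV _ (fun s : R => s ^+ m) t _ 1 tmn dm) _.
    rewrite /GRing.scale /=; case: m {dm tmn} => [|m]; first by rewrite oppr0 !mul0r mulr0.
    by rewrite !exprS /=; field; rewrite tn expf_neq0.
  have d2 : is_derive t (1 : R) (fun s : R => expR (- s^-1)) (t ^- 2 * expR (- t^-1)).
    have dv : is_derive t (1 : R) (fun s : R => - s^-1) (t ^- 2).
      apply: is_derive_eq (is_deriveN (@is_deriveV _ id t _ 1 tn _)) _.
      by rewrite /GRing.scale /= mulr1 opprK.
    apply: is_derive_eq (@is_derive1_comp _ expR (fun s => - s^-1) t _ _ _ dv) _.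
    by rewrite mulrC.
  apply: is_derive_eq (is_deriveM d1 d2) _.
  rewrite /GRing.scale /= !exprS; field; rewrite tn expf_neq0//.
Unshelve. all: by end_near. Qed.

End flat_function.

Section lipschitz.
Context (R : realType) (N : nat).
Implicit Types (f : 'rV[R]_N -> R).
Local Notation e_ := (@basis_vec R N).

Lemma sum_basis_vec (v : 'rV[R]_N) : \sum_i v 0 i *: e_ i = v.
Proof. by rewrite [RHS]row_sum_delta. Qed.

Lemma lipschitz_partial f B : (forall i x, derivable f x (e_ i)) ->
  (forall i x, `|'D_(e_ i) f x| <= B) ->
  forall x v : 'rV[R]_N, `|f (x + v) - f x| <= B * \sum_i `|v 0 i|.
Proof.
move=> df dB x v; rewrite -[in f (x + v)](sum_basis_vec v).
elim: (index_enum _) x => [|i r ih] x; first by rewrite !big_nil addr0 subrr normr0 mulr0.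
rewrite !big_cons addrA -(subrKA (f (x + v 0 i *: e_ i))) mulrDr.
apply: le_trans (ler_normD _ _) _; rewrite [leLHS]addrC; apply: lerD; last exact: ih.
have := @mvt_abs R _ f x (e_ i) (v 0 i) 0 B; rewrite mulr0 subr0; apply => // s _.
by rewrite subr0.
Qed.

End lipschitz.

Section kernels.
Context (R : realType) (N : nat).
Implicit Types (f g : 'rV[R]_N -> R).
Local Notation e_ := (@basis_vec R N).

Lemma continuous_comp_subr f (x : 'rV[R]_N) : continuous f ->
  continuous (fun y : 'rV[R]_N => f (y - x)).
Proof.
move=> cf; have -> : (fun y : 'rV[R]_N => f (y - x)) = f \o diag_affine (fun=> 1) (fun i => - x 0 i).
  by apply/funext => y /=; congr f; apply/rowP => i; rewrite !mxE mul1r.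
by move=> y; apply: continuous_comp; [exact: continuous_diag_affine|exact: cf].
Qed.

Definition kernel_on (L : R) f :=
  (forall k, Ck k f) /\ forall x : 'rV[R]_N, (exists i, L < `|x 0 i|) -> f x = 0.

Lemma compact_rV_box (K : set 'rV[R]_N) : compact K ->
  exists2 L, 0 < L & forall (x : 'rV[R]_N) i, K x -> `|x 0 i| <= L.
Proof.
move=> /compact_bounded[M [_ MP]]; exists (`|M| + 1); first by rewrite ltr_wpDl.
move=> x i Kx; apply: le_trans (MP (`|M| + 1) _ x Kx); last by rewrite (le_lt_trans (ler_norm M))// ltrDl.
rewrite -[`|x|]/(mx_norm x) mx_normrE.
exact: (le_bigmax_cond _ (fun ij : 'I_1 * 'I_N => `|x ij.1 ij.2|) (isT : predT (0, i))).
Qed.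

Lemma compact_box (L : R) : compact [set x : 'rV[R]_N | forall i, `|x 0 i| <= L].
Proof.
have := @rV_compact R N (fun _ => [set t : R | `|t| <= L]).
rewrite (_ : [set v | _] = [set x : 'rV[R]_N | forall i, `|x 0 i| <= L]).
  apply => i; rewrite (_ : mkset _ = `[- L, L]%classic); first exact: segment_compact.
  by apply/seteqP; split => t /=; rewrite in_itv /= ler_norml.
by apply/seteqP; split => x h i; have := h i; rewrite ?ord1.
Qed.

Lemma box_support_bounded L f : continuous f ->
  (forall x : 'rV[R]_N, (exists i, L < `|x 0 i|) -> f x = 0) -> exists2 B, 0 < B & forall x, `|f x| <= B.
Proof.
move=> cf f0; have cfK : {within [set x : 'rV[R]_N | forall i, `|x 0 i| <= L], continuous f}.
  exact: continuous_subspaceT.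
have /compact_bounded[M [_ MP]] := continuous_compact cfK (@compact_box L).
exists (`|M| + 1); first by rewrite ltr_wpDl.
move=> x; have [h|/existsNP[i /negP]] := pselect (forall i, `|x 0 i| <= L).
  by apply: (MP (`|M| + 1)); [rewrite (le_lt_trans (ler_norm M))// ltrDl|exists x].
by rewrite -ltNge => h; rewrite f0 ?normr0 ?addr_ge0//; exists i.
Qed.

Lemma kernel_on_bounded L f : kernel_on L f -> exists2 B, 0 < B & forall x, `|f x| <= B.
Proof. by move=> [Cf f0]; apply: (box_support_bounded (Ck_continuous (Cf 0%N)) f0). Qed.

Lemma kernel_on_derive L f i : kernel_on L f -> kernel_on L ('D_(e_ i) f).
Proof.
move=> [Cf f0]; split; first by move=> k; exact: (Ck_derive (Cf k.+1)).
move=> x [j xj]; suff [_ ->] : is_derive x (e_ i) f 0 by [].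
apply: is_derive_eps => eta eta0; exists (`|x 0 j| - L); first by rewrite subr_gt0.
move=> t tL; rewrite mulr0 subr0 (f0 x); last by exists j.
suff xt : exists k, L < `|(x + t *: e_ i) 0 k|.
  by rewrite (f0 _ xt) subrr normr0 mulr_ge0// ltW.
exists j; rewrite !mxE eqxx /=.
apply: (@lt_le_trans _ _ (`|x 0 j| - `|t|)); first by lra.
apply: le_trans (lerB_normD _ _); rewrite lerB// normrM.
by rewrite ler_piMr//; case: eqP; rewrite ?normr1 ?normr0.
Qed.

Lemma kernel_onN L f : kernel_on L f -> kernel_on L (fun x => - f x).
Proof.
move=> [Cf f0]; split; first by move=> k; exact: CkN.
by move=> x /f0 ->; rewrite oppr0.
Qed.

Lemma kernel_on_lipschitz L f : kernel_on L f ->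
  exists2 B, 0 < B & forall x v : 'rV[R]_N, `|f (x + v) - f x| <= B * \sum_i `|v 0 i|.
Proof.
move=> kf; have [Cf f0] := kf.
have /choice[B BP] : forall i, exists B, 0 < B /\ forall x, `|'D_(e_ i) f x| <= B.
  by move=> i; have [B B0 BP] := kernel_on_bounded (kernel_on_derive i kf); exists B.
have BS i : B i <= 1 + \sum_j B j.
  rewrite (bigD1 i)//= addrCA lerDl addr_ge0// sumr_ge0// => j _.
  by have [/ltW] := BP j.
exists (1 + \sum_i B i).
  by rewrite ltr_pwDl// sumr_ge0// => j _; have [/ltW] := BP j.
apply: lipschitz_partial => i x; first exact: (Ck_derivable (Cf 1%N)).
by have [_ h] := BP i; exact: le_trans (h x) (BS i).
Qed.

Lemma integrable_box f (c : 'rV[R]_N) (r B : R) : 0 < r -> measurable_fun setT f ->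
  (forall x, `|f x| <= B) -> (forall x : 'rV[R]_N, (exists i, r <= `|c 0 i - x 0 i|) -> f x = 0) ->
  (leb N).-integrable setT (EFin \o f) /\ `|\int[leb N]_x f x| <= B * (2 * r) ^+ N.
Proof.
move=> r0 mf fB f0.
pose Q := [set x : 'rV[R]_N | forall i, `|c 0 i - x 0 i| < r].
have mQ : measurable Q by exact: measurable_box.
have fQ : f = f \_ Q.
  apply/funext => x; rewrite patchE; case: ifPn => // /negP xQ; apply: f0.
  apply: contrapT => h; apply: xQ; apply/mem_set => i; rewrite ltNge; apply/negP => hi.
  by apply: h; exists i.
have Qoo : leb N Q = ((2 * r) ^+ N)%:E by exact: leb_box.
have Qlt : (leb N Q < +oo)%E by rewrite Qoo ltry.
have iQ : (leb N).-integrable Q (EFin \o f).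
  apply: measurable_bounded_integrable => //.
    exact: measurable_funS mf.
  by exists B; split; rewrite ?num_real// => M BM x _ /=; rewrite (le_trans (fB x))// ltW.
have iT : (leb N).-integrable setT (EFin \o f).
  rewrite fQ; have := (integrable_mkcond (EFin \o f) mQ).1 iQ.
  by rewrite (_ : (EFin \o f) \_ Q = EFin \o f \_ Q)// restrict_EFin.
split => //; rewrite [in leLHS]fQ -Rintegral_mkcond.
apply: le_trans (le_normr_Rintegral mQ iQ) _.
have -> : B * (2 * r) ^+ N = \int[leb N]_(x in Q) cst B x.
  by rewrite Rintegral_cst//; congr (_ * _); exact: (esym (congr1 fine Qoo)).
apply: le_Rintegral => //; first exact: integrable_norm.
apply: measurable_bounded_integrable => //.
by exists `|B|; split; rewrite ?num_real// => M BM x _; rewrite /= ltW.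
Qed.

Variable L : R.
Hypothesis L0 : 0 < L.

(** The kernel is taken at [y - x], not [x - y]: the value at [x] looks at [psi] on the translate of
    the support of [ker] by [x], and differentiation in [x] produces a minus sign. *)
Definition conv (psi : 'rV[R]_N -> R) (ker : 'rV[R]_N -> R) (x : 'rV[R]_N) : R :=
  \int[leb N]_y (psi y * ker (y - x)).

Section conv.
Variables (psi : 'rV[R]_N -> R) (C : R).
Hypotheses (mpsi : measurable_fun setT psi) (psiC : forall x, `|psi x| <= C).

Let C0 : 0 <= C. Proof. by apply: le_trans (psiC 0). Qed.

Lemma measurable_conv_integrand ker x : continuous ker ->
  measurable_fun setT (fun y => psi y * ker (y - x)).
Proof.
move=> ck; apply: measurable_funM => //.
apply: measurableT_comp; first exact: continuous_measurable_rV.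
exact: measurable_translate.
Qed.

Lemma integrable_conv ker x : kernel_on L ker ->
  (leb N).-integrable setT (EFin \o (fun y => psi y * ker (y - x))).
Proof.
move=> kk; have [B B0 kB] := kernel_on_bounded kk; have [Ck k0] := kk.
have [] // := @integrable_box (fun y => psi y * ker (y - x)) x (L + 1) (C * B).
- exact: addr_gt0.
- by apply: measurable_conv_integrand; exact: (Ck_continuous (Ck 0%N)).
- by move=> y; rewrite normrM ler_pM.
- move=> y [i yi]; rewrite k0 ?mulr0//; exists i; rewrite !mxE distrC.
  by apply: lt_le_trans yi; rewrite ltrDl.
Qed.

Lemma conv_diff_le (ker1 ker2 : 'rV[R]_N -> R) (x : 'rV[R]_N) (B : R) : continuous ker1 -> continuous ker2 ->
  (leb N).-integrable setT (EFin \o (fun y => psi y * ker1 y)) ->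
  (leb N).-integrable setT (EFin \o (fun y => psi y * ker2 y)) ->
  (forall y, `|ker1 y - ker2 y| <= B) ->
  (forall y : 'rV[R]_N, (exists i, L + 1 <= `|x 0 i - y 0 i|) -> ker1 y = ker2 y) ->
  `|\int[leb N]_y (psi y * ker1 y) - \int[leb N]_y (psi y * ker2 y)| <=
    C * B * (2 * (L + 1)) ^+ N.
Proof.
move=> c1 c2 i1 i2 kB k0; rewrite -RintegralB//.
have [] // := @integrable_box (fun y => psi y * ker1 y - psi y * ker2 y) x (L + 1) (C * B).
- exact: addr_gt0.
- by apply: measurable_funB; apply: measurable_funM => //; exact: continuous_measurable_rV.
- by move=> y; rewrite -mulrBr normrM ler_pM.
- by move=> y h; rewrite k0// subrr.
Qed.

Lemma continuous_conv ker : kernel_on L ker -> continuous (conv psi ker).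
Proof.
move=> kk; have [B B0 kB] := kernel_on_lipschitz kk; have [Ck k0] := kk.
have cker := Ck_continuous (Ck 0%N).
have ctr (x : 'rV[R]_N) : continuous (fun y : 'rV[R]_N => ker (y - x)).
  exact: continuous_comp_subr.
move=> x V /nbhs_ballP[e /= e0 eV].
pose K := C * B * N%:R * (2 * (L + 1)) ^+ N + 1.
have K1 : 0 < K.
  by rewrite ltr_wpDl// !mulr_ge0 ?exprn_ge0// ?mulr_ge0 ?addr_ge0// ltW.
apply/nbhs_ballP; exists (Num.min 1 (e / K)); first by rewrite /= lt_min ltr01 divr_gt0.
move=> z /ball_rVE; rewrite lt_min ltr01 divr_gt0// => /(_ isT) xz.
have xz1 i : `|x 0 i - z 0 i| < 1 by have := xz i; rewrite lt_min => /andP[].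
have xz2 i : `|x 0 i - z 0 i| < e / K by have := xz i; rewrite lt_min => /andP[].
apply: eV; rewrite -ball_normE /=.
rewrite /conv; apply: le_lt_trans (@conv_diff_le _ _ x (B * (N%:R * (e / K))) (ctr x) (ctr z) _ _ _ _) _.
- exact: integrable_conv.
- exact: integrable_conv.
- move=> y; have := kB (y - z) (z - x); rewrite addrA subrK => /le_trans; apply.
  rewrite ler_wpM2l ?(ltW B0)//.
  apply: (@le_trans _ _ (\sum_(i < N) (e / K))); last by rewrite sumr_const card_ord mulr_natl.
  by apply: ler_sum => i _; rewrite !mxE distrC ltW.
- move=> y [i yi]; rewrite !k0//; exists i; rewrite !mxE.
    have : `|x 0 i - y 0 i| <= `|x 0 i - z 0 i| + `|y 0 i - z 0 i| by rewrite (distrC (y 0 i)); exact: ler_distD.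
    by have := xz1 i; lra.
  by rewrite distrC; lra.
have -> : C * (B * (N%:R * (e / K))) * (2 * (L + 1)) ^+ N =
  (C * B * N%:R * (2 * (L + 1)) ^+ N) / K * e by ring.
by rewrite -[ltRHS]mul1r ltr_pM2r// ltr_pdivrMr// mul1r /K ltrDl.
Qed.

(** The second derivative of the kernel bounds its Taylor remainder uniformly in [y], so that
    boundedness and measurability of [psi] are enough to differentiate under the integral. *)
Lemma is_derive_conv ker i x : kernel_on L ker ->
  is_derive x (e_ i) (conv psi ker) (conv psi (fun y => - 'D_(e_ i) ker y) x).
Proof.
move=> kk; have kd := kernel_on_derive i kk; have kdn := kernel_onN kd.
have [B B0 dB] := kernel_on_bounded (kernel_on_derive i kd).
have [Ck k0] := kk; have [Cd d0] := kd.
have cker := Ck_continuous (Ck 0%N); have cd := Ck_continuous (Cd 0%N).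
have ctr (g : 'rV[R]_N -> R) (z : 'rV[R]_N) : continuous g -> continuous (fun y : 'rV[R]_N => g (y - z)).
  exact: continuous_comp_subr.
pose K := C * B * (2 * (L + 1)) ^+ N + 1.
have K1 : 0 < K.
  by rewrite ltr_wpDl// !mulr_ge0 ?exprn_ge0// ?mulr_ge0 ?addr_ge0// ltW.
apply: is_derive_eps => eta eta0; exists (Num.min 1 (eta / K)).
  by rewrite lt_min ltr01 divr_gt0.
move=> t; rewrite lt_min => /andP[t1 t2].
have i1 z := @integrable_conv ker z kk.
have i2 := @integrable_conv _ x kdn.
have i3 : (leb N).-integrable setT (EFin \o (fun y => psi y * (ker (y - x) + t * - 'D_(e_ i) ker (y - x)))).
  have := integrableD measurableT (i1 x) (integrableZl measurableT t i2).
  by apply: eq_integrable => // y _ /=; rewrite -EFinD; congr EFin; ring.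
have -> : conv psi ker (x + t *: e_ i) - conv psi ker x - t * conv psi (fun y => - 'D_(e_ i) ker y) x =
  \int[leb N]_y (psi y * ker (y - (x + t *: e_ i))) -
  \int[leb N]_y (psi y * (ker (y - x) + t * - 'D_(e_ i) ker (y - x))).
  rewrite -addrA -opprD; congr (_ - _).
  rewrite /conv -RintegralZl// -RintegralD//; last exact: (integrableZl measurableT t i2).
  by apply: eq_Rintegral => y _; ring.
apply: le_trans (@conv_diff_le _ _ x (B * `|t| * `|t|) _ _ (i1 _) i3 _ _) _.
- exact: ctr.
- have c1 := ctr _ x cker; have c2 := ctr _ x cd.
  move=> y; apply: cvgD (c1 y) _; apply: cvgM; first exact: cvg_cst.
  exact: cvgN (c2 y).
- move=> y; rewrite opprD addrA; set w := y - x.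
  have -> : ker (w - t *: e_ i) - (ker w + t * - 'D_(e_ i) ker w) =
     ker (w + (- t) *: e_ i) - ker w - (- t) * 'D_(e_ i) ker w by rewrite scaleNr; ring.
  rewrite -[X in B * _ * X]normrN; apply: mvt_abs => s st; first exact: (Ck_derivable (Ck 1%N)).
  have := @mvt_abs R _ ('D_(e_ i) ker) w (e_ i) s 0 B; rewrite mulr0 subr0 => h.
  apply: le_trans (h _ _) _.
  + by move=> ? _; exact: (Ck_derivable (Cd 1%N)).
  + by move=> ? _; rewrite subr0.
  + by rewrite ler_wpM2l ?(ltW B0)// -(normrN t).
- move=> y [j yj]; rewrite !k0 ?d0 ?oppr0 ?mulr0 ?addr0//; exists j; rewrite !mxE ?eqxx /=.
  + by rewrite distrC; lra.
  + by rewrite distrC; lra.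
  + rewrite opprD addrA -normrN opprB.
    have h : `|t * (j == i)%:R| <= `|t| by rewrite normrM ler_piMr//; case: eqP; rewrite ?normr1 ?normr0.
    have := lerB_normD (x 0 j - y 0 j) (t * (j == i)%:R).
    by rewrite (_ : t * _ - _ = x 0 j - y 0 j + t * (j == i)%:R); [lra|ring].
have -> : C * (B * `|t| * `|t|) * (2 * (L + 1)) ^+ N =
  (C * B * (2 * (L + 1)) ^+ N) * `|t| * `|t| by ring.
rewrite ler_wpM2r//; apply: (@le_trans _ _ (K * `|t|)); first by rewrite ler_wpM2r// /K; lra.
by move: t2; rewrite ltr_pdivlMr// mulrC => /ltW.
Qed.

Lemma Ck_conv k ker : kernel_on L ker -> Ck k (conv psi ker).
Proof.
elim: k ker => [|k ih] ker kk; split => //=; try exact: continuous_conv.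
move=> i; have h x := is_derive_conv i x kk; split; first by move=> x; have [] := h x.
apply: Ck_ext (ih _ (kernel_onN (kernel_on_derive i kk))) => x.
by have [_ ->] := h x.
Qed.

End conv.

End kernels.

Section mollifier.
Context (R : realType) (N : nat).
Local Notation e_ := (@basis_vec R N).

Definition bump (d : R) (x : 'rV[R]_N) : R := \prod_(i < N) (flat 0 (x 0 i) * flat 0 (d - x 0 i)).

Lemma Ck_flat k m i : Ck k (fun x : 'rV[R]_N => flat m (x 0 i)).
Proof.
have dE n (x : 'rV[R]_N) j : is_derive x (e_ j) (fun x : 'rV[R]_N => flat n (x 0 i))
    ((i == j)%:R * (flat n.+2 (x 0 i) + (- n%:R) * flat n.+1 (x 0 i))).
  have [df dv] := is_derive_flat n (x 0 i).
  apply: is_derive_eps => eta eta0; have [d d0 dP] := derive_eps df eta0.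
  exists d => // t td; rewrite !mxE eqxx /=.
  case: (eqVneq i j) => [ij|ij] /=.
    by have := dP t td; rewrite dv -[t *: 1]/(t * 1) mul1r mulNr.
  by rewrite mulr0 addr0 subrr mul0r mulr0 subr0 normr0 mulr_ge0// ltW.
have cE n : continuous (fun x : 'rV[R]_N => flat n (x 0 i)).
  move=> x; apply: (@continuous_comp _ _ _ (fun x : 'rV[R]_N => x 0 i) (flat n)).
    exact: coord_continuous.
  have [df _] := is_derive_flat n (x 0 i).
  by apply: differentiable_continuous; exact/derivable1_diffP.
elim: k m => [|k ih] m; split => //= j; split.
  by move=> x; have [] := dE m x j.
apply: Ck_ext (CkZ (i == j)%:R (CkD (ih m.+2) (CkZ (- m%:R) (ih m.+1)))) => x.
by have [_ ->] := dE m x j.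
Qed.

Lemma Ck_bump k d : Ck k (bump d).
Proof.
apply: Ck_prod => i; apply: CkM; first exact: Ck_flat.
apply: Ck_ext (Ck_diag_affine (fun=> -1) (fun=> d) (Ck_flat k 0 i)) => x /=.
by rewrite mxE; congr flat; ring.
Qed.

Lemma bump_ge0 d x : 0 <= bump d x.
Proof. by apply: prodr_ge0 => i _; rewrite mulr_ge0 ?flat_ge0. Qed.

Lemma bump_gt0 d (x : 'rV[R]_N) : (forall i, 0 < x 0 i < d) -> 0 < bump d x.
Proof.
move=> h; apply: prodr_gt0 => i _; have /andP[h1 h2] := h i.
by rewrite mulr_gt0 ?flat_gt0 ?subr_gt0.
Qed.

Lemma bump_neq0 d (x : 'rV[R]_N) : bump d x != 0 -> forall i, 0 < x 0 i < d.
Proof.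
move=> b0 i; apply/andP; rewrite -subr_gt0 -[_ < d]subr_gt0 subr0.
have : flat 0 (x 0 i) * flat 0 (d - x 0 i) != 0.
  by apply: contra_neq b0 => h; rewrite /bump (bigD1 i)//= h mul0r.
rewrite mulf_eq0 negb_or => /andP[h1 h2].
by split; rewrite -(flat_gt0 0) lt_neqAle flat_ge0 eq_sym ?h1 ?h2.
Qed.

Lemma bump_kernel d : 0 < d -> kernel_on d (bump d).
Proof.
move=> d0; split; first by move=> k; exact: Ck_bump.
move=> x [i xi]; apply/eqP; apply: contraTT xi => /bump_neq0/(_ i)/andP[h1 h2].
by rewrite -leNgt gtr0_norm// ltW.
Qed.

Lemma bump_integrable d x : 0 < d ->
  (leb N).-integrable setT (EFin \o (fun y => bump d (y - x))).
Proof.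
move=> d0.
have := integrable_conv d0 (@measurable_cst _ _ _ _ setT (1 : R)) (C := 1) _ x (bump_kernel d0).
have h1 : forall y : 'rV[R]_N, `|cst (1 : R) y| <= 1 by move=> y; rewrite normr1.
by move=> /(_ h1); apply: eq_integrable => // y _ /=; rewrite mul1r.
Qed.

Definition bump_mass d : R := \int[leb N]_y bump d y.

Lemma bump_mass_translate d x : 0 < d -> \int[leb N]_y bump d (y - x) = bump_mass d.
Proof.
move=> d0; apply: (Rintegral_translate (- x) (f := bump d)).
by have := bump_integrable 0 d0; apply: eq_integrable => // y _ /=; rewrite subr0.
Qed.

Lemma bump_mass_gt0 d : 0 < d -> 0 < bump_mass d.
Proof.
move=> d0; rewrite lt_neqAle Rintegral_ge0 ?andbT; last by move=> x _; exact: bump_ge0.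
apply/negP => /eqP m0.
have ib : (leb N).-integrable setT (EFin \o bump d).
  by have := bump_integrable 0 d0; apply: eq_integrable => // y _ /=; rewrite subr0.
have [+ _] := ae_eq_integral_abs (leb N) measurableT (measurable_int _ ib).
move=> /(_ _)[].
  rewrite (eq_integral (EFin \o bump d)); last by move=> x _ /=; rewrite ger0_norm ?bump_ge0.
  rewrite -[LHS]fineK; last exact: integrable_fin_num.
  by congr EFin; exact: (esym m0).
move=> Z [mZ Z0 sZ].
pose Q := [set x : 'rV[R]_N | forall i, `|(\row__ (d / 2)) 0 i - x 0 i| < d / 2].
have d2 : 0 < d / 2 by rewrite divr_gt0.
have : (leb N Q <= leb N Z)%E.
  apply: le_measure; rewrite ?inE//; first exact: measurable_box.
  move=> x Qx; apply: sZ => /= /(_ I)[] /eqP; apply/negP; rewrite gt_eqF//.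
  by apply: bump_gt0 => i; have := Qx i; rewrite mxE ltr_norml; lra.
by rewrite Z0 leb_box// lee_fin leNgt exprn_gt0// mulr_gt0.
Qed.

Definition mollify (d : R) (psi : 'rV[R]_N -> R) (x : 'rV[R]_N) : R :=
  conv psi (fun y => (bump_mass d)^-1 * bump d y) x.

Section mollify.
Variables (d : R) (d0 : 0 < d).

Let rho y := (bump_mass d)^-1 * bump d y.

Let krho : kernel_on d rho.
Proof.
have [Cb b0] := bump_kernel d0; split; first by move=> k; exact: CkZ.
by move=> x /b0; rewrite /rho => ->; rewrite mulr0.
Qed.

Let rho_ge0 y : 0 <= rho y.
Proof. by rewrite mulr_ge0 ?bump_ge0// invr_ge0 ltW// bump_mass_gt0. Qed.

Let irho x : (leb N).-integrable setT (EFin \o (fun y => rho (y - x))).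
Proof. exact: (integrableZl measurableT _ (bump_integrable x d0)). Qed.

Let rho1 x : \int[leb N]_y rho (y - x) = 1.
Proof.
rewrite /rho RintegralZl//; last exact: bump_integrable.
by rewrite bump_mass_translate// mulVf// gt_eqF// bump_mass_gt0.
Qed.

Section fixed.
Variables (psi : 'rV[R]_N -> R) (C : R).
Hypotheses (mpsi : measurable_fun setT psi) (psiC : forall x, `|psi x| <= C).

Lemma Ck_mollify k : Ck k (mollify d psi).
Proof. exact: (Ck_conv d0 mpsi psiC k krho). Qed.

Let ipsi x := integrable_conv d0 mpsi psiC x krho.

(** [mollify d psi x] is the mean of [psi] for a probability density carried by the cube [x + ]0,
    d[^N], hence inherits any bound valid there. Only points with larger coordinates are seen, which
    matters for functions with a jump below [x]. *)
Lemma mollify_near (x : 'rV[R]_N) (c eta : R) :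
  (forall y : 'rV[R]_N, (forall i, 0 < y 0 i - x 0 i < d) -> `|psi y - c| <= eta) ->
  `|mollify d psi x - c| <= eta.
Proof.
move=> h; have icr := integrableZl measurableT c (irho x).
have -> : mollify d psi x - c = \int[leb N]_y ((psi y - c) * rho (y - x)).
  rewrite -[X in _ - X]mulr1 -(rho1 x) -RintegralZl// /mollify /conv -RintegralB//.
    by apply: eq_Rintegral => y _; rewrite mulrBl.
  exact: ipsi.
have ii : (leb N).-integrable setT (EFin \o (fun y => (psi y - c) * rho (y - x))).
  have := integrableB measurableT (ipsi x) icr.
  by apply: eq_integrable => // y _ /=; rewrite mulrBl.
apply: le_trans (le_normr_Rintegral measurableT ii) _.
rewrite -[leRHS]mulr1 -(rho1 x) -RintegralZl//; apply: le_Rintegral => //.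
- exact: integrable_norm.
- exact: (integrableZl measurableT eta (irho x)).
move=> y _; rewrite normrM (ger0_norm (rho_ge0 _)).
have [r0|r0] := eqVneq (rho (y - x)) 0; first by rewrite r0 !mulr0.
rewrite ler_wpM2r//; apply: h => i.
have /bump_neq0/(_ i) : bump d (y - x) != 0 by apply: contra_neq r0; rewrite /rho => ->; rewrite mulr0.
by rewrite !mxE.
Qed.

Lemma mollify_translate x v :
  mollify d psi (x + v) = mollify d (fun y => psi (y + v)) x.
Proof.
rewrite /mollify /conv -(Rintegral_translate v); last exact: ipsi.
by apply: eq_Rintegral => y _; congr (_ * (_ * bump d _)); rewrite opprD addrACA subrr addr0.
Qed.

End fixed.

Lemma mollify_le (psi : 'rV[R]_N -> R) (C : R) : measurable_fun setT psi -> (forall x, `|psi x| <= C) ->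
  forall x, `|mollify d psi x| <= C.
Proof.
by move=> mpsi psiC x; have := mollify_near mpsi psiC (x := x) (c := 0) (eta := C);
  rewrite subr0; apply => y _; rewrite subr0.
Qed.

(** Mollification commutes with translation, so a difference quotient of the mean is the mean of the
    difference quotients. Forward increments of [psi] suffice, and [psi] itself may fail to be
    differentiable. *)
Lemma mollify_derive_near (psi : 'rV[R]_N -> R) (C : R) (x e : 'rV[R]_N) (c eta r : R) : measurable_fun setT psi ->
  (forall x, `|psi x| <= C) -> derivable (mollify d psi) x e -> 0 < r ->
  (forall y : 'rV[R]_N, (forall i, 0 < y 0 i - x 0 i < d) -> forall t, 0 < t < r ->
    `|psi (y + t *: e) - psi y - t * c| <= eta * t) ->
  `|'D_e (mollify d psi) x - c| <= eta.
Proof.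
move=> mpsi psiC dm r0 h; apply/ler_addgt0Pl => k k0.
have [s s0 sP] := derive_eps dm k0.
pose t := Num.min r s / 2.
have t0 : 0 < t by rewrite divr_gt0// lt_min r0.
have tr : t < r by rewrite ltr_pdivrMr// gt_min; apply/orP; left; lra.
have ts : `|t| < s by rewrite gtr0_norm// ltr_pdivrMr// gt_min; apply/orP; right; lra.
have := sP t ts; rewrite (gtr0_norm t0) (mollify_translate mpsi psiC).
have mt : measurable_fun setT (fun y : 'rV[R]_N => psi (y + t *: e)).
  exact: measurableT_comp mpsi (measurable_translate _).
have mB : measurable_fun setT (fun y : 'rV[R]_N => psi (y + t *: e) - psi y) by exact: measurable_funB.
have BC y : `|psi (y + t *: e) - psi y| <= C + C.
  by apply: le_trans (ler_normB _ _) _; apply: lerD.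
have -> : mollify d (fun y => psi (y + t *: e)) x - mollify d psi x =
   mollify d (fun y => psi (y + t *: e) - psi y) x.
  rewrite /mollify /conv -RintegralB//.
  - by apply: eq_Rintegral => y _; rewrite mulrBl.
  - exact: (integrable_conv d0 mt (fun y => psiC _) x krho).
  - exact: (integrable_conv d0 mpsi psiC x krho).
have tI : 0 < t < r by rewrite t0.
have := mollify_near mB BC (x := x) (c := t * c) (eta := eta * t) (fun y hy => h y hy t tI).
move: (mollify d (fun y => psi (y + t *: e) - psi y) x) => a ha hb.
have : `|t * 'D_e (mollify d psi) x - t * c| <= (k + eta) * t.
  have -> : t * 'D_e (mollify d psi) x - t * c = (a - t * c) - (a - t * 'D_e (mollify d psi) x) by ring.
  by apply: le_trans (ler_normB _ _) _; rewrite addrC mulrDl lerD.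
by rewrite -mulrBr normrM gtr0_norm// mulrC ler_pM2r.
Qed.

Lemma mollify_support (psi : 'rV[R]_N -> R) (S : set 'rV[R]_N) (x : 'rV[R]_N) :
  (forall y, ~ S y -> psi y = 0) -> mollify d psi x != 0 ->
  exists2 y : 'rV[R]_N, S y & forall i, 0 < y 0 i - x 0 i < d.
Proof.
move=> psi0; apply: contra_neqP => /forall2NP h.
rewrite /mollify /conv /Rintegral (eq_integral (cst 0%E)) ?integral0// => y _.
have [Sy|nS] := pselect (S y); last by rewrite psi0// mul0r.
have [//|nb] := h y.
have [->|b0] := eqVneq (bump d (y - x)) 0; first by rewrite !mulr0.
by exfalso; apply: nb => i; have := bump_neq0 b0 i; rewrite !mxE.
Qed.

End mollify.

(* Mollification averages over the cube [x + ]0, d[^N], so a function living on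
   [S] is spread over its [d]-neighbourhood. *)
Lemma test_function_mollify (d : R) (psi : 'rV[R]_N -> R) (C L : R) (S A : set 'rV[R]_N) : 0 < d ->
  measurable_fun setT psi -> (forall x, `|psi x| <= C) ->
  (forall y, ~ S y -> psi y = 0) ->
  (forall y i, S y -> `|y 0 i| <= L) ->
  (forall y, S y -> ball y (2 * d) `<=` A) -> test_function A (mollify d psi).
Proof.
move=> d0 mpsi psiC psi0 SL SA; split; first by move=> k; exact: (Ck_mollify d0 mpsi psiC).
pose K := closure [set x | mollify d psi x != 0].
have Sx x : mollify d psi x != 0 -> exists2 y, S y & ball y d x.
  move=> /(mollify_support psi0)[y Sy h]; exists y => //; apply/ball_rVE => // i.
  by rewrite ger0_norm; have := h i; lra.
exists K; split.
- apply: (subclosed_compact (@closed_closure _ _) (@compact_box R N (L + d + d))).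
  move=> x /(_ _ (nbhsx_ballx x d d0))[y [/Sx[z Sz zy] xy]] i.
  have := SL _ i Sz; move/ball_rVE: zy => /(_ d0)/(_ i); move/ball_rVE: xy => /(_ d0)/(_ i).
  by rewrite !ltr_norml !ler_norml; lra.
- move=> x /(_ _ (nbhsx_ballx x d d0))[y [/Sx[z Sz zy] xy]]; apply: (SA _ Sz).
  rewrite mulr2n mulrDl mul1r; apply: ball_triangle zy _; exact: ball_sym.
- move=> x xK; apply/eqP; apply: contrapT => /negP h; apply: xK; exact: subset_closure.
Qed.

End mollifier.

(** * Weak derivatives *)

Lemma cvg_div_nat2 (R : realType) (c : R) : (c / k.+2%:R) @[k --> \oo] --> 0.
Proof.
rewrite -(mulr0 c); apply: cvgM; first exact: cvg_cst.
apply: (@squeeze_cvgr _ _ _ _ (fun=> 0) (@harmonic R)); last exact: cvg_harmonic.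
  by apply: nearW => k; rewrite invr_ge0 ler0n /harmonic /= lef_pV2 ?posrE ?ltr0n// ler_nat.
exact: cvg_cst.
Qed.

Section Lebesgue_norms.
Context (R : realType) (N : nat).
Implicit Types (A : set 'rV[R]_N) (f g : 'rV[R]_N -> R).

Lemma sqrtr_lt (r e : R) : 0 <= r -> 0 < e -> (Num.sqrt r < e) = (r < e ^+ 2).
Proof.
by move=> r0 e0; rewrite -[e in LHS](ger0_norm (ltW e0)) -sqrtr_sqr ltr_sqrt// exprn_gt0.
Qed.

Lemma L2normE A f : L2norm A f = ((\int[leb N]_(x in A) (f x ^+ 2)%:E) `^ 2^-1)%E.
Proof.
rewrite /L2norm unlock /= [in RHS]integral_mkcond; congr (_ `^ _)%E.
apply: eq_integral => x _; rewrite /= !patchE; case: ifP => _.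
  by rewrite powR_mulrn// real_normK ?num_real.
by rewrite normr0 powR_mulrn// expr0n.
Qed.

Lemma L2P A f : measurable A -> L2 A f <-> sqint (leb N) A f.
Proof.
move=> mA; rewrite /L2; split.
  move=> /andP[]; rewrite !inE /= => mf; rewrite /finite_norm -/(L2norm A f) L2normE => foo.
  split; first exact/(measurable_restrictT _ mA).
  by apply: lty_poweRy foo; rewrite gt_eqF.
move=> [mf foo]; apply/andP; split; rewrite !inE /=.
  exact/(measurable_restrictT _ mA).
by rewrite /finite_norm -/(L2norm A f) L2normE; exact: poweR_lty.
Qed.

Lemma L2norm_lt A f (e : R) : 0 < e -> sqint (leb N) A f ->
  (L2norm A f < e%:E)%E = (rsq (leb N) A f < e ^+ 2).
Proof.
move=> e0 fA; rewrite L2normE rsqE// poweR_EFin lte_fin powR12_sqrt ?rsq_ge0//.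
by rewrite sqrtr_lt// rsq_ge0.
Qed.

End Lebesgue_norms.

Section test_functions.
Context (R : realType) (N : nat).
Implicit Types (A U : set 'rV[R]_N) (f g phi : 'rV[R]_N -> R).
Local Notation e_ := (@basis_vec R N).

Lemma test_functionS A B phi : A `<=` B -> test_function A phi -> test_function B phi.
Proof.
by move=> AB [Cphi [K [cK KA phi0]]]; split => //; exists K; split => //; exact: subset_trans AB.
Qed.

Lemma test_function_continuous A phi : test_function A phi -> continuous phi.
Proof. by move=> [Cphi _]; exact: (Ck_continuous (Cphi 0%N)). Qed.

Lemma test_function_measurable A phi : test_function A phi -> measurable_fun setT phi.
Proof. by move=> /test_function_continuous; exact: continuous_measurable_rV. Qed.

Lemma test_function_kernel A phi : test_function A phi -> exists2 L, 0 < L & kernel_on L phi.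
Proof.
move=> [Cphi [K [cK _ phi0]]]; have [L L0 LK] := compact_rV_box cK.
exists L => //; split => // x [i xi]; apply: phi0 => Kx; have := LK x i Kx; lra.
Qed.

Lemma test_function_out A phi x : test_function A phi -> ~ A x -> phi x = 0.
Proof. by move=> [_ [K [_ KA phi0]]] nA; apply: phi0 => /KA. Qed.

Lemma closed_compact_rV (K : set 'rV[R]_N) : compact K -> closed K.
Proof. by apply: compact_closed; exact: norm_hausdorff. Qed.

Lemma test_function_derive A phi i : test_function A phi -> test_function A ('D_(e_ i) phi).
Proof.
move=> [Cphi [K [cK KA phi0]]]; split; first by move=> k; exact: (Ck_derive (Cphi k.+1)).
exists K; split => // x Kx; suff [_ ->] : is_derive x (e_ i) phi 0 by [].
have /nbhs_ballP[r /= r0 rK] : nbhs x (~` K).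
  by apply: open_nbhs_nbhs; split => //; apply: closed_openC; exact: closed_compact_rV.
apply: is_derive_eps => eta eta0; exists r => // t tr.
rewrite mulr0 subr0 (phi0 x)// phi0; first by rewrite subrr normr0 mulr_ge0// ltW.
apply: rK; apply/ball_rVE => // j; rewrite !mxE eqxx /= opprD addrA subrr sub0r normrN.
by apply: le_lt_trans tr; rewrite normrM ler_piMr//; case: eqP; rewrite ?normr1 ?normr0.
Qed.

Lemma test_functionD A phi psi : test_function A phi -> test_function A psi ->
  test_function A (phi \+ psi).
Proof.
move=> [Cp [K [cK KA p0]]] [Cq [L [cL LA q0]]]; split; first by move=> k; exact: CkD.
exists (K `|` L); split; [exact: compactU|by move=> x [/KA|/LA]|].
by move=> x /not_orP[nK nL]; rewrite /= p0// q0// addr0.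
Qed.

Lemma test_functionM A phi psi : test_function A phi -> (forall k, Ck k psi) ->
  test_function A (phi \* psi).
Proof.
move=> [Cp [K [cK KA p0]]] Cq; split; first by move=> k; exact: CkM.
by exists K; split => // x nK; rewrite /= p0// mul0r.
Qed.

Lemma test_function_bounded A phi : test_function A phi ->
  exists2 B, 0 < B & forall x, `|phi x| <= B.
Proof. by move=> /test_function_kernel[L L0 /kernel_on_bounded]. Qed.

Lemma test_function_cutoff U : open U -> exists chi : nat -> 'rV[R]_N -> R,
  [/\ forall k, test_function U (chi k), forall k x, 0 <= chi k x <= 1 &
      forall x, U x -> exists K, forall k, (K <= k)%N -> chi k x = 1].
Proof.
move=> oU; pose d k : R := k.+1%:R^-1.
have d0 k : 0 < d k by rewrite invr_gt0 ltr0n.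
(* Points of [W k] are within [d k] of a centre whose ball of radius [3 * d k] lies in [U], so that
   the margin [2 * d k] required by [test_function_mollify] remains. The bound on the centres keeps
   the support bounded. *)
pose C k := [set c : 'rV[R]_N | (forall i, `|c 0 i| <= k%:R) /\ ball c (3 * d k) `<=` U].
pose W k := \bigcup_(c in C k) ball c (d k).
have mW k : measurable (W k).
  by apply: open_measurable_rV; apply: bigcup_open => c _; exact: ball_open.
have b1 k x : `|\1_(W k) x| <= 1 :> R by rewrite indicE; case: (_ \in _); rewrite ?normr1 ?normr0.
exists (fun k => mollify (d k) (\1_(W k))); split.
- move=> k; apply: (@test_function_mollify _ _ _ _ 1 (k%:R + d k) (W k)) => //.
  + by move=> y yW; rewrite indicE memNset.
  + move=> y i [c [ck _] cy]; have h := (ball_rVE c y (d0 k)).1 cy i; have := ck i.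
    rewrite ltr_norml in h; rewrite !ler_norml; lra.
  + move=> y [c [_ cU] cy] z yz; apply: cU; rewrite (_ : 3 * d k = d k + 2 * d k); last by ring.
    exact: ball_triangle cy yz.
- move=> k x.
  have mI : measurable_fun setT (\1_(W k) : 'rV[R]_N -> R) by exact: measurable_indic.
  have := @mollify_near R N (d k) (d0 k) (\1_(W k)) 1 mI (b1 k) x 2^-1 2^-1.
  rewrite ler_norml => h; have /h/andP[h1 h2] : forall y : 'rV[R]_N,
      (forall i, 0 < y 0 i - x 0 i < d k) -> `|\1_(W k) y - 2^-1| <= 2^-1 :> R.
    by move=> y _; rewrite indicE; case: (_ \in _); rewrite ler_norml /=; apply/andP; split; lra.
  by apply/andP; split; lra.
- move=> x Ux; have /nbhs_ballP[r /= r0 rU] := oU _ Ux.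
  pose M := \sum_i `|x 0 i|.
  have M0 : 0 <= M by exact: sumr_ge0.
  exists (Num.truncn (M + 3 / r)).+1 => k Mk.
  have kM : M + 3 / r < k%:R.
    by apply: lt_le_trans (truncnS_gt _) _; rewrite ler_nat.
  have r3 : 0 < 3 / r by rewrite divr_gt0.
  apply/eqP; rewrite -subr_eq0 -normr_eq0 eq_le normr_ge0 andbT.
  apply: mollify_near => // y hy; rewrite indicE mem_set ?subrr ?normr0//.
  exists x; last by apply/ball_rVE => // i; have := hy i; rewrite distrC ltr_norml; lra.
  split => [i|].
    have : `|x 0 i| <= M by rewrite /M (bigD1 i)//= lerDl sumr_ge0.
    by lra.
  apply: subset_trans rU; apply: le_ball; rewrite -ler_pdivlMl// /d -[leRHS]invrK lef_pV2 ?posrE ?invr_gt0//.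
    by rewrite invfM invrK mulrC; apply: (@le_trans _ _ k%:R); [lra|rewrite ler_nat].
  by rewrite mulr_gt0.
Qed.

End test_functions.

(** * The fundamental lemma of the calculus of variations *)

Section uniqueness.
Context (R : realType) (N : nat).
Implicit Types (A U : set 'rV[R]_N) (f g phi : 'rV[R]_N -> R).

Lemma measurable_rV_sub_open : measurable `<=` <<s [set U : set 'rV[R]_N | open U] >>.
Proof.
move=> A mA; pose T := g_sigma_algebraType [set U : set 'rV[R]_N | open U].
have mid : measurable_fun setT (fun x : T => (x : 'rV[R]_N)).
  apply: measurable_fun_coordP => i.
  apply: (measurability _ (RGenOInfty.measurableE R)) => _ [_ [r ->] <-].
  rewrite setTI; apply: sub_sigma_algebra => /=.
  have /continuousP : continuous (fun x : 'rV[R]_N => x 0 i) by move=> x; exact: coord_continuous.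
  by apply; exact: interval_open.
by have := mid measurableT A mA; rewrite setTI.
Qed.

(** Cut-offs converging to the indicator of [A] intersected with an open [U] show that [g] has
    integral zero there. Open sets are stable under intersection and generate the Borel sets, so a
    Dynkin argument gives the same for every Borel set. *)
Lemma integral_test_ae0 A g : open A -> (leb N).-integrable A (EFin \o g) ->
  (forall phi, test_function A phi -> \int[leb N]_(x in A) (g x * phi x) = 0) ->
  {ae leb N, forall x, A x -> g x = 0}.
Proof.
move=> oA ig g0; have mA := open_measurable_rV oA.
have /integrableP[mg _] := ig.
have gU U : open U -> (\int[leb N]_(x in A `&` U) (g x)%:E = 0)%E.
  move=> oU; have oAU : open (A `&` U) by exact: openI.
  have mAU := open_measurable_rV oAU.
  have [chi [chiT chi01 chi1]] := test_function_cutoff oAU.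
  have mgR : measurable_fun A g by exact/measurable_EFinP.
  have [] := @dominated_convergence _ _ _ (leb N) A mA (fun k x => (g x * chi k x)%:E)
     (fun x => (g x * \1_(A `&` U) x)%:E) (fun x => `|(g x)%:E|%E).
  - move=> k; apply/measurable_EFinP; apply: measurable_funM => //.
    by apply: measurable_funTS; exact: test_function_measurable (chiT k).
  - by apply/measurable_EFinP; apply: measurable_funM => //; exact: measurable_indic.
  - apply: aeW => x Ax; apply: cvg_EFin; first by near=> k.
    apply: cvgM; first exact: cvg_cst.
    have [AUx|nAU] := pselect ((A `&` U) x).
      have [K KP] := chi1 _ AUx; rewrite indicE mem_set//.
      by apply: cvg_near_cst; exists K => // k /= /KP.
    rewrite indicE memNset//; apply: cvg_near_cst; apply: nearW => k.
    exact: test_function_out (chiT k) nAU.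
  - exact: integrable_abse.
  - apply: aeW => x k Ax; rewrite /= lee_fin normrM ler_piMr//.
    by have /andP[h1 h2] := chi01 k x; rewrite ger0_norm.
  move=> _ _; have -> : [sequence (\int[leb N]_(x in A) (g x * chi k x)%:E)%E]_k = cst 0%E.
    apply/funext => k /=.
    have := g0 (chi k) (test_functionS (@subIsetl _ _ _) (chiT k)).
    rewrite /Rintegral => h; rewrite -[LHS]fineK ?h//.
    apply: integrable_fin_num => //.
    have [B _ chiB] := test_function_bounded (chiT k).
    apply: (@le_integrable _ _ _ _ _ mA _ (fun x => `|(g x)%:E|%E)) => //.
    - apply/measurable_EFinP; apply: measurable_funM => //.
      by apply: measurable_funTS; exact: test_function_measurable (chiT k).
    - move=> x Ax; rewrite /= normr_id lee_fin normrM ler_piMr//.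
      by have /andP[h1 h2] := chi01 k x; rewrite ger0_norm.
    - exact: integrable_abse.
  move=> /(cvg_lim (@ereal_hausdorff R)); rewrite lim_cst; last exact: ereal_hausdorff.
  move=> h; transitivity (\int[leb N]_(x in A) (g x * \1_(A `&` U) x)%:E)%E => //.
  rewrite integral_mkcond [RHS]integral_mkcond.
  apply: eq_integral => x _; rewrite !patchE indicE in_setI.
  by case: (x \in A); case: (x \in U); rewrite /= ?mulr1 ?mulr0.
pose G := [set E : set 'rV[R]_N | measurable E /\ (\int[leb N]_(x in A `&` E) (g x)%:E = 0)%E].
have dG : dynkin G.
  split.
  - split => //; exact: (gU _ openT).
  - move=> E [mE E0]; split; first exact: measurableC.
    have mAE : measurable (A `&` E) by exact: measurableI.
    have mAE' : measurable (A `&` ~` E) by apply: measurableI => //; exact: measurableC.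
    have AEE : A `&` E `|` A `&` ~` E = A by rewrite -setIUr setUv setIT.
    have := @integral_setU _ _ _ (leb N) _ _ (EFin \o g) mAE mAE'; rewrite AEE => /(_ mg).
    have dis : [disjoint A `&` E & A `&` ~` E] by apply/disj_setPS => x [[_ +] [_ +]].
    move=> /(_ dis); rewrite E0 add0e => <-.
    by have := gU _ openT; rewrite setIT.
  - move=> F tF GF; split; first by apply: bigcup_measurable => k _; case: (GF k).
    have mAF k : measurable (A `&` F k) by apply: measurableI => //; case: (GF k).
    rewrite setI_bigcupr integral_bigcup//.
    + by apply: eseries0 => k _ _; case: (GF k).
    + exact: trivIset_setIl.
    + apply: integrableS ig => //; first exact: bigcup_measurable.
      by apply: bigcup_sub => k _; exact: subIsetl.
have sG : measurable `<=` G.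
  apply: subset_trans measurable_rV_sub_open _.
  rewrite -setI_closed_g_dynkin_g_sigma_algebra; last by move=> U V; exact: openI.
  apply: smallest_sub => // U oU; split; [exact: open_measurable_rV|exact: gU].
have [|Z [mZ Z0 sZ]] := @integral_ae_eq _ _ _ (leb N) A mA (cst 0%E) (EFin \o g) ig (measurable_cst _).
  move=> E EA mE; rewrite integral0; have [_] := sG _ mE.
  by rewrite setIidr.
exists Z; split => // x nx; apply: sZ => /= h; apply: nx => Ax.
by have [] := h Ax.
Unshelve. all: by end_near. Qed.

End uniqueness.

Section weak_derivatives.
Context (R : realType) (N : nat).
Implicit Types (A U : set 'rV[R]_N) (f g phi : 'rV[R]_N -> R).
Local Notation e_ := (@basis_vec R N).
Local Notation mu := (@leb R N).

Lemma test_function_sqint A B phi : measurable B -> test_function A phi -> sqint mu B phi.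
Proof.
move=> mB tp; have [L L0 [Cp p0]] := test_function_kernel tp.
have [C C0 pC] := test_function_bounded tp; have mp := test_function_measurable tp.
have mp2 : measurable_fun setT (fun x => phi x ^+ 2) by exact: measurable_funX.
have [| | |/integrableP[_ i2] _] := @integrable_box R N (fun x => phi x ^+ 2) 0 (L + 1) (C ^+ 2) _ mp2.
- exact: addr_gt0.
- by move=> x; rewrite normrX ler_pXn2r ?nnegrE// ltW.
- move=> x [i]; rewrite mxE sub0r normrN => xi; rewrite p0 ?expr0n//; exists i; lra.
apply: (@sqint_subset _ _ _ _ _ setT) => //; split => //.
apply: le_lt_trans i2; rewrite le_eqVlt; apply/orP; left; apply/eqP.
by apply: eq_integral => x _ /=; rewrite ger0_norm ?sqr_ge0.
Qed.

Lemma weak_pderiv_uniq A i f g1 g2 : open A -> (mu A < +oo)%E ->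
  is_weak_pderiv A i f g1 -> is_weak_pderiv A i f g2 ->
  {ae mu, forall x, A x -> g1 x = g2 x}.
Proof.
move=> oA Aoo [/L2P g1A w1] [/L2P g2A w2]; have mA := open_measurable_rV oA.
have {}g1A := g1A mA; have {}g2A := g2A mA.
have : {ae mu, forall x, A x -> g1 x - g2 x = 0}.
  apply: integral_test_ae0 => //; first exact: (sqint_integrable mA Aoo (sqintB mA g1A g2A)).
  move=> phi tp; have pA := test_function_sqint mA tp.
  have i1 := sqint_mul mA g1A pA; have i2 := sqint_mul mA g2A pA.
  have -> : \int[mu]_(x in A) ((g1 x - g2 x) * phi x) =
      \int[mu]_(x in A) (g1 x * phi x) - \int[mu]_(x in A) (g2 x * phi x).
    by rewrite -RintegralB//; apply: eq_Rintegral => x _; rewrite mulrBl.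
  by apply/eqP; rewrite subr_eq0 -eqr_opp -w1// -w2.
by apply: filterS => x h Ax; apply/eqP; rewrite -subr_eq0 h.
Qed.

Lemma weak_pderivP A i f g : is_weak_pderiv A i f g ->
  is_weak_pderiv A i f (weak_pderiv A i f).
Proof. by move=> fg; rewrite /weak_pderiv; case: xgetP => [g' _|/(_ g)]. Qed.

Lemma weak_pderiv_ae A i f g : open A -> (mu A < +oo)%E -> is_weak_pderiv A i f g ->
  {ae mu, forall x, A x -> weak_pderiv A i f x = g x}.
Proof. by move=> oA Aoo fg; exact: (weak_pderiv_uniq oA Aoo (weak_pderivP fg) fg). Qed.

Lemma is_weak_pderiv_eq A i f f' g : (forall x, A x -> f x = f' x) ->
  is_weak_pderiv A i f g -> is_weak_pderiv A i f' g.
Proof.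
move=> ff' [gA w]; split => // phi tp; rewrite -w//.
by apply: eq_Rintegral => x /set_mem Ax; rewrite ff'.
Qed.

Lemma is_weak_pderivS A U i f g : open A -> open U -> U `<=` A ->
  is_weak_pderiv A i f g -> is_weak_pderiv U i f g.
Proof.
move=> oA oU UA [gA w]; have mA := open_measurable_rV oA; have mU := open_measurable_rV oU.
split; first by apply/L2P => //; apply: sqint_subset UA _ => //; exact/L2P.
move=> phi tp; have := w _ (test_functionS UA tp).
have E (h psi : 'rV[R]_N -> R) : (forall x, ~ U x -> psi x = 0) ->
    \int[mu]_(x in A) (h x * psi x) = \int[mu]_(x in U) (h x * psi x).
  move=> p0; rewrite Rintegral_mkcond [RHS]Rintegral_mkcond; apply: eq_Rintegral => x _.
  rewrite !patchE; case: (boolP (x \in U)) => [/set_mem Ux|/negP nU].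
    by rewrite mem_set//; exact: UA.
  by case: ifP => // _; rewrite p0 ?mulr0// => Ux; apply: nU; exact: mem_set.
rewrite !E => // x nU; first exact: test_function_out tp nU.
exact: (test_function_out (test_function_derive i tp) nU).
Qed.

Lemma is_weak_pderivD A i f f' g g' : measurable A ->
  sqint mu A f -> sqint mu A f' ->
  is_weak_pderiv A i f g -> is_weak_pderiv A i f' g' ->
  is_weak_pderiv A i (f \+ f') (g \+ g').
Proof.
move=> mA fA fA' [/L2P gA w] [/L2P gA' w']; have {}gA := gA mA; have {}gA' := gA' mA.
split; first by apply/L2P => //; exact: sqintD.
move=> phi tp; have pA := test_function_sqint mA tp.
have dA := test_function_sqint mA (test_function_derive i tp).
have E (h h' psi : 'rV[R]_N -> R) : sqint mu A h -> sqint mu A h' -> sqint mu A psi ->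
    \int[mu]_(x in A) ((h x + h' x) * psi x) =
    \int[mu]_(x in A) (h x * psi x) + \int[mu]_(x in A) (h' x * psi x).
  move=> hA hA' sA; rewrite -RintegralD//; [|exact: sqint_mul|exact: sqint_mul].
  by apply: eq_Rintegral => x _; rewrite mulrDl.
by rewrite !E// w// w'// opprD.
Qed.

Lemma is_weak_pderivZ A i c f g : measurable A -> sqint mu A f ->
  is_weak_pderiv A i f g -> is_weak_pderiv A i (fun x => c * f x) (fun x => c * g x).
Proof.
move=> mA fA [/L2P gA w]; have {}gA := gA mA.
split; first by apply/L2P => //; exact: sqintZ.
move=> phi tp; have pA := test_function_sqint mA tp.
have dA := test_function_sqint mA (test_function_derive i tp).
have E (h psi : 'rV[R]_N -> R) : sqint mu A h -> sqint mu A psi ->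
    \int[mu]_(x in A) (c * h x * psi x) = c * \int[mu]_(x in A) (h x * psi x).
  move=> hA sA; rewrite -RintegralZl//; last exact: sqint_mul.
  by apply: eq_Rintegral => x _; rewrite mulrA.
by rewrite !E// w// mulrN.
Qed.

Lemma is_weak_pderivB A i f f' g g' : measurable A ->
  sqint mu A f -> sqint mu A f' ->
  is_weak_pderiv A i f g -> is_weak_pderiv A i f' g' ->
  is_weak_pderiv A i (f \- f') (g \- g').
Proof.
move=> mA fA fA' w w'.
have := is_weak_pderivD mA fA (sqintZ mA (-1) fA') w (is_weak_pderivZ (-1) mA fA' w').
rewrite (_ : f \+ _ = f \- f'); last by apply/funext => x /=; rewrite mulN1r.
by rewrite (_ : g \+ _ = g \- g')//; apply/funext => x /=; rewrite mulN1r.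
Qed.

Lemma Rintegral_mul_cvg A f psi (fk : nat -> 'rV[R]_N -> R) : measurable A ->
  sqint mu A f -> (forall k, sqint mu A (fk k)) -> sqint mu A psi ->
  rsq mu A (fk k \- f) @[k --> \oo] --> 0 ->
  \int[mu]_(x in A) (fk k x * psi x) @[k --> \oo] --> \int[mu]_(x in A) (f x * psi x).
Proof.
move=> mA fA fkA pA cf; apply/cvgrPdist_le => e e0.
pose P := rsq mu A psi + 1; have P0 : 0 < P by rewrite ltr_wpDl// rsq_ge0.
pose l := 2 * P / e; have l0 : 0 < l by rewrite divr_gt0// mulr_gt0.
have e2 : 0 < e / 2 / l by rewrite divr_gt0// divr_gt0.
near=> k; have kf : rsq mu A (fk k \- f) < e / 2 / l by near: k; exact: (cvgr_lt 0).
rewrite -RintegralB//; [|exact: sqint_mul|exact: sqint_mul].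
rewrite (_ : \int[mu]_(x in A) _ = \int[mu]_(x in A) ((f \- fk k) x * psi x)); last first.
  by apply: eq_Rintegral => x _; rewrite mulrBl.
apply: le_trans (rsq_mul_le mA l0 (sqintB mA fA (fkA k)) pA) _.
rewrite rsqC; have h1 : l * rsq mu A (fk k \- f) <= e / 2.
  by rewrite mulrC -ler_pdivlMr// ltW.
have h2 : l^-1 * rsq mu A psi <= e / 2.
  rewrite /l invf_div -mulrA ler_pM2l// ler_pdivrMl ?mulr_gt0//.
  by rewrite /P; lra.
by rewrite [leRHS]splitr lerD.
Unshelve. all: by end_near. Qed.

Lemma is_weak_pderiv_lim A i f g (fk gk : nat -> 'rV[R]_N -> R) : measurable A ->
  sqint mu A f -> sqint mu A g -> (forall k, sqint mu A (fk k)) ->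
  (forall k, is_weak_pderiv A i (fk k) (gk k)) ->
  rsq mu A (fk k \- f) @[k --> \oo] --> 0 -> rsq mu A (gk k \- g) @[k --> \oo] --> 0 ->
  is_weak_pderiv A i f g.
Proof.
move=> mA fA gA fkA w cf cg; split; first exact/L2P.
move=> phi tp; have pA := test_function_sqint mA tp.
have dA := test_function_sqint mA (test_function_derive i tp).
have gkA k : sqint mu A (gk k) by apply/L2P => //; case: (w k).
have c1 := Rintegral_mul_cvg mA fA fkA dA cf.
have c2 : (- \int[mu]_(x in A) (gk k x * phi x)) @[k --> \oo] --> - \int[mu]_(x in A) (g x * phi x).
  by apply: cvgN; exact: Rintegral_mul_cvg.
apply: (cvg_unique (@norm_hausdorff _ _) c1).
by rewrite (_ : (fun k => _) = (fun k => - \int[mu]_(x in A) (gk k x * phi x)))//;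
  apply/funext => k; have [_ ->] := w k.
Qed.

Lemma compact_measurable_rV (K : set 'rV[R]_N) : compact K -> measurable K.
Proof.
move=> cK; rewrite -[K]setCK; apply: measurableC; apply: open_measurable_rV.
by apply: closed_openC; exact: closed_compact_rV.
Qed.

Lemma compact_open_ball (K : set 'rV[R]_N) A : compact K -> open A -> K `<=` A ->
  exists2 r, 0 < r & forall x, K x -> ball x r `<=` A.
Proof.
move=> /compact_near_coveringP cK oA KA.
have : \forall r \near (0 : R)^'+, K `<=` (fun x => ball x r `<=` A).
  apply: cK => x Kx; have /nbhs_ballP[r /= r0 rA] := oA _ (KA _ Kx).
  exists (ball x (r / 2), [set s : R | s < r / 2]) => /=.
    split; first by apply: nbhsx_ballx; rewrite divr_gt0.
    by apply: nbhs_right_lt; rewrite divr_gt0.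
  move=> [y s] /= [xy sr] z yz; apply: rA; rewrite (splitr r).
  by apply: ball_triangle xy _; apply: le_ball yz; exact: ltW.
move=> h; near (0 : R)^'+ => r; exists r => //; near: r; exact: h.
Unshelve. all: by end_near. Qed.

(** A single step [t] per compact set and accuracy is asked for, so closeness along a sequence is
    enough. Against a test function the increment is shifted from [f] to [phi], whose quotients
    converge uniformly. *)
Lemma is_weak_pderiv_quotient A i f g : open A -> (mu A < +oo)%E ->
  sqint mu A f -> sqint mu A g ->
  (forall K : set 'rV[R]_N, compact K -> K `<=` A -> forall eps r, 0 < eps -> 0 < r ->
    exists2 t, 0 < t < r &
      sqint mu K (fun y => (f (y + t *: e_ i) - f y) / t - g y) /\
      rsq mu K (fun y => (f (y + t *: e_ i) - f y) / t - g y) <= eps) ->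
  is_weak_pderiv A i f g.
Proof.
move=> oA Aoo fA gA h; have mA := open_measurable_rV oA.
split; first exact/L2P.
move=> phi tp; have [Cp [K [cK KA p0]]] := tp.
have mK := compact_measurable_rV cK.
have [r0 r00 rA] := compact_open_ball cK oA KA.
have pA := test_function_sqint mA tp.
have td := test_function_derive i tp; have dA := test_function_sqint mA td.
have [B B0 dB] := test_function_bounded (test_function_derive i td).
have cd := Ck_derivable (proj1 td 1%N).
pose F := f \_ A.
have mF : measurable_fun setT F by apply/(measurable_restrictT _ mA); case: fA.
have iF : (mu).-integrable setT (EFin \o (fun y => `|F y|)).
  apply: (@integrable_norm _ _ _ mu setT F).
  have := (integrable_mkcond (EFin \o f) mA).1 (sqint_integrable mA Aoo fA).
  by rewrite restrict_EFin.
apply/eqP; rewrite -subr_eq0 opprK -normr_eq0 eq_le normr_ge0 andbT.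
apply/ler_addgt0Pl => e e0; rewrite addr0.
pose P := rsq mu A phi + 1; have P0 : 0 < P by rewrite ltr_wpDl// rsq_ge0.
(* This weight balances [rsq_mul_le]: the quotient error, at most [e / 4 / l], and the norm of [phi]
   contribute at most [e / 4] each. The other [e / 2] pays for the quotient of [phi], through the
   choice of [s]. *)
pose l := 4 * P / e; have l0 : 0 < l by rewrite divr_gt0// mulr_gt0.
have el : 0 < e / 4 / l by rewrite divr_gt0// divr_gt0.
pose I := \int[mu]_y `|F y|; have I0 : 0 <= I by exact: Rintegral_ge0.
pose s := Num.min r0 (e / 2 / (B * I + 1)).
have BI : 0 < B * I + 1 by rewrite ltr_wpDl// mulr_ge0// ltW.
have s0 : 0 < s by rewrite lt_min r00 divr_gt0// divr_gt0.
have [t /andP[t0 ts] [qK qe]] := h K cK KA _ _ el s0.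
have tr0 : t < r0 by rewrite (lt_le_trans ts)// ge_min lexx.
pose Q y := (f (y + t *: e_ i) - f y) / t.
have bph := test_function_bounded tp.
have iFp (psi : 'rV[R]_N -> R) : measurable_fun setT psi -> (exists2 C, 0 < C & forall x, `|psi x| <= C) ->
    (mu).-integrable setT (EFin \o (fun y => F y * psi y)).
  move=> mpsi [C C0 psiC].
  apply: (@le_integrable _ _ _ _ _ measurableT _ (fun y => (C * `|F y|)%:E)) => //.
  - by apply/measurable_EFinP; exact: measurable_funM.
  - move=> y _; rewrite /= lee_fin normrM mulrC [leRHS]ger0_norm ?mulr_ge0 ?(ltW C0)//.
    by rewrite ler_wpM2r.
  - exact: (integrableZl measurableT C iF).
have mphi := test_function_measurable tp.
pose ps y := phi (y - t *: e_ i).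
have mps : measurable_fun setT ps by exact: measurableT_comp mphi (measurable_translate _).
have bps : exists2 C, 0 < C & forall x, `|ps x| <= C by have [C C0 pC] := bph; exists C => // x; exact: pC.
have gK : sqint mu K g by exact: sqint_subset KA gA.
have sQ : sqint mu K Q.
  have := sqintD mK qK gK; apply: eq_sqint => y _ /=; exact: subrK.
have pK : sqint mu K phi by exact: sqint_subset KA pA.
have toK (h' : 'rV[R]_N -> R) : \int[mu]_y (F y * h' y) = \int[mu]_(y in A) (f y * h' y).
  rewrite [RHS]Rintegral_mkcond; apply: eq_Rintegral => y _; rewrite /F !patchE.
  by case: ifP => _; rewrite ?mul0r.
(* Discrete integration by parts. *)
have E1 : \int[mu]_y (F y * ps y) - \int[mu]_y (F y * phi y) = t * \int[mu]_(y in K) (Q y * phi y).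
  have ip := iFp _ mps bps; have := Rintegral_translate (t *: e_ i) ip => <-.
  have i1 := integrable_translate (t *: e_ i) ip; have i2 := iFp _ mphi bph.
  rewrite -(RintegralB measurableT i1 i2).
  rewrite -RintegralZl//; last exact: sqint_mul.
  rewrite [RHS]Rintegral_mkcond; apply: eq_Rintegral => y _; rewrite /ps addrK patchE.
  case: ifPn => [/set_mem Ky|/negP nK]; last first.
    by rewrite (p0 y) ?mulr0 ?subrr// => Ky; apply: nK; exact: mem_set.
  rewrite /F !patchE !mem_set; [|exact: KA|].
    by rewrite /Q; field; rewrite gt_eqF.
  apply: (rA _ Ky); apply/ball_rVE => // j; rewrite !mxE eqxx /= opprD addrA subrr sub0r normrN.
  by rewrite normrM gtr0_norm// (le_lt_trans _ tr0)// ler_piMr ?(ltW t0)//; case: eqP; rewrite ?normr1 ?normr0.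
have E2 : `|\int[mu]_(y in A) (f y * 'D_(e_ i) phi y) -
    t^-1 * (\int[mu]_y (F y * phi y) - \int[mu]_y (F y * ps y))| <= e / 2.
  have i1 := iFp _ mphi bph; have i2 := iFp _ mps bps.
  have i3 := iFp _ (test_function_measurable td) (test_function_bounded td).
  rewrite -toK -RintegralB// -RintegralZl//; last first.
    exact: (integrableB measurableT i1 i2).
  rewrite -RintegralB//; last first.
    exact: (integrableZl measurableT t^-1 (integrableB measurableT i1 i2)).
  rewrite (_ : \int[mu]_y _ = \int[mu]_y (F y * ('D_(e_ i) phi y - t^-1 * (phi y - ps y)))); last first.
    by apply: eq_Rintegral => y _; ring.
  have i4 : (mu).-integrable setT (EFin \o (fun y => F y * ('D_(e_ i) phi y - t^-1 * (phi y - ps y)))).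
    have := integrableB measurableT i3 (integrableZl measurableT t^-1 (integrableB measurableT i1 i2)).
    by apply: eq_integrable => // y _ /=; rewrite -!EFinB; congr EFin; ring.
  apply: le_trans (le_normr_Rintegral measurableT i4) _.
  apply: (@le_trans _ _ (\int[mu]_y (B * t * `|F y|))).
    apply: le_Rintegral => //; first exact: integrable_norm.
      exact: (integrableZl measurableT (B * t) iF).
    move=> y _; rewrite normrM mulrC ler_wpM2r//.
    have := @mvt_abs R _ phi y (e_ i) (- t) ('D_(e_ i) phi y) (B * t) => hm.
    rewrite -(ler_pM2l t0) -[X in X * `|_|]gtr0_norm// -normrM.
    have -> : t * ('D_(e_ i) phi y - t^-1 * (phi y - ps y)) =
       phi (y + - t *: e_ i) - phi y - - t * 'D_(e_ i) phi y.
      by rewrite scaleNr /ps; field; rewrite gt_eqF.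
    apply: le_trans (hm _ _) _; last by rewrite normrN gtr0_norm// mulrC.
    + by move=> z _; exact: (Ck_derivable (Cp 1%N)).
    + move=> z zt; have := @mvt_abs R _ ('D_(e_ i) phi) y (e_ i) z 0 B; rewrite mulr0 subr0 => hm2.
      apply: le_trans (hm2 _ _) _; [by move=> w _; exact: cd|by move=> w _; rewrite subr0|].
      by rewrite ler_pM2l// (le_trans zt)// normrN gtr0_norm.
  rewrite RintegralZl// -/I; apply: (@le_trans _ _ ((B * I + 1) * t)).
    by rewrite mulrAC ler_wpM2r ?(ltW t0)//; lra.
  by rewrite mulrC -ler_pdivlMr// ltW// (lt_le_trans ts)// ge_min lexx orbT.
have E3 : `|\int[mu]_(y in K) (Q y * phi y) - \int[mu]_(y in A) (g y * phi y)| <= e / 2.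
  have -> : \int[mu]_(y in A) (g y * phi y) = \int[mu]_(y in K) (g y * phi y).
    rewrite Rintegral_mkcond [RHS]Rintegral_mkcond; apply: eq_Rintegral => y _; rewrite !patchE.
    case: (boolP (y \in K)) => [/set_mem Ky|/negP nK]; first by rewrite mem_set//; exact: KA.
    by rewrite p0 ?mulr0 ?if_same// => Ky; apply: nK; exact: mem_set.
  rewrite -RintegralB//; [|exact: sqint_mul|exact: sqint_mul].
  rewrite (_ : \int[mu]_(y in K) _ = \int[mu]_(y in K) ((Q y - g y) * phi y)); last first.
    by apply: eq_Rintegral => y _; rewrite mulrBl.
  apply: le_trans (rsq_mul_le mK l0 qK pK) _.
  have h1 : l * (e / 4 / l) = e / 4 by field; rewrite gt_eqF.
  have h2 : l^-1 * rsq mu K phi <= e / 4.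
    rewrite /l invf_div -mulrA ler_pM2l// ler_pdivrMl ?mulr_gt0//.
    have := rsq_subset mK mA KA pA; rewrite /P; clear; lra.
  move: (ler_wpM2l (ltW l0) qe) h2; rewrite h1; clear; lra.
have E4 : t^-1 * (\int[mu]_y (F y * phi y) - \int[mu]_y (F y * ps y)) = - \int[mu]_(y in K) (Q y * phi y).
  by rewrite -opprB E1; field; rewrite gt_eqF.
rewrite E4 opprK in E2.
rewrite (_ : _ + _ = (\int[mu]_(y in A) (f y * 'D_(e_ i) phi y) + \int[mu]_(y in K) (Q y * phi y)) -
   (\int[mu]_(y in K) (Q y * phi y) - \int[mu]_(y in A) (g y * phi y))); last by ring.
by rewrite (splitr e) (le_trans (ler_normB _ _))// lerD.
Qed.

(** Dominated convergence along the steps [s / (k + 2)]: the local Lipschitz bound dominates, and an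
    exceptional null set is allowed because the layered data have a kink on the plane
    [final y = - H]. *)
Lemma is_weak_pderiv_ae_quotient A i f g : open A -> (mu A < +oo)%E ->
  sqint mu A f -> sqint mu A g ->
  (forall K : set 'rV[R]_N, compact K -> K `<=` A -> exists C r, 0 < r /\
    forall y t, K y -> 0 < t < r -> `|f (y + t *: e_ i) - f y| <= C * t) ->
  {ae mu, forall y, A y -> forall eps, 0 < eps -> exists2 r, 0 < r & forall t, 0 < t < r ->
    `|f (y + t *: e_ i) - f y - t * g y| <= eps * t} ->
  is_weak_pderiv A i f g.
Proof.
move=> oA Aoo fA gA hK hq; apply: is_weak_pderiv_quotient => // K cK KA eps r eps0 r0.
have mA := open_measurable_rV oA; have mK := compact_measurable_rV cK.
have [r1 r10 rA] := compact_open_ball cK oA KA.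
have [C [r2 [r20 hC]]] := hK K cK KA.
pose s := Num.min r (Num.min r1 r2); have s0 : 0 < s by rewrite !lt_min r0 r10.
pose t k : R := s / k.+2%:R.
have tI k : 0 < t k < s.
  by rewrite divr_gt0//= ltr_pdivrMr// ltr_pMr// ltr1n.
have gK : sqint mu K g by exact: sqint_subset KA gA.
have Koo : (mu K < +oo)%E.
  by apply: le_lt_trans Aoo; apply: le_measure; rewrite ?inE.
pose q k y := (f (y + t k *: e_ i) - f y) / t k - g y.
have Kt k y : K y -> A (y + t k *: e_ i).
  move=> Ky; have /andP[t0 ts] := tI k.
  apply: (rA _ Ky); apply/ball_rVE => // j; rewrite !mxE eqxx /= opprD addrA subrr sub0r normrN.
  rewrite normrM gtr0_norm// (@le_lt_trans _ _ (t k))//.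
    by rewrite ler_piMr ?(ltW t0)//; case: eqP; rewrite ?normr1 ?normr0.
  by apply: lt_le_trans ts _; rewrite !ge_min lexx !orbT.
have mq k : measurable_fun K (q k).
  have [mf _] := fA; have [mg _] := gK; apply: measurable_funB => //.
  apply: measurable_funM => //; apply: measurable_funB; last exact: measurable_funS mf.
  have mfA : measurable_fun setT (f \_ A) by exact/(measurable_restrictT _ mA).
  have : measurable_fun K (fun y => (f \_ A) (y + t k *: e_ i)).
    by apply: measurable_funTS; exact: measurableT_comp mfA (measurable_translate _).
  by apply: eq_measurable_fun => y /set_mem Ky; rewrite patchE mem_set//; exact: Kt.
have gb : sqint mu K (fun y => `|C| + `|g y|).
  apply: sqintD => //; first exact: sqint_cst.
  by apply: (sqint_dom _ _ gK) => //; [case: gK => mg _; exact: measurableT_comp|move=> y _; rewrite real_normK ?num_real].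
have qb k y : K y -> `|q k y| <= `| `|C| + `|g y| |.
  move=> Ky; have /andP[t0 ts] := tI k.
  rewrite [leRHS]ger0_norm ?addr_ge0// /q (le_trans (ler_normB _ _))// lerD2r.
  rewrite normrM normfV (gtr0_norm t0) ler_pdivrMr//.
  apply: le_trans (hC _ _ Ky _) _; last by rewrite ler_wpM2r ?(ltW t0)// ler_norm.
  by rewrite t0 (lt_le_trans ts)// !ge_min lexx !orbT.
have c0 : rsq mu K (q k) @[k --> \oo] --> 0.
  apply: (rsq_dct mK mq gb qb).
  apply: filterS hq => y hy Ky; apply/cvgrPdist_le => e e0.
  have [r' r'0 hr'] := hy (KA _ Ky) _ e0.
  have tc : t k @[k --> \oo] --> 0 by exact: cvg_div_nat2.
  move/cvgrPdist_lt : tc => /(_ _ r'0)[k0 _ hk0].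
  exists k0 => // k /= /hk0 /=; have /andP[t0 _] := tI k; rewrite sub0r normrN gtr0_norm// => tr.
  have := hr' (t k); rewrite t0 tr => /(_ isT) h.
  rewrite sub0r normrN /q -(ler_pM2r t0) -[X in _ * X]gtr0_norm// -normrM.
  by rewrite mulrBl divfK ?gt_eqF// [g y * _]mulrC.
move/cvgrPdist_le : c0 => /(_ _ eps0)[k0 _ hk0].
exists (t k0).
  by have /andP[t0 ts] := tI k0; rewrite t0 (lt_le_trans ts)// ge_min lexx.
split.
  apply: (sqint_dom mK (mq k0) gb) => y Ky; have := qb k0 y Ky.
  by rewrite -(ler_pXn2r (ltn0Sn 1)) ?nnegrE// !real_normK ?num_real.
by have := hk0 k0 (leqnn _); rewrite /= sub0r normrN ger0_norm// rsq_ge0.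
Qed.

End weak_derivatives.

(** * Sobolev functions with an explicit gradient *)

Section Sobolev_norms.
Context (R : realType) (N : nat).
Implicit Types (A U : set 'rV[R]_N) (f g w phi : 'rV[R]_N -> R) (p q : 'I_N -> 'rV[R]_N -> R).
Local Notation e_ := (@basis_vec R N).
Local Notation mu := (@leb R N).

Lemma ball_basis_vec (x : 'rV[R]_N) (r t : R) i : `|t| < r -> ball x r (x + t *: e_ i).
Proof.
move=> tr; apply/ball_rVE => [|j]; first exact: le_lt_trans tr.
rewrite !mxE eqxx /= opprD addrA subrr sub0r normrN normrM.
by rewrite (le_lt_trans _ tr)// ler_piMr//; case: eqP; rewrite ?normr1 ?normr0.
Qed.

Lemma is_weak_pderiv_derivable A i f g (C : R) : open A -> (mu A < +oo)%E ->
  sqint mu A f -> sqint mu A g -> (forall x, A x -> is_derive x (e_ i) f (g x)) ->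
  (forall x, A x -> `|g x| <= C) -> is_weak_pderiv A i f g.
Proof.
move=> oA Aoo fA gA dfg gC; apply: is_weak_pderiv_ae_quotient => //.
  move=> K cK KA; have [r r0 rA] := compact_open_ball cK oA KA.
  exists C, r; split => // y t Ky /andP[t0 tr].
  have := @mvt_abs R _ f y (e_ i) t 0 C; rewrite mulr0 subr0 (gtr0_norm t0).
  have As s : `|s| <= t -> A (y + s *: e_ i).
    by move=> st; apply: (rA _ Ky); apply: ball_basis_vec; exact: le_lt_trans tr.
  apply=> s /As As'; first by case: (dfg _ As').
  by rewrite subr0; have [_ ->] := dfg _ As'; exact: gC.
apply: aeW => y Ay e e0; have [df <-] := dfg _ Ay.
have [r r0 hr] := derive_eps df e0; exists r => // t /andP[t0 tr].
by have := hr t; rewrite gtr0_norm//; exact.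
Qed.

Lemma is_weak_pderiv_test A U i phi : open A -> (mu A < +oo)%E -> test_function U phi ->
  is_weak_pderiv A i phi ('D_(e_ i) phi).
Proof.
move=> oA Aoo tp; have mA := open_measurable_rV oA.
have td := test_function_derive i tp; have [C C0 dC] := test_function_bounded td.
apply: (@is_weak_pderiv_derivable _ _ _ _ C) => //.
  exact: (test_function_sqint mA tp).
  exact: (test_function_sqint mA td).
by move=> x _; apply: DeriveDef => //; have [Cp _] := tp; exact: (Ck_derivable (Cp 1%N)).
Qed.

(** Weights enter as a factor [Num.sqrt (w x)] inside the square, so that weighted energies are
    again sums of [rsq]. *)
Lemma sqint_weight A w f (C : R) : measurable A -> measurable_fun A w ->
  (forall x, A x -> 0 <= w x <= C) -> sqint mu A f ->
  sqint mu A (fun x => Num.sqrt (w x) * f x).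
Proof.
move=> mA mw wC fA; apply: (sqint_dom mA _ (sqintZ mA (Num.sqrt C) fA)).
  apply: measurable_funM; last by case: fA.
  exact: measurableT_comp (continuous_measurable_fun (@sqrt_continuous R)) mw.
move=> x Ax; have /andP[w0 wc] := wC _ Ax; have C0 := le_trans w0 wc.
by rewrite !exprMn !sqr_sqrtr// ler_wpM2r// sqr_ge0.
Qed.

Lemma integral_weighted_sum A w (C : R) (p : 'I_N -> 'rV[R]_N -> R) :
  measurable A -> measurable_fun A w -> (forall x, A x -> 0 <= w x <= C) ->
  (forall i, sqint mu A (p i)) ->
  (\int[mu]_(x in A) (w x * \sum_i p i x ^+ 2)%:E =
   (\sum_i rsq mu A (fun x => Num.sqrt (w x) * p i x))%:E)%E.
Proof.
move=> mA mw wC pA; have wpA i := sqint_weight mA mw wC (pA i).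
rewrite -sumEFin (eq_bigr (fun i => \int[mu]_(x in A) ((Num.sqrt (w x) * p i x) ^+ 2)%:E)%E); last first.
  by move=> i _; rewrite rsqE.
rewrite -ge0_integral_sum//; last 2 first.
- by move=> i; apply: measurable_sqr; case: (wpA i).
- by move=> i x _; rewrite lee_fin sqr_ge0.
apply: eq_integral => x /set_mem Ax; rewrite sumEFin; congr EFin.
rewrite big_distrr; apply: eq_bigr => i _ /=.
by rewrite exprMn sqr_sqrtr//; have /andP[] := wC _ Ax.
Qed.

Lemma integral_grad_sq A w f (C : R) (p : 'I_N -> 'rV[R]_N -> R) : open A -> (mu A < +oo)%E ->
  measurable_fun A w -> (forall x, A x -> 0 <= w x <= C) ->
  (forall i, is_weak_pderiv A i f (p i)) ->
  (\int[mu]_(x in A) (w x * grad_sq A f x)%:E =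
   (\sum_i rsq mu A (fun x => Num.sqrt (w x) * p i x))%:E)%E.
Proof.
move=> oA Aoo mw wC fp; have mA := open_measurable_rV oA.
have pA i : sqint mu A (p i) by apply/L2P => //; case: (fp i).
have qA i : sqint mu A (weak_pderiv A i f).
  by apply/L2P => //; have [] := weak_pderivP (fp i).
rewrite (integral_weighted_sum mA mw wC qA) (eq_bigr (fun i => rsq mu A (fun x => Num.sqrt (w x) * p i x)))// => i _.
have [mwp _] := sqint_weight mA mw wC (pA i); have [mwq _] := sqint_weight mA mw wC (qA i).
by apply: ae_rsq => //; apply: filterS (weak_pderiv_ae oA Aoo (fp i)) => x h Ax; rewrite h.
Qed.

Lemma H1normE A f (p : 'I_N -> 'rV[R]_N -> R) : open A -> (mu A < +oo)%E -> sqint mu A f ->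
  (forall i, is_weak_pderiv A i f (p i)) ->
  H1norm A f = ((rsq mu A f + \sum_i rsq mu A (p i))%:E `^ 2^-1)%E.
Proof.
move=> oA Aoo fA fp; have mA := open_measurable_rV oA; rewrite /H1norm; congr (_ `^ _)%E.
have w1 (x : 'rV[R]_N) : A x -> 0 <= (cst 1 x : R) <= 1 by rewrite ler01 lexx.
have := integral_grad_sq oA Aoo (measurable_cst (1 : R)) w1 fp.
have -> : \sum_i rsq mu A (fun x => Num.sqrt (cst 1 x) * p i x) = \sum_i rsq mu A (p i).
  by apply: eq_bigr => i _; apply: eq_rsq => x _; rewrite sqrtr1 mul1r.
rewrite EFinD => <-; rewrite -rsqE//.
have qA i : sqint mu A (weak_pderiv A i f).
  by apply/L2P => //; have [] := weak_pderivP (fp i).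
rewrite -ge0_integralD//.
- by apply: eq_integral => x _; rewrite -EFinD mul1r.
- by move=> x _; rewrite lee_fin sqr_ge0.
- by apply: measurable_sqr; case: fA.
- by move=> x _; rewrite lee_fin mulr_ge0// sumr_ge0// => i _; exact: sqr_ge0.
- apply/measurable_EFinP; apply: measurable_funM => //; apply: measurable_sum => i.
  by apply: measurable_funX; case: (qA i).
Qed.

Lemma H1norm_lt A f (p : 'I_N -> 'rV[R]_N -> R) (e : R) : open A -> (mu A < +oo)%E -> sqint mu A f ->
  (forall i, is_weak_pderiv A i f (p i)) -> 0 < e ->
  (H1norm A f < e%:E)%E = (rsq mu A f + \sum_i rsq mu A (p i) < e ^+ 2).
Proof.
move=> oA Aoo fA fp e0; rewrite (H1normE oA Aoo fA fp).
have h : 0 <= rsq mu A f + \sum_i rsq mu A (p i).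
  by rewrite addr_ge0 ?rsq_ge0// sumr_ge0// => i _; exact: rsq_ge0.
by rewrite poweR_EFin lte_fin powR12_sqrt// sqrtr_lt.
Qed.

(** The gradient is carried along as data, because [weak_pderiv] returns an arbitrary
    representative; [H1dist] below is the square of the H^1 distance. *)
Definition in_H1 A f (p : 'I_N -> 'rV[R]_N -> R) : Prop :=
  sqint mu A f /\ forall i, is_weak_pderiv A i f (p i).

Definition H1dist A f p g q : R := rsq mu A (f \- g) + \sum_i rsq mu A (p i \- q i).

Lemma in_H1P A f p : in_H1 A f p -> measurable A -> forall i, sqint mu A (p i).
Proof. by move=> [_ fp] mA i; apply/L2P => //; case: (fp i). Qed.

Lemma in_H1B A f p g q : measurable A -> in_H1 A f p -> in_H1 A g q ->
  in_H1 A (f \- g) (fun i => p i \- q i).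
Proof.
move=> mA [fA fp] [gA gq]; split; first exact: sqintB.
by move=> i; exact: is_weak_pderivB.
Qed.

Lemma in_H1D A f p g q : measurable A -> in_H1 A f p -> in_H1 A g q ->
  in_H1 A (f \+ g) (fun i => p i \+ q i).
Proof.
move=> mA [fA fp] [gA gq]; split; first exact: sqintD.
by move=> i; exact: is_weak_pderivD.
Qed.

Lemma in_H1_test A U phi : open A -> (mu A < +oo)%E -> test_function U phi ->
  in_H1 A phi (fun i => 'D_(e_ i) phi).
Proof.
move=> oA Aoo tp; split; last by move=> i; exact: (is_weak_pderiv_test i oA Aoo tp).
exact: test_function_sqint (open_measurable_rV oA) tp.
Qed.

Lemma H1dist_lt A f p g q (e : R) : open A -> (mu A < +oo)%E -> in_H1 A f p -> in_H1 A g q ->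
  0 < e -> (H1norm A (f \- g)%R < e%:E)%E = (H1dist A f p g q < e ^+ 2).
Proof.
move=> oA Aoo fp gq e0; have [fA w] := in_H1B (open_measurable_rV oA) fp gq.
exact: H1norm_lt.
Qed.

Lemma H1dist_ge0 A f p g q : 0 <= H1dist A f p g q.
Proof. by rewrite addr_ge0 ?rsq_ge0// sumr_ge0// => i _; exact: rsq_ge0. Qed.

Lemma in_H1_weak A f : H1 A f -> measurable A -> in_H1 A f (fun i => weak_pderiv A i f).
Proof.
move=> [/L2P fA h] mA; split; first exact: fA.
by move=> i; have [g] := h i; exact: weak_pderivP.
Qed.

Lemma H1_in A f p : in_H1 A f p -> measurable A -> H1 A f.
Proof. by move=> [fA fp] mA; split; [exact/L2P|move=> i; exists (p i)]. Qed.

Lemma H10_approx A f : open A -> (mu A < +oo)%E -> H10 A f ->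
  exists p, in_H1 A f p /\ forall e, 0 < e -> exists phi, test_function A phi /\
    H1dist A f p phi (fun i => 'D_(e_ i) phi) < e.
Proof.
move=> oA Aoo [fH h]; exists (fun i => weak_pderiv A i f).
have fp := in_H1_weak fH (open_measurable_rV oA); split => // e e0.
have se : 0 < Num.sqrt e by rewrite sqrtr_gt0.
have [phi [tp fphi]] := h _ se; exists phi; split => //.
by move: fphi; rewrite (H1dist_lt oA Aoo fp (in_H1_test oA Aoo tp) se) sqr_sqrtr// ltW.
Qed.

Lemma H10_test A phi : open A -> (mu A < +oo)%E -> test_function A phi -> H10 A phi.
Proof.
move=> oA Aoo tp; have mA := open_measurable_rV oA; have pp := in_H1_test oA Aoo tp.
split; first exact: H1_in pp mA.
move=> e e0; exists phi; split => //; rewrite (H1dist_lt oA Aoo pp pp e0) /H1dist.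
have z f : rsq mu A (f \- f) = 0.
  rewrite (@eq_rsq _ _ _ _ A _ (cst 0)); last by move=> x _; exact: subrr.
  by rewrite /rsq /Rintegral integral0_eq// => x _; rewrite expr0n.
by rewrite z big1 ?addr0 ?exprn_gt0.
Qed.

Lemma in_H1S A U f p : open A -> open U -> U `<=` A -> in_H1 A f p -> in_H1 U f p.
Proof.
move=> oA oU UA [fA fp]; split; last by move=> i; exact: is_weak_pderivS UA (fp i).
exact: (sqint_subset (open_measurable_rV oU) (open_measurable_rV oA) UA fA).
Qed.

Lemma in_H1_lim A f p (fk : nat -> 'rV[R]_N -> R) pk : measurable A -> sqint mu A f ->
  (forall i, sqint mu A (p i)) -> (forall k, in_H1 A (fk k) (pk k)) ->
  H1dist A f p (fk k) (pk k) @[k --> \oo] --> 0 -> in_H1 A f p.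
Proof.
move=> mA fA pA fkA c0; split => // i.
have le k : rsq mu A (fk k \- f) <= H1dist A f p (fk k) (pk k).
  by rewrite rsqC /H1dist lerDl sumr_ge0// => j _; exact: rsq_ge0.
have lei k : rsq mu A (pk k i \- p i) <= H1dist A f p (fk k) (pk k).
  rewrite rsqC /H1dist (bigD1 i)//= addrCA lerDl addr_ge0 ?rsq_ge0// sumr_ge0// => j _.
  exact: rsq_ge0.
apply: (@is_weak_pderiv_lim _ _ _ _ _ _ fk (fun k => pk k i)) => //.
- by move=> k; case: (fkA k).
- by move=> k; case: (fkA k).
- apply: (@squeeze_cvgr _ _ _ _ (fun=> 0) _ _ _ _ (@cvg_cst _ _ _ _ _) c0).
  by apply: nearW => k; rewrite rsq_ge0 le.
- apply: (@squeeze_cvgr _ _ _ _ (fun=> 0) _ _ _ _ (@cvg_cst _ _ _ _ _) c0).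
  by apply: nearW => k; rewrite rsq_ge0 lei.
Qed.

End Sobolev_norms.

(** * Difference quotients of functions in H^1_0, extended by zero *)

Section translation_estimates.
Context (R : realType) (N : nat).
Implicit Types (A U : set 'rV[R]_N) (f g phi : 'rV[R]_N -> R) (p : 'I_N -> 'rV[R]_N -> R).
Local Notation e_ := (@basis_vec R N).
Local Notation mu := (@leb R N).

Lemma measurable_line i : measurable_fun setT
  (fun z : 'rV[R]_N * R => z.1 + z.2 *: e_ i).
Proof.
apply: measurable_fun_coordP => j.
rewrite (_ : (fun _ => _) = (fun z : 'rV[R]_N * R => z.1 0 j + z.2 * (i == j)%:R)); last first.
  by apply/funext => z; rewrite !mxE eqxx /= eq_sym.
apply: measurable_funD; first exact: measurableT_comp (measurable_coord j) measurable_fst.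
by apply: measurable_funM => //; exact: measurable_snd.
Qed.

(** Cauchy-Schwarz on each segment of length [t] bounds the squared increment by [t] times the
    integral of the squared derivative; Tonelli and translation invariance then supply the second
    factor [t]. *)
Lemma test_function_increment A i phi (t : R) : test_function A phi -> 0 < t ->
  rsq mu setT (fun x => phi (x + t *: e_ i) - phi x) <= t ^+ 2 * rsq mu setT ('D_(e_ i) phi).
Proof.
move=> tp t0; have td := test_function_derive i tp.
have mp := test_function_measurable tp; have md := test_function_measurable td.
have pT := test_function_sqint measurableT tp; have dT := test_function_sqint measurableT td.
have iT : sqint mu setT (fun x => phi (x + t *: e_ i) - phi x).
  apply: (sqintB measurableT _ pT); split; first exact: measurableT_comp mp (measurable_translate _).
  case: pT => _; rewrite -(@integral_leb_translate _ _ (t *: e_ i) (fun x => (phi x ^+ 2)%:E))//.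
    exact: measurable_sqr.
  by move=> y; rewrite lee_fin sqr_ge0.
rewrite -lee_fin EFinM -!rsqE//.
pose G (z : 'rV[R]_N * R) : \bar R := (('D_(e_ i) phi (z.1 + z.2 *: e_ i)) ^+ 2)%:E.
have mG : measurable_fun setT G.
  apply: measurable_sqr.
  exact: measurableT_comp md (measurable_line i).
have G0 z : (0 <= G z)%E by rewrite lee_fin sqr_ge0.
pose J := `[0, t]%classic : set R.
pose GJ (z : 'rV[R]_N * R) : \bar R := (G z * (\1_J z.2)%:E)%E.
have mGJ : measurable_fun setT GJ.
  apply: emeasurable_funM => //; apply/measurable_EFinP.
  have mJ : measurable_fun setT (\1_J : R -> R) by apply: measurable_indic; exact: measurable_itv.
  exact: measurableT_comp mJ measurable_snd.
have GJ0 z : (0 <= GJ z)%E by rewrite mule_ge0// lee_fin indicE; case: (_ \in _).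
have GJE x : (\int[lebesgue_measure]_s GJ (x, s) = \int[lebesgue_measure]_(s in J) G (x, s))%E.
  by rewrite [RHS]integral_mkcond epatch_indic.
have mF : measurable_fun setT (fun x => \int[lebesgue_measure]_s GJ (x, s))%E.
  exact: (@measurable_fun_fubini_tonelli_F _ _ _ _ R (@lebesgue_measure R) GJ).
apply: (@le_trans _ _ (\int[mu]_x (t%:E * \int[lebesgue_measure]_s GJ (x, s)))%E).
  apply: ge0_le_integral => //.
  - by move=> x _; rewrite lee_fin sqr_ge0.
  - by apply: measurable_sqr; case: iT.
  - exact: measurable_funeM.
  - move=> x _; rewrite GJE.
    pose F s := phi (x + s *: e_ i); pose f (s : R) : R := 'D_(e_ i) phi (x + s *: e_ i).
    have cl (h : 'rV[R]_N -> R) : continuous h -> continuous (fun s : R => h (x + s *: e_ i)).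
      move=> ch s; apply: continuous_comp; last exact: ch.
      by apply: cvgD; [exact: cvg_cst|apply: cvgZr_tmp; exact: cvg_id].
    have cF : {within `[0, t], continuous F}.
      by apply: continuous_subspaceT; apply: cl; exact: test_function_continuous tp.
    have cf : {within `[0, t], continuous f}.
      exact: continuous_subspaceT (cl _ (test_function_continuous td)).
    have dF s : s \in `]0, t[ -> is_derive s 1 F (f s).
      by move=> _; apply: is_derive_line; have [Cp _] := tp; exact: (Ck_derivable (Cp 1%N)).
    have := sqr_increment_le t0 cf cF dF; rewrite /F scale0r addr0 subr0.
    have fI : sqint (@lebesgue_measure R) `[0, t]%classic f by exact: within_sqint_itv.
    move=> h; apply: (@le_trans _ _ (t * rsq (@lebesgue_measure R) `[0, t]%classic f)%:E).
      by rewrite lee_fin.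
    rewrite EFinM; apply: lee_wpmul2l; first by rewrite lee_fin ltW.
    by rewrite le_eqVlt; apply/orP; left; apply/eqP; exact: (esym (rsqE fI)).
rewrite ge0_integralZl//; last 2 first.
- by move=> x _; exact: integral_ge0.
- by rewrite lee_fin ltW.
have -> : (\int[mu]_x \int[lebesgue_measure]_s GJ (x, s) = \int[lebesgue_measure]_s \int[mu]_x GJ (x, s))%E.
  exact: (@fubini_tonelli _ _ _ _ R mu (@lebesgue_measure R) GJ mGJ GJ0).
rewrite expr2 EFinM -muleA lee_wpmul2l ?lee_fin ?(ltW t0)//.
have E s : (\int[mu]_x GJ (x, s) = (\1_J s)%:E * \int[mu]_x ('D_(e_ i) phi x ^+ 2)%:E)%E.
  rewrite -(@integral_leb_translate _ _ (s *: e_ i) (fun x => ('D_(e_ i) phi x ^+ 2)%:E))//; last 2 first.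
  - exact: measurable_sqr.
  - by move=> y; rewrite lee_fin sqr_ge0.
  rewrite -ge0_integralZl//.
  - by apply: eq_integral => x _; rewrite /GJ muleC.
  - apply: measurable_sqr.
    exact: measurableT_comp md (measurable_translate _).
  - by move=> y _; rewrite lee_fin sqr_ge0.
have -> : (\int[lebesgue_measure]_s \int[mu]_x GJ (x, s) =
    \int[lebesgue_measure]_s ((rsq mu setT ('D_(e_ i) phi))%:E * (\1_J s)%:E))%E.
  by apply: eq_integral => s _; rewrite E rsqE// muleC.
rewrite rsqE//.
rewrite ge0_integralZl//.
- rewrite muleC; apply: lee_wpmul2r; first by rewrite lee_fin rsq_ge0.
  have mJ : measurable J by exact: measurable_itv.
  have -> : (\int[lebesgue_measure]_x (\1_J x)%:E = @lebesgue_measure R J)%E.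
    by rewrite integral_indic// setIT.
  by rewrite lebesgue_measure_itv/= lte_fin t0 sube0.
- by apply/measurable_EFinP; apply: measurable_indic; exact: measurable_itv.
- by rewrite lee_fin rsq_ge0.
Qed.

Definition H10_data A f p : Prop := in_H1 A f p /\ forall e, 0 < e ->
  exists phi, test_function A phi /\ H1dist A f p phi (fun i => 'D_(e_ i) phi) < e.

Lemma H10_dataB A f p phi : open A -> (mu A < +oo)%E -> H10_data A f p -> test_function A phi ->
  H10_data A (f \- phi) (fun i => p i \- 'D_(e_ i) phi).
Proof.
move=> oA Aoo [fp h] tp; have mA := open_measurable_rV oA; split.
  exact: (in_H1B mA fp (in_H1_test oA Aoo tp)).
move=> e e0; have [psi [ts hs]] := h e e0; exists (psi \- phi); split.
  have := test_functionD ts (test_functionM tp (fun k => Ck_cst _ k (-1))).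
  by rewrite (_ : psi \+ _ = psi \- phi)//; apply/funext => x /=; rewrite mulrN1.
have E1 x : (f \- phi \- (psi \- phi)) x = (f \- psi) x by rewrite /=; ring.
have [Cp _] := tp; have [Cs _] := ts.
have E2 i x : (p i \- 'D_(e_ i) phi \- 'D_(e_ i) (psi \- phi)) x = (p i \- 'D_(e_ i) psi) x.
  rewrite /= deriveB; [ring|exact: (Ck_derivable (Cs 1%N))|exact: (Ck_derivable (Cp 1%N))].
by rewrite /H1dist (eq_rsq mu (fun x _ => E1 x)) (eq_bigr _ (fun i _ => eq_rsq mu (fun x _ => E2 i x))).
Qed.

Lemma restrict_in A f x : A x -> (f \_ A) x = f x.
Proof. by move=> Ax; rewrite patchE mem_set. Qed.

Lemma restrict_out A f x : ~ A x -> (f \_ A) x = 0.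
Proof. by move=> Ax; rewrite patchE memNset. Qed.

Lemma rsq_restrict A f : measurable A -> rsq mu setT (f \_ A) = rsq mu A f.
Proof.
move=> mA; rewrite /rsq [RHS]Rintegral_mkcond; apply: eq_Rintegral => x _; rewrite !patchE.
by case: ifP => // _; rewrite expr0n.
Qed.

Lemma sqint_restrict A f : measurable A -> sqint mu A f -> sqint mu setT (f \_ A).
Proof.
move=> mA [mf foo]; split; first exact/(measurable_restrictT _ mA).
rewrite (_ : integral _ _ _ = \int[mu]_(x in A) (f x ^+ 2)%:E)%E//.
rewrite [RHS]integral_mkcond; apply: eq_integral => x _; rewrite !patchE.
by case: ifP => // _; rewrite expr0n.
Qed.

Lemma sqint_translate (v : 'rV[R]_N) f : sqint mu setT f -> sqint mu setT (fun x => f (x + v)).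
Proof.
move=> [mf foo]; split; first exact: measurableT_comp mf (measurable_translate _).
move: foo; rewrite -(@integral_leb_translate _ _ v (fun x => (f x ^+ 2)%:E))//.
  exact: measurable_sqr.
by move=> y; rewrite lee_fin sqr_ge0.
Qed.

(** The estimate for test functions passes to limits at the cost of a factor 4, from two uses of the
    bound of [(a + b)^2] by [2 a^2 + 2 b^2]. With [e1] as chosen, the remainders [4 t^2 e1] and
    [8 e1] add up to [e]. *)
Lemma H10_increment A f p i (t : R) : open A -> (mu A < +oo)%E -> H10_data A f p -> 0 < t ->
  rsq mu setT (fun x => (f \_ A) (x + t *: e_ i) - (f \_ A) x) <= 4 * t ^+ 2 * rsq mu A (p i).
Proof.
move=> oA Aoo [fp h] t0; have mA := open_measurable_rV oA; have [fA _] := fp.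
have pA := in_H1P fp mA i; apply/ler_addgt0Pr => e e0.
pose e1 := e / (4 * t ^+ 2 + 8); have c0 : 0 < 4 * t ^+ 2 + 8 by rewrite ltr_wpDl// mulr_ge0// sqr_ge0.
have [phi [tp hp]] := h e1 (divr_gt0 e0 c0).
have td := test_function_derive i tp.
have FA := sqint_restrict mA fA; have pT := test_function_sqint measurableT tp.
have FpA := sqintB measurableT FA pT.
have i1 := sqintB measurableT (sqint_translate (t *: e_ i) pT) pT.
have i2 := sqintB measurableT (sqint_translate (t *: e_ i) FpA) FpA.
have dA := test_function_sqint mA td.
have out (g : 'rV[R]_N -> R) : test_function A g -> rsq mu setT g = rsq mu A g.
  move=> tg; rewrite -[RHS]rsq_restrict//; apply: eq_rsq => x _; rewrite patchE.
  by case: ifPn => // /negP nA; apply: (test_function_out tg) => Ax; apply: nA; exact: mem_set.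
have h1 := rsqD2 measurableT i1 i2.
have h2 := test_function_increment i tp t0; rewrite (out _ td) in h2.
have h3 : rsq mu setT (fun x => (f \_ A \- phi) (x + t *: e_ i) - (f \_ A \- phi) x) <= 4 * rsq mu A (f \- phi).
  have := rsqB2 measurableT (sqint_translate (t *: e_ i) FpA) FpA.
  rewrite rsq_translate; last by case: FpA.
  have -> : rsq mu setT (f \_ A \- phi) = rsq mu A (f \- phi).
    rewrite -[RHS]rsq_restrict//; apply: eq_rsq => x _; rewrite /= !patchE.
    case: ifPn => // /negP nA; rewrite (test_function_out tp) ?subrr// => Ax.
    by apply: nA; exact: mem_set.
  by move/le_trans; apply; rewrite -mulrDl -natrD.
have h4 : rsq mu A ('D_(e_ i) phi) <= 2 * rsq mu A (p i) + 2 * rsq mu A (p i \- 'D_(e_ i) phi).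
  rewrite (@eq_rsq _ _ _ _ _ ('D_(e_ i) phi) (p i \- (p i \- 'D_(e_ i) phi))).
    exact: (rsqB2 mA pA (sqintB mA pA dA)).
  by move=> x _ /=; ring.
have h5 : rsq mu A (p i \- 'D_(e_ i) phi) <= e1.
  apply: le_trans (ltW hp); rewrite /H1dist (bigD1 i)//= addrCA lerDl addr_ge0 ?rsq_ge0// sumr_ge0// => j _.
  exact: rsq_ge0.
have h6 : rsq mu A (f \- phi) <= e1.
  by apply: le_trans (ltW hp); rewrite /H1dist lerDl sumr_ge0// => j _; exact: rsq_ge0.
have h7 : e = (4 * t ^+ 2 + 8) * e1 by rewrite /e1 mulrC divfK// gt_eqF.
have h8 : t ^+ 2 * rsq mu A ('D_(e_ i) phi) <= t ^+ 2 * (2 * rsq mu A (p i) + 2 * e1).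
  by rewrite ler_wpM2l ?sqr_ge0// (le_trans h4)// lerD2l ler_wpM2l.
rewrite (@eq_rsq _ _ _ _ _ _ ((fun x => phi (x + t *: e_ i) - phi x) \+
  (fun x => (f \_ A \- phi) (x + t *: e_ i) - (f \_ A \- phi) x))); last first.
  by move=> x _ /=; ring.
apply: le_trans h1 _; rewrite {1}h7.
move: h2 h3 h6 h8; lra.
Qed.

Lemma test_function_taylor A i phi : test_function A phi ->
  exists2 B, 0 < B & forall x t, 0 < t ->
    `|phi (x + t *: e_ i) - phi x - t * 'D_(e_ i) phi x| <= B * t ^+ 2.
Proof.
move=> tp; have td := test_function_derive i tp.
have [B B0 dB] := test_function_bounded (test_function_derive i td).
exists B => // x t t0; have [Cp _] := tp; have [Cd _] := td.
have := @mvt_abs R _ phi x (e_ i) t ('D_(e_ i) phi x) (B * t); rewrite gtr0_norm// => hm.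
rewrite expr2 mulrA; apply: hm => [s _|s st]; first exact: (Ck_derivable (Cp 1%N)).
have := @mvt_abs R _ ('D_(e_ i) phi) x (e_ i) s 0 B; rewrite mulr0 subr0 => hm2.
apply: le_trans (hm2 _ _) _; [by move=> w _; exact: (Ck_derivable (Cd 1%N))|by move=> w _; rewrite subr0|].
by rewrite ler_pM2l.
Qed.

(** With a test function [phi] close to [f], the error splits into [a], the quotient of [f - phi],
    bounded by [H10_increment] uniformly in [t]; [b], the Taylor error of [phi], small with [t]; and
    [c], the difference of the derivatives. *)
Lemma H10_quotient A f p i (e : R) : open A -> (mu A < +oo)%E -> H10_data A f p -> 0 < e ->
  exists2 r, 0 < r & forall t, 0 < t < r ->
    sqint mu A (fun x => ((f \_ A) (x + t *: e_ i) - (f \_ A) x) / t - p i x) /\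
    rsq mu A (fun x => ((f \_ A) (x + t *: e_ i) - (f \_ A) x) / t - p i x) <= e.
Proof.
move=> oA Aoo fp e0; have mA := open_measurable_rV oA.
have [fH h] := fp; have [fA _] := fH; have pA := in_H1P fH mA i.
(* In the final sum [a] counts twice and [b], [c] four times: [8 / 24 + 4 / 24] leaves one half of
   [e] for [b], which the choice of [r] secures. *)
have e24 : 0 < e / 24 by rewrite divr_gt0.
have [phi [tp hp]] := h _ e24.
have td := test_function_derive i tp; have [B B0 hB] := test_function_taylor i tp.
have pT := test_function_sqint measurableT tp; have dA := test_function_sqint mA td.
have FA := sqint_restrict mA fA.
pose m := fine (mu A); have m0 : 0 <= m by rewrite fine_ge0.
have c0 : 0 < 8 * (B ^+ 2 * m + 1) by rewrite mulr_gt0// ltr_wpDl// mulr_ge0// sqr_ge0.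
pose r := Num.min 1 (e / (8 * (B ^+ 2 * m + 1))).
exists r; first by rewrite lt_min ltr01 divr_gt0.
move=> t /andP[t0 tr]; have t1 : t < 1 by rewrite (lt_le_trans tr)// ge_min lexx.
have te : t * (8 * (B ^+ 2 * m + 1)) < e.
  by rewrite -ltr_pdivlMr// (lt_le_trans tr)// ge_min lexx orbT.
pose a x := t^-1 * ((f \- phi) \_ A (x + t *: e_ i) - (f \- phi) \_ A x).
pose b x := (phi (x + t *: e_ i) - phi x) / t - 'D_(e_ i) phi x.
pose c := 'D_(e_ i) phi \- p i.
have fpA := sqint_restrict mA (sqintB mA fA (test_function_sqint mA tp)).
have iT := sqintB measurableT (sqint_translate (t *: e_ i) fpA) fpA.
have aT : sqint mu setT a by exact: sqintZ.
have aA : sqint mu A a by apply: sqint_subset aT.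
have cA : sqint mu A c by exact: sqintB.
have mb : measurable_fun setT b.
  apply: measurable_funB; last exact: test_function_measurable td.
  apply: measurable_funM => //; apply: measurable_funB; last by case: pT.
  by case: (sqint_translate (t *: e_ i) pT).
have bB x : `|b x| <= B * t.
  rewrite -(ler_pM2r t0) -mulrA -expr2 -[X in _ * X]gtr0_norm// -normrM.
  by rewrite mulrBl divfK ?gt_eqF// [_ * t]mulrC; exact: hB.
have bA : sqint mu A b.
  by apply: (@sqint_bounded _ _ _ _ _ mA _ (B * t)) => //; exact: measurable_funTS.
have rb : rsq mu A b <= B ^+ 2 * m * t.
  have cB := sqint_cst mA (B * t) Aoo.
  apply: (@le_trans _ _ (rsq mu A (cst (B * t)))).
    apply: le_rsq => //; first by case: bA.
    move=> x _; rewrite -[leLHS]real_normK ?num_real// ler_pXn2r ?nnegrE//=.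
    by rewrite mulr_ge0// ltW.
  rewrite /rsq (_ : (fun x => cst (B * t) x ^+ 2) = cst ((B * t) ^+ 2))// Rintegral_cst// -/m exprMn.
  rewrite mulrAC ler_wpM2l//; first by apply: mulr_ge0 => //; exact: sqr_ge0.
  by rewrite expr2 ler_piMr ?ltW.
have ra : rsq mu A a <= 4 * (e / 24).
  apply: le_trans (rsq_subset mA measurableT _ aT) _ => //.
  rewrite /a (rsqZ measurableT _ iT) exprVn mulrC ler_pdivrMr ?exprn_gt0//.
  apply: le_trans (H10_increment i oA Aoo (H10_dataB oA Aoo fp tp) t0) _.
  rewrite mulrAC ler_pM2r ?exprn_gt0// ler_pM2l//.
  apply: le_trans (ltW hp); rewrite /H1dist (bigD1 i)//= addrCA lerDl addr_ge0 ?rsq_ge0// sumr_ge0// => j _.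
  exact: rsq_ge0.
have rc : rsq mu A c <= e / 24.
  rewrite rsqC; apply: le_trans (ltW hp).
  rewrite /H1dist (bigD1 i)//= addrCA lerDl addr_ge0 ?rsq_ge0// sumr_ge0// => j _.
  exact: rsq_ge0.
have E x : A x -> (a \+ (b \+ c)) x = ((f \_ A) (x + t *: e_ i) - (f \_ A) x) / t - p i x.
  move=> Ax; rewrite /a /b /c /= !(restrict_in _ Ax).
  have [Ay|Ay] := pselect (A (x + t *: e_ i)); last rewrite (test_function_out tp Ay).
    by rewrite !(restrict_in _ Ay) /=; field; rewrite gt_eqF.
  by rewrite !(restrict_out _ Ay) /=; field; rewrite gt_eqF.
have bcA := sqintD mA bA cA.
split; first exact: eq_sqint E (sqintD mA aA bcA).
rewrite -(eq_rsq mu E); apply: le_trans (rsqD2 mA aA bcA) _.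
have := rsqD2 mA bA cA; move: ra rb rc te; lra.
Qed.

Lemma rsq_increment_opp f (v : 'rV[R]_N) : sqint mu setT f ->
  rsq mu setT (fun x => f (x - v) - f x) = rsq mu setT (fun x => f (x + v) - f x).
Proof.
move=> fT; rewrite -(@rsq_translate _ _ v (fun x => f (x - v) - f x)); last first.
  by have [] := sqintB measurableT (sqint_translate (- v) fT) fT.
by rewrite -rsqN; apply: eq_rsq => x _; rewrite addrK opprB.
Qed.

End translation_estimates.

(** * Pointwise boundary values of a continuous function in H^1_0 *)

Section C2_boundary.
Context (R : realType) (n : nat).
Implicit Types (D : set 'rV[R]_n) (u : 'rV[R]_n -> R).
Local Notation e_ := (@basis_vec R n).
Local Notation mu := (@leb R n).

Lemma continuous_col' i : continuous (fun x : 'rV[R]_n => col' i x).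
Proof.
move=> x B /nbhs_ballP[e /= e0 eB]; apply/nbhs_ballP; exists e => //= y xy.
apply: eB; apply/ball_rVE => // j; rewrite !mxE.
exact: (ball_rVE x y e0).1.
Qed.

(* A nonzero boundary value of [u] forces, for every [m], one of [m] successive steps
   of length [O(1/m)] along a line leaving [D] to be a jump of fixed size. *)
Lemma H10_boundary0 D u : open D -> (mu D < +oo)%E -> C2_domain D -> H10 D u ->
  {within closure D, continuous u} -> forall x, boundary D x -> u x = 0.
Proof.
move=> oD Doo [_ _ _ hD] /(H10_approx oD Doo)[p [up hp]] cu x0 bx0.
have [i [s [g [U [Cg U0 UD]]]]] := hD _ bx0.
have mD := open_measurable_rV oD.
have [cx0 nx0] := bx0; have {}nx0 : ~ D x0 by move=> Dx; apply: nx0; rewrite (interior_id _).1.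
pose v : 'rV[R]_n := (-1) ^+ s *: e_ i.
(* Inside [U] the set [D] is where [G] is positive, and [G] grows at unit rate in the direction
   [v]. *)
pose G (x : 'rV[R]_n) : R := (-1) ^+ s * x 0 i - g (col' i x).
have cG : continuous G.
  rewrite (_ : G = cst ((-1) ^+ s) \* (fun x : 'rV[R]_n => x 0 i) - (g \o (fun x => col' i x)))//.
  move=> x; apply: continuousB.
    by apply: continuousM; [exact: cst_continuous|exact: coord_continuous].
  by apply: continuous_comp; [exact: continuous_col'|exact: (Ck_continuous Cg)].
have {}UD x : U x -> D x <-> 0 < G x by move=> /UD ->; rewrite subr_gt0.
have GD x t : G (x + t *: v) = G x + t.
  rewrite /G (_ : col' i _ = col' i x); last first.
    apply/rowP => j; rewrite !mxE eqxx /= eq_sym (negbTE (neq_lift i j)).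
    by rewrite !mulr0 addr0.
  rewrite !mxE !eqxx mulr1 mulrDr addrAC; congr (_ + _).
  by rewrite mulrCA -exprD addnn -mul2n exprM sqrrN !expr1n mulr1.
have [/eqP//|c0] := boolP (u x0 == 0); exfalso.
set c := u x0 in c0.
have c2 : 0 < `|c| / 2 by rewrite divr_gt0// normr_gt0.
have [r r0 hr] : exists2 r, 0 < r & ball x0 r `<=` U /\
    forall x, ball x0 r x -> closure D x -> `|c| / 2 <= `|u x|.
  have := (within_continuousP (closure D) u).1 cu _ cx0.
  move=> /(_ (ball c (`|c| / 2)) (nbhsx_ballx _ _ c2)) /nbhs_ballP[r1 /= r10 h1].
  have /nbhs_ballP[r2 /= r20 h2] := U0.
  exists (Num.min r1 r2); first by rewrite lt_min r10.
  split => x hx; first by apply: h2; apply: le_ball hx; rewrite ge_min lexx orbT.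
  move=> Dx; have : ball c (`|c| / 2) (u x).
    by apply: h1 => //; apply: le_ball hx; rewrite ge_min lexx.
  rewrite /ball /= => h; have := lerB_dist c (c - u x); rewrite subKr; lra.
have [rU ru] := hr.
have Ux0 : U x0 by apply/rU/ballxx.
have G0 : G x0 = 0.
  apply/eqP; rewrite eq_le; apply/andP; split.
    by rewrite leNgt; apply/negP => /(UD _ Ux0).
  rewrite leNgt; apply/negP => Gx0.
  have : nbhs x0 (ball x0 r `&` [set x | G x < 0]).
    apply: filterI; first exact: nbhsx_ballx.
    by apply: (cG x0 [set y | y < 0]); exact: lt_nbhsl.
  move=> /cx0[y [Dy [/rU Uy]]] /=; have := (UD _ Uy).1 Dy; lra.
pose tau := r / 6; have tau0 : 0 < tau by rewrite divr_gt0.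
(* Points near [x0] outside the closure side of the graph which a shift by [2 * tau] brings into
   [D]. The set is open and contains [x0 - tau v], so it has positive measure; [2 * tau = r / 3]
   keeps the whole path in [ball x0 r]. *)
pose B0 := ball x0 (r / 2) `&` ([set x | G x < 0] `&` [set x | 0 < G (x + (2 * tau) *: v)]).
have oG (S : set R) : open S -> open (G @^-1` S) by move: S; exact/continuousP.
have o1 : open (G @^-1` [set y | y < 0]) by apply: oG; exact: open_lt.
have o2 y : open (G @^-1` [set z | y < z]) by apply: oG; exact: open_gt.
have oB0 : open B0.
  apply: openI; first exact: ball_open.
  apply: openI; first exact: o1.
  rewrite (_ : [set x | _] = [set x | - (2 * tau) < G x]); last first.
    by apply/seteqP; split => x /=; rewrite GD; lra.
  exact: o2.
have bv x t : `|t| < r / 2 -> ball x (r / 2) (x + t *: v).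
  by move=> tr; rewrite scalerA; apply: ball_basis_vec; rewrite normrM normrX normrN normr1 expr1n mulr1.
have mB0 := open_measurable_rV oB0.
have B0gt : (0 < mu B0)%E.
  apply: leb_open_gt0 => //; exists (x0 + (- tau) *: v); split.
    by apply: bv; rewrite normrN gtr0_norm /tau; lra.
  by split; rewrite /= -?addrA -?scalerDl GD G0; lra.
have B0oo : (mu B0 < +oo)%E.
  apply: (@leb_bounded_lty _ _ _ (\sum_j `|x0 0 j| + r)) => // x j [/ball_rVE h _].
  have hj := h (divr_gt0 r0 (ltr0Sn _ _)) j.
  have : `|x0 0 j| <= \sum_j `|x0 0 j| by rewrite (bigD1 j)//= lerDl sumr_ge0.
  by have := ler_normB (x0 0 j) (x0 0 j - x 0 j); rewrite subKr; lra.
pose F := u \_ D; have [uA _] := up; have FT := sqint_restrict mD uA.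
pose b := fine (mu B0); have b0 : 0 < b by rewrite fine_gt0// B0gt.
(* By [H10_increment] each of the [m] increments of length [2 tau / m] has squared norm of order
   [1 / m^2], so together they cost only [1 / m], whereas each point of [B0] contributes a fixed
   jump. *)
have step m : (0 < m)%N -> c ^+ 2 / 4 * b <= 16 * tau ^+ 2 * rsq mu D (p i) / m%:R.
  move=> m0; pose t := 2 * tau / m%:R.
  have mR : (0 : R) < m%:R by rewrite ltr0n.
  have t0 : 0 < t by rewrite divr_gt0// mulr_gt0.
  pose J k x := F (x + (k.+1%:R * t) *: v) - F (x + (k%:R * t) *: v).
  pose J0 x := F (x + t *: v) - F x.
  have JT : sqint mu setT J0 by exact: (sqintB measurableT (sqint_translate _ FT) FT).
  have JE k x : J k x = J0 (x + (k%:R * t) *: v).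
    by rewrite /J /J0 -addrA -scalerDl -natr1 mulrDl mul1r.
  have sJ k : sqint mu setT (J k).
    by apply: eq_sqint (sqint_translate ((k%:R * t) *: v) JT) => x _; rewrite JE.
  have rJ k : rsq mu setT (J k) <= 4 * t ^+ 2 * rsq mu D (p i).
    rewrite (eq_rsq mu (fun x _ => JE k x)) rsq_translate; last by case: JT.
    apply: le_trans (H10_increment i oD Doo (conj up hp) t0); rewrite /J0 /v le_eqVlt; apply/orP; left; apply/eqP.
    have := sqrf_eq1 ((-1) ^+ s : R); rewrite sqrr_sign eqxx => /esym /orP[] /eqP ->.
      by rewrite scale1r.
    by rewrite scaleN1r scalerN; exact: rsq_increment_opp.
  have jump x : B0 x -> c ^+ 2 / 4 <= \sum_(k < m) J k x ^+ 2.
    move=> [bx [/= Gx Gx2]].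
    have bx' (k : nat) : (k <= m)%N -> ball x0 r (x + (k%:R * t) *: v).
      move=> km; rewrite (splitr r); apply: ball_triangle bx _; apply: bv.
      rewrite ger0_norm; last by rewrite mulr_ge0// ltW.
      apply: (@le_lt_trans _ _ (2 * tau)); last by rewrite /tau; lra.
      by rewrite /t mulrA ler_pdivrMr// mulrC ler_wpM2l ?ler_nat// mulr_ge0// ltW.
    (* At the first index for which the path is in [D], the preceding point is outside, where the
       extension by zero vanishes; this increment has size at least [|c| / 2]. *)
    pose P k := `[< D (x + (k%:R * t) *: v) >].
    have exP : exists k, P k.
      exists m; apply/asboolP/UD; first exact/rU/bx'.
      by rewrite /t mulrC divfK// gt_eqF.
    case: (ex_minnP exP) => k /asboolP Dk kmin.
    have km : (k <= m)%N.
      apply: kmin; apply/asboolP/UD; first exact/rU/bx'.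
      by rewrite /t mulrC divfK// gt_eqF.
    case: k Dk kmin km => [|k] Dk kmin km.
      move: Dk; rewrite mul0r scale0r addr0 => /UD.
      have : U x by have := rU _ (bx' 0%N (leq0n _)); rewrite mul0r scale0r addr0.
      move=> Ux /(_ Ux); lra.
    have nDk : ~ D (x + (k%:R * t) *: v).
      by move=> Dk'; have /kmin : P k by [apply/asboolP]; rewrite ltnn.
    rewrite (bigD1 (Ordinal km))//=; apply: (@le_trans _ _ (J k x ^+ 2)); last first.
      by rewrite lerDl sumr_ge0// => j _; exact: sqr_ge0.
    rewrite /J /F (restrict_in _ Dk) (restrict_out _ nDk) subr0.
    have := ru _ (bx' _ km) (subset_closure Dk).
    rewrite -(ler_pXn2r (ltn0Sn 1)) ?nnegrE// ?(ltW c2)// real_normK ?num_real// exprMn real_normK ?num_real//.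
    by rewrite exprVn (_ : 2 ^+ 2 = 4 :> R)// -natrX.
  have : (\int[mu]_(x in B0) (c ^+ 2 / 4)%:E <= \int[mu]_x (\sum_(k < m) (J k x ^+ 2)%:E))%E.
    apply: (@le_trans _ _ (\int[mu]_(x in B0) (\sum_(k < m) (J k x ^+ 2)%:E))%E).
      apply: ge0_le_integral => //.
      - by move=> x _; rewrite lee_fin divr_ge0// sqr_ge0.
      - apply: measurable_funTS; apply: emeasurable_sum => k.
        by apply: measurable_sqr; case: (sJ k).
      - by move=> x /jump; rewrite sumEFin lee_fin.
    apply: ge0_subset_integral => //.
      apply: emeasurable_sum => k.
      by apply: measurable_sqr; case: (sJ k).
    by move=> x _; apply: sume_ge0 => k _; rewrite lee_fin sqr_ge0.
  rewrite integral_cst// ge0_integral_sum//; last 2 first.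
  - by move=> k; apply: measurable_sqr; case: (sJ k).
  - by move=> k x _; rewrite lee_fin sqr_ge0.
  rewrite (eq_bigr (fun k : 'I_m => (rsq mu setT (J k))%:E)); last by move=> k _; rewrite rsqE.
  have bE : mu B0 = b%:E by rewrite fineK// ge0_fin_numE.
  move=> h; have {h}/le_trans : c ^+ 2 / 4 * b <= \sum_(k < m) rsq mu setT (J k).
    by rewrite -lee_fin EFinM -sumEFin -bE; exact: h.
  apply.
  apply: (@le_trans _ _ (\sum_(k < m) (4 * t ^+ 2 * rsq mu D (p i)))).
    by apply: ler_sum => k _; exact: rJ.
  rewrite sumr_const card_ord -mulr_natr /t le_eqVlt; apply/orP; left; apply/eqP.
  by field; rewrite gt_eqF.
pose K := 16 * tau ^+ 2 * rsq mu D (p i).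
pose a := c ^+ 2 / 4 * b; have a0 : 0 < a by rewrite mulr_gt0// divr_gt0// exprn_even_gt0.
have := step (Num.truncn (K / a)).+1 (ltn0Sn _); rewrite -/K -/a.
rewrite ler_pdivlMr ?ltr0n// mulrC -ler_pdivlMr//; apply/negP; rewrite -ltNge.
exact: truncnS_gt.
Qed.

End C2_boundary.

(** * Regularity up to the boundary *)

Section ess_sup_continuous.
Context (R : realType) (n : nat).
Local Notation mu := (@leb R n).

Lemma within_closure_nbhs (D : set 'rV[R]_n) (u : 'rV[R]_n -> R) x : open D ->
  {within closure D, continuous u} -> D x -> {for x, continuous u}.
Proof.
move=> oD /within_continuousP cu Dx B Bux.
have := cu _ (subset_closure Dx) _ Bux => /nbhs_ballP[r /= r0 hr].
have /nbhs_ballP[r' /= r'0 hr'] := oD _ Dx.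
apply/nbhs_ballP; exists (Num.min r r') => /=; first by rewrite lt_min r0.
move=> y xy; apply: hr; first by apply: le_ball xy; rewrite ge_min lexx.
by apply/subset_closure/hr'; apply: le_ball xy; rewrite ge_min lexx orbT.
Qed.

(** By continuity a violation at one point spreads to a nonempty open set, which has positive
    measure. *)
Lemma le_Linfty_norm (D : set 'rV[R]_n) (u : 'rV[R]_n -> R) (m : R) : open D ->
  {within closure D, continuous u} -> ('N[mu]_(+oo)[EFin \o (u \_ D)] <= m%:E)%E ->
  forall x, D x -> u x <= m.
Proof.
move=> oD cu um x Dx; rewrite leNgt; apply/negP => mux.
pose V := D `&` [set y | m < u y].
have oV : open V.
  rewrite openE => y [Dy /= my]; apply: filterI; first exact: oD.
  by apply: (within_closure_nbhs oD cu Dy (lt_nbhsr my)).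
have mV := open_measurable_rV oV.
have V0 : (0 < mu V)%E by apply: leb_open_gt0 => //; exists x.
have T0 : (0 < mu setT)%E by apply: lt_le_trans V0 _; apply: le_measure; rewrite ?inE.
move: um; rewrite unlock /= T0 => /ess_supP[Z [mZ Z0 VZ]].
suff VsZ : V `<=` Z.
  by move: V0; rewrite ltNge -Z0; apply/negP/negPn/le_measure; rewrite ?inE.
move=> y [Dy my]; apply: VZ => /=; rewrite restrict_in// lee_fin => /ler_normlP[_]; move: my => /=; lra.
Qed.

End ess_sup_continuous.

Section differentiability_up_to_the_boundary.
Context (R : realType) (N : nat).
Implicit Types (A : set 'rV[R]_N) (f : 'rV[R]_N -> R) (P v : 'rV[R]_N).
Local Notation e_ := (@basis_vec R N).

Lemma Ck_closureS k A f : Ck_closure k.+1 A f -> Ck_closure k A f.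
Proof.
elim: k f => [|k ih] f [cf df]; split => // i; have [d1 [g [gE gC]]] := df i.
by split => //; exists g; split => //; exact: ih.
Qed.

Lemma Ck1_closureP A f : Ck_closure 1 A f -> {within closure A, continuous f} /\
  exists G : 'I_N -> 'rV[R]_N -> R, forall i, {within closure A, continuous (G i)} /\
    forall x, A x -> is_derive x (e_ i) f (G i x).
Proof.
move=> [cf df]; split => //.
have /choice[G hG] : forall i, exists g, {within closure A, continuous g} /\
    forall x, A x -> is_derive x (e_ i) f (g x).
  move=> i; have [d1 [g [gE [cg _]]]] := df i; exists g; split => // x Ax.
  by apply: DeriveDef; [exact: d1|rewrite gE].
by exists G.
Qed.

Lemma closure_ray A P v (r : R) : 0 < r -> (forall s, 0 < s < r -> A (P + s *: v)) ->
  closure A P.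
Proof.
move=> r0 hA B BP.
have : (P + s *: v) @[s --> 0^'+] --> P.
  rewrite -[X in _ --> X]addr0 -(scale0r v); apply: cvg_at_right_filter.
  by apply: cvgD; [exact: cvg_cst|apply: cvgZr_tmp; exact: cvg_id].
move=> /(_ _ BP) h.
have [s [Bs As]] : (exists s, B (P + s *: v) /\ A (P + s *: v)).
  near (0 : R)^'+ => s; exists s; split; first by near: s; exact: h.
  apply: hA; apply/andP; split; near: s; [exact: nbhs_right_gt|exact: nbhs_right_lt].
by exists (P + s *: v).
Unshelve. all: by end_near. Qed.

Lemma cvg_closure_ray A f P v (r : R) : 0 < r -> {within closure A, continuous f} ->
  (forall s, 0 < s < r -> A (P + s *: v)) -> f (P + s *: v) @[s --> 0^'+] --> f P.
Proof.
move=> r0 cf hA B BP.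
have cv : (P + s *: v) @[s --> 0^'+] --> P.
  rewrite -[X in _ --> X]addr0 -(scale0r v); apply: cvg_at_right_filter.
  by apply: cvgD; [exact: cvg_cst|apply: cvgZr_tmp; exact: cvg_id].
have := (within_continuousP _ _).1 cf _ (closure_ray r0 hA) _ BP.
move=> /nbhs_ballP[e /= e0 he]; have h : \forall s \near (0 : R)^'+, ball P e (P + s *: v) := cv _ (nbhsx_ballx P e e0).
suff : \forall s \near (0 : R)^'+, B (f (P + s *: v)) by [].
apply: filterS (filterI h (filterI (nbhs_right_gt 0) (nbhs_right_lt r0))) => s [bs [s0 sr]].
by apply: (he _ bs); apply/subset_closure/hA/andP.
Qed.

(** [P] may lie on the boundary: the mean value theorem is used on the segment moved into [A] along
    [v], and continuity on the closure allows the shift to tend to 0. *)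
Lemma closure_mvt A f P v i (r t c eta : R) : 0 < r -> 0 <= t ->
  {within closure A, continuous f} ->
  (forall th s, 0 <= th <= t -> 0 < s < r ->
    [/\ A (P + th *: e_ i + s *: v), derivable f (P + th *: e_ i + s *: v) (e_ i) &
      `|'D_(e_ i) f (P + th *: e_ i + s *: v) - c| <= eta]) ->
  `|f (P + t *: e_ i) - f P - t * c| <= eta * t.
Proof.
move=> r0 t0 cf h.
have c1 : f (P + t *: e_ i + s *: v) @[s --> 0^'+] --> f (P + t *: e_ i).
  apply: cvg_closure_ray r0 cf _ => s sr; have [|//] := h t s _ sr; by rewrite t0 lexx.
have c2 : f (P + s *: v) @[s --> 0^'+] --> f P.
  apply: cvg_closure_ray r0 cf _ => s sr; have [|] := h 0 s _ sr; first by rewrite lexx.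
  by rewrite scale0r addr0.
have c3 : `|f (P + t *: e_ i + s *: v) - f (P + s *: v) - t * c| @[s --> 0^'+] -->
    `|f (P + t *: e_ i) - f P - t * c|.
  by apply: cvg_norm; apply: cvgB; [exact: cvgB|exact: cvg_cst].
apply: (ler_cvg_to c3 (@cvg_cst _ (eta * t) _ _ _)).
near=> s; have sr : 0 < s < r.
  by apply/andP; split; near: s; [exact: nbhs_right_gt|exact: nbhs_right_lt].
have E th : P + s *: v + th *: e_ i = P + th *: e_ i + s *: v by rewrite addrAC.
have [|th tht] := @mvt_line R _ f (P + s *: v) (e_ i) t t0.
  by move=> th tht; rewrite E; have [] := h th s tht sr.
rewrite !E => ->; rewrite -mulrBr normrM ger0_norm// mulrC ler_wpM2r//.
by have [] := h th s tht sr.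
Unshelve. all: by end_near. Qed.

(** Two successive moves, meant for a coordinate of [x] and for [w = u x]. The second may have
    either sign, as [u] may rise or fall. *)
Lemma closure_mvt2 A f P v i k (r t tau c1 c2 eta : R) : 0 < r -> 0 <= t ->
  {within closure A, continuous f} ->
  (forall th1 th2 s, 0 <= th1 <= t -> (0 <= th2 <= tau) || (tau <= th2 <= 0) -> 0 < s < r ->
    let Q := P + th1 *: e_ i + th2 *: e_ k + s *: v in
    [/\ A Q, derivable f Q (e_ i), derivable f Q (e_ k),
      `|'D_(e_ i) f Q - c1| <= eta & `|'D_(e_ k) f Q - c2| <= eta]) ->
  `|f (P + t *: e_ i + tau *: e_ k) - f P - t * c1 - tau * c2| <= eta * (t + `|tau|).
Proof.
move=> r0 t0 cf h.
have h1 : `|f (P + t *: e_ i) - f P - t * c1| <= eta * t.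
  apply: (@closure_mvt A f P v i r) => // th s tht sr.
  have := h th 0 s tht _ sr; rewrite lexx /= scale0r addr0 => h'.
  by case: h' => //; case: leP => //= /ltW ->.
have h2 : `|f (P + t *: e_ i + tau *: e_ k) - f (P + t *: e_ i) - tau * c2| <= eta * `|tau|.
  have [tau0|tau0] := leP 0 tau.
    rewrite [`|tau|]ger0_norm//; apply: (@closure_mvt A f _ v k r) => // th s tht sr.
    by have [] := h t th s _ _ sr; rewrite ?t0 ?lexx ?tht.
  have := @closure_mvt A f (P + t *: e_ i + tau *: e_ k) v k r (- tau) c2 eta r0.
  rewrite [`|tau|]ltr0_norm// scaleNr addrK => h3.
  rewrite -normrN [X in `|X|](_ : _ = f (P + t *: e_ i) - f (P + t *: e_ i + tau *: e_ k) - - tau * c2); last by ring.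
  apply: h3 => // [|th s /andP[th0 tht] sr]; first by lra.
  rewrite -(addrA (P + t *: e_ i)) -scalerDl.
  have [] := h t (tau + th) s _ _ sr => //; first by rewrite t0 lexx.
  by apply/orP; right; apply/andP; split; lra.
rewrite [X in `|X|](_ : _ = (f (P + t *: e_ i) - f P - t * c1) +
  (f (P + t *: e_ i + tau *: e_ k) - f (P + t *: e_ i) - tau * c2)); last by ring.
by rewrite mulrDr (le_trans (ler_normD _ _))// lerD.
Qed.

Lemma within_closure_bounded A f (L : R) : {within closure A, continuous f} ->
  exists2 C, 0 < C & forall x : 'rV[R]_N, closure A x -> (forall i, `|x 0 i| <= L) -> `|f x| <= C.
Proof.
move=> cf; pose K := closure A `&` [set x : 'rV[R]_N | forall i, `|x 0 i| <= L].
have cK : compact K.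
  apply: (subclosed_compact _ (@compact_box _ _ L)); last by move=> x [].
  by apply: closedI; [exact: closed_closure|exact: closed_compact_rV (@compact_box _ _ L)].
have := @continuous_compact _ _ f K (continuous_subspaceW (@subIsetl _ _ _) cf) cK.
move=> /compact_bounded[B [_ hB]].
exists (`|B| + 1) => [|x Ax xL]; first by rewrite ltr_wpDl.
by apply: (hB (`|B| + 1)); [rewrite (le_lt_trans (ler_norm B))// ltrDl|exists x].
Qed.

Lemma within_closure_near A f P (e : R) : {within closure A, continuous f} -> closure A P -> 0 < e ->
  exists2 r, 0 < r & forall Q, closure A Q -> ball P r Q -> `|f Q - f P| < e.
Proof.
move=> /within_continuousP cf AP e0.
have := cf _ AP _ (nbhsx_ballx (f P) e e0) => /nbhs_ballP[r /= r0 hr].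
by exists r => // Q AQ PQ; rewrite distrC; exact: (hr Q PQ AQ).
Qed.

End differentiability_up_to_the_boundary.

Section pt_algebra.
Context (R : realType) (n : nat).

Lemma pt_addl (x : 'rV[R]_n) z t j :
  pt (x + t *: basis_vec R j) z = pt x z + t *: basis_vec R (lshift 1 j).
Proof.
apply/rowP => i; case: (split_ordP i) => k ->; rewrite [RHS]mxE ?pt_lshift ?pt_rshift !mxE eqxx /=.
  by rewrite eq_lshift.
by rewrite eq_rlshift mulr0 addr0.
Qed.

Lemma pt_addr (x : 'rV[R]_n) z t : pt x (z + t) = pt x z + t *: basis_vec R (rshift n ord0).
Proof.
apply/rowP => i; case: (split_ordP i) => k ->; rewrite [RHS]mxE ?pt_lshift ?pt_rshift !mxE eqxx /=.
  by rewrite eq_lrshift mulr0 addr0.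
by rewrite eq_rshift !ord1 eqxx mulr1.
Qed.

Lemma init_addl (y : 'rV[R]_(n + 1)) t j :
  init (y + t *: basis_vec R (lshift 1 j)) = init y + t *: basis_vec R j.
Proof. by rewrite -{1}(pt_init_final y) -pt_addl init_pt. Qed.

Lemma final_addl (y : 'rV[R]_(n + 1)) t j :
  final (y + t *: basis_vec R (lshift 1 j)) = final y.
Proof. by rewrite -{1}(pt_init_final y) -pt_addl final_pt. Qed.

Lemma init_addr (y : 'rV[R]_(n + 1)) t : init (y + t *: basis_vec R (rshift n ord0)) = init y.
Proof. by rewrite -{1}(pt_init_final y) -pt_addr init_pt. Qed.

Lemma final_addr (y : 'rV[R]_(n + 1)) t :
  final (y + t *: basis_vec R (rshift n ord0)) = final y + t.
Proof. by rewrite -{1}(pt_init_final y) -pt_addr final_pt. Qed.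

Lemma continuous_init : continuous (@init R n).
Proof.
move=> x B /nbhs_ballP[e /= e0 eB]; apply/nbhs_ballP; exists e => //= y /ball_rVE h.
by apply: eB; apply/ball_rVE => // i; rewrite !mxE; exact: h.
Qed.

Lemma continuous_final : continuous (@final R n).
Proof.
rewrite (_ : @final R n = (fun y : 'rV[R]_(n + 1) => y 0 (rshift n ord0))).
  by move=> x; exact: coord_continuous.
by apply/funext => y; rewrite /final !mxE.
Qed.

Lemma ball_pt (x x' : 'rV[R]_n) z z' r : ball x r x' -> `|z - z'| < r -> ball (pt x z) r (pt x' z').
Proof.
move=> xx' zz'; have r0 : 0 < r by exact: le_lt_trans zz'.
apply/ball_rVE => // i; case: (split_ordP i) => k ->; rewrite ?pt_lshift ?pt_rshift//.
exact: (ball_rVE x x' r0).1.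
Qed.

Lemma norm_pt_le (x : 'rV[R]_n) z (L : R) : (forall i, `|x 0 i| <= L) -> `|z| <= L ->
  forall i, `|pt x z 0 i| <= L.
Proof.
by move=> xL zL i; case: (split_ordP i) => k ->; rewrite ?pt_lshift ?pt_rshift.
Qed.

End pt_algebra.

(** * Increments of functions that are C^1 up to the boundary *)

Section closure_increments.
Context (R : realType) (N : nat).
Local Notation e_ := (@basis_vec R N).
Variables (A : set 'rV[R]_N) (f : 'rV[R]_N -> R) (G : 'I_N -> 'rV[R]_N -> R).
Hypotheses (cf : {within closure A, continuous f})
  (cG : forall i, {within closure A, continuous (G i)})
  (dG : forall i x, A x -> is_derive x (e_ i) f (G i x)).

(** The parallelogram swept by the two moves, together with its inward translates along [v], lies in
    [S]; only translates with [s > 0] are required, so the parallelogram itself may touch the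
    boundary. *)
Definition reach (P v : 'rV[R]_N) i k (t tau r : R) (S : set 'rV[R]_N) :=
  forall th1 th2 s, 0 <= th1 <= t -> (0 <= th2 <= tau) || (tau <= th2 <= 0) -> 0 < s < r ->
    S (P + th1 *: e_ i + th2 *: e_ k + s *: v).

Lemma increment_lip (P v : 'rV[R]_N) i k (t tau r C : R) : 0 < r -> 0 <= t ->
  reach P v i k t tau r [set Q | [/\ A Q, `|G i Q| <= C & `|G k Q| <= C]] ->
  `|f (P + t *: e_ i + tau *: e_ k) - f P| <= C * (t + `|tau|).
Proof.
move=> r0 t0 hr.
have hr0 th1 th2 s : 0 <= th1 <= t -> (0 <= th2 <= tau) || (tau <= th2 <= 0) -> 0 < s < r ->
    let Q := P + th1 *: e_ i + th2 *: e_ k + s *: v in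
    [/\ A Q, derivable f Q (e_ i), derivable f Q (e_ k),
      `|'D_(e_ i) f Q - 0| <= C & `|'D_(e_ k) f Q - 0| <= C].
  move=> h1 h2 h3 Q; have [AQ GiQ GkQ] := hr _ _ _ h1 h2 h3.
  have [di Ei] := dG i AQ; have [dk Ek] := dG k AQ; rewrite !subr0 Ei Ek.
  split; [exact: AQ|exact: di|exact: dk|exact: GiQ|exact: GkQ].
have <- : f (P + t *: e_ i + tau *: e_ k) - f P - t * 0 - tau * 0 = f (P + t *: e_ i + tau *: e_ k) - f P.
  by rewrite !mulr0 !subr0.
exact: (@closure_mvt2 R N A f P v i k r).
Qed.

Lemma increment_near (P v : 'rV[R]_N) i k (e : R) : closure A P -> 0 < e ->
  exists2 rho, 0 < rho & forall t tau r, 0 < r -> 0 <= t -> t + `|tau| < rho ->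
    reach P v i k t tau r A ->
    `|f (P + t *: e_ i + tau *: e_ k) - f P - t * G i P - tau * G k P| <= e * (t + `|tau|).
Proof.
move=> AP e0.
have [r1 r10 h1] := within_closure_near (@cG i) AP e0.
have [r2 r20 h2] := within_closure_near (@cG k) AP e0.
pose r' := Num.min r1 r2; have r'0 : 0 < r' by rewrite lt_min r10.
pose V := \sum_l `|v 0 l|; have V0 : 0 <= V by exact: sumr_ge0.
have V1 : 0 < V + 1 by rewrite ltr_wpDl.
exists (r' / 2) => [|t tau r r0 t0 tr hr]; first by rewrite divr_gt0.
pose q := Num.min r (r' / 2 / (V + 1)).
have q0 : 0 < q by rewrite lt_min r0 !divr_gt0.
apply: (@closure_mvt2 R N A f P v i k q t tau) => // th1 th2 s t1 t2 /andP[s0 sq] Q.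
have AQ : A Q by apply: hr => //; rewrite s0 (lt_le_trans sq) ?ge_min ?lexx.
have PQ : ball P r' Q.
  apply/ball_rVE => // l; rewrite /Q !mxE eqxx /=.
  have sv : s * (V + 1) < r' / 2.
    by rewrite -ltr_pdivlMr// (lt_le_trans sq)// ge_min lexx orbT.
  have vl : `|v 0 l| <= V by rewrite /V (bigD1 l)//= lerDl sumr_ge0.
  have b1 : `|th1 * (l == i)%:R| <= t.
    have /andP[a1 a2] := t1; rewrite normrM ger0_norm//; case: (l == i).
      by rewrite normr1 mulr1.
    by rewrite normr0 mulr0.
  have b2 : `|th2 * (l == k)%:R| <= `|tau|.
    have a2 : `|th2| <= `|tau|.
      by case/orP: t2 => /andP[a1 a2]; [rewrite !ger0_norm//; lra|rewrite !ler0_norm//; lra].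
    by rewrite normrM; case: (l == k); rewrite ?normr1 ?normr0 ?mulr1// mulr0.
  have b3 : `|s * v 0 l| <= s * V by rewrite normrM gtr0_norm// ler_wpM2l// ltW.
  rewrite (_ : _ - _ = - (th1 * (l == i)%:R) - (th2 * (l == k)%:R + s * v 0 l)); last by ring.
  apply: le_lt_trans (ler_normB _ _) _; rewrite normrN.
  have := ler_normD (th2 * (l == k)%:R) (s * v 0 l); lra.
have [di Ei] := dG i AQ; have [dk Ek] := dG k AQ; rewrite Ei Ek.
split => //; apply: ltW.
  by apply: h1; [exact: subset_closure|apply: le_ball PQ; rewrite ge_min lexx].
by apply: h2; [exact: subset_closure|apply: le_ball PQ; rewrite ge_min lexx orbT].
Qed.

End closure_increments.

Section pt_topology.
Context (R : realType) (n : nat).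

Lemma pt_addZ (x x' : 'rV[R]_n) (z z' s : R) :
  pt x z + s *: pt x' z' = pt (x + s *: x') (z + s * z').
Proof.
apply/rowP => i; case: (split_ordP i) => k ->;
  by rewrite [LHS]mxE [X in _ + X]mxE ?pt_lshift ?pt_rshift ?mxE.
Qed.

Lemma continuous_pt (T : topologicalType) (f : T -> 'rV[R]_n) (g : T -> R) y :
  {for y, continuous f} -> {for y, continuous g} -> {for y, continuous (fun y => pt (f y) (g y))}.
Proof.
move=> cf cg B /nbhs_ballP[e /= e0 eB].
have h1 : \forall z \near y, ball (f y) e (f z) := cf _ (nbhsx_ballx (f y) e e0).
have h2 : \forall z \near y, ball (g y) e (g z) := cg _ (nbhsx_ballx (g y) e e0).
suff : \forall z \near y, B (pt (f z) (g z)) by [].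
by apply: filterS (filterI h1 h2) => z [/= b1 b2]; apply: eB; exact: ball_pt.
Qed.

Lemma sqint_cylinder (D : set 'rV[R]_n) (a b : R) (g : 'rV[R]_n -> R) : measurable D -> a <= b ->
  sqint (leb n) D g ->
  sqint (leb (n + 1)) [set y | D (init y) /\ a < final y < b] (g \o @init R n) /\
  rsq (leb (n + 1)) [set y | D (init y) /\ a < final y < b] (g \o @init R n) = (b - a) * rsq (leb n) D g.
Proof.
move=> mD ab gD; have [mg goo] := gD.
set Z := [set y | _].
have mZ : measurable Z.
  have -> : Z = @init R n @^-1` D `&` @final R n @^-1` `]a, b[.
    by apply/seteqP; split => y /=; rewrite in_itv /= => -[].
  apply: measurableI; rewrite -[X in measurable X]setTI.
    exact: measurable_init.
  by apply: measurable_final => //; exact: measurable_itv.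
have mgr : measurable_fun setT (g \_ D) by exact/(measurable_restrictT _ mD).
have I01 (z : R) : (\1_`]a, b[ z : R) ^+ 2 = \1_`]a, b[ z.
  by rewrite indicE; case: (_ \in _); rewrite ?expr1n ?expr0n.
have ZE y : ((g \o @init R n) \_ Z) y = (g \_ D) (init y) * \1_`]a, b[ (final y).
  rewrite indicE; have [Dy|Dy] := pselect (D (init y)); last first.
    by rewrite (restrict_out _ Dy) mul0r restrict_out// => -[].
  rewrite (restrict_in _ Dy); have [ay|ay] := pselect (a < final y < b).
    by rewrite restrict_in//= mem_set ?mulr1//= in_itv.
  by rewrite restrict_out ?memNset ?mulr0//= ?in_itv//= => -[].
have mI : measurable_fun setT (\1_`]a, b[ : R -> R) by apply: measurable_indic; exact: measurable_itv.
have mgZ : measurable_fun Z (g \o @init R n).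
  apply/(measurable_restrictT _ mZ); rewrite (funext ZE); apply: measurable_funM.
    exact: measurableT_comp mgr (@measurable_init R n).
  exact: measurableT_comp mI (@measurable_final R n).
have E : (\int[leb (n + 1)]_(y in Z) (((g \o @init R n) y) ^+ 2)%:E = (b - a)%:E * (rsq (leb n) D g)%:E)%E.
  have -> : (\int[leb (n + 1)]_(y in Z) (((g \o @init R n) y) ^+ 2)%:E =
     \int[leb (n + 1)]_y ((((g \o @init R n) \_ Z) y) ^+ 2)%:E)%E.
    rewrite integral_mkcond; apply: eq_integral => y _; rewrite !patchE.
    by case: ifP => // _; rewrite expr0n.
  rewrite integral_leb_pt; last 2 first.
  - by apply: measurable_sqr; exact/(measurable_restrictT _ mZ).
  - by move=> y; rewrite lee_fin sqr_ge0.
  rewrite -(rsq_restrict g mD) -rsqE//; last exact: sqint_restrict.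
  rewrite -ge0_integralZl//; last 3 first.
  - exact: measurable_sqr.
  - by move=> x _; rewrite lee_fin sqr_ge0.
  - by rewrite lee_fin subr_ge0.
  apply: eq_integral => x _.
  transitivity (\int[lebesgue_measure]_z (((g \_ D) x ^+ 2)%:E * (\1_`]a, b[ z)%:E))%E.
    by apply: eq_integral => z _; rewrite ZE init_pt final_pt exprMn I01 EFinM.
  rewrite ge0_integralZl//; [|exact/measurable_EFinP|by rewrite lee_fin sqr_ge0].
  rewrite integral_indic// setIT muleC; congr (_ * _)%E.
  transitivity (@lebesgue_measure R `]a, b[%classic) => //.
  rewrite lebesgue_measure_itv/= lte_fin; case: ltP => [_|ba]; first by rewrite EFinB.
  by congr EFin; lra.
have gZ : sqint (leb (n + 1)) Z (g \o @init R n) by split => //; rewrite E -EFinM ltry.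
by split => //; apply: EFin_inj; rewrite -rsqE// E EFinM.
Qed.

End pt_topology.

(** * Smooth truncation *)

Section products.
Context d (T : measurableType d) (R : realType) (mu : {measure set T -> \bar R}).
Implicit Types (A : set T) (f g : T -> R).

Lemma measurable_inv_pos A f : measurable_fun A f -> (forall x, A x -> 0 < f x) ->
  measurable_fun A (fun x => (f x)^-1).
Proof.
move=> mf f0; apply: (@eq_measurable_fun _ _ _ _ _ (fun x => f x `^ (-1))).
  by move=> x /set_mem Ax; rewrite powR_inv1// ltW// f0.
exact: (measurableT_comp (measurable_powR (-1)) mf).
Qed.

Lemma sqint_mul_bounded A f g C : measurable A -> measurable_fun A f -> (forall x, A x -> `|f x| <= C) ->
  sqint mu A g -> sqint mu A (f \* g) /\ rsq mu A (f \* g) <= C ^+ 2 * rsq mu A g.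
Proof.
move=> mA mf fC gA; have mfg : measurable_fun A (f \* g) by apply: measurable_funM => //; case: gA.
have le x : A x -> (f \* g) x ^+ 2 <= (C * g x) ^+ 2.
  move=> Ax; rewrite /= !exprMn ler_wpM2r ?sqr_ge0//.
  rewrite -[leLHS]real_normK ?num_real// ler_pXn2r ?nnegrE ?fC//.
  exact: le_trans (normr_ge0 _) (fC _ Ax).
have CgA := sqintZ mA C gA; split; first exact: (sqint_dom mA mfg CgA le).
by rewrite -(rsqZ mA C gA); exact: le_rsq.
Qed.

End products.

Section truncation.
Context (R : realType).

Lemma is_derive_sqr_pos (y : R) :
  is_derive y (1 : R) (fun y => Num.max 0 y ^+ 2) (2 * Num.max 0 y).
Proof.
apply: is_derive_eps => e e0; exists e => // t te; rewrite -[t *: 1]/(t * 1) mulr1.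
apply: (@le_trans _ _ (t ^+ 2)); last first.
  by rewrite -real_normK ?num_real// expr2 ler_wpM2r// ltW.
rewrite ler_norml.
by case: (leP 0 (y + t)) => h1; case: (leP 0 y) => h2; rewrite ?expr0n /= ?mulr0; apply/andP; split; nra.
Qed.

Lemma is_derive_inv (F : R -> R) (s a : R) : F s != 0 -> is_derive s (1 : R) F a ->
  is_derive s (1 : R) (fun y => (F y)^-1) (- (F s) ^- 2 *: a).
Proof.
by move=> F0 [dF <-]; apply: DeriveDef; [exact: derivableV|exact: deriveV].
Qed.

Definition strunc_ratio (eta s : R) := Num.max 0 (s ^+ 2 - eta ^+ 2) / (s ^+ 2 + eta ^+ 2).

(* A C^1 approximation of the identity that vanishes on [-eta, eta]. *)
Definition strunc (eta s : R) := s * strunc_ratio eta s ^+ 2.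

Definition strunc' (eta s : R) := strunc_ratio eta s ^+ 2 +
  8 * strunc_ratio eta s * (s ^+ 2 * eta ^+ 2 / (s ^+ 2 + eta ^+ 2) ^+ 2).

Lemma strunc_ratio_bound eta s : 0 < eta -> 0 <= strunc_ratio eta s <= 1.
Proof.
move=> eta0; have p0 : 0 < s ^+ 2 + eta ^+ 2 by rewrite ltr_wpDl ?sqr_ge0// exprn_gt0.
rewrite /strunc_ratio divr_ge0 ?le_max ?lexx ?(ltW p0)//= ler_pdivrMr// mul1r ge_max (ltW p0)/=.
by have := sqr_ge0 eta; lra.
Qed.

Lemma strunc0 eta s : `|s| <= eta -> strunc eta s = 0 /\ strunc' eta s = 0.
Proof.
move=> se; have h : s ^+ 2 <= eta ^+ 2.
  by rewrite -[leLHS]real_normK ?num_real// ler_pXn2r ?nnegrE// (le_trans _ se).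
have z : strunc_ratio eta s = 0 by rewrite /strunc_ratio max_l ?mul0r// subr_le0.
by rewrite /strunc /strunc' z expr0n /= !(mulr0, mul0r) addr0.
Qed.

Lemma strunc_le eta s : 0 < eta -> `|strunc eta s| <= `|s|.
Proof.
move=> eta0; have /andP[m0 m1] := strunc_ratio_bound s eta0.
by rewrite normrM ler_piMr// ger0_norm ?sqr_ge0// expr_le1.
Qed.

Let ratio_le (a b : R) : 0 <= a -> 0 <= b -> a * b / (a + b) ^+ 2 <= 4^-1.
Proof.
move=> a0 b0; have [->|ab] := eqVneq (a + b) 0; first by rewrite expr0n invr0 mulr0 invr_ge0.
have p0 : 0 < (a + b) ^+ 2 by rewrite exprn_even_gt0.
by rewrite ler_pdivrMr//; have := sqr_ge0 (a - b); nra.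
Qed.

Lemma strunc'_bound eta s : 0 < eta -> 0 <= strunc' eta s <= 3.
Proof.
move=> eta0; have /andP[m0 m1] := strunc_ratio_bound s eta0.
have q1 := ratio_le (sqr_ge0 s) (sqr_ge0 eta).
have q0 : 0 <= s ^+ 2 * eta ^+ 2 / (s ^+ 2 + eta ^+ 2) ^+ 2.
  by rewrite divr_ge0 ?sqr_ge0// mulr_ge0 ?sqr_ge0.
have mm : 0 <= strunc_ratio eta s ^+ 2 <= 1 by rewrite sqr_ge0 expr_le1.
have mq : 0 <= strunc_ratio eta s * (s ^+ 2 * eta ^+ 2 / (s ^+ 2 + eta ^+ 2) ^+ 2) <= 4^-1.
  rewrite mulr_ge0//=; apply: le_trans q1; exact: ler_piMl.
by rewrite /strunc' -mulrA; lra.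
Qed.

Lemma is_derive_strunc eta (s : R) : 0 < eta -> is_derive s (1 : R) (strunc eta) (strunc' eta s).
Proof.
move=> eta0; have p0 : s ^+ 2 + eta ^+ 2 != 0 by rewrite gt_eqF// ltr_wpDl ?sqr_ge0// exprn_gt0.
have d1 : is_derive s (1 : R) (fun s => s ^+ 2 - eta ^+ 2) (2 * s).
  by apply: is_derive_eq; rewrite /= -[_ *: 1]/(_ * 1); ring.
have d2 : is_derive s (1 : R) (fun s => Num.max 0 (s ^+ 2 - eta ^+ 2) ^+ 2)
    (2 * Num.max 0 (s ^+ 2 - eta ^+ 2) * (2 * s)).
  exact: (@is_derive1_comp _ (fun y => Num.max 0 y ^+ 2) (fun s => s ^+ 2 - eta ^+ 2) s _ _ (is_derive_sqr_pos _) d1).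
have d3 : is_derive s (1 : R) (fun s => (s ^+ 2 + eta ^+ 2) ^+ 2) (2 * (s ^+ 2 + eta ^+ 2) * (2 * s)).
  by apply: is_derive_eq; rewrite /= -![_ *: _]/(_ * _); ring.
have d4 : is_derive s (1 : R) (fun s => ((s ^+ 2 + eta ^+ 2) ^+ 2)^-1)
    (- ((s ^+ 2 + eta ^+ 2) ^+ 2) ^- 2 *: (2 * (s ^+ 2 + eta ^+ 2) * (2 * s))).
  exact: (@is_derive_inv (fun s => (s ^+ 2 + eta ^+ 2) ^+ 2) s _ (expf_neq0 2 p0) d3).
have -> : strunc eta = (fun s => s) * ((fun s => Num.max 0 (s ^+ 2 - eta ^+ 2) ^+ 2) * (fun s => ((s ^+ 2 + eta ^+ 2) ^+ 2)^-1)).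
  by apply/funext => x; rewrite /strunc /strunc_ratio expr_div_n.
have d5 := is_deriveM (is_derive_id s 1) (is_deriveM d2 d4).
apply: (is_derive_eq d5); rewrite /strunc' /strunc_ratio.
set Mx := Num.max 0 (s ^+ 2 - eta ^+ 2).
transitivity (s * (Mx ^+ 2 * (- ((s ^+ 2 + eta ^+ 2) ^+ 2) ^- 2 * (2 * (s ^+ 2 + eta ^+ 2) * (2 * s))) +
  ((s ^+ 2 + eta ^+ 2) ^+ 2)^-1 * (2 * Mx * (2 * s))) + Mx ^+ 2 * ((s ^+ 2 + eta ^+ 2) ^+ 2)^-1 * 1); first by [].
rewrite /Mx; have [m0|m0] := leP (s ^+ 2 - eta ^+ 2) 0.
  by rewrite !(mul0r, mulr0, expr0n, addr0, add0r).
by field.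
Qed.

Lemma strunc_continuous eta : 0 < eta -> continuous (strunc eta).
Proof.
move=> eta0 s; have [ds _] := is_derive_strunc s eta0.
exact/differentiable_continuous/derivable1_diffP.
Qed.

Lemma strunc'_continuous eta : 0 < eta -> continuous (strunc' eta).
Proof.
move=> eta0.
have p0 (s : R) : s ^+ 2 + eta ^+ 2 != 0 by rewrite gt_eqF// ltr_wpDl ?sqr_ge0// exprn_gt0.
have cs : continuous (fun s : R => s ^+ 2 + eta ^+ 2).
  by move=> s; apply: cvgD; [exact: exprn_continuous|exact: cvg_cst].
have cm : continuous (fun s : R => s ^+ 2 - eta ^+ 2).
  by move=> s; apply: cvgB; [exact: exprn_continuous|exact: cvg_cst].
have ci : continuous (fun s : R => (s ^+ 2 + eta ^+ 2)^-1) by move=> s; apply: cvgV; [exact: p0|exact: cs].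
have cr : continuous (strunc_ratio eta).
  rewrite (_ : strunc_ratio eta = fun s => (s ^+ 2 - eta ^+ 2 + `|s ^+ 2 - eta ^+ 2|) / 2 / (s ^+ 2 + eta ^+ 2)).
    move=> s; apply: cvgM; last exact: ci.
    apply: cvgM; last exact: cvg_cst.
    by apply: cvgD; [exact: cm|apply: cvg_norm; exact: cm].
  by apply/funext => s; rewrite /strunc_ratio maxr_absE add0r sub0r normrN.
have csq (g : R -> R) : continuous g -> continuous (fun s => g s ^+ 2).
  move=> cg; rewrite (_ : (fun s => g s ^+ 2) = g \* g); first by move=> s; apply: continuousM; exact: cg.
  by apply/funext => x; rewrite /= expr2.
move=> s; rewrite /strunc'; apply: cvgD; first exact: (csq _ cr).
apply: cvgM; first by apply: cvgM; [exact: cvg_cst|exact: cr].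
apply: cvgM; first by apply: cvgM; [exact: exprn_continuous|exact: cvg_cst].
by apply: cvgV; [exact: expf_neq0|exact: (csq _ cs)].
Qed.

Lemma strunc_near eta s : 0 < eta < `|s| ->
  `|strunc eta s - s| <= 4 * eta ^+ 2 / `|s| /\ `|strunc' eta s - 1| <= 12 * eta ^+ 2 / s ^+ 2.
Proof.
move=> /andP[eta0 es]; have s0 : 0 < `|s| by apply: lt_trans es.
have sn : s != 0 by rewrite -normr_gt0.
have s20 : 0 < s ^+ 2 by rewrite -real_normK ?num_real// exprn_gt0.
have e20 : 0 < eta ^+ 2 by rewrite exprn_gt0.
have p0 : 0 < s ^+ 2 + eta ^+ 2 by rewrite addr_gt0.
have /andP[m0 m1] := strunc_ratio_bound s eta0.
have h1 : 1 - strunc_ratio eta s <= 2 * (eta ^+ 2 / s ^+ 2).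
  have -> : strunc_ratio eta s = (s ^+ 2 - eta ^+ 2) / (s ^+ 2 + eta ^+ 2).
    by rewrite /strunc_ratio max_r// subr_ge0 -[leRHS]real_normK ?num_real// ler_pXn2r ?nnegrE ?ltW.
  have -> : 1 - (s ^+ 2 - eta ^+ 2) / (s ^+ 2 + eta ^+ 2) = 2 * (eta ^+ 2 / (s ^+ 2 + eta ^+ 2)).
    by field; rewrite gt_eqF.
  by rewrite ler_pM2l// ler_pM2l// lef_pV2 ?posrE// lerDl ltW.
have h2 : 1 - strunc_ratio eta s ^+ 2 <= 4 * (eta ^+ 2 / s ^+ 2) by nra.
have h3 : strunc_ratio eta s ^+ 2 <= 1 by rewrite expr_le1.
split.
  rewrite (_ : _ - s = - (s * (1 - strunc_ratio eta s ^+ 2))); last by rewrite /strunc; ring.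
  rewrite normrN normrM [X in _ * X]ger0_norm ?subr_ge0//.
  have -> : 4 * eta ^+ 2 / `|s| = `|s| * (4 * (eta ^+ 2 / s ^+ 2)).
    by rewrite -[s ^+ 2]real_normK ?num_real//; field; rewrite gt_eqF.
  by rewrite ler_wpM2l.
have q1 : 0 <= s ^+ 2 * eta ^+ 2 / (s ^+ 2 + eta ^+ 2) ^+ 2 <= eta ^+ 2 / s ^+ 2.
  apply/andP; split; first by apply: divr_ge0; [apply: mulr_ge0|]; exact: sqr_ge0.
  rewrite ler_pdivrMr ?exprn_gt0//.
  have -> : eta ^+ 2 / s ^+ 2 * (s ^+ 2 + eta ^+ 2) ^+ 2 =
    s ^+ 2 * eta ^+ 2 + 2 * eta ^+ 2 * eta ^+ 2 + eta ^+ 2 * eta ^+ 2 * (eta ^+ 2 / s ^+ 2).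
    by field.
  have a1 : 0 <= 2 * eta ^+ 2 * eta ^+ 2 by apply: mulr_ge0; [apply: mulr_ge0 => //|]; exact: ltW.
  have a2 : 0 <= eta ^+ 2 * eta ^+ 2 * (eta ^+ 2 / s ^+ 2).
    by apply: mulr_ge0; [apply: mulr_ge0|apply: divr_ge0]; exact: ltW.
  by lra.
have q2 : 0 <= strunc_ratio eta s * (s ^+ 2 * eta ^+ 2 / (s ^+ 2 + eta ^+ 2) ^+ 2) <= eta ^+ 2 / s ^+ 2.
  have /andP[a b] := q1; rewrite mulr_ge0//=; apply: le_trans b; exact: ler_piMl.
by rewrite /strunc' -mulrA ler_norml -(mulrA 12); apply/andP; split; lra.
Qed.

End truncation.

Section directional_chain_rule.
Context (R : realType) (V : normedModType R).

(** The increment [d] of [f] can vanish for [t] different from 0, so no quotient by [d] is formed;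
    both first-order expansions are inserted into one another. *)
Lemma is_derive_comp_direction (f : V -> R) (T : R -> R) (y e : V) (a b : R) :
  is_derive y e f a -> is_derive (f y) (1 : R) T b -> is_derive y e (T \o f) (b * a).
Proof.
move=> [df <-] [dT <-]; set c := 'D_e f y; set b' := 'D_1 T _.
apply: is_derive_eps => eta eta0.
have c1 : 0 < `|c| + 1 by rewrite ltr_wpDl.
have b1 : 0 < `|b'| + 1 by rewrite ltr_wpDl.
have [r1 r10 h1] := derive_eps dT (divr_gt0 (divr_gt0 eta0 (ltr0Sn _ 1)) c1).
have e2 : 0 < Num.min 1 (eta / 2 / (`|b'| + 1)) by rewrite lt_min ltr01 !divr_gt0.
have [r2 r20 h2] := derive_eps df e2.
exists (Num.min r2 (r1 / (`|c| + 1))) => [|t]; first by rewrite lt_min r20 divr_gt0.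
rewrite lt_min => /andP[t2 t1]; have {h2} := h2 t t2; rewrite -/c.
set d := f (y + t *: e) - f y => h2.
have h2a : `|d - t * c| <= `|t|.
  by apply: le_trans h2 _; rewrite ler_piMl// ge_min lexx.
have h2b : `|d - t * c| <= eta / 2 / (`|b'| + 1) * `|t|.
  by apply: le_trans h2 _; rewrite ler_wpM2r// ge_min lexx orbT.
have dle : `|d| <= (`|c| + 1) * `|t|.
  rewrite -(subrK (t * c) d) mulrDl mul1r addrC; apply: le_trans (ler_normD _ _) _.
  by rewrite normrM mulrC lerD2l.
have := h1 d; rewrite -[d *: 1]/(d * 1) mulr1 (_ : f y + d = f (y + t *: e)); last by rewrite /d; ring.
have dr : `|d| < r1 by apply: le_lt_trans dle _; rewrite mulrC -ltr_pdivlMr.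
move=> /(_ dr); rewrite -/b' => h3 /=.
rewrite (_ : _ - _ = (T (f (y + t *: e)) - T (f y) - d * b') + b' * (d - t * c)); last by ring.
apply: le_trans (ler_normD _ _) _; 
have -> : eta * `|t| = eta / 2 * `|t| + eta / 2 * `|t| by rewrite -mulrDl -splitr.
apply: lerD.
  apply: le_trans h3 _; apply: le_trans (ler_wpM2l _ dle) _; first by rewrite ltW// !divr_gt0.
  by rewrite mulrA divfK// gt_eqF.
rewrite normrM; apply: (@le_trans _ _ ((`|b'| + 1) * (eta / 2 / (`|b'| + 1) * `|t|))).
  by apply: ler_pM => //; rewrite lerDl.
by rewrite mulrA mulrCA divff ?mulr1// gt_eqF.
Qed.

End directional_chain_rule.

Section H1_distance.
Context (R : realType) (N : nat).
Implicit Types (A : set 'rV[R]_N) (f g : 'rV[R]_N -> R) (p q : 'I_N -> 'rV[R]_N -> R).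
Local Notation mu := (@leb R N).

Lemma cvg0_lt (a : nat -> R) (r : R) : a k @[k --> \oo] --> 0 -> 0 < r -> \forall k \near \oo, a k < r.
Proof.
move=> /cvgrPdist_lt h r0; apply: filterS (h _ r0) => k.
by rewrite sub0r normrN; exact: le_lt_trans (ler_norm _).
Qed.

Lemma H1dist_tri A f p g q f' p' : measurable A -> in_H1 A f p -> in_H1 A g q -> in_H1 A f' p' ->
  H1dist A f p f' p' <= 2 * H1dist A f p g q + 2 * H1dist A g q f' p'.
Proof.
move=> mA fp gq fp'; rewrite /H1dist.
have h1 : rsq mu A (f \- f') <= 2 * rsq mu A (f \- g) + 2 * rsq mu A (g \- f').
  by apply: rsq_tri => //; [case: fp|case: fp'|case: gq].
have h2 : \sum_i rsq mu A (p i \- p' i) <= \sum_i (2 * rsq mu A (p i \- q i) + 2 * rsq mu A (q i \- p' i)).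
  apply: ler_sum => i _; apply: rsq_tri => //; [exact: in_H1P fp mA i|exact: in_H1P fp' mA i|exact: in_H1P gq mA i].
by move: h2; rewrite big_split /= -!big_distrr /=; lra.
Qed.

Lemma H1dist_cvg A f p (fk : nat -> 'rV[R]_N -> R) pk e :
  rsq mu A (f \- fk k) @[k --> \oo] --> 0 ->
  (forall i, rsq mu A (p i \- pk k i) @[k --> \oo] --> 0) -> 0 < e ->
  \forall k \near \oo, H1dist A f p (fk k) (pk k) < e.
Proof.
move=> cf cp e0; have e1 : 0 < e / N.+1%:R by rewrite divr_gt0.
have h1 : \forall k \near \oo, rsq mu A (f \- fk k) < e / N.+1%:R by exact: cvg0_lt cf e1.
have h2 : \forall k \near \oo, forall i, rsq mu A (p i \- pk k i) < e / N.+1%:R.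
  by apply: filter_forall => i; exact: cvg0_lt (cp i) e1.
apply: filterS2 h1 h2 => k h1 h2; rewrite /H1dist.
apply: (@lt_le_trans _ _ (e / N.+1%:R + \sum_(i < N) e / N.+1%:R)).
  by apply: ltr_leD => //; apply: ler_sum => i _; exact: ltW.
by rewrite sumr_const card_ord -mulrS -[leLHS]mulr_natr divfK.
Qed.

End H1_distance.

Section triangle_inequality.
Context d (T : measurableType d) (R : realType) (mu : {measure set T -> \bar R}).

Lemma rsq_tri_le (A : set T) (h f g : T -> R) (a b : R) : measurable A ->
  sqint mu A f -> sqint mu A g -> sqint mu A h ->
  rsq mu A (h \- f) <= a -> rsq mu A (h \- g) <= b -> rsq mu A (f \- g) <= 2 * (a + b).
Proof.
move=> mA fA gA hA; rewrite rsqC => ha hb; apply: le_trans (rsq_tri mA fA gA hA) _.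
by rewrite mulrDr lerD// ler_pM2l.
Qed.

End triangle_inequality.

(** * The domains [Omega u] and [Omega_delta u] *)

Section geometry.
Context (R : realType) (n : nat).
Variables (D : set 'rV[R]_n) (H M L : R) (u : 'rV[R]_n -> R).
Hypotheses (oD : open D) (DL : forall x i, D x -> `|x 0 i| <= L) (H0 : 0 < H)
  (cu : {within closure D, continuous u}) (uH : forall x, D x -> - H <= u x)
  (uM : forall x, D x -> u x <= M - H) (HL : H + 1 <= L) (ML : M <= L).
Local Notation Omd := (@Omega_ R n D H u).
Local Notation mu := (@leb R (n + 1)).
Local Notation O := (@Omega R n D H u).
Local Notation nu := (@leb R n).
Local Notation e_ := (@basis_vec R (n + 1)).
Local Notation grad f := (fun i => 'D_(basis_vec R i) f).
Local Notation iz := (rshift n (@ord0 0)).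

Lemma continuous_at_u x : D x -> {for x, continuous u}.
Proof. exact: within_closure_nbhs. Qed.

Lemma continuous_u_init y : D (init y) -> {for y, continuous (u \o @init R n)}.
Proof. by move=> Dy; apply: continuous_comp; [exact: continuous_init|exact: continuous_at_u]. Qed.

Lemma nbhs_init y : D (init y) -> nbhs y (@init R n @^-1` D).
Proof. by move=> Dy; apply: continuous_init; exact: oD. Qed.

Lemma open_below : open [set y : 'rV[R]_(n + 1) | D (init y) /\ final y < u (init y)].
Proof.
rewrite openE => y [Dy yu].
have c : {for y, continuous (fun y : 'rV[R]_(n + 1) => u (init y) - final y)}.
  exact: (continuousB (continuous_u_init Dy) (@continuous_final R n y)).
have p0 : 0 < u (init y) - final y by rewrite subr_gt0.
have h := @filterI _ _ (nbhs_filter y) _ _ (nbhs_init Dy) (c _ (lt_nbhsr p0)).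
by apply: (@filterS _ _ (nbhs_filter y) _ _ _ h) => z [Dz /=]; rewrite subr_gt0.
Qed.

Lemma open_above a : open [set y : 'rV[R]_(n + 1) | a < final y].
Proof. by apply: (open_comp _ (@open_gt R a)) => y _; exact: continuous_final. Qed.

Lemma open_under a : open [set y : 'rV[R]_(n + 1) | D (init y) /\ a < final y < u (init y)].
Proof.
rewrite (_ : [set y | _] = [set y | D (init y) /\ final y < u (init y)] `&` [set y | a < final y]).
  by apply: openI; [exact: open_below|exact: open_above].
by apply/seteqP; split => y /= => [[? /andP[]]|[[? ?] ?]] //; split => //; apply/andP.
Qed.

Lemma open_Omega_ d : open (Omd d). Proof. exact: open_under. Qed.
Lemma open_Omega : open (@Omega R n D H u). Proof. exact: open_under. Qed.

Lemma Omega_box d y i : d <= 1 -> Omd d y -> `|y 0 i| <= L.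
Proof.
move=> d1 [Dy /andP[y1 y2]]; rewrite -(pt_init_final y).
apply: norm_pt_le => [j|]; first exact: DL.
by have := uM Dy; move: HL ML H0; rewrite ler_norml => h1 h2 h3 h; apply/andP; split; lra.
Qed.

Lemma Omega_finite d : d <= 1 -> (mu (Omd d) < +oo)%E.
Proof.
move=> d1; apply: (@leb_bounded_lty _ _ _ L); first by apply: open_measurable_rV; exact: open_Omega_.
by move=> x i; exact: Omega_box.
Qed.

Lemma Omega_sub d : 0 <= d -> @Omega R n D H u `<=` Omd d.
Proof. by move=> d0 y [Dy /andP[y1 y2]]; split => //; apply/andP; split => //; lra. Qed.

Definition layer_pt (d : R) (y : 'rV[R]_(n + 1)) : 'rV[R]_(n + 1 + 1) :=
  pt (pt (init y) (- H + (final y + H) / d)) (u (init y)).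

Definition main_pt (y : 'rV[R]_(n + 1)) : 'rV[R]_(n + 1 + 1) := pt y (u (init y)).

(* [layered d hb h] is [hu_ d]; its partial derivatives have the same form. *)
Definition layered (d : R) (Fb Fh : 'rV[R]_(n + 1 + 1) -> R) (y : 'rV[R]_(n + 1)) : R :=
  if final y < - H then Fb (layer_pt d y) else Fh (main_pt y).

Lemma hu_layered hb h d : hu_ H u hb h d = layered d hb h.
Proof.
by apply/funext => y; rewrite /hu_ /h_ /layered /layer_pt /main_pt; case: ifP; rewrite // pt_init_final.
Qed.

(** An inward direction at the faces of the domains of [hb] and [h]: [w] increases, leaving the face
    [w = - H], while [z] leaves the face [z = - H] downwards for [c = - 1] and upwards for
    [c = 1]. *)
Local Notation vw c := (pt (pt (0 : 'rV[R]_n) c) 1).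

Lemma ptZ x (z w c s : R) :
  pt (pt x z) w + s *: vw c = pt (pt x (z + s * c)) (w + s).
Proof. by rewrite !pt_addZ scaler0 addr0 mulr1. Qed.

Lemma dom_hb_ray x (z w s : R) : D x -> - H - 1 < z - s -> z <= - H -> - H <= w -> 0 < s ->
  dom_hb D H (pt (pt x z) w + s *: vw (-1)).
Proof.
move=> Dx z1 z2 w1 s0; rewrite ptZ /dom_hb /= !init_pt !final_pt; split => //; last by lra.
by apply/andP; split; lra.
Qed.

Lemma dom_h_ray x (z w s : R) : D x -> - H <= z -> - H <= w -> 0 < s ->
  dom_h D H (pt (pt x z) w + s *: vw 1).
Proof. by move=> Dx z1 w1 s0; rewrite ptZ /dom_h /= !init_pt !final_pt; split => //; lra. Qed.

Lemma ray_box x (z w c s : R) : D x -> - H - 1 <= z <= M -> - H <= w <= M -> `|c| <= 1 ->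
  0 < s <= 1 -> forall i, `|(pt (pt x z) w + s *: vw c) 0 i| <= L + 1.
Proof.
move=> Dx z1 w1 c1 /andP[s0 s1] i; rewrite ptZ.
have sc : `|s * c| <= 1 by rewrite normrM gtr0_norm// mulr_ile1// ltW.
have hsc : -1 <= s * c <= 1 by rewrite -ler_norml.
move: HL ML H0 => h1 h2 h3.
apply: norm_pt_le; last by rewrite ler_norml; lra.
apply: norm_pt_le; last by rewrite ler_norml; lra.
by move=> j; apply: le_trans (DL _ Dx) _; lra.
Qed.

Lemma closure_dom_hb x (z w : R) : D x -> - H - 1 < z <= - H -> - H <= w ->
  closure (dom_hb D H) (pt (pt x z) w).
Proof.
move=> Dx /andP[z1 z2] w1; apply: (@closure_ray _ _ _ _ (vw (-1)) (z + H + 1)); first by lra.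
by move=> s /andP[s0 s1]; apply: dom_hb_ray => //; lra.
Qed.

Lemma closure_dom_h x (z w : R) : D x -> - H <= z -> - H <= w ->
  closure (dom_h D H) (pt (pt x z) w).
Proof.
move=> Dx z1 w1; apply: (@closure_ray _ _ _ _ (vw 1) 1) => // s /andP[s0 s1].
exact: dom_h_ray.
Qed.

Lemma pt_box x (z w : R) : D x -> - H - 1 <= z <= M -> - H <= w <= M ->
  forall i, `|pt (pt x z) w 0 i| <= L.
Proof.
move=> Dx z1 w1; move: HL ML H0 => h1 h2 h3; apply: norm_pt_le; last by rewrite ler_norml; lra.
by apply: norm_pt_le; [move=> j; exact: DL|rewrite ler_norml; lra].
Qed.

Lemma layer_z d (z : R) : 0 < d -> - H - d < z < - H -> - H - 1 < - H + (z + H) / d < - H.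
Proof.
move=> d0 /andP[z1 z2].
have h1 : -1 < (z + H) / d by rewrite ltr_pdivlMr// mulN1r; lra.
have h2 : (z + H) / d < 0 by rewrite ltr_pdivrMr// mul0r; lra.
by apply/andP; split; lra.
Qed.

(** * The boundary data as a function on the thickened domain *)

Section fixed_delta.
Variable d : R.
Hypotheses (d0 : 0 < d) (d1 : d <= 1).

Lemma layer_pt_closure y : Omd d y -> final y < - H ->
  closure (dom_hb D H) (layer_pt d y) /\ forall i, `|layer_pt d y 0 i| <= L.
Proof.
move=> [Dy /andP[y1 y2]] yH; have h := uH Dy; have h' := uM Dy.
have yy : - H - d < final y < - H by rewrite y1.
have /andP[z1 z2] := layer_z d0 yy.
split; first by apply: closure_dom_hb => //; rewrite z1 ltW.
by apply: pt_box => //; move: HL ML H0 d1 => h1 h2 h3 h4; apply/andP; split; lra.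
Qed.

Lemma main_pt_closure y : Omd d y -> - H <= final y ->
  closure (dom_h D H) (main_pt y) /\ forall i, `|main_pt y 0 i| <= L.
Proof.
move=> [Dy /andP[y1 y2]] yH; have h := uH Dy; have h' := uM Dy.
rewrite /main_pt -{1 3}(pt_init_final y); split; first exact: closure_dom_h.
by apply: pt_box => //; move: HL ML H0 d1 => h1 h2 h3 h4; apply/andP; split; lra.
Qed.

Lemma layered_bounded Fb Fh : {within closure (dom_hb D H), continuous Fb} ->
  {within closure (dom_h D H), continuous Fh} ->
  exists2 C, 0 < C & forall y, Omd d y -> `|layered d Fb Fh y| <= C.
Proof.
move=> cb ch; have [Cb Cb0 hb] := within_closure_bounded L cb.
have [Ch Ch0 hh] := within_closure_bounded L ch.
exists (Cb + Ch) => [|y Oy]; first exact: addr_gt0.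
rewrite /layered; case: ltP => yH.
  by have [h1 h2] := layer_pt_closure Oy yH; rewrite (le_trans (hb _ h1 h2))// lerDl ltW.
by have [h1 h2] := main_pt_closure Oy yH; rewrite (le_trans (hh _ h1 h2))// lerDr ltW.
Qed.

Lemma continuous_layer_pt y : D (init y) -> {for y, continuous (layer_pt d)}.
Proof.
move=> Dy; apply: continuous_pt; last exact: continuous_u_init.
apply: continuous_pt; first exact: continuous_init.
apply: continuousD; first exact: cst_continuous.
apply: continuousM; last exact: cst_continuous.
by apply: continuousD; [exact: continuous_final|exact: cst_continuous].
Qed.

Lemma continuous_main_pt y : D (init y) -> {for y, continuous main_pt}.
Proof. by move=> Dy; apply: continuous_pt; [exact: cvg_id|exact: continuous_u_init]. Qed.

Lemma within_comp_continuous (A : set 'rV[R]_(n + 1)) (B : set 'rV[R]_(n + 1 + 1))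
    (F : 'rV[R]_(n + 1 + 1) -> R) (pp : 'rV[R]_(n + 1) -> 'rV[R]_(n + 1 + 1)) :
  {within closure B, continuous F} -> (forall y, A y -> closure B (pp y)) ->
  (forall y, A y -> {for y, continuous pp}) -> {within A, continuous (F \o pp)}.
Proof.
move=> cF AB cpp; apply/within_continuousP => y Ay V /nbhs_ballP[e /= e0 eV].
have [r r0 hr] := within_closure_near cF (AB _ Ay) e0.
have /nbhs_ballP[r' /= r'0 h'] := cpp _ Ay _ (nbhsx_ballx (pp y) r r0).
apply/nbhs_ballP; exists r' => // y' yy' Ay'; apply: eV.
by rewrite /ball /= distrC; apply: hr; [exact: AB|exact: h'].
Qed.

Lemma layered_measurable Fb Fh : {within closure (dom_hb D H), continuous Fb} ->
  {within closure (dom_h D H), continuous Fh} -> measurable_fun (Omd d) (layered d Fb Fh).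
Proof.
move=> cb ch; have mO : measurable (Omd d) by apply: open_measurable_rV; exact: open_Omega_.
pose B := [set y : 'rV[R]_(n + 1) | final y < - H].
have mB : measurable B.
  apply: open_measurable_rV; apply: (open_comp _ (@open_lt R (- H))) => y _.
  exact: continuous_final.
have mB' : measurable (~` B) by exact: measurableC.
rewrite (_ : Omd d = (Omd d `&` B) `|` (Omd d `&` ~` B)); last by rewrite -setIUr setUv setIT.
have m1 : measurable (Omd d `&` B) by exact: measurableI.
have m2 : measurable (Omd d `&` ~` B) by exact: measurableI.
apply/measurable_funU => //; split.
  apply: (@eq_measurable_fun _ _ _ _ _ (Fb \o layer_pt d)).
    by move=> y /set_mem[_ yB]; rewrite /layered yB.
  apply: within_continuous_measurable => //.
  apply: within_comp_continuous cb _ _ => y [Oy yB]; first by have [] := layer_pt_closure Oy yB.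
  by apply: continuous_layer_pt; case: Oy.
apply: (@eq_measurable_fun _ _ _ _ _ (Fh \o main_pt)).
  by move=> y /set_mem[_ yB]; rewrite /layered ifN//; exact/negP.
apply: within_continuous_measurable => //.
apply: within_comp_continuous ch _ _ => y [Oy yB].
  by have [] := main_pt_closure Oy; rewrite // leNgt; apply/negP.
by apply: continuous_main_pt; case: Oy.
Qed.

Lemma layered_sqint Fb Fh : {within closure (dom_hb D H), continuous Fb} ->
  {within closure (dom_h D H), continuous Fh} -> sqint mu (Omd d) (layered d Fb Fh).
Proof.
move=> cb ch; have [C C0 hC] := layered_bounded cb ch.
apply: (@sqint_bounded _ _ _ _ _ _ _ C) => //; last exact: layered_measurable.
  apply: open_measurable_rV; exact: open_Omega_.
exact: Omega_finite.
Qed.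

Section derivatives.
Variables (hb h : 'rV[R]_(n + 1 + 1) -> R) (Gb Gh : 'I_(n + 1 + 1) -> 'rV[R]_(n + 1 + 1) -> R).
Hypotheses (chb : {within closure (dom_hb D H), continuous hb})
  (ch : {within closure (dom_h D H), continuous h})
  (cGb : forall i, {within closure (dom_hb D H), continuous (Gb i)})
  (cGh : forall i, {within closure (dom_h D H), continuous (Gh i)})
  (dGb : forall i x, dom_hb D H x -> is_derive x (basis_vec R i) hb (Gb i x))
  (dGh : forall i x, dom_h D H x -> is_derive x (basis_vec R i) h (Gh i x))
  (hbh : forall x w, D x -> - H <= w -> hb (pt (pt x (- H)) w) = h (pt (pt x (- H)) w)).

Local Notation kz := (idx_z n).
Local Notation kw := (rshift (n + 1) (@ord0 0)).
Local Notation kx j := (lshift 1 (lshift 1 j)).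

Let in_box (A : set 'rV[R]_(n + 1 + 1)) := [set Q | A Q /\ forall i, `|Q 0 i| <= L + 1].

Lemma gradient_bound : exists2 C, 0 < C & forall i,
  (forall Q, in_box (dom_hb D H) Q -> `|Gb i Q| <= C) /\ (forall Q, in_box (dom_h D H) Q -> `|Gh i Q| <= C).
Proof.
have hB A (G : 'I_(n + 1 + 1) -> 'rV[R]_(n + 1 + 1) -> R) : (forall i, {within closure A, continuous (G i)}) ->
    exists2 C, 0 < C & forall i Q, in_box A Q -> `|G i Q| <= C.
  move=> cG; have /choice[B hB] : forall i, exists C, 0 < C /\ forall Q, in_box A Q -> `|G i Q| <= C.
    move=> i; have [C C0 hC] := within_closure_bounded (L + 1) (cG i).
    by exists C; split => // Q [AQ bQ]; apply: hC => //; exact: subset_closure.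
  exists (\sum_i B i + 1) => [|i Q bQ].
    by rewrite ltr_wpDl// sumr_ge0// => i _; rewrite ltW//; case: (hB i).
  have [_ h'] := hB i; rewrite (le_trans (h' _ bQ))// (bigD1 i)//= -addrA lerDl addr_ge0//.
  by rewrite sumr_ge0// => k _; rewrite ltW//; case: (hB k).
have [C1 C10 h1] := hB _ _ cGb; have [C2 C20 h2] := hB _ _ cGh.
exists (C1 + C2) => [|i]; first exact: addr_gt0.
split => Q bQ; first by rewrite (le_trans (h1 i _ bQ))// lerDl ltW.
by rewrite (le_trans (h2 i _ bQ))// lerDr ltW.
Qed.

Lemma move_xw x z w j (a b : R) : pt (pt (x + a *: basis_vec R j) z) (w + b) =
  pt (pt x z) w + a *: basis_vec R (kx j) + b *: basis_vec R kw.
Proof. by rewrite pt_addr !pt_addl. Qed.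

Lemma move_z x z w (a : R) : pt (pt x (z + a)) w = pt (pt x z) w + a *: basis_vec R kz.
Proof. by rewrite pt_addr pt_addl. Qed.

Lemma reach_h_xw x z w j (t tau : R) : (forall th, 0 <= th <= t -> D (x + th *: basis_vec R j)) ->
  - H <= z <= M -> - H <= w <= M -> - H <= w + tau <= M ->
  reach (pt (pt x z) w) (vw 1) (kx j) kw t tau 1 (in_box (dom_h D H)).
Proof.
move=> Dx /andP[z1 z2] /andP[w1 w2] /andP[v1 v2] th1 th2 s t1 t2 /andP[s0 s1].
have h1 : - H <= w + th2 <= M by case/orP: t2 => /andP[a1 a2]; apply/andP; split; lra.
have /andP[h2 h3] := h1.
rewrite -move_xw; split; first by apply: dom_h_ray => //; exact: Dx.
apply: ray_box => //; [exact: Dx|by apply/andP; split; lra|by rewrite normr1|by rewrite s0 ltW].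
Qed.

Lemma reach_hb_xw x z w j (t tau : R) : (forall th, 0 <= th <= t -> D (x + th *: basis_vec R j)) ->
  - H - 1 < z <= - H -> - H <= w <= M -> - H <= w + tau <= M ->
  reach (pt (pt x z) w) (vw (-1)) (kx j) kw t tau (Num.min 1 (z + H + 1)) (in_box (dom_hb D H)).
Proof.
move=> Dx /andP[z1 z2] /andP[w1 w2] /andP[v1 v2] th1 th2 s t1 t2 /andP[s0].
rewrite lt_min => /andP[s1 s2].
have h1 : - H <= w + th2 <= M by case/orP: t2 => /andP[a1 a2]; apply/andP; split; lra.
have /andP[h2 h3] := h1.
rewrite -move_xw; split; first by apply: dom_hb_ray => //; [exact: Dx|lra].
apply: ray_box => //; [exact: Dx|by apply/andP; split; lra|by rewrite normrN normr1|by rewrite s0 ltW].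
Qed.

Lemma reach_h_z x z w (t : R) : D x -> - H <= z -> z + t <= M -> - H <= w <= M ->
  reach (pt (pt x z) w) (vw 1) kz kz t 0 1 (in_box (dom_h D H)).
Proof.
move=> Dx z1 z2 /andP[w1 w2] th1 th2 s /andP[t1 t2] t3 /andP[s0 s1].
have -> : th2 = 0 by case/orP: t3 => /andP[a1 a2]; lra.
rewrite scale0r addr0 -move_z; split; first by apply: dom_h_ray => //; lra.
by apply: ray_box; rewrite ?normr1 ?s0 ?w1 ?w2 ?(ltW s1)//; apply/andP; split; lra.
Qed.

Lemma reach_hb_z x z w (t : R) : D x -> - H - 1 < z -> z + t <= - H -> - H <= w <= M ->
  reach (pt (pt x z) w) (vw (-1)) kz kz t 0 (Num.min 1 (z + H + 1)) (in_box (dom_hb D H)).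
Proof.
move=> Dx z1 z2 /andP[w1 w2] th1 th2 s /andP[t1 t2] t3 /andP[s0]; rewrite lt_min => /andP[s1 s2].
have -> : th2 = 0 by case/orP: t3 => /andP[a1 a2]; lra.
rewrite scale0r addr0 -move_z; split; first by apply: dom_hb_ray => //; lra.
by apply: ray_box; rewrite ?normrN ?normr1 ?s0 ?w1 ?w2 ?(ltW s1)//; apply/andP; split; lra.
Qed.

Lemma layer_pt_z y t : layer_pt d (y + t *: basis_vec R iz) = layer_pt d y + (t / d) *: basis_vec R kz.
Proof.
rewrite /layer_pt init_addr final_addr -move_z; congr (pt (pt _ _) _).
by field; rewrite gt_eqF.
Qed.

Lemma main_pt_z y t : main_pt (y + t *: basis_vec R iz) = main_pt y + t *: basis_vec R kz.
Proof. by rewrite /main_pt init_addr -pt_addl. Qed.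

Lemma main_ptE y : main_pt y = pt (pt (init y) (final y)) (u (init y)).
Proof. by rewrite /main_pt pt_init_final. Qed.

Lemma layered_z_lip : exists2 C, 0 < C & forall y t, 0 < t -> Omd d y ->
  Omd d (y + t *: basis_vec R iz) ->
  `|layered d hb h (y + t *: basis_vec R iz) - layered d hb h y| <= C * t.
Proof.
have [C C0 hC] := gradient_bound; exists (C + C / d) => [|y t t0 Oy Ot].
  by rewrite addr_gt0// divr_gt0.
have [Dy /andP[y1 y2]] := Oy; move: Ot => [_ /andP[]]; rewrite init_addr final_addr => y3 y4.
have uy := uH Dy; have uy' := uM Dy; have w1 : - H <= u (init y) <= M by apply/andP; split => //; move: H0; lra.
have [hCb hCh] := hC kz.
have stepb P v r s : 0 < r -> 0 <= s -> reach P v kz kz s 0 r (in_box (dom_hb D H)) ->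
    `|hb (P + s *: basis_vec R kz) - hb P| <= C * s.
  move=> r0 s0 hr; have := @increment_lip R _ _ hb Gb chb dGb P v kz kz s 0 r C r0 s0.
  rewrite scale0r addr0 normr0 addr0; apply => th1 th2 q a1 a2 a3.
  by have bQ := hr _ _ _ a1 a2 a3; have [AQ _] := bQ; split => //; exact: hCb.
have steph P v r s : 0 < r -> 0 <= s -> reach P v kz kz s 0 r (in_box (dom_h D H)) ->
    `|h (P + s *: basis_vec R kz) - h P| <= C * s.
  move=> r0 s0 hr; have := @increment_lip R _ _ h Gh ch dGh P v kz kz s 0 r C r0 s0.
  rewrite scale0r addr0 normr0 addr0; apply => th1 th2 q a1 a2 a3.
  by have bQ := hr _ _ _ a1 a2 a3; have [AQ _] := bQ; split => //; exact: hCh.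
have Cd : 0 <= C / d by rewrite divr_ge0 ?ltW.
have layer s : 0 <= s -> final y < - H -> final y + s <= - H ->
    `|hb (layer_pt d y + (s / d) *: basis_vec R kz) - hb (layer_pt d y)| <= C / d * s.
  move=> s0 yH yt; have /andP[z1 z2] := layer_z d0 (introT andP (conj y1 yH)).
  have -> : C / d * s = C * (s / d) by rewrite mulrAC mulrA.
  apply: (stepb _ (vw (-1)) (Num.min 1 (- H + (final y + H) / d + H + 1))).
  - by rewrite lt_min ltr01 /=; lra.
  - by rewrite divr_ge0// ltW.
  - apply: reach_hb_z => //; rewrite -addrA gerDl -mulrDl ler_pdivrMr// mul0r; lra.
have main z s : 0 <= s -> - H <= z -> z + s <= M ->
    `|h (pt (pt (init y) z) (u (init y)) + s *: basis_vec R kz) - h (pt (pt (init y) z) (u (init y)))| <= C * s.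
  by move=> s0 z1 z2; apply: (steph _ (vw 1) 1) => //; exact: reach_h_z.
rewrite /layered final_addr layer_pt_z main_pt_z main_ptE; case: ifPn => yt; case: ifPn => yH.
- apply: le_trans (layer _ (ltW t0) yH (ltW yt)) _.
  by rewrite ler_wpM2r ?(ltW t0)// lerDr ltW.
- by move: yt yH; rewrite -leNgt => a1 a2; lra.
- have {}yt : - H <= final y + t by rewrite leNgt.
  (* A segment crossing the interface is cut at [z = - H], where [hbh] makes the two branches
     agree. *)
  pose s := - H - final y; have s0 : 0 <= s by rewrite /s; lra.
  have E1 : layer_pt d y + (s / d) *: basis_vec R kz = pt (pt (init y) (- H)) (u (init y)).
    by rewrite /layer_pt -move_z /s; congr (pt (pt _ _) _); field; rewrite gt_eqF.
  have E2 : pt (pt (init y) (final y)) (u (init y)) + t *: basis_vec R kz =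
      pt (pt (init y) (- H)) (u (init y)) + (t - s) *: basis_vec R kz.
    by rewrite -!move_z /s; congr (pt (pt _ _) _); lra.
  have sH : final y + s <= - H by rewrite /s; lra.
  have h1 := layer s s0 yH sH; rewrite E1 hbh// in h1.
  have h2 : `|h (pt (pt (init y) (- H)) (u (init y)) + (t - s) *: basis_vec R kz) -
      h (pt (pt (init y) (- H)) (u (init y)))| <= C * (t - s).
    by apply: main; rewrite /s //; move: H0 => H0'; lra.
  rewrite E2 -[X in `|X|](subrKA (h (pt (pt (init y) (- H)) (u (init y))))).
  rewrite (le_trans (ler_normD _ _))// mulrDl lerD// ?(le_trans h1)// ?(le_trans h2)//.
    by rewrite ler_wpM2l ?(ltW C0)//; lra.
  by rewrite ler_wpM2l//; rewrite /s; lra.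
- have {}yH : - H <= final y by rewrite leNgt.
  apply: le_trans (main _ _ (ltW t0) yH _) _; first by move: H0; lra.
  by rewrite ler_wpM2r ?(ltW t0)// lerDl.
Qed.

Lemma layered_z_near y e : Omd d y -> final y != - H -> 0 < e ->
  exists2 r, 0 < r & forall t, 0 < t < r ->
    `|layered d hb h (y + t *: basis_vec R iz) - layered d hb h y -
      t * layered d (fun P => d^-1 * Gb kz P) (Gh kz) y| <= e * t.
Proof.
move=> Oy yH e0; have [Dy /andP[y1 y2]] := Oy.
have uy := uH Dy; have uy' := uM Dy; have w1 : - H <= u (init y) <= M by apply/andP; split => //; move: H0; lra.
have sub (A : set 'rV[R]_(n + 1 + 1)) P v i k t tau r : reach P v i k t tau r (in_box A) -> reach P v i k t tau r A.
  by move=> hr th1 th2 s a1 a2 a3; case: (hr th1 th2 s a1 a2 a3).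
have [{}yH|{}yH] : final y < - H \/ - H < final y by case: ltgtP yH => // [?|?] _; [left|right].
- have [cP bP] := layer_pt_closure Oy yH.
  have ed : 0 < e * d by rewrite mulr_gt0.
  have [rho rho0 hrho] := @increment_near R _ _ hb Gb chb cGb dGb _ (vw (-1)) kz kz _ cP ed.
  exists (Num.min (- H - final y) (rho * d)).
    by rewrite lt_min mulr_gt0// andbT; lra.
  move=> t /andP[t0]; rewrite lt_min => /andP[t1 t2].
  have /andP[z1 z2] := layer_z d0 (introT andP (conj y1 yH)).
  rewrite /layered final_addr layer_pt_z yH (_ : final y + t < - H); last by lra.
  have := hrho (t / d) 0 (Num.min 1 (- H + (final y + H) / d + H + 1)).
  rewrite lt_min ltr01 /= scale0r addr0 normr0 !addr0 mul0r subr0 => h1.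
  have -> : t * (d^-1 * Gb kz (layer_pt d y)) = t / d * Gb kz (layer_pt d y) by rewrite mulrA.
  have -> : e * t = e * d * (t / d) by field; rewrite gt_eqF.
  apply: h1; first by lra.
  + by rewrite divr_ge0// ltW.
  + by rewrite ltr_pdivrMr.
  + apply: sub; apply: reach_hb_z => //; rewrite -addrA gerDl -mulrDl ler_pdivrMr// mul0r; lra.
- have [cP bP] := main_pt_closure Oy (ltW yH).
  have [rho rho0 hrho] := @increment_near R _ _ h Gh ch cGh dGh _ (vw 1) kz kz _ cP e0.
  exists (Num.min rho (M - final y)).
    by rewrite lt_min rho0 /=; move: H0; lra.
  move=> t /andP[t0]; rewrite lt_min => /andP[t1 t2].
  have yt : - H <= final y + t by lra.
  rewrite /layered final_addr main_pt_z !ltNge (ltW yH) yt /=.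
  have := hrho t 0 1; rewrite scale0r addr0 normr0 !addr0 mul0r subr0; apply => //; first exact: ltW.
  by apply: sub; rewrite main_ptE; apply: reach_h_z => //; lra.
Qed.

(** A horizontal move changes [w] by the increment of [u], which is not of order [t] in general; it
    is therefore kept as a separate term. *)
Lemma layered_x_lip j : exists2 C, 0 < C & forall y t, 0 < t ->
  (forall th, 0 <= th <= t -> Omd d (y + th *: basis_vec R (lshift 1 j))) ->
  `|layered d hb h (y + t *: basis_vec R (lshift 1 j)) - layered d hb h y| <=
    C * (t + `|u (init y + t *: basis_vec R j) - u (init y)|).
Proof.
have [C C0 hC] := gradient_bound; exists C => // y t t0 Oy.
have Oy0 : Omd d y by have := Oy 0; rewrite scale0r addr0; apply; rewrite lexx ltW.
have Dth th : 0 <= th <= t -> D (init y + th *: basis_vec R j).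
  by move=> /Oy[]; rewrite init_addl.
have [Dy /andP[y1 y2]] := Oy0; have Dt : D (init y + t *: basis_vec R j) by apply: Dth; rewrite lexx ltW.
have uy := uH Dy; have uy' := uM Dy; have ut := uH Dt; have ut' := uM Dt.
have w1 : - H <= u (init y) <= M by apply/andP; split => //; move: H0; lra.
set tau := u _ - u (init y).
have w2 : - H <= u (init y) + tau <= M by rewrite /tau addrC subrK; apply/andP; split => //; move: H0; lra.
have utau : u (init y + t *: basis_vec R j) = u (init y) + tau by rewrite /tau; ring.
rewrite /layered final_addl; case: ifPn => yH.
  have /andP[z1 z2] := layer_z d0 (introT andP (conj y1 yH)).
  rewrite /layer_pt init_addl final_addl utau move_xw.
  apply: (@increment_lip R _ _ hb Gb chb dGb _ (vw (-1)) _ _ _ _ (Num.min 1 (- H + (final y + H) / d + H + 1))).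
  - by rewrite lt_min ltr01 /=; lra.
  - exact: ltW.
  - have hr := @reach_hb_xw (init y) (- H + (final y + H) / d) (u (init y)) j t tau Dth _ w1 w2.
    move=> th1 th2 s a1 a2 a3; have bQ := hr _ _ _ _ a1 a2 a3; rewrite z1 (ltW z2) in bQ.
    have {}bQ := bQ isT; split; first by case: bQ.
      by apply: (hC _).1.
    by apply: (hC _).1.
have {}yH : - H <= final y by rewrite leNgt.
rewrite !main_ptE init_addl final_addl utau move_xw.
apply: (@increment_lip R _ _ h Gh ch dGh _ (vw 1) _ _ _ _ 1) => //; first exact: ltW.
have yH' : - H <= final y <= M by rewrite yH; move: H0; lra.
move=> th1 th2 s a1 a2 a3; have bQ := reach_h_xw Dth yH' w1 w2 a1 a2 a3.
by split; [case: bQ|exact: (hC _).2|exact: (hC _).2].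
Qed.

Lemma layered_x_near j y e : Omd d y -> 0 < e -> exists2 rho, 0 < rho & forall t, 0 < t ->
  t + `|u (init y + t *: basis_vec R j) - u (init y)| < rho ->
  (forall th, 0 <= th <= t -> Omd d (y + th *: basis_vec R (lshift 1 j))) ->
  `|layered d hb h (y + t *: basis_vec R (lshift 1 j)) - layered d hb h y -
     t * layered d (Gb (kx j)) (Gh (kx j)) y -
     (u (init y + t *: basis_vec R j) - u (init y)) * layered d (Gb kw) (Gh kw) y| <=
    e * (t + `|u (init y + t *: basis_vec R j) - u (init y)|).
Proof.
move=> Oy0 e0; have [Dy /andP[y1 y2]] := Oy0.
have uy := uH Dy; have uy' := uM Dy.
have w1 : - H <= u (init y) <= M by apply/andP; split => //; move: H0; lra.
have sub (A : set 'rV[R]_(n + 1 + 1)) P v i k t tau r : reach P v i k t tau r (in_box A) -> reach P v i k t tau r A.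
  by move=> hr th1 th2 s a1 a2 a3; case: (hr th1 th2 s a1 a2 a3).
have common t : 0 < t -> (forall th, 0 <= th <= t -> Omd d (y + th *: basis_vec R (lshift 1 j))) ->
    (forall th, 0 <= th <= t -> D (init y + th *: basis_vec R j)) /\
    - H <= u (init y) + (u (init y + t *: basis_vec R j) - u (init y)) <= M.
  move=> t0 Oy; have Dth th : 0 <= th <= t -> D (init y + th *: basis_vec R j).
    by move=> /Oy[]; rewrite init_addl.
  have Dt : D (init y + t *: basis_vec R j) by apply: Dth; rewrite lexx ltW.
  split=> //; rewrite addrC subrK uH//=; have := uM Dt; move: H0; lra.
have [yH|yH] := ltP (final y) (- H).
- have [cP bP] := layer_pt_closure Oy0 yH.
  have [rho rho0 hrho] := @increment_near R _ _ hb Gb chb cGb dGb _ (vw (-1)) (kx j) kw _ cP e0.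
  exists rho => // t t0 tr Oy; have [Dth w2] := common t t0 Oy.
  have /andP[z1 z2] := layer_z d0 (introT andP (conj y1 yH)).
  rewrite /layered final_addl yH; set tau := u _ - u (init y) in tr w2 *.
  have -> : layer_pt d (y + t *: basis_vec R (lshift 1 j)) =
      layer_pt d y + t *: basis_vec R (kx j) + tau *: basis_vec R kw.
    rewrite /layer_pt init_addl final_addl -move_xw; congr pt.
    by rewrite /tau; ring.
  apply: (hrho _ _ (Num.min 1 (- H + (final y + H) / d + H + 1))) => //.
  + by rewrite lt_min ltr01 /=; lra.
  + exact: ltW.
  + by apply: sub; apply: reach_hb_xw => //; rewrite z1 ltW.
- have [cP bP] := main_pt_closure Oy0 yH.
  have [rho rho0 hrho] := @increment_near R _ _ h Gh ch cGh dGh _ (vw 1) (kx j) kw _ cP e0.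
  exists rho => // t t0 tr Oy; have [Dth w2] := common t t0 Oy.
  rewrite /layered final_addl ltNge yH /=; set tau := u _ - u (init y) in tr w2 *.
  have -> : main_pt (y + t *: basis_vec R (lshift 1 j)) =
      main_pt y + t *: basis_vec R (kx j) + tau *: basis_vec R kw.
    rewrite !main_ptE init_addl final_addl -move_xw; congr pt.
    by rewrite /tau; ring.
  apply: (hrho _ _ 1) => //; first exact: ltW.
  rewrite main_ptE; apply: sub; apply: reach_h_xw => //; rewrite yH; move: H0; lra.
Qed.

Lemma is_weak_pderiv_layered_z :
  is_weak_pderiv (Omd d) iz (layered d hb h) (layered d (fun P => d^-1 * Gb kz P) (Gh kz)).
Proof.
have oO := @open_Omega_ d; have Ooo := Omega_finite d1; have mO := open_measurable_rV oO.
have cGd : {within closure (dom_hb D H), continuous (fun P => d^-1 * Gb kz P)}.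
  apply/within_continuousP => P AP; apply: cvgM; first exact: cvg_cst.
  exact: (within_continuousP _ _).1 (@cGb kz) P AP.
apply: is_weak_pderiv_ae_quotient => //; [exact: layered_sqint|exact: layered_sqint| |].
  move=> K cK KO; have [r r0 rO] := compact_open_ball cK oO KO.
  have [C C0 hC] := layered_z_lip; exists C, r; split => // y t Ky /andP[t0 tr].
  apply: hC => //; first exact: KO.
  by apply: (rO _ Ky); apply: ball_basis_vec; rewrite gtr0_norm.
exists [set y | final y = - H]; split.
- rewrite (_ : [set y | _] = @final R n @^-1` [set - H])//.
  by rewrite -[X in measurable X]setTI; apply: measurable_final.
- exact: leb_final_null.
- move=> y hy /=; apply: contrapT => yH; apply: hy => Oy e e0.
  by apply: layered_z_near => //; exact/eqP.
Qed.

End derivatives.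

End fixed_delta.

(** * Horizontal weak derivatives through the chain rule *)

Section chain_rule.
Variable d : R.
Hypotheses (d0 : 0 < d) (d1 : d <= 1).
Variables (hb h : 'rV[R]_(n + 1 + 1) -> R) (Gb Gh : 'I_(n + 1 + 1) -> 'rV[R]_(n + 1 + 1) -> R).
Hypotheses (chb : {within closure (dom_hb D H), continuous hb})
  (ch : {within closure (dom_h D H), continuous h})
  (cGb : forall i, {within closure (dom_hb D H), continuous (Gb i)})
  (cGh : forall i, {within closure (dom_h D H), continuous (Gh i)})
  (dGb : forall i x, dom_hb D H x -> is_derive x (basis_vec R i) hb (Gb i x))
  (dGh : forall i x, dom_h D H x -> is_derive x (basis_vec R i) h (Gh i x)).
Variable p : 'I_n -> 'rV[R]_n -> R.
Hypothesis up : H10_data D u p.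
Local Notation lay := (layered d).
Local Notation kw := (rshift (n + 1) (@ord0 0)).
Local Notation kx j := (lshift 1 (lshift 1 j)).

Definition layered_dx j y := lay (Gb (kx j)) (Gh (kx j)) y + lay (Gb kw) (Gh kw) y * p j (init y).

Let oO : open (Omd d). Proof. exact: open_Omega_. Qed.
Let mO : measurable (Omd d). Proof. exact: open_measurable_rV. Qed.
Let Ooo : (mu (Omd d) < +oo)%E. Proof. exact: Omega_finite. Qed.
Let mD : measurable D. Proof. exact: open_measurable_rV. Qed.
Let Doo : (leb n D < +oo)%E. Proof. by apply: (@leb_bounded_lty _ _ _ L) => // x i; exact: DL. Qed.

Lemma sqint_init_sub (A : set 'rV[R]_(n + 1)) (g : 'rV[R]_n -> R) : measurable A ->
  A `<=` Omd d -> sqint (leb n) D g ->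
  sqint mu A (g \o @init R n) /\ rsq mu A (g \o @init R n) <= (2 * (L + 1)) * rsq (leb n) D g.
Proof.
move=> mA AO gD; pose Z := [set y : 'rV[R]_(n + 1) | D (init y) /\ - (L + 1) < final y < L + 1].
have LL : - (L + 1) <= L + 1 by move: HL H0; lra.
have [gZ rZ] := sqint_cylinder mD LL gD.
have mZ : measurable Z.
  have -> : Z = @init R n @^-1` D `&` @final R n @^-1` `]- (L + 1), L + 1[.
    by apply/seteqP; split => y /=; rewrite in_itv /= => -[].
  apply: measurableI; rewrite -[X in measurable X]setTI; first exact: measurable_init.
  by apply: measurable_final => //; exact: measurable_itv.
have AZ : A `<=` Z.
  move=> y /AO [Dy /andP[y1 y2]]; split => //.
  by have := uM Dy; move: HL ML H0 d1 => *; apply/andP; split; lra.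
split; first exact: sqint_subset AZ gZ.
apply: le_trans (rsq_subset mA mZ AZ gZ) _; rewrite rZ.
by rewrite (_ : L + 1 - - (L + 1) = 2 * (L + 1)); last by ring.
Qed.

Lemma layered_dx_sqint j : sqint mu (Omd d) (layered_dx j).
Proof.
have pD := in_H1P up.1 mD j; have [pO _] := sqint_init_sub mO (@subset_refl _ _) pD.
have [C C0 hC] := layered_bounded d0 d1 (@cGb kw) (@cGh kw).
have mW := layered_measurable d0 d1 (@cGb kw) (@cGh kw).
apply: sqintD => //; first exact: layered_sqint.
by have [] := sqint_mul_bounded mO mW hC pO.
Qed.

(** The first-order error divided by [t + |tau|], with [tau] the increment of [u], is bounded and
    tends to 0 pointwise. In the difference quotient it is multiplied by [1 + |tau / t|], known to
    converge only in L^2. Replacing [tau / t] by the weak derivative of [u] gives [S k], treated by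
    dominated convergence; the correction [V] is bounded by the L^2 error of [tau / t]. *)
Lemma is_weak_pderiv_layered_x j :
  is_weak_pderiv (Omd d) (lshift 1 j) (lay hb h) (layered_dx j).
Proof.
have pD := in_H1P up.1 mD j.
have fO : sqint mu (Omd d) (lay hb h) by exact: layered_sqint.
apply: is_weak_pderiv_quotient => //; first exact: layered_dx_sqint.
move=> K cK KO eps r eps0 r0; have mK := compact_measurable_rV cK.
have [r1 r10 rO] := compact_open_ball cK oO KO.
have [C C0 hC] := layered_x_lip d0 chb ch cGb cGh dGb dGh j.
have [CJ CJ0 hJ] := layered_bounded d0 d1 (@cGb (kx j)) (@cGh (kx j)).
have [CW CW0 hW] := layered_bounded d0 d1 (@cGb kw) (@cGh kw).
pose J := lay (Gb (kx j)) (Gh (kx j)); pose W := lay (Gb kw) (Gh kw).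
pose B := C + CJ + CW; have B0 : 0 < B by rewrite !addr_gt0.
pose Z := 2 * (L + 1); have Z0 : 0 < Z by rewrite mulr_gt0//; move: HL H0; lra.
(* Chosen so that [rsq mu K V] is at most [4 * B ^+ 2 * (Z * e1) = eps / 4]; [S k] gets the same
   share, and each is counted twice. *)
pose e1 := eps / (16 * B ^+ 2 * Z); have BZ : 0 < 16 * B ^+ 2 * Z by rewrite mulr_gt0// mulr_gt0// exprn_gt0.
have [r2 r20 hq] := H10_quotient j oD Doo up (divr_gt0 eps0 BZ).
pose s := Num.min r (Num.min r1 r2); have s0 : 0 < s by rewrite !lt_min r0 r10.
pose t k : R := s / k.+2%:R.
have tI k : 0 < t k < s by rewrite divr_gt0//= ltr_pdivrMr// ltr_pMr// ltr1n.
have tc : t k @[k --> \oo] --> 0 by exact: cvg_div_nat2.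
have path k y : K y -> forall th, 0 <= th <= t k -> Omd d (y + th *: basis_vec R (lshift 1 j)).
  move=> Ky th /andP[th0 tht]; apply: (rO _ Ky); apply: ball_basis_vec; rewrite ger0_norm//.
  have /andP[_ ts] := tI k; rewrite (le_lt_trans tht)// (lt_le_trans ts)//.
  by rewrite /s !ge_min lexx !orbT.
pose tau k (y : 'rV[R]_(n + 1)) := (u \_ D) (init y + t k *: basis_vec R j) - (u \_ D) (init y).
have tauE k y : K y -> tau k y = u (init y + t k *: basis_vec R j) - u (init y).
  move=> Ky; have /andP[t0 _] := tI k; rewrite /tau !restrict_in//.
    by have := path k y Ky 0; rewrite lexx ltW// scale0r addr0 => /(_ isT)[].
  by have := path k y Ky (t k); rewrite lexx ltW// => /(_ isT)[]; rewrite init_addl.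
pose den k y := t k + `|tau k y|.
have den0 k y : 0 < den k y by have /andP[t0 _] := tI k; rewrite ltr_pwDl.
pose Nu k y := lay hb h (y + t k *: basis_vec R (lshift 1 j)) - lay hb h y - t k * J y - tau k y * W y.
pose E k y := Nu k y * (den k y)^-1.
have EB k y : K y -> `|E k y| <= B.
  move=> Ky; have /andP[t0 _] := tI k.
  rewrite /E normrM normfV [`|den k y|]gtr0_norm// ler_pdivrMr//.
  have h1 := hC y (t k) t0 (path k y Ky); rewrite -tauE// -/(den k y) in h1.
  have h2 : `|t k * J y| <= CJ * den k y.
    rewrite normrM (gtr0_norm t0) mulrC; apply: ler_pM => //; first exact: ltW.
      exact: hJ (KO _ Ky).
    by rewrite /den lerDl.
  have h3 : `|tau k y * W y| <= CW * den k y.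
    rewrite normrM mulrC; apply: ler_pM => //; first exact: hW (KO _ Ky).
    by rewrite /den lerDr ltW.
  have -> : B * den k y = C * den k y + CJ * den k y + CW * den k y by rewrite /B; ring.
  rewrite /Nu; apply: le_trans (ler_normB _ _) _; rewrite lerD//.
  by apply: le_trans (ler_normB _ _) _; rewrite lerD.
have mF : measurable_fun setT ((u \_ D) : 'rV[R]_n -> R).
  by apply/(measurable_restrictT _ mD); case: up.1.1.
have mtau k : measurable_fun setT (tau k).
  apply: measurable_funB; last exact: measurableT_comp mF (@measurable_init R n).
  apply: (measurableT_comp mF).
  exact: measurableT_comp (measurable_translate _) (@measurable_init R n).
have mden k : measurable_fun setT (den k).
  by apply: measurable_funD => //; exact: measurableT_comp (mtau k).
have mlay : measurable_fun setT ((lay hb h) \_ (Omd d)) by apply/(measurable_restrictT _ mO); case: fO.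
have mlt k : measurable_fun K (fun y => lay hb h (y + t k *: basis_vec R (lshift 1 j))).
  have : measurable_fun K (fun y => ((lay hb h) \_ (Omd d)) (y + t k *: basis_vec R (lshift 1 j))).
    by apply: measurable_funTS; exact: measurableT_comp mlay (measurable_translate _).
  apply: eq_measurable_fun => y /set_mem Ky; rewrite restrict_in//.
  by apply: (path k y Ky); have /andP[t0 _] := tI k; rewrite lexx ltW.
have mJ : measurable_fun K J by apply: measurable_funS mO KO _; exact: (layered_measurable d0 d1).
have mW : measurable_fun K W by apply: measurable_funS mO KO _; exact: (layered_measurable d0 d1).
have mly : measurable_fun K (lay hb h) by apply: measurable_funS mO KO _; case: fO.
have mE k : measurable_fun K (E k).
  apply: measurable_funM.
    apply: measurable_funB; last by apply: measurable_funM => //; exact: measurable_funTS.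
    apply: measurable_funB; last exact: measurable_funM.
    exact: measurable_funB.
  by apply: measurable_inv_pos => [|y _]; [exact: measurable_funTS|exact: den0].
have [pK _] := sqint_init_sub mK KO pD.
pose g y := B * (1 + `|p j (init y)|).
have Koo : (mu K < +oo)%E by apply: le_lt_trans Ooo; apply: le_measure; rewrite ?inE.
have pK1 : sqint mu K (fun y => 1 + `|p j (init y)|).
  apply: sqintD => //; first exact: sqint_cst.
  apply: (sqint_dom mK _ pK); last by move=> y _ /=; rewrite real_normK ?num_real.
  by have [mp _] := pK; exact: measurableT_comp mp.
have gK : sqint mu K g by exact: sqintZ.
pose S k y := E k y * (1 + `|p j (init y)|).
have mS k : measurable_fun K (S k) by apply: measurable_funM => //; case: pK1.
have SK k : sqint mu K (S k) by have [] := sqint_mul_bounded mK (mE k) (EB k) pK1.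
have c0 : rsq mu K (S k) @[k --> \oo] --> 0.
  apply: (rsq_dct mK mS gK).
    move=> k y Ky; rewrite /S /g normrM [leRHS]normrM (gtr0_norm B0) ler_wpM2r//; exact: EB.
  apply: aeW => y Ky.
  rewrite -[X in _ --> X](mul0r (1 + `|p j (init y)|)); apply: cvgM; last exact: cvg_cst.
  apply/cvgrPdist_le => e e0.
  have [rho rho0 hrho] := layered_x_near d0 d1 chb ch cGb cGh dGb dGh j (KO _ Ky) e0.
  have Dy : D (init y) by case: (KO _ Ky).
  have uc := continuous_at_u Dy.
  have rho2 : 0 < rho / 2 by rewrite divr_gt0.
  have /nbhs_ballP[q /= q0 hqu] := uc _ (nbhsx_ballx (u (init y)) _ rho2).
  move/cvgrPdist_lt : tc => /(_ (Num.min q (rho / 2))); rewrite lt_min q0 rho2 => /(_ isT)[k0 _ hk0].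
  exists k0 => // k /= /hk0 /=; have /andP[t0 _] := tI k; rewrite !sub0r !normrN gtr0_norm// lt_min => /andP[tq trho].
  have ub : `|tau k y| < rho / 2.
    by rewrite tauE// distrC; apply: hqu; apply: ball_basis_vec; rewrite gtr0_norm.
  have := hrho (t k) t0 _ (path k y Ky); rewrite -tauE//.
  rewrite -/(den k y) -/(J y) -/(W y) -/(Nu k y) => h1.
  rewrite /E normrM normfV [`|den k y|]gtr0_norm// ler_pdivrMr//; apply: h1.
  rewrite /den [ltRHS]splitr; exact: ltrD.
have eps4 : 0 < eps / 4 by rewrite divr_gt0.
move/cvgrPdist_le : c0 => /(_ _ eps4)[k _ /(_ k (leqnn _))] /=.
rewrite sub0r normrN ger0_norm ?rsq_ge0// => rS.
exists (t k).
  by have /andP[t0 ts] := tI k; rewrite t0 (lt_le_trans ts)// /s ge_min lexx.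
have /andP[t0 ts] := tI k.
have [TD rT] : sqint (leb n) D (fun x => ((u \_ D) (x + t k *: basis_vec R j) - (u \_ D) x) / t k - p j x) /\
    rsq (leb n) D (fun x => ((u \_ D) (x + t k *: basis_vec R j) - (u \_ D) x) / t k - p j x) <= e1.
  by apply: hq; rewrite t0 (lt_le_trans ts)// /s !ge_min lexx !orbT.
have [TK rTK] := sqint_init_sub mK KO TD.
set T := fun x => _ / _ - _ in TD rT TK rTK.
pose V y := E k y * (`|tau k y / t k| - `|p j (init y)|) + W y * T (init y).
have id y : K y -> (lay hb h (y + t k *: basis_vec R (lshift 1 j)) - lay hb h y) / t k - layered_dx j y = S k y + V y.
  move=> Ky; rewrite /layered_dx -/(J y) -/(W y) /S /V.
  have -> : T (init y) = tau k y / t k - p j (init y) by [].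
  have hN : Nu k y = E k y * den k y by rewrite /E divfK// gt_eqF.
  have -> : E k y * (1 + `|p j (init y)|) + (E k y * (`|tau k y / t k| - `|p j (init y)|) +
      W y * (tau k y / t k - p j (init y))) =
      E k y * (1 + `|tau k y / t k|) + W y * (tau k y / t k - p j (init y)) by ring.
  have -> : 1 + `|tau k y / t k| = den k y / t k.
    by rewrite normrM normfV (gtr0_norm t0) /den; field; rewrite gt_eqF.
  by rewrite mulrA -hN /Nu; field; rewrite gt_eqF.
have mV : measurable_fun K V.
  apply: measurable_funD; last by apply: measurable_funM => //; case: TK.
  apply: measurable_funM => //; apply: measurable_funB.
    apply: measurable_funTS; apply: measurableT_comp => //.
    by apply: measurable_funM => //; exact: mtau.
  by have [mp _] := pK; exact: measurableT_comp mp.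
have Vle y : K y -> V y ^+ 2 <= (2 * B * T (init y)) ^+ 2.
  move=> Ky.
  have h1 : `|V y| <= 2 * B * `|T (init y)|.
    rewrite /V; apply: le_trans (ler_normD _ _) _; rewrite normrM [X in _ + X]normrM.
    have -> : 2 * B * `|T (init y)| = B * `|T (init y)| + B * `|T (init y)| by ring.
    apply: lerD.
      apply: ler_pM => //; first exact: EB.
      exact: ler_dist_dist.
    rewrite ler_wpM2r//; apply: le_trans (hW _ (KO _ Ky)) _.
    by rewrite /B lerDr addr_ge0 ?ltW.
  rewrite -[leLHS]real_normK ?num_real// -[leRHS]real_normK ?num_real//.
  rewrite ler_pXn2r ?nnegrE// normrM (gtr0_norm (mulr_gt0 (ltr0Sn _ 1) B0)).
  exact: h1.
have BTK := sqintZ mK (2 * B) TK.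
have VK : sqint mu K V by exact: (sqint_dom mK mV BTK Vle).
have rV : rsq mu K V <= 4 * B ^+ 2 * (Z * e1).
  apply: le_trans (le_rsq mK mV BTK Vle) _; rewrite (rsqZ mK _ TK) exprMn -natrX.
  apply: ler_wpM2l; first by apply: mulr_ge0 => //; exact: sqr_ge0.
  by apply: le_trans rTK _; apply: ler_wpM2l => //; exact: ltW.
have hE : 4 * B ^+ 2 * (Z * e1) = eps / 4.
  by rewrite /e1; field; rewrite !gt_eqF.
split; first by apply: eq_sqint (sqintD mK (SK k) VK) => y Ky; rewrite id.
rewrite (eq_rsq mu id); apply: le_trans (rsqD2 mK (SK k) VK) _.
by move: rS rV; rewrite hE; lra.
Qed.

End chain_rule.

(** * Functions of class C^1_B and their values on the bottom *)

Definition bottom_value (f : 'rV[R]_(n + 1) -> R) (x : 'rV[R]_n) : R := f (pt x (- H)).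

Lemma Omega_open : open O. Proof. exact: open_Omega. Qed.
Lemma Omega_measurable : measurable O. Proof. exact: open_measurable_rV Omega_open. Qed.
Lemma base_measurable : measurable D. Proof. exact: open_measurable_rV. Qed.

Lemma Omega_in_box y i : O y -> `|y 0 i| <= L.
Proof. by move=> Oy; exact: (@Omega_box 1 y i (lexx 1) (Omega_sub ler01 Oy)). Qed.

Lemma Omega_lty : (mu O < +oo)%E.
Proof. by apply: (@leb_bounded_lty _ _ _ L) => [|x i]; [exact: Omega_measurable|exact: Omega_in_box]. Qed.

Lemma base_lty : (nu D < +oo)%E.
Proof. by apply: (@leb_bounded_lty _ _ _ L) => [|x i]; [exact: base_measurable|exact: DL]. Qed.

Lemma closure_in_box y i : closure O y -> `|y 0 i| <= L.
Proof.
pose B := [set y : 'rV[R]_(n + 1) | forall i, `|y 0 i| <= L].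
have cB : closed B by exact: closed_compact_rV (@compact_box _ _ L).
have OB : O `<=` B by move=> z Oz j; exact: Omega_in_box.
by move=> /(closure_subset OB)/cB; exact.
Qed.

Lemma C1_B_grad phi : C1_B D H u phi -> {within closure O, continuous phi} /\
  exists G : 'I_(n + 1) -> 'rV[R]_(n + 1) -> R, forall i, {within closure O, continuous (G i)} /\
    forall x, O x -> is_derive x (basis_vec R i) phi (G i x).
Proof. by move=> [C1 _ _]; exact: Ck1_closureP. Qed.

Lemma C1_B_bounded phi : C1_B D H u phi ->
  exists2 C, 0 < C & (forall y, closure O y -> `|phi y| <= C) /\
    forall i y, O y -> `|'D_(basis_vec R i) phi y| <= C.
Proof.
move=> /C1_B_grad[cphi [G hG]].
have [C0 C00 h0] := within_closure_bounded L cphi.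
have /choice[B hB] : forall i, exists C, 0 < C /\ forall y, closure O y -> `|G i y| <= C.
  move=> i; have [C Cp hC] := within_closure_bounded L (hG i).1.
  by exists C; split => // y cy; apply: hC => // j; exact: closure_in_box.
exists (C0 + \sum_i B i).
  by rewrite ltr_pwDl// sumr_ge0// => i _; rewrite ltW//; case: (hB i).
have S0 : 0 <= \sum_i B i by rewrite sumr_ge0// => i _; rewrite ltW//; case: (hB i).
split => [y cy|i y Oy].
  by rewrite (le_trans (h0 y cy _))// => [j|]; [exact: closure_in_box|rewrite lerDl].
have [_ ->] := (hG i).2 _ Oy; have [_ h1] := hB i.
rewrite (le_trans (h1 _ (subset_closure Oy)))// (bigD1 i)//= addrCA lerDl addr_ge0 ?(ltW C00)//.
by rewrite sumr_ge0// => k _; rewrite ltW//; case: (hB k).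
Qed.

Lemma C1_B_in_H1 phi : C1_B D H u phi -> in_H1 O phi (grad phi).
Proof.
move=> Cp; have mO := Omega_measurable; have Ooo := Omega_lty.
have [C C0 [h1 h2]] := C1_B_bounded Cp; have [cphi [G hG]] := C1_B_grad Cp.
have mphi : measurable_fun O phi.
  by apply: within_continuous_measurable => //; apply: continuous_subspaceW cphi; exact: subset_closure.
have mG i : measurable_fun O ('D_(basis_vec R i) phi).
  apply: (@eq_measurable_fun _ _ _ _ _ (G i)).
    by move=> x /set_mem Ox; have [_ ->] := (hG i).2 _ Ox.
  apply: within_continuous_measurable => //; apply: continuous_subspaceW (hG i).1.
  exact: subset_closure.
have phiO : sqint mu O phi.
  by apply: (@sqint_bounded _ _ _ _ _ mO _ C) => // y Oy; apply: h1; exact: subset_closure.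
have GO i : sqint mu O ('D_(basis_vec R i) phi).
  by apply: (@sqint_bounded _ _ _ _ _ mO _ C) => // y Oy; exact: h2.
split => // i; apply: (@is_weak_pderiv_derivable _ _ _ _ _ _ C) => //.
- exact: Omega_open.
- by move=> x Ox; apply: DeriveDef => //; case: ((hG i).2 _ Ox).
- by move=> x; exact: h2.
Qed.

Lemma C1_B_test A phi : test_function A phi ->
  (forall y, A y -> D (init y) /\ final y < u (init y)) -> C1_B D H u phi.
Proof.
move=> tp hA; have [Cp _] := tp; split.
- split; first by apply: continuous_subspaceT; exact: test_function_continuous tp.
  move=> i; split=> [x _|]; first exact: (Ck_derivable (Cp 1%N)).
  exists ('D_(basis_vec R i) phi); split => //; split => //.
  by apply: continuous_subspaceT; exact: test_function_continuous (test_function_derive i tp).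
- move=> x Dx; apply: (test_function_out tp) => /hA[_].
  by rewrite final_pt init_pt ltxx.
- move=> x z [_ nD] _; apply: (test_function_out tp) => /hA[]; rewrite init_pt => Dx _.
  by apply: nD; rewrite (interior_id _).1.
Qed.

Lemma C1_BB phi psi : C1_B D H u phi -> C1_B D H u psi -> C1_B D H u (phi \- psi).
Proof.
move=> [[cp dp] pu pb] [[cq dq] qu qb]; split.
- split.
    by apply/within_continuousP => x cx; apply: cvgB;
      [exact: (within_continuousP _ _).1 cp x cx|exact: (within_continuousP _ _).1 cq x cx].
  move=> i; have [d1 [g1 [e1 [c1 _]]]] := dp i; have [d2 [g2 [e2 [c2 _]]]] := dq i.
  split=> [x Ox|]; first exact: derivableB (d1 _ Ox) (d2 _ Ox).
  exists (g1 \- g2); split=> [x Ox|]; first by rewrite /= e1// e2// deriveB//; [exact: d1|exact: d2].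
  split => //; apply/within_continuousP => x cx; apply: cvgB;
    [exact: (within_continuousP _ _).1 c1 x cx|exact: (within_continuousP _ _).1 c2 x cx].
- by move=> x Dx; rewrite /= pu// qu// subrr.
- by move=> x z bx hz; rewrite /= pb// qb// subrr.
Qed.

Lemma C1_B_gradB phi psi i y : C1_B D H u phi -> C1_B D H u psi -> O y ->
  'D_(basis_vec R i) (phi \- psi) y = 'D_(basis_vec R i) phi y - 'D_(basis_vec R i) psi y.
Proof.
move=> /C1_B_grad[_ [G hG]] /C1_B_grad[_ [G' hG']] Oy.
by apply: deriveB; [case: ((hG i).2 _ Oy)|case: ((hG' i).2 _ Oy)].
Qed.

Lemma C1_BZ phi c : C1_B D H u phi -> C1_B D H u (c \*: phi) /\
  forall i y, O y -> 'D_(basis_vec R i) (c \*: phi) y = c * 'D_(basis_vec R i) phi y.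
Proof.
move=> [[cp dp] pu pb]; split; last first.
  by move=> i y Oy; rewrite deriveZ//; have [d1 _] := dp i; exact: d1.
split.
- split; first by apply/within_continuousP => x cx; apply: cvgZr; exact: (within_continuousP _ _).1 cp x cx.
  move=> i; have [d1 [g1 [e1 [c1 _]]]] := dp i.
  split=> [x Ox|]; first exact: derivableZ (d1 _ Ox).
  exists (c \*: g1); split=> [x Ox|]; first by rewrite /= e1// deriveZ//; exact: d1.
  by split => //; apply/within_continuousP => x cx; apply: cvgZr; exact: (within_continuousP _ _).1 c1 x cx.
- by move=> x Dx; rewrite /= pu// scaler0.
- by move=> x z bx hz; rewrite /= pb// scaler0.
Qed.

Lemma C1_B_mean phi psi : C1_B D H u phi -> C1_B D H u psi ->
  C1_B D H u (fun y => (phi y + psi y) / 2) /\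
  forall i y, O y -> 'D_(basis_vec R i) (fun y => (phi y + psi y) / 2) y =
    ('D_(basis_vec R i) phi y + 'D_(basis_vec R i) psi y) / 2.
Proof.
move=> Cp Cq; have [C1 D1] := C1_BZ 2^-1 Cp; have [C2 D2] := C1_BZ (- 2^-1) Cq.
have -> : (fun y => (phi y + psi y) / 2) = (2^-1 \*: phi) \- (- 2^-1 \*: psi).
  by apply/funext => y; rewrite /= /GRing.scale /=; ring.
split; first exact: C1_BB.
by move=> i y Oy; rewrite C1_B_gradB// D1// D2//; ring.
Qed.

(** Moving towards the midpoint of the vertical segment enters [O]. Over the contact set this fails,
    which is why bottom values there come from the convention in [C1_B]. *)
Lemma closure_segment x z : D x -> - H < u x -> - H <= z <= u x -> closure O (pt x z).
Proof.
move=> Dx Hu /andP[z1 z2].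
have hr : forall s, 0 < s < Num.min 1 (u x + H) ->
    O (pt x z + s *: pt 0 ((- H + u x) / 2 - z)).
  move=> s; rewrite lt_min => /andP[s0 /andP[s1 s2]].
  rewrite pt_addZ scaler0 addr0; split; rewrite init_pt// final_pt.
  have -> : z + s * ((- H + u x) / 2 - z) = (1 - s) * z + s * ((- H + u x) / 2) by ring.
  have a1 : (1 - s) * (- H) <= (1 - s) * z by rewrite ler_wpM2l//; lra.
  have a2 : (1 - s) * z <= (1 - s) * u x by rewrite ler_wpM2l//; lra.
  have b1 : s * (- H) < s * ((- H + u x) / 2) by rewrite ltr_pM2l//; lra.
  have b2 : s * ((- H + u x) / 2) < s * u x by rewrite ltr_pM2l//; lra.
  by apply/andP; split; lra.
apply: closure_ray hr; rewrite lt_min ltr01 /=; lra.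
Qed.

Lemma bottom_contact phi x : C1_B D H u phi -> D x -> u x = - H -> bottom_value phi x = 0.
Proof. by move=> [_ h _] Dx ux; rewrite /bottom_value -ux h. Qed.

Lemma base_u_ge x : D x -> u x = - H \/ - H < u x.
Proof. by move=> /uH; rewrite le_eqVlt => /orP[/eqP->|]; [left|right]. Qed.

Lemma bottom_bounded phi : C1_B D H u phi -> exists2 C, 0 < C & forall x, D x -> `|bottom_value phi x| <= C.
Proof.
move=> Cp; have [C C0 [h _]] := C1_B_bounded Cp; exists C => // x Dx.
have [ux|ux] := base_u_ge Dx; first by rewrite (bottom_contact Cp Dx ux) normr0 ltW.
by apply: h; apply: closure_segment => //; rewrite lexx ltW.
Qed.

Lemma continuous_pt_slice (z : R) : continuous (fun x : 'rV[R]_n => pt x z).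
Proof. by move=> x; apply: continuous_pt; [exact: cvg_id|exact: cst_continuous]. Qed.

Lemma continuous_pt_line (x : 'rV[R]_n) : continuous (fun z : R => pt x z).
Proof. by move=> z; apply: continuous_pt; [exact: cst_continuous|exact: cvg_id]. Qed.

Lemma bottom_measurable phi : C1_B D H u phi -> measurable_fun D (bottom_value phi).
Proof.
move=> Cp; have mD := base_measurable; have [cphi _] := C1_B_grad Cp.
have mu1 : measurable_fun D u.
  by apply: within_continuous_measurable => //; apply: continuous_subspaceW cu; exact: subset_closure.
pose U := D `&` u @^-1` `]- H, +oo[.
have mU : measurable U by apply: mu1 => //; exact: measurable_itv.
have mU' : measurable (D `\` U) by exact: measurableD.
have -> : D = U `|` (D `\` U).
  by rewrite setDUK//; exact: subIsetl.
apply/measurable_funU => //; split; last first.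
  apply: (@eq_measurable_fun _ _ _ _ _ (cst (0 : R))); last exact: measurable_cst.
  move=> x /set_mem [Dx nU]; rewrite (bottom_contact Cp Dx)//.
  have [//|ux] := base_u_ge Dx; exfalso; apply: nU; split => //=.
  by rewrite in_itv /= andbT.
apply: within_continuous_measurable => //; apply/within_continuousP => x [Dx /=].
rewrite in_itv /= andbT => ux V /nbhs_ballP[e /= e0 eV].
have cl z : U z -> closure O (pt z (- H)).
  move=> [Dz /=]; rewrite in_itv /= andbT => uz.
  by apply: closure_segment => //; rewrite lexx ltW.
have Ux : U x by split => //=; rewrite in_itv /= andbT.
have [r r0 hr] := within_closure_near cphi (cl _ Ux) e0.
apply/nbhs_ballP; exists r => // z xz Uz; apply: eV.
rewrite /ball /= distrC; apply: hr; first exact: cl.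
by apply: ball_pt => //; rewrite subrr normr0.
Qed.

Lemma bottom_sqint phi : C1_B D H u phi -> sqint nu D (bottom_value phi).
Proof.
move=> Cp; have [C C0 hC] := bottom_bounded Cp.
apply: (@sqint_bounded _ _ _ _ _ base_measurable _ C) => //; first exact: base_lty.
exact: bottom_measurable.
Qed.

Lemma Omega_slice f x : D x ->
  (\int[@lebesgue_measure R]_(z in `](- H)%R, (u x)[) (f (pt x z) ^+ 2)%:E =
   \int[@lebesgue_measure R]_z (((f \_ O) (pt x z)) ^+ 2)%:E)%E.
Proof.
move=> Dx; rewrite integral_mkcond; apply: eq_integral => z _; rewrite patchE.
have [Oz|Oz] := pselect (O (pt x z)).
  rewrite (restrict_in f Oz) mem_set//= in_itv /=.
  by case: Oz => _; rewrite init_pt final_pt.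
rewrite (restrict_out f Oz) expr0n memNset//= in_itv /= => hz.
by apply: Oz; split; rewrite ?init_pt ?final_pt.
Qed.

Lemma Omega_slice_measurable f : sqint mu O f ->
  measurable_fun D (fun x => \int[@lebesgue_measure R]_(z in `](- H)%R, (u x)[) (f (pt x z) ^+ 2)%:E)%E.
Proof.
move=> [mf _]; have mO := Omega_measurable.
have mfr : measurable_fun setT (f \_ O) by exact/(measurable_restrictT _ mO).
apply: (@eq_measurable_fun _ _ _ _ _ (fun x => \int[@lebesgue_measure R]_z (((f \_ O) (pt x z)) ^+ 2)%:E)%E).
  by move=> x /set_mem Dx; rewrite Omega_slice.
apply: measurable_funTS.
apply: (@measurable_fun_fubini_tonelli_F _ _ _ _ R (@lebesgue_measure R)
  (fun p : 'rV[R]_n * R => (((f \_ O) (pt p.1 p.2)) ^+ 2)%:E)).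
  by apply: measurable_sqr; exact: measurableT_comp mfr (@measurable_pt R n).
by move=> p; rewrite lee_fin sqr_ge0.
Qed.

Lemma rsq_Omega_fubini f : sqint mu O f ->
  ((rsq mu O f)%:E = \int[nu]_(x in D) \int[@lebesgue_measure R]_(z in `](- H)%R, (u x)[) (f (pt x z) ^+ 2)%:E)%E.
Proof.
move=> fO; have mO := Omega_measurable; have [mf _] := fO.
rewrite -rsqE// integral_mkcond.
have mfr : measurable_fun setT (f \_ O) by exact/(measurable_restrictT _ mO).
have E y : ((fun y => (f y ^+ 2)%:E) \_ O) y = (((f \_ O) y) ^+ 2)%:E.
  by rewrite !patchE; case: ifP => // _; rewrite expr0n.
rewrite (eq_integral (fun y => (((f \_ O) y) ^+ 2)%:E)); last by move=> y _; exact: E.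
rewrite integral_leb_pt; last 2 first.
- exact: measurable_sqr.
- by move=> y; rewrite lee_fin sqr_ge0.
rewrite [RHS]integral_mkcond; apply: eq_integral => x _; rewrite patchE.
case: ifPn => [/set_mem Dx|/negP nD]; first by rewrite Omega_slice.
apply: integral0_eq => z _; rewrite restrict_out ?expr0n// => -[]; rewrite init_pt => Dx _.
by apply: nD; exact: mem_set.
Qed.

(* On each vertical segment the value at the bottom is controlled because [phi]
   vanishes at the top. *)
Lemma trace_inequality phi : C1_B D H u phi ->
  rsq nu D (bottom_value phi) <= rsq mu O phi + rsq mu O ('D_(basis_vec R iz) phi).
Proof.
move=> Cp; have [cphi [G hG]] := C1_B_grad Cp; have [_ topz _] := Cp.
have [phiO w] := C1_B_in_H1 Cp; have mO := Omega_measurable.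
have dO : sqint mu O ('D_(basis_vec R iz) phi) by apply/L2P => //; case: (w iz).
have bD := bottom_sqint Cp; have mD := base_measurable.
rewrite -lee_fin EFinD (rsq_Omega_fubini phiO) (rsq_Omega_fubini dO) -rsqE//.
have i1 := Omega_slice_measurable phiO; have i2 := Omega_slice_measurable dO.
have p0 f x : D x -> (0 <= \int[@lebesgue_measure R]_(z in `](- H)%R, (u x)[) (f (pt x z) ^+ 2)%:E)%E.
  by move=> _; apply: integral_ge0 => z _; rewrite lee_fin sqr_ge0.
pose I (f : 'rV[R]_(n + 1) -> R) x := (\int[@lebesgue_measure R]_(z in `](- H)%R, (u x)[) (f (pt x z) ^+ 2)%:E)%E.
apply: (@le_trans _ _ (\int[nu]_(x in D) (I phi x + I ('D_(basis_vec R iz) phi) x))%E); last first.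
  by rewrite ge0_integralD//; exact: p0.
apply: ge0_le_integral => //.
- by move=> x _; rewrite lee_fin sqr_ge0.
- by apply: measurable_sqr; case: bD.
- by apply: emeasurable_funD.
move=> x Dx; have [ux|ux] := base_u_ge Dx.
  rewrite (bottom_contact Cp Dx ux) expr0n adde_ge0//; exact: p0.
pose F z := phi (pt x z); pose f z := G iz (pt x z).
have line (g : 'rV[R]_(n + 1) -> R) : {within closure O, continuous g} ->
    {within `[(- H), (u x)], continuous (fun z => g (pt x z))}.
  move=> cg; apply/subspace_continuousP => z /=; rewrite in_itv /= => hz V /nbhs_ballP[e /= e0 eV].
  have [r r0 hr] := within_closure_near cg (closure_segment Dx ux hz) e0.
  apply/nbhs_ballP; exists r => // z' zz' /=; rewrite in_itv /= => hz'; apply: eV.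
  rewrite /ball /= distrC; apply: hr; first exact: closure_segment.
  by apply: ball_pt zz'; exact: ballxx.
have dF z : z \in `](- H), (u x)[ -> is_derive z (1 : R) F (f z).
  rewrite in_itv /= => hz; have Oz : O (pt x z) by split; rewrite ?init_pt ?final_pt.
  have ptE s : pt x s = pt x 0 + s *: basis_vec R iz by rewrite -pt_addr add0r.
  have [dz dzE] := (hG iz).2 _ Oz; rewrite /f -dzE.
  have -> : F = fun s => phi (pt x 0 + s *: basis_vec R iz) by apply/funext => s; rewrite /F ptE.
  by move: dz; rewrite (ptE z) => dz; exact: is_derive_line.
have cf := line _ (hG iz).1; have cF := line _ cphi.
have := sqr_endpoint_le ux cf cF dF (topz _ Dx).
have sF := within_sqint_itv cF; have sf := within_sqint_itv cf.
have open_itv (g : R -> R) : sqint (@lebesgue_measure R) `[(- H), (u x)]%classic g ->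
  (\int[@lebesgue_measure R]_(z in `](- H)%R, (u x)[) (g z ^+ 2)%:E = (rsq (@lebesgue_measure R) `[(- H), (u x)]%classic g)%:E)%E.
  move=> gI; have mg : measurable_fun `](- H)%R, (u x)[ (fun z => (g z ^+ 2)%:E).
    apply: measurable_sqr; case: gI => mg _.
    by apply: measurable_funS mg => //; exact: subset_itv_oo_cc.
  exact: (etrans (esym (@integral_itv_bndoo _ _ _ _ true false mg)) (rsqE gI)).
rewrite -lee_fin EFinD => h.
apply: le_trans h _; rewrite -(open_itv _ sF) -(open_itv _ sf).
apply: leeD => //; rewrite le_eqVlt; apply/orP; left; apply/eqP.
apply: eq_integral => z /set_mem /=; rewrite in_itv /= => hz.
have Oz : O (pt x z) by split; rewrite ?init_pt ?final_pt.
by have [_ ->] := (hG iz).2 _ Oz.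
Qed.

Let oO : open O. Proof. exact: Omega_open. Qed.
Let mO : measurable O. Proof. exact: Omega_measurable. Qed.
Let Ooo : (mu O < +oo)%E. Proof. exact: Omega_lty. Qed.

(** * Density in C^1_B of test functions that ignore the bottom *)

Section density.
Hypothesis u0 : forall x, boundary D x -> u x = 0.

(** There is no lower bound on the height: test functions of this set keep arbitrary values at
    [z = - H] and continue into the layer, where [recovery] uses them. *)
Definition below : set 'rV[R]_(n + 1) := [set y | D (init y) /\ final y < u (init y)].

Lemma closure_Omega y : closure O y -> closure D (init y) /\ - H <= final y <= u (init y).
Proof.
move=> cy; have cD : closure D (init y).
  move=> B /(continuous_init (x := y)) By.
  by have [z [[Dz _] Bz]] := cy _ By; exists (init z).
have ge : - H <= final y.
  rewrite leNgt; apply/negP => yH.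
  have [z [[_ /andP[z1 _]] /= z2]] := cy _ (continuous_final (x := y) (lt_nbhsl yH)).
  by move: (lt_trans z1 z2); rewrite ltxx.
split => //; rewrite ge /= leNgt; apply/negP => uy.
pose e := (final y - u (init y)) / 2; have e0 : 0 < e by rewrite /e divr_gt0// subr_gt0.
have [r r0 hr] := within_closure_near cu cD e0.
have n1 := continuous_init (x := y) (nbhsx_ballx (init y) r r0).
have n2 := continuous_final (x := y) (nbhsx_ballx (final y) e e0).
have [z [[Dz /andP[_ z2]] [/= b1 b2]]] := cy _ (@filterI _ _ (nbhs_filter y) _ _ n1 n2).
have := hr _ (subset_closure Dz) b1; rewrite ltr_norml.
by move: b2; rewrite /ball /= ltr_norml /e in e0 *; lra.
Qed.

(** Such a point lies either on the graph of [u], or over the boundary of [D], where [u = 0]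
    confines its height to the range of the lateral condition up to the lowest corner. *)
Lemma C1_B_zero_off_below phi y : C1_B D H u phi -> closure O y -> ~ below y -> phi y = 0.
Proof.
move=> Cp cy nb; have [cD /andP[y1 y2]] := closure_Omega cy; have [_ ptop plat] := Cp.
have [Dy|nD] := pselect (D (init y)).
  have -> : y = pt (init y) (u (init y)); last exact: ptop.
  rewrite -[LHS](pt_init_final y); congr pt; apply/eqP; rewrite eq_le y2 leNgt.
  by apply/negP => h; apply: nb.
have bD : boundary D (init y) by split => //; rewrite (interior_id _).1.
rewrite (u0 bD) in y2.
(* The lateral condition is imposed for [- H < z] only; at the corner [z = - H] the value is the
   limit along the lateral boundary. Heights in []- H, 0[] do belong to the closure of [O], since
   [u] is close to 0 nearby. *)
have [yH|yH] : final y = - H \/ - H < final y by move: y1; rewrite le_eqVlt => /orP[/eqP->|]; [left|right].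
  have side z : - H < z <= 0 -> phi (pt (init y) z) = 0 by exact: plat.
  have clz z : - H < z < 0 -> closure O (pt (init y) z).
    move=> /andP[z1 z2] B Bz; pose e := - z; have e0 : 0 < e by rewrite /e oppr_gt0.
    have [r r0 hr] := within_closure_near cu cD e0.
    have n1 := continuous_pt_slice (x := init y) Bz.
    have [x [Dx [/= b1 Bx]]] := cD _ (@filterI _ _ (nbhs_filter (init y)) _ _ (nbhsx_ballx (init y) r r0) n1).
    exists (pt x z); split => //; split; rewrite ?init_pt ?final_pt// z1 /=.
    have := hr _ (subset_closure Dx) b1; rewrite (u0 bD) subr0 ltr_norml /e; lra.
  have [cphi _] := C1_B_grad Cp.
  apply/eqP; rewrite -normr_eq0 eq_le normr_ge0 andbT; apply/ler_addgt0Pl => e e0; rewrite addr0.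
  have [r r0 hr] := within_closure_near cphi cy e0.
  pose z := - H + Num.min (H / 2) (r / 2).
  have m0 : 0 < Num.min (H / 2) (r / 2) by rewrite lt_min !divr_gt0.
  have m1 : Num.min (H / 2) (r / 2) <= H / 2 by rewrite ge_min lexx.
  have m2 : Num.min (H / 2) (r / 2) <= r / 2 by rewrite ge_min lexx orbT.
  have zI : - H < z < 0 by move: H0 => h; apply/andP; split; rewrite /z; lra.
  have := hr _ (clz _ zI); rewrite side; last by case/andP: zI => -> /ltW ->.
  rewrite sub0r normrN => h; apply/ltW/h.
  rewrite -{1}(pt_init_final y); apply: ball_pt; first exact: ballxx.
  by rewrite yH /z opprD addrA subrr sub0r normrN gtr0_norm//; lra.
by rewrite -(pt_init_final y) plat// yH.
Qed.

Section fixed_phi.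
Variables (phi : 'rV[R]_(n + 1) -> R) (Cp : C1_B D H u phi).

Let S eta := [set y | closure O y /\ eta <= `|phi y|].

Let compact_S eta : 0 < eta -> compact (S eta).
Proof.
move=> eta0; have [cphi _] := C1_B_grad Cp.
apply: (subclosed_compact _ (@compact_box _ _ L)); last first.
  by move=> y [cy _] i; exact: closure_in_box.
move=> y cSy; have cy : closure O y.
  by apply: (closed_closure (A := O)); apply: closure_subset cSy => z [].
split => //; rewrite leNgt; apply/negP => ye.
have e0 : 0 < eta - `|phi y| by rewrite subr_gt0.
have [r r0 hr] := within_closure_near cphi cy e0.
have [z [[cz z1] z2]] := cSy _ (nbhsx_ballx y r r0).
have := hr _ cz z2; have := lerB_dist (phi z) (phi y); lra.
Qed.

Let S_below eta : 0 < eta -> S eta `<=` below.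
Proof.
move=> eta0 y [cy]; apply: contraPP => nb; rewrite (C1_B_zero_off_below Cp cy nb) normr0.
by apply/negP; rewrite -ltNge.
Qed.

Let f eta := (strunc eta \o phi) \_ O.

Let f_off eta y : 0 < eta -> ~ S eta y -> f eta y = 0.
Proof.
move=> eta0 nS; rewrite /f; have [Oy|Oy] := pselect (O y); last exact: restrict_out.
rewrite restrict_in//=; have [] // := @strunc0 R eta (phi y); rewrite leNgt; apply/negP => h; apply: nS.
by split; [exact: subset_closure|exact: ltW].
Qed.

Let Df eta i y := strunc' eta (phi y) * 'D_(e_ i) phi y.

Let is_derive_f eta i y : 0 < eta -> O y -> is_derive y (e_ i) (f eta) (Df eta i y).
Proof.
move=> eta0 Oy; have [_ [G hG]] := C1_B_grad Cp.
have [dphi _] := (hG i).2 _ Oy.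
have d1 : is_derive y (e_ i) phi ('D_(e_ i) phi y) by exact: DeriveDef.
have d2 := is_derive_comp_direction d1 (is_derive_strunc (phi y) eta0).
have /nbhs_ballP[r /= r0 rO] := oO Oy.
have -> : Df eta i y = 'D_(e_ i) (strunc eta \o phi) y by have [_ ->] := d2.
apply: is_derive_eps => e e0; have [d2a _] := d2; have [r' r'0 h'] := derive_eps d2a e0.
exists (Num.min r r') => [|t]; first by rewrite lt_min r0.
rewrite lt_min => /andP[tr tr']; rewrite /f !restrict_in//; first exact: h'.
by apply: rO; exact: ball_basis_vec.
Qed.

Let cphi y : O y -> {for y, continuous phi}.
Proof. by move=> Oy; have [cp _] := C1_B_grad Cp; exact: (within_closure_nbhs oO cp Oy). Qed.

Let near_O (h : 'rV[R]_(n + 1) -> R) y e : O y -> {for y, continuous h} -> 0 < e ->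
  exists2 r, 0 < r & forall z, ball y r z -> O z /\ `|h z - h y| <= e.
Proof.
move=> Oy ch e0; have /nbhs_ballP[r /= r0 rO] := oO Oy.
have /nbhs_ballP[r' /= r'0 hr'] := ch _ (nbhsx_ballx (h y) e e0).
exists (Num.min r r') => [|z yz]; first by rewrite lt_min r0.
split; first by apply: rO; apply: le_ball yz; rewrite ge_min lexx.
by rewrite distrC ltW//; apply: hr'; apply: le_ball yz; rewrite ge_min lexx orbT.
Qed.

Let f_cont eta y e : 0 < eta -> O y -> 0 < e ->
  exists2 r, 0 < r & forall z, ball y r z -> `|f eta z - f eta y| <= e.
Proof.
move=> eta0 Oy e0.
have ct : {for y, continuous (strunc eta \o phi)}.
  by apply: continuous_comp; [exact: cphi|exact: strunc_continuous].
have [r r0 hr] := near_O Oy ct e0; exists r => // z /hr[Oz].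
by rewrite /f !restrict_in.
Qed.

Let Df_cont eta i y e : 0 < eta -> O y -> 0 < e ->
  exists2 r, 0 < r & forall z, ball y r z -> O z /\ `|Df eta i z - Df eta i y| <= e.
Proof.
move=> eta0 Oy e0; have [_ [G hG]] := C1_B_grad Cp.
have cG : {for y, continuous (G i)} by exact: within_closure_nbhs (hG i).1 Oy.
have ct : {for y, continuous ((strunc' eta \o phi) \* G i)}.
  by apply: continuousM => //; apply: continuous_comp; [exact: cphi|exact: strunc'_continuous].
have [r r0 hr] := near_O Oy ct e0; exists r => // z /hr[Oz h]; split => //.
by rewrite /Df; have [_ ->] := (hG i).2 _ Oz; have [_ ->] := (hG i).2 _ Oy.
Qed.

Let mphi : measurable_fun O phi. Proof. by have [[]] := C1_B_in_H1 Cp. Qed.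

Let mDphi i : measurable_fun O ('D_(e_ i) phi).
Proof. by have [] := in_H1P (C1_B_in_H1 Cp) mO i. Qed.

Let mf eta : 0 < eta -> measurable_fun setT (f eta).
Proof.
move=> eta0; apply/(measurable_restrictT _ mO).
exact: measurableT_comp (continuous_measurable_fun (strunc_continuous eta0)) mphi.
Qed.

Let mDf eta i : 0 < eta -> measurable_fun O (Df eta i).
Proof.
move=> eta0; apply: measurable_funM; last exact: mDphi.
exact: measurableT_comp (continuous_measurable_fun (strunc'_continuous eta0)) mphi.
Qed.

(** The truncated function lives where [|phi| >= eta], a compact part of the closure of [O]
    contained in [below], hence at a distance [rho] from its complement; mollification at scale at
    most [rho / 2] fits in between. *)
Let truncated_dense eta e : 0 < eta -> 0 < e -> exists Psi, test_function below Psi /\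
  H1dist O (f eta) (Df eta) Psi (grad Psi) < e.
Proof.
move=> eta0 e0; have oA : open below by exact: open_below.
have [rho rho0 hrho] := compact_open_ball (compact_S eta0) oA (S_below eta0).
have [C C0 [phiC DC]] := C1_B_bounded Cp.
have fC y : `|f eta y| <= C.
  rewrite /f; have [Oy|Oy] := pselect (O y); last by rewrite restrict_out// normr0 ltW.
  by rewrite restrict_in//= (le_trans (strunc_le _ eta0))// phiC//; exact: subset_closure.
have DfC i y : O y -> `|Df eta i y| <= 3 * C.
  move=> Oy; have /andP[t0 t3] := strunc'_bound (phi y) eta0.
  by rewrite normrM ger0_norm//; apply: ler_pM => //; exact: DC.
pose d k : R := rho / 2 / k.+2%:R.
have r2 : 0 < rho / 2 by rewrite divr_gt0.
have d0 k : 0 < d k by rewrite divr_gt0.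
have drho k : 2 * d k <= rho.
  have : d k <= rho / 2 by rewrite ler_pdivrMr// ler_peMr ?ltW// ltr1n.
  by lra.
have dc : d k @[k --> \oo] --> 0 by exact: cvg_div_nat2.
pose Psi k := mollify (d k) (f eta).
have tPsi k : test_function below (Psi k).
  apply: (@test_function_mollify _ _ (d k) (f eta) C L (S eta)) => //.
  - exact: mf.
  - by move=> y; exact: f_off.
  - by move=> y i [cy _]; exact: closure_in_box.
  - by move=> y Sy; apply: subset_trans (hrho _ Sy); apply: le_ball.
have dPsi k i y : derivable (Psi k) y (e_ i) by have [CP _] := tPsi k; exact: (Ck_derivable (CP 1%N)).
have near_cube (y z : 'rV[R]_(n + 1)) k r : d k < r -> (forall l, 0 < z 0 l - y 0 l < d k) -> ball y r z.
  move=> dr hz; apply/ball_rVE; first exact: lt_trans (d0 k) dr.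
  by move=> l; rewrite distrC gtr0_norm; have := hz l; lra.
have small r : 0 < r -> \forall k \near \oo, d k < r by move=> r0; exact: cvg0_lt dc r0.
have c1 : rsq mu O (f eta \- Psi k) @[k --> \oo] --> 0.
  apply: (rsq_dct mO (g := cst (2 * C))) => [k||k y Oy|].
  - apply: measurable_funB; first exact: measurable_funTS (mf eta0).
    by apply: measurable_funTS; exact: test_function_measurable (tPsi k).
  - exact: sqint_cst.
  - have C2 : 0 <= 2 * C by rewrite mulr_ge0// ltW.
    rewrite /= (ger0_norm C2); apply: le_trans (ler_normB _ _) _.
    have := fC y; have := mollify_le (d0 k) (mf eta0) fC y; rewrite -/(Psi k) /Psi; lra.
  - apply: aeW => y Oy; apply/cvgrPdist_le => e1 e10.
    have [r r0 hr] := f_cont eta0 Oy e10.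
    apply: filterS (small r r0) => k dr; rewrite sub0r normrN distrC.
    apply: (mollify_near (d0 k) (mf eta0) fC) => z hz; apply: hr.
    exact: near_cube dr hz.
have c2 i : rsq mu O (Df eta i \- 'D_(e_ i) (Psi k)) @[k --> \oo] --> 0.
  apply: (rsq_dct mO (g := cst (6 * C))) => [k||k y Oy|].
  - apply: measurable_funB; first exact: mDf.
    by apply: measurable_funTS; exact: test_function_measurable (test_function_derive i (tPsi k)).
  - exact: sqint_cst.
  - have h1 : `|'D_(e_ i) (Psi k) y| <= 3 * C.
      rewrite -[X in `|X|]subr0.
      apply: (mollify_derive_near (d0 k) (r := rho) (mf eta0) fC (dPsi k i y)) => // z hz t /andP[t0 tr].
      rewrite mulr0 subr0.
      (* The extension by zero [f eta] may jump at [z = - H]. The kernel being one-sided, all points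
         averaged for [y] in [O] lie above [y], and the jump is not seen. *)
      have zH : - H < final z.
        have [_ /andP[y1 _]] := Oy; apply: lt_trans y1 _; rewrite -subr_gt0.
        by have /andP[] := hz (rshift n ord0); rewrite /final !mxE.
      have fin s : 0 <= s -> - H < final (z + s *: e_ i).
        move=> s0; apply: lt_le_trans zH _; rewrite /final !mxE lerDl mulr_ge0// ler0n.
      (* A nonzero increment has an endpoint in [S eta]. The segment is shorter than [rho], so it
         stays in [below], hence in [O], and the mean value theorem applies. *)
      have seg : S eta z \/ S eta (z + t *: e_ i) -> forall s, 0 <= s <= t -> O (z + s *: e_ i).
        move=> hS s /andP[s0 st].
        have [Dz uz] : below (z + s *: e_ i).
          case: hS => hS; apply: (hrho _ hS).
            by apply: ball_basis_vec; rewrite ger0_norm//; exact: le_lt_trans tr.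
          rewrite (_ : s = t + (s - t)); last by ring.
          rewrite scalerDl addrA; apply: ball_basis_vec.
          by rewrite ler0_norm ?subr_le0// opprB; lra.
        by split => //; rewrite uz fin.
      have [hS|hS] := pselect (S eta z \/ S eta (z + t *: e_ i)); last first.
        move/not_orP : hS => [n1 n2]; rewrite !f_off// subrr normr0 mulr_ge0 ?mulr_ge0 ?ltW//.
      have dseg s : 0 <= s <= t -> derivable (f eta) (z + s *: e_ i) (e_ i).
        by move=> st; have [] := is_derive_f i eta0 (seg hS s st).
      have [s st ->] := @mvt_line R _ (f eta) z (e_ i) t (ltW t0) dseg.
      have [_ ->] := is_derive_f i eta0 (seg hS s st).
      by rewrite normrM gtr0_norm// mulrC ler_wpM2r ?(ltW t0)// DfC//; exact: seg.
    have C6 : 0 <= 6 * C by rewrite mulr_ge0// ltW.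
    rewrite /= (ger0_norm C6); apply: le_trans (ler_normB _ _) _.
    have := DfC i y Oy; lra.
  - apply: aeW => y Oy; apply/cvgrPdist_le => e1 e10.
    have [r r0 hr] := Df_cont i eta0 Oy e10; have r20 : 0 < r / 2 by rewrite divr_gt0.
    apply: filterS (small _ r20) => k dr; rewrite sub0r normrN distrC.
    apply: (mollify_derive_near (d0 k) (r := r / 2) (mf eta0) fC (dPsi k i y)) => // z hz t /andP[t0 tr].
    have bz s : `|s| <= t -> ball y r (z + s *: e_ i).
      move=> st; rewrite (splitr r); apply: ball_triangle (near_cube _ _ _ _ dr hz) _.
      by apply: ball_basis_vec; exact: le_lt_trans tr.
    have := @mvt_abs R _ (f eta) z (e_ i) t (Df eta i y) e1; rewrite [`|t|]gtr0_norm//; apply=> s /bz /hr[Oz h].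
      by have [] := is_derive_f i eta0 Oz.
    by have [_ ->] := is_derive_f i eta0 Oz.
have [k0 _ hk0] := H1dist_cvg (p := Df eta) (pk := fun k => grad (Psi k)) c1 c2 e0.
by exists (Psi k0); split => //; exact: (hk0 k0 (leqnn _)).
Qed.

(* The gradient of [phi] vanishes a.e. where [phi = 0], as both it and its product
   with the indicator of [phi <> 0] are weak gradients of [phi]. *)
Lemma C1_B_dense e : 0 < e -> exists Psi, test_function below Psi /\
  H1dist O phi (grad phi) Psi (grad Psi) < e.
Proof.
move=> e0; pose eta k : R := k.+1%:R^-1; have eta0 k : 0 < eta k by rewrite invr_gt0.
have [C C0 [phiC DC]] := C1_B_bounded Cp.
have phiH := C1_B_in_H1 Cp; have [phiO wphi] := phiH.
have dO i := in_H1P phiH mO i.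
have fO k : sqint mu O (f (eta k)).
  apply: (sqint_dom mO _ phiO); first exact: measurable_funTS (mf (eta0 k)).
  move=> y Oy; rewrite /f restrict_in//= -[leLHS]real_normK ?num_real// -[leRHS]real_normK ?num_real//.
  by rewrite ler_pXn2r ?nnegrE// strunc_le.
have DfO k i : sqint mu O (Df (eta k) i).
  apply: (sqint_dom mO (mDf i (eta0 k)) (sqintZ mO 3 (dO i))) => y Oy.
  rewrite /Df !exprMn ler_wpM2r ?sqr_ge0//; have /andP[a b] := strunc'_bound (phi y) (eta0 k).
  by rewrite ler_pXn2r ?nnegrE.
have fw k i : is_weak_pderiv O i (f (eta k)) (Df (eta k) i).
  apply: (@is_weak_pderiv_derivable _ _ _ _ _ _ (3 * C)) => // y Oy; first exact: is_derive_f.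
  have /andP[t0 t3] := strunc'_bound (phi y) (eta0 k).
  by rewrite normrM ger0_norm//; apply: ler_pM => //; exact: DC.
have ce : eta k @[k --> \oo] --> 0 by exact: cvg_harmonic.
have sm (r : R) : 0 < r -> \forall k \near \oo, eta k < r by exact: cvg0_lt.
have c1 : rsq mu O (f (eta k) \- phi) @[k --> \oo] --> 0.
  apply: (rsq_dct mO (g := fun y => 2 * phi y)) => [k||k y Oy|].
  - by apply: measurable_funB => //; case: (fO k).
  - exact: sqintZ.
  - rewrite /f /= restrict_in//= normrM (gtr0_norm (ltr0Sn R 1)); apply: le_trans (ler_normB _ _) _.
    have := strunc_le (phi y) (eta0 k); lra.
  - apply: aeW => y Oy; apply/cvgrPdist_le => e1 e10.
    have [p0|p0] := eqVneq (phi y) 0.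
      apply: nearW => k; rewrite /f /= restrict_in//= p0 (strunc0 _).1 ?normr0 ?(ltW (eta0 k))//.
      by rewrite subr0 subr0 normr0 ltW.
    have p1 : 0 < `|phi y| by rewrite normr_gt0.
    pose b := Num.min 1 (e1 * `|phi y| / 4).
    have b0 : 0 < b by rewrite lt_min ltr01 divr_gt0// mulr_gt0.
    apply: filterS2 (sm _ p1) (sm _ b0) => k k1 k2.
    have [h _] := @strunc_near R (eta k) (phi y) (introT andP (conj (eta0 k) k1)).
    rewrite sub0r normrN /= /f restrict_in//=; apply: le_trans h _.
    have kb : b <= e1 * `|phi y| / 4 by rewrite ge_min lexx orbT.
    have k3 : eta k <= 1 by rewrite (le_trans (ltW k2))// ge_min lexx.
    have k4 : eta k ^+ 2 <= eta k by rewrite expr2 ler_piMl// ltW.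
    rewrite ler_pdivrMr//; have := lt_le_trans k2 kb; lra.
pose w i y := if phi y == 0 then 0 else 'D_(e_ i) phi y.
have mw i : measurable_fun O (w i).
  have -> : w i = fun y => (if phi y == 0 then 0 else 'D_(e_ i) phi y) by [].
  apply: (measurable_fun_if mO); [exact: measurable_fun_eqr|exact: measurable_cst|].
  by apply: (measurable_funS mO) (mDphi i); exact: subIsetl.
have wO i : sqint mu O (w i).
  by apply: (sqint_dom mO (mw i) (dO i)) => y Oy; rewrite /w; case: ifP => // _; rewrite expr0n sqr_ge0.
have c2 i : rsq mu O (Df (eta k) i \- w i) @[k --> \oo] --> 0.
  apply: (rsq_dct mO (g := fun y => 4 * 'D_(e_ i) phi y)) => [k||k y Oy|].
  - by apply: measurable_funB => //; case: (DfO k i).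
  - exact: sqintZ.
  - have /andP[t0 t3] := strunc'_bound (phi y) (eta0 k).
    rewrite /= normrM (gtr0_norm (ltr0Sn R 3)); apply: le_trans (ler_normB _ _) _.
    have h1 : `|Df (eta k) i y| <= 3 * `|'D_(e_ i) phi y| by rewrite normrM ger0_norm// ler_wpM2r.
    have h2 : `|w i y| <= `|'D_(e_ i) phi y| by rewrite /w; case: ifP => // _; rewrite normr0.
    by lra.
  - apply: aeW => y Oy; apply/cvgrPdist_le => e1 e10.
    have [p0|p0] := eqVneq (phi y) 0.
      apply: nearW => k; rewrite /w /Df /= p0 eqxx (strunc0 _).2 ?normr0 ?(ltW (eta0 k))//.
      by rewrite mul0r !subr0 normr0 ltW.
    have p1 : 0 < `|phi y| by rewrite normr_gt0.
    have p2 : 0 < phi y ^+ 2 by rewrite exprn_even_gt0.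
    pose b := Num.min 1 (e1 * phi y ^+ 2 / (12 * C)).
    have b0 : 0 < b by rewrite lt_min ltr01 divr_gt0// mulr_gt0.
    apply: filterS2 (sm _ p1) (sm _ b0) => k k1 k2.
    have [_ h] := @strunc_near R (eta k) (phi y) (introT andP (conj (eta0 k) k1)).
    rewrite sub0r normrN /= /w (negbTE p0) /Df -[X in _ - X]mul1r -mulrBl normrM.
    apply: (@le_trans _ _ (12 * eta k ^+ 2 / phi y ^+ 2 * C)).
      by apply: ler_pM => //; exact: DC.
    rewrite mulrAC ler_pdivrMr// mulrAC -ler_pdivlMl ?mulr_gt0//.
    rewrite (le_trans (_ : _ <= eta k)) //.
      by rewrite expr2 ler_piMl ?(ltW (eta0 k))// (le_trans (ltW k2))// ge_min lexx.
    by rewrite mulrC (le_trans (ltW k2))// ge_min lexx orbT.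
have ww i : is_weak_pderiv O i phi (w i).
  exact: (is_weak_pderiv_lim mO phiO (wO i) fO (fun k => fw k i) c1 (c2 i)).
have c2' i : rsq mu O ('D_(e_ i) phi \- Df (eta k) i) @[k --> \oo] --> 0.
  rewrite (_ : (fun k => _) = (fun k => rsq mu O (Df (eta k) i \- w i)))//.
  apply/funext => k; rewrite rsqC; apply: ae_rsq => //.
  - have := weak_pderiv_uniq oO Ooo (wphi i) (ww i).
    by apply: filterS => y h Oy; rewrite /= h.
  - by apply: measurable_funB; [case: (DfO k i)|exact: mDphi].
  - by apply: measurable_funB; [case: (DfO k i)|exact: mw].
have c1' : rsq mu O (phi \- f (eta k)) @[k --> \oo] --> 0.
  by rewrite (_ : (fun k => _) = (fun k => rsq mu O (f (eta k) \- phi)))//; apply/funext => k; rewrite rsqC.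
have e4 : 0 < e / 4 by rewrite divr_gt0.
have [k _ /(_ k (leqnn _)) /= hk] := H1dist_cvg (p := grad phi) (pk := fun k => Df (eta k)) c1' c2' e4.
have [Psi [tP hP]] := truncated_dense (eta0 k) e4.
exists Psi; split => //.
have := H1dist_tri mO phiH (conj (fO k) (fw k)) (in_H1_test oO Ooo tP); lra.
Qed.

End fixed_phi.
End density.

(** * Traces of functions in H^1_B *)

Local Notation bot := bottom_value.
Implicit Types (theta phi psi : 'rV[R]_(n + 1) -> R) (p : 'I_(n + 1) -> 'rV[R]_(n + 1) -> R)
  (t : 'rV[R]_n -> R).

Let mD : measurable D. Proof. exact: open_measurable_rV. Qed.
Let C1H phi : C1_B D H u phi -> in_H1 O phi (grad phi).
Proof. exact: C1_B_in_H1. Qed.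
Let C1D phi i : C1_B D H u phi -> sqint mu O ('D_(e_ i) phi).
Proof. by move=> /C1H hp; exact: (in_H1P hp). Qed.
Let C1b phi : C1_B D H u phi -> sqint nu D (bot phi).
Proof. exact: bottom_sqint. Qed.

Lemma bottom_dist phi psi : C1_B D H u phi -> C1_B D H u psi ->
  rsq nu D (bot phi \- bot psi) <= H1dist O phi (grad phi) psi (grad psi).
Proof.
move=> Cp Cq; have := trace_inequality (C1_BB Cp Cq).
move/le_trans; apply; rewrite /H1dist lerD2l.
rewrite (@eq_rsq _ _ _ _ O _ ('D_(e_ (rshift n ord0)) phi \- 'D_(e_ (rshift n ord0)) psi)); last first.
  by move=> y Oy; rewrite /= (C1_B_gradB _ Cp Cq Oy).
by rewrite (bigD1 (rshift n ord0))//= lerDl sumr_ge0// => i _; exact: rsq_ge0.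
Qed.

(** [trace_inequality] applied to differences makes the bottom values Cauchy as soon as the
    functions and their vertical derivatives are; completeness provides the gradient and the trace
    together. *)
Lemma trace_limit theta (phi : nat -> 'rV[R]_(n + 1) -> R) : sqint mu O theta ->
  (forall k, C1_B D H u (phi k)) -> rsq mu O (theta \- phi k) @[k --> \oo] --> 0 ->
  (forall i e, 0 < e -> exists K, forall j k, (K <= j)%N -> (K <= k)%N ->
    rsq mu O ('D_(e_ i) (phi j) \- 'D_(e_ i) (phi k)) <= e) ->
  exists p t, [/\ in_H1 O theta p, sqint nu D t,
    forall i, rsq mu O (p i \- 'D_(e_ i) (phi k)) @[k --> \oo] --> 0 &
    rsq nu D (t \- bot (phi k)) @[k --> \oo] --> 0].
Proof.
move=> tO Cp ct cg.
have /choice[p hp] : forall i, exists g, sqint mu O g /\ rsq mu O (g \- 'D_(e_ i) (phi k)) @[k --> \oo] --> 0.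
  move=> i; have [g [gO cvg]] := sqint_complete mO (fun k => C1D i (Cp k)) (cg i).
  by exists g; split => //; under eq_fun do rewrite rsqC.
have cphi : forall e, 0 < e -> exists K, forall j k, (K <= j)%N -> (K <= k)%N ->
    rsq mu O (phi j \- phi k) <= e.
  move=> e e0; have e4 : 0 < e / 4 by rewrite divr_gt0.
  have [K _ hK] := cvg0_lt ct e4; exists K => j k Kj Kk.
  have [pj _] := C1H (Cp j); have [pk _] := C1H (Cp k).
  apply: le_trans (rsq_tri_le mO pj pk tO (ltW (hK j Kj)) (ltW (hK k Kk))) _; lra.
have cb : forall e, 0 < e -> exists K, forall j k, (K <= j)%N -> (K <= k)%N ->
    rsq nu D (bot (phi j) \- bot (phi k)) <= e.
  move=> e e0; have e2 : 0 < e / 2 by rewrite divr_gt0.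
  have [K1 h1] := cphi _ e2; have [K2 h2] := cg (rshift n ord0) _ e2.
  exists (maxn K1 K2) => j k; rewrite !geq_max => /andP[j1 j2] /andP[k1 k2].
  have := trace_inequality (C1_BB (Cp j) (Cp k)).
  rewrite (@eq_rsq _ _ _ _ O ('D_(e_ (rshift n ord0)) (phi j \- phi k))
    ('D_(e_ (rshift n ord0)) (phi j) \- 'D_(e_ (rshift n ord0)) (phi k))).
    move/le_trans; apply; rewrite [leRHS]splitr; apply: lerD; [exact: h1|exact: h2].
  by move=> y Oy; rewrite /= (C1_B_gradB _ (Cp j) (Cp k) Oy).
have [t [tD ctt]] := sqint_complete mD (fun k => C1b (Cp k)) cb.
exists p, t; split => //.
- apply: (in_H1_lim mO tO (fun i => (hp i).1) (fun k => C1H (Cp k))).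
  apply/cvgrPdist_lt => e e0; rewrite /=.
  have := H1dist_cvg (p := p) (pk := fun k => grad (phi k)) ct (fun i => (hp i).2) e0.
  by apply: filterS => k; rewrite sub0r normrN ger0_norm// H1dist_ge0.
- by move=> i; have [] := hp i.
- by under eq_fun do rewrite rsqC.
Qed.

(** Membership in H^1_B with explicit gradient [p] and trace [t], reached by the same approximants.
    This replaces the abstract extension in [is_trace] by something that passes to the limit in the
    energy. *)
Definition trace_data theta p t := [/\ in_H1 O theta p, sqint nu D t &
  forall e, 0 < e -> exists phi, [/\ C1_B D H u phi, H1dist O theta p phi (grad phi) < e &
    rsq nu D (t \- bot phi) < e]].

Lemma trace_data_lim theta p t (phi : nat -> 'rV[R]_(n + 1) -> R) : in_H1 O theta p -> sqint nu D t ->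
  (forall k, C1_B D H u (phi k)) -> rsq mu O (theta \- phi k) @[k --> \oo] --> 0 ->
  (forall i, rsq mu O (p i \- 'D_(e_ i) (phi k)) @[k --> \oo] --> 0) ->
  rsq nu D (t \- bot (phi k)) @[k --> \oo] --> 0 -> trace_data theta p t.
Proof.
move=> tp tD Cp c1 c2 c3; split => // e e0.
have h1 := H1dist_cvg (p := p) (pk := fun k => grad (phi k)) c1 c2 e0.
have h2 := cvg0_lt c3 e0.
near \oo => k; exists (phi k); split => //; near: k; [exact: h1|exact: h2].
Unshelve. all: end_near. Qed.

Lemma H1_B_trace_data theta : H1_B D H u theta -> exists p t, trace_data theta p t.
Proof.
move=> [H1t ht]; have tp := in_H1_weak H1t mO; have [tO _] := tp.
set q := fun i => weak_pderiv O i theta in tp.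
have /choice[phi hphi] : forall k, exists phi, C1_B D H u phi /\
    H1dist O theta q phi (grad phi) < (k.+1%:R^-1) ^+ 2.
  move=> k; have k0 : 0 < k.+1%:R^-1 :> R by rewrite invr_gt0.
  have [phi [Cp]] := ht _ k0; rewrite (H1dist_lt oO Ooo tp (C1H Cp) k0) => hp.
  by exists phi.
have Cp k := (hphi k).1.
have dc : H1dist O theta q (phi k) (grad (phi k)) @[k --> \oo] --> 0.
  have c0 : (fun k => (k.+1%:R^-1) ^+ 2 : R) @ \oo --> 0.
    by rewrite -(mulr0 (0 : R)); under eq_fun do rewrite expr2; apply: cvgM; exact: cvg_harmonic.
  apply: (@squeeze_cvgr _ _ _ _ (fun=> 0) (fun k => (k.+1%:R^-1) ^+ 2 : R)) => //; last exact: cvg_cst.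
  by apply: nearW => k; rewrite H1dist_ge0 ltW//; exact: (hphi k).2.
have c1 : rsq mu O (theta \- phi k) @[k --> \oo] --> 0.
  apply: (squeeze_cvgr _ (cvg_cst 0) dc); apply: nearW => k; rewrite rsq_ge0 /=.
  by rewrite /H1dist lerDl sumr_ge0// => i _; exact: rsq_ge0.
have c2 i : rsq mu O (q i \- 'D_(e_ i) (phi k)) @[k --> \oo] --> 0.
  apply: (squeeze_cvgr _ (cvg_cst 0) dc); apply: nearW => k; rewrite rsq_ge0 /=.
  rewrite /H1dist (bigD1 i)//= addrCA lerDl addr_ge0 ?rsq_ge0// sumr_ge0// => j _; exact: rsq_ge0.
have cg : forall i e, 0 < e -> exists K, forall j k, (K <= j)%N -> (K <= k)%N ->
    rsq mu O ('D_(e_ i) (phi j) \- 'D_(e_ i) (phi k)) <= e.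
  move=> i e e0; have e4 : 0 < e / 4 by rewrite divr_gt0.
  have [K _ hK] := cvg0_lt (c2 i) e4; exists K => j k Kj Kk.
  have tq := in_H1P tp mO i.
  apply: le_trans (rsq_tri_le mO (C1D i (Cp j)) (C1D i (Cp k)) tq (ltW (hK j Kj)) (ltW (hK k Kk))) _; lra.
have [p [t [tp' tD cp ct]]] := trace_limit tO Cp c1 cg.
by exists p, t; exact: (trace_data_lim tp' tD Cp c1 cp ct).
Qed.

Lemma trace_data_H1_B theta p t : trace_data theta p t -> H1_B D H u theta.
Proof.
move=> [tp tD ht]; split; first exact: H1_in tp mO.
move=> e e0; have [phi [Cp hp _]] := ht _ (exprn_gt0 2 e0).
by exists phi; split => //; rewrite (H1dist_lt oO Ooo tp (C1H Cp) e0).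
Qed.

Lemma trace_data_is_trace theta p t : trace_data theta p t -> is_trace D H u theta t.
Proof.
move=> [tp tD ht]; split; first exact/L2P.
move=> e e0; have e20 : 0 < e ^+ 2 by rewrite exprn_gt0.
(* The distances of [phi] and of [psi] to [theta] count four times and that of the bottom of [psi]
   to [t] twice: in total less than [10 / 16] of [e ^+ 2]. *)
have e16 : 0 < e ^+ 2 / 16 by rewrite divr_gt0.
have r0 : 0 < e / 4 by rewrite divr_gt0.
exists (e / 4) => // phi Cp; rewrite (H1dist_lt oO Ooo tp (C1H Cp) r0) => dphi.
have [psi [Cq dpsi bpsi]] := ht _ e16.
rewrite L2norm_lt//; last by apply: sqintB => //; exact: C1b.
have h1 : rsq nu D (bot phi \- t) <= 2 * rsq nu D (bot phi \- bot psi) + 2 * rsq nu D (bot psi \- t).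
  exact (rsq_tri mD (C1b Cp) tD (C1b Cq)).
have h2 := bottom_dist Cp Cq.
have h3 := H1dist_tri mO (C1H Cp) tp (C1H Cq).
have h4 : H1dist O phi (grad phi) theta p = H1dist O theta p phi (grad phi).
  by rewrite /H1dist rsqC; congr (_ + _); apply: eq_bigr => i _; rewrite rsqC.
rewrite h4 in h3; rewrite rsqC in bpsi; rewrite expr_div_n -natrX in dphi.
apply: le_lt_trans h1 _; move: e20 h2 h3 dphi dpsi bpsi.
move: (rsq nu D (bot phi \- bot psi)) (rsq nu D (bot psi \- t)) (H1dist O phi _ _ _).
move: (H1dist O theta _ _ _) (H1dist O theta _ _ _) (e ^+ 2) => a b c d f g; lra.
Qed.

Lemma is_trace_uniq theta t t' : H1_B D H u theta -> is_trace D H u theta t ->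
  is_trace D H u theta t' -> {ae nu, forall x, D x -> t' x = t x}.
Proof.
move=> [_ ht] [/(L2P _ mD) tD h1] [/(L2P _ mD) tD' h2].
suff : rsq nu D (t' \- t) = 0.
  move=> /(sqint_ae0 mD (sqintB mD tD' tD)).
  by apply: filterS => x h Dx; apply/eqP; rewrite -subr_eq0; apply/eqP/h.
apply/eqP; rewrite eq_le rsq_ge0 andbT; apply/ler_addgt0Pl => e e0; rewrite addr0.
have s0 : 0 < Num.sqrt (e / 4) by rewrite sqrtr_gt0 divr_gt0.
have [r r0 hr] := h1 _ s0; have [r' r'0 hr'] := h2 _ s0.
have [|phi [Cp dphi]] := ht (Num.min r r'); first by rewrite lt_min r0.
have := hr phi Cp (lt_le_trans dphi _); rewrite lee_fin ge_min lexx => /(_ isT).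
have := hr' phi Cp (lt_le_trans dphi _); rewrite lee_fin ge_min lexx orbT => /(_ isT).
rewrite !L2norm_lt//; try by apply: sqintB => //; exact: C1b.
rewrite sqr_sqrtr ?divr_ge0 ?(ltW e0)// => a b.
have a' : rsq nu D (bot phi \- t') < e / 4 by exact: a.
have b' : rsq nu D (bot phi \- t) < e / 4 by exact: b.
by apply: le_trans (rsq_tri_le mD tD' tD (C1b Cp) (ltW a') (ltW b')) _; lra.
Qed.

(** Functions in C^1_B have bottom value 0 over the contact set, so the restriction of [t] to it is
    an L^2 limit of zero functions. *)
Lemma trace_data_contact theta p t : trace_data theta p t ->
  {ae nu, forall x, D x -> u x = - H -> t x = 0}.
Proof.
move=> [tp tD ht].
pose c x := if u x == - H then t x else 0.
have mc : measurable_fun D c.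
  have [mt _] := tD; apply: (measurable_fun_if mD).
  - apply: measurable_fun_eqr; last exact: measurable_cst.
    by apply: within_continuous_measurable => //; exact: continuous_subspaceW (@subset_closure _ D) cu.
  - by apply: (measurable_funS mD) mt; exact: subIsetl.
  - exact: measurable_cst.
have cD : sqint nu D c.
  by apply: (sqint_dom mD mc tD) => x Dx; rewrite /c; case: ifP => // _; rewrite expr0n sqr_ge0.
have c0 : rsq nu D c = 0.
  apply/eqP; rewrite eq_le rsq_ge0 andbT; apply/ler_addgt0Pl => e e0; rewrite addr0.
  have [phi [Cp _ bphi]] := ht _ e0; apply: le_trans (ltW bphi).
  apply: (le_rsq mD mc (sqintB mD tD (C1b Cp))) => x Dx; rewrite /c; case: ifPn => [/eqP uxH|_].
    by rewrite /= (bottom_contact Cp Dx uxH) subr0.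
  by rewrite expr0n sqr_ge0.
have := sqint_ae0 mD cD c0; apply: filterS => x h Dx uxH.
by have := h Dx; rewrite /c uxH eqxx.
Qed.

(** [trace] picks some representative through [xget], hence agreement holds almost everywhere only,
    and its measurability has to be recorded separately. *)
Lemma trace_data_trace theta p t : trace_data theta p t ->
  {ae nu, forall x, D x -> trace D H u theta x = t x} /\ measurable_fun D (trace D H u theta).
Proof.
move=> td; have tr := trace_data_is_trace td; have HB := trace_data_H1_B td.
set t' := xget (fun=> 0) [set t | is_trace D H u theta t].
have tr' : is_trace D H u theta t' by exact: (@xgetPex _ (fun=> 0) _ (ex_intro _ _ tr)).
split.
  have h1 := is_trace_uniq HB tr tr'; have h2 := trace_data_contact td.
  apply: filterS2 h1 h2 => x h1 h2 Dx; rewrite /trace -/t'; case: ifPn => [/eqP uxH|_].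
    by rewrite h2.
  exact: h1.
have [/(L2P _ mD)[mt' _] _] := tr'.
apply: (measurable_fun_if mD).
- apply: measurable_fun_eqr; last exact: measurable_cst.
  by apply: within_continuous_measurable => //; exact: continuous_subspaceW (@subset_closure _ D) cu.
- exact: measurable_cst.
- by apply: (measurable_funS mD) mt'; exact: subIsetl.
Qed.

(** * Lower semicontinuity of the limit energy *)

Section quadratic_form.
Variables (q : 'I_(n + 1) -> 'rV[R]_(n + 1) -> R) (a w : 'rV[R]_n -> R) (C : R).
Hypotheses (qO : forall i, sqint mu O (q i)) (aD : sqint nu D a) (mw : measurable_fun D w)
  (wC : forall x, D x -> `|w x| <= C).

(** Twice the limit functional, for [q] the gradient of [hu], [a] the gap between the data on the
    two faces of the layer and [w] the square root of [sigma] at the bottom; see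
    [energy_of_trace]. *)
Definition energy p t : R := \sum_i rsq mu O (p i \+ q i) + rsq nu D (fun x => w x * (t x + a x)).

Lemma energy_ge0 p t : 0 <= energy p t.
Proof. by rewrite addr_ge0 ?rsq_ge0// sumr_ge0// => i _; exact: rsq_ge0. Qed.

Let weighted t : sqint nu D t -> sqint nu D (fun x => w x * t x) /\
  rsq nu D (fun x => w x * t x) <= C ^+ 2 * rsq nu D t.
Proof. by move=> tD; exact: (sqint_mul_bounded mD mw wC tD). Qed.

(* [(a + b)^2 <= (1 + e) a^2 + (1 + 1 / e) b^2] in every term. *)
Lemma energy_perturb e p t p' t' : 0 < e ->
  (forall i, sqint mu O (p i)) -> sqint nu D t -> (forall i, sqint mu O (p' i)) -> sqint nu D t' ->
  energy p t <= (1 + e) * energy p' t' +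
    (1 + e^-1) * (\sum_i rsq mu O (p i \- p' i) + C ^+ 2 * rsq nu D (t \- t')).
Proof.
move=> e0 pO tD pO' tD'; rewrite /energy.
have h1 : \sum_i rsq mu O (p i \+ q i) <=
    \sum_i ((1 + e) * rsq mu O (p' i \+ q i) + (1 + e^-1) * rsq mu O (p i \- p' i)).
  apply: ler_sum => i _.
  rewrite (@eq_rsq _ _ _ _ O _ ((p' i \+ q i) \+ (p i \- p' i))); last first.
    by move=> y _ /=; ring.
  by apply: rsqD_le => //; [exact: sqintD|exact: sqintB].
have [w1 w2] := weighted (sqintB mD tD tD').
have [w3 _] := weighted (sqintD mD tD' aD).
have h2 : rsq nu D (fun x => w x * (t x + a x)) <=
    (1 + e) * rsq nu D (fun x => w x * (t' x + a x)) + (1 + e^-1) * rsq nu D (fun x => w x * (t x - t' x)).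
  rewrite (@eq_rsq _ _ _ _ D _ ((fun x => w x * (t' x + a x)) \+ (fun x => w x * (t x - t' x)))).
    exact: rsqD_le.
  by move=> x _ /=; ring.
move: h1; rewrite big_split /= -!big_distrr /= => h1.
have e1 : 0 <= 1 + e^-1 by rewrite addr_ge0// invr_ge0 ltW.
have := ler_wpM2l e1 w2; rewrite /=; lra.
Qed.

(** An inequality, because the contribution of [t - t'] is nonnegative and dropped: Cauchy gradients
    already force Cauchy traces. *)
Lemma energy_parallelogram p t p' t' :
  (forall i, sqint mu O (p i)) -> sqint nu D t -> (forall i, sqint mu O (p' i)) -> sqint nu D t' ->
  energy (fun i y => (p i y + p' i y) / 2) (fun x => (t x + t' x) / 2) +
    (\sum_i rsq mu O (p i \- p' i)) / 4 <= (energy p t + energy p' t') / 2.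
Proof.
move=> pO tD pO' tD'; rewrite /energy.
have h1 i : rsq mu O ((fun y => (p i y + p' i y) / 2) \+ q i) + rsq mu O (p i \- p' i) / 4 =
    (rsq mu O (p i \+ q i) + rsq mu O (p' i \+ q i)) / 2.
  rewrite -(rsq_parallelogram mO (sqintD mO (pO i) (qO i)) (sqintD mO (pO' i) (qO i))).
  congr (_ + _); first by apply: eq_rsq => y _ /=; field.
  rewrite (_ : rsq mu O (p i \- p' i) / 4 = (2^-1) ^+ 2 * rsq mu O (p i \- p' i)); last by field.
  by rewrite -rsqZ//; [apply: eq_rsq => y _ /=; field|exact: sqintB].
have [w1 _] := weighted (sqintD mD tD aD); have [w2 _] := weighted (sqintD mD tD' aD).
have := rsq_parallelogram mD w1 w2.
have := @rsq_ge0 _ _ _ nu D (fun x => (w x * (t \+ a) x - w x * (t' \+ a) x) / 2).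
rewrite (@eq_rsq _ _ _ _ D (fun x => (w x * (t \+ a) x + w x * (t' \+ a) x) / 2)
  (fun x => w x * ((t x + t' x) / 2 + a x))); last by move=> x _ /=; field.
have : \sum_i rsq mu O ((fun y => (p i y + p' i y) / 2) \+ q i) + (\sum_i rsq mu O (p i \- p' i)) / 4 =
    (\sum_i rsq mu O (p i \+ q i) + \sum_i rsq mu O (p' i \+ q i)) / 2.
  by rewrite mulr_suml -big_split -big_split mulr_suml /=; apply: eq_bigr => i _; exact: h1.
rewrite /=; lra.
Qed.

Let mean phi psi y : R := (phi y + psi y) / 2.

(* Near-minimisers of the energy over shrinking [L^2]-balls around [theta] form a
   Cauchy sequence by the parallelogram identity. *)
Lemma energy_lsc theta c : sqint mu O theta ->
  (forall e, 0 < e -> exists phi, [/\ C1_B D H u phi, rsq mu O (theta \- phi) < e &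
    energy (grad phi) (bot phi) < c + e]) ->
  exists p t, trace_data theta p t /\ energy p t <= c.
Proof.
move=> tO hyp.
pose r k : R := k.+1%:R^-1; have r0 k : 0 < r k by rewrite invr_gt0.
have rle j k : (j <= k)%N -> r k <= r j by move=> jk; rewrite lef_pV2 ?posrE ?ltr0n// ler_nat ltnS.
pose E phi := energy (grad phi) (bot phi).
(* The infimum [m k] over the ball of squared radius [1 / (k + 1)] does not decrease with [k] and is
   at most [c]; its limit [l] is the level that the near-minimisers approach. *)
pose S k := [set E phi | phi in [set phi | C1_B D H u phi /\ rsq mu O (theta \- phi) < r k]].
have Slb k : lbound (S k) 0 by move=> _ [phi _ <-]; exact: energy_ge0.
have S0 k : S k !=set0.
  by have [phi [Cp tp _]] := hyp _ (r0 k); exists (E phi); exists phi.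
have Sinf k : has_inf (S k) by split => //; exists 0; exact: Slb.
pose m k := inf (S k).
have mE k phi : C1_B D H u phi -> rsq mu O (theta \- phi) < r k -> m k <= E phi.
  by move=> Cp tp; apply: ge_inf; [exists 0; exact: Slb|exists phi].
have mc k : m k <= c.
  apply/ler_addgt0Pr => e e0.
  have [|phi [Cp tp Ep]] := hyp (Num.min (r k) e); first by rewrite lt_min r0.
  apply: le_trans (mE k _ Cp _) _; first by apply: lt_le_trans tp _; rewrite ge_min lexx.
  by apply: le_trans (ltW Ep) _; rewrite lerD2l ge_min lexx orbT.
have mm j k : (j <= k)%N -> m j <= m k.
  move=> jk; apply: lb_le_inf => // _ [phi [Cp tp] <-]; apply: mE => //.
  exact: lt_le_trans tp (rle _ _ jk).
have [l lc ml] : exists2 l, l <= c & m k @[k --> \oo] --> l /\ forall k, m k <= l.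
  have cvm : cvgn m.
    by apply: nondecreasing_is_cvgn; [move=> j k; exact: mm|exists c => _ [k _ <-]; exact: mc].
  exists (limn m); first by apply: limr_le => //; apply: nearW => k; exact: mc.
  by split => // k; apply: nondecreasing_cvgn_le => // i j; exact: mm.
have /choice[psi hpsi] : forall k, exists psi, [/\ C1_B D H u psi, rsq mu O (theta \- psi) < r k &
    E psi < m k + r k].
  move=> k; have [_ [phi [Cp tp] <-] h] := inf_adherent (r0 k) (Sinf k).
  by exists phi.
have Cp k : C1_B D H u (psi k) by have [] := hpsi k.
have Op k : sqint mu O (psi k) by have [] := C1H (Cp k).
have c1 : rsq mu O (theta \- psi k) @[k --> \oo] --> 0.
  apply: (@squeeze_cvgr _ _ _ _ (fun=> 0) r); [|exact: cvg_cst|exact: cvg_harmonic].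
  by apply: nearW => k; rewrite rsq_ge0 ltW//; have [] := hpsi k.
(* The midpoint of two near-minimisers of index at least [K] lies in ball [K], so its energy is at
   least [m K > l - e / 8], while their mean energy is below [l + e / 8]. The parallelogram bound
   leaves less than [e / 4] for a quarter of the squared gradient difference. *)
have cauchy e : 0 < e -> exists K, forall j k, (K <= j)%N -> (K <= k)%N ->
    \sum_i rsq mu O ('D_(e_ i) (psi j) \- 'D_(e_ i) (psi k)) <= e.
  move=> e0; have e8 : 0 < e / 8 by rewrite divr_gt0.
  have cr : r k @[k --> \oo] --> 0 by exact: cvg_harmonic.
  have n1 := cvg0_lt cr e8.
  have n2 : \forall k \near \oo, l - m k < e / 8.
    by have /cvgrPdist_lt/(_ _ e8) := ml.1; apply: filterS => k; exact: le_lt_trans (ler_norm _).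
  have [K _ hK] := filterI n1 n2; exists K => j k Kj Kk.
  have [C1m Dm] := C1_B_mean (Cp j) (Cp k).
  have tm : rsq mu O (theta \- mean (psi j) (psi k)) < r K.
    have [_ tj _] := hpsi j; have [_ tk _] := hpsi k.
    have a1 := lt_le_trans tj (rle _ _ Kj); have a2 := lt_le_trans tk (rle _ _ Kk).
    have := rsq_parallelogram mO (sqintB mO tO (Op j)) (sqintB mO tO (Op k)).
    rewrite (@eq_rsq _ _ _ _ O (fun x => ((theta \- psi j) x + (theta \- psi k) x) / 2)
      (theta \- mean (psi j) (psi k))); last by move=> y _; rewrite /mean /=; field.
    have := @rsq_ge0 _ _ _ mu O (fun x => ((theta \- psi j) x - (theta \- psi k) x) / 2).
    by lra.
  have := mE K _ C1m tm.
  have -> : E (mean (psi j) (psi k)) =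
      energy (fun i y => ('D_(e_ i) (psi j) y + 'D_(e_ i) (psi k) y) / 2)
        (fun x => (bot (psi j) x + bot (psi k) x) / 2).
    by rewrite /E /energy; congr (_ + _); apply: eq_bigr => i _; apply: eq_rsq => y Oy /=; rewrite Dm.
  have := energy_parallelogram (fun i => C1D i (Cp j)) (C1b (Cp j)) (fun i => C1D i (Cp k)) (C1b (Cp k)).
  have [_ _ Ej] := hpsi j; have [_ _ Ek] := hpsi k; move: Ej Ek; rewrite /E.
  have [k1 k2] := hK K (leqnn _); have := ml.2 j; have := ml.2 k.
  have := rle _ _ Kj; have := rle _ _ Kk; move: k1 k2; rewrite /=; lra.
have cg : forall i e, 0 < e -> exists K, forall j k, (K <= j)%N -> (K <= k)%N ->
    rsq mu O ('D_(e_ i) (psi j) \- 'D_(e_ i) (psi k)) <= e.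
  move=> i e /cauchy[K hK]; exists K => j k Kj Kk; apply: le_trans (hK j k Kj Kk).
  by rewrite (bigD1 i)//= lerDl sumr_ge0// => s _; exact: rsq_ge0.
have [p [t [tp tD cp ct]]] := trace_limit tO Cp c1 cg.
exists p, t; split; first exact: (trace_data_lim tp tD Cp c1 cp ct).
apply: le_trans lc.
have pO i := in_H1P tp mO i.
(* [energy_perturb] against [psi k]: the error terms vanish in the limit and only the factor [1 + e]
   survives. *)
have bound e : 0 < e -> energy p t <= (1 + e) * l.
  move=> e0; set rhs := (1 + e) * l.
  have : (fun k => (1 + e) * (l + r k) + (1 + e^-1) * (\sum_i rsq mu O (p i \- 'D_(e_ i) (psi k)) +
      C ^+ 2 * rsq nu D (t \- bot (psi k)))) @ \oo --> (1 + e) * (l + 0) + (1 + e^-1) * (\sum_(i < n + 1) 0 + C ^+ 2 * 0).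
    apply: cvgD; first by apply: cvgMr; apply: cvgD; [exact: cvg_cst|exact: cvg_harmonic].
    apply: cvgMr; apply: cvgD; last exact: cvgMr.
    by apply: cvg_big => [|i _]; [exact: add_continuous|exact: cp].
  rewrite big1// mulr0 !addr0 mulr0 addr0 => cvl; rewrite /rhs -(cvg_lim _ cvl)//.
  apply: limr_ge; first by apply: cvgP cvl.
  apply: nearW => k; apply: le_trans (energy_perturb e0 pO tD (fun i => C1D i (Cp k)) (C1b (Cp k))) _.
  rewrite lerD2r ler_pM2l ?addr_gt0//; have [_ _ Ek] := hpsi k.
  by have := ml.2 k; move: Ek; rewrite /E; lra.
have l0 : 0 <= l by apply: le_trans (ml.2 0%N); apply: lb_le_inf => // x; exact: Slb.
apply/ler_addgt0Pr => e e0.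
have el : 0 < e / (l + 1) by rewrite divr_gt0// ltr_pwDr.
apply: le_trans (bound _ el) _; rewrite mulrDl mul1r lerD2l.
by rewrite -mulrA ger_pMr// mulrC ler_pdivrMr ?ltr_pwDr//; lra.
Qed.

End quadratic_form.
End geometry.

(** * Approximation in the unit layer *)

(** The data in the form in which they are used: continuous extensions [Gb] and [Gh] of the first
    derivatives, one size [L] for all boxes, pointwise bounds and zero boundary values for [u]. *)
Record setting (R : realType) (n : nat) (D : set 'rV[R]_n) (H M L s0 : R) (u : 'rV[R]_n -> R)
    (sigma : 'rV[R]_(n + 1) -> R) (hb h : 'rV[R]_(n + 1 + 1) -> R)
    (Gb Gh : 'I_(n + 1 + 1) -> 'rV[R]_(n + 1 + 1) -> R) (p : 'I_n -> 'rV[R]_n -> R) : Prop := Setting {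
  st_open : open D;
  st_box : forall x i, D x -> `|x 0 i| <= L;
  st_H : 0 < H;
  st_cu : {within closure D, continuous u};
  st_uH : forall x, D x -> - H <= u x;
  st_uM : forall x, D x -> u x <= M - H;
  st_HL : H + 1 <= L;
  st_ML : M <= L;
  st_u0 : forall x, boundary D x -> u x = 0;
  st_up : H10_data D u p;
  st_chb : {within closure (dom_hb D H), continuous hb};
  st_ch : {within closure (dom_h D H), continuous h};
  st_cGb : forall i, {within closure (dom_hb D H), continuous (Gb i)};
  st_cGh : forall i, {within closure (dom_h D H), continuous (Gh i)};
  st_dGb : forall i x, dom_hb D H x -> is_derive x (basis_vec R i) hb (Gb i x);
  st_dGh : forall i x, dom_h D H x -> is_derive x (basis_vec R i) h (Gh i x);
  st_hbh : forall x w, D x -> - H <= w -> hb (pt (pt x (- H)) w) = h (pt (pt x (- H)) w);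
  st_csigma : {within layer_closed D H, continuous sigma};
  st_s0 : 0 < s0;
  st_sigma : forall y, layer_closed D H y -> s0 <= sigma y }.

Section composition.
Context (R : realType) (N : nat).

Lemma within_comp_line (B : set 'rV[R]_N) (F : 'rV[R]_N -> R) (g : R -> 'rV[R]_N) (A : set R) :
  {within closure B, continuous F} -> (forall z, A z -> closure B (g z)) ->
  (forall z, A z -> {for z, continuous g}) -> {within A, continuous (F \o g)}.
Proof.
move=> cF AB cg; apply/subspace_continuousP => z Az V /nbhs_ballP[e /= e0 eV].
have [r r0 hr] := within_closure_near cF (AB _ Az) e0.
have /nbhs_ballP[r' /= r'0 h'] := cg _ Az _ (nbhsx_ballx (g z) r r0).
apply/nbhs_ballP; exists r' => // z' zz' Az'; apply: eV.
by rewrite /ball /= distrC; apply: hr; [exact: AB|exact: h'].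
Qed.

End composition.

Section layer.
Context (R : realType) (n : nat) (D : set 'rV[R]_n) (H d : R).

(** An instance of [Omega] with flat top [- H] and bottom [- H - d], so that the Tonelli formulas
    proved for [Omega] apply to the layer as well. *)
Definition layer : set 'rV[R]_(n + 1) := @Omega R n D (H + d) (fun=> - H).

Lemma layerP y : layer y <-> D (init y) /\ - H - d < final y < - H.
Proof. by rewrite /layer /Omega /= opprD. Qed.

End layer.

(** * Approximating a vertical derivative by test functions of the unit layer *)

Section layer_density.
Context (R : realType) (n : nat) (D : set 'rV[R]_n).
Variables (H L C : R) (beta c : 'rV[R]_(n + 1) -> R).
Local Notation Q := (layer D H 1).
Local Notation mu := (@leb R (n + 1)).
Local Notation e_ := (@basis_vec R (n + 1)).
Local Notation iz := (rshift n (@ord0 0)).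
Hypotheses (oD : open D) (DL : forall x i, D x -> `|x 0 i| <= L) (HL : `|H| + 1 <= L) (C0 : 0 < C)
  (cb : {within Q, continuous beta}) (cc : {within Q, continuous c})
  (cline : forall x, D x -> {within `[(- H - 1), (- H)], continuous (fun z => beta (pt x z))})
  (dline : forall x z, D x -> - H - 1 < z < - H ->
    is_derive z (1 : R) (fun z => beta (pt x z)) (c (pt x z)))
  (top0 : forall x, D x -> beta (pt x (- H)) = 0)
  (bot0 : forall x, D x -> beta (pt x (- H - 1)) = 0)
  (cC : forall y, Q y -> `|c y| <= C).

Lemma unit_layer_open : open Q.
Proof. by apply: Omega_open => //; apply: continuous_subspaceT; exact: cst_continuous. Qed.

Let oQ := unit_layer_open.
Let mQ : measurable Q. Proof. exact: open_measurable_rV. Qed.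

Lemma unit_layer_box y i : Q y -> `|y 0 i| <= L.
Proof.
move=> /layerP[Dy hz]; rewrite -(pt_init_final y); apply: norm_pt_le; first by move=> j; exact: DL.
have := ler_norm H; have := ler_norm (- H); rewrite normrN; move: HL hz; rewrite ler_norml; lra.
Qed.

Let Qoo : (mu Q < +oo)%E.
Proof. by apply: (@leb_bounded_lty _ _ _ L) => // y i; exact: unit_layer_box. Qed.

Let B := beta \_ Q.

(** As [beta] vanishes on both faces, its extension by zero takes at height [z] the value of [beta]
    at the clamped height; clamping does not increase distances, which yields the vertical Lipschitz
    bound. *)
Let clamp (z : R) : R := if z <= - H - 1 then - H - 1 else if - H <= z then - H else z.

Let BE x z : D x -> B (pt x z) = beta (pt x (clamp z)).
Proof.
move=> Dx; rewrite /B /clamp; case: leP => z1.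
  rewrite restrict_out ?bot0// => /layerP[_]; rewrite final_pt; lra.
case: leP => z2; first by rewrite restrict_out ?top0// => /layerP[_]; rewrite final_pt; lra.
by rewrite restrict_in//; apply/layerP; rewrite init_pt final_pt z1.
Qed.

Let subline x z z' : D x -> - H - 1 <= z -> z' <= - H ->
  {within `[z, z'], continuous (fun z => beta (pt x z))}.
Proof.
move=> Dx h1 h2; apply: continuous_subspaceW (cline Dx) => s /=.
by rewrite !in_itv /= => /andP[a b]; apply/andP; split; lra.
Qed.

Let increment x z z' : D x -> - H - 1 <= z -> z < z' -> z' <= - H ->
  exists2 xi, z < xi < z' & beta (pt x z') - beta (pt x z) = c (pt x xi) * (z' - z).
Proof.
move=> Dx h1 h2 h3.
have [|xi] := @MVT R (fun z => beta (pt x z)) (fun z => c (pt x z)) z z' h2 _ (subline Dx h1 h3).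
  by move=> s; rewrite in_itv /= => hs; apply: dline => //; lra.
by rewrite in_itv /=; exists xi.
Qed.

Let B_lip x z z' : z <= z' -> `|B (pt x z') - B (pt x z)| <= C * (z' - z).
Proof.
move=> zz'; have [Dx|nD] := pselect (D x); last first.
  rewrite /B !restrict_out ?subrr ?normr0; try by move=> /layerP[]; rewrite init_pt.
  by rewrite mulr_ge0 ?(ltW C0)// subr_ge0.
rewrite !BE//; have cl1 s : - H - 1 <= clamp s <= - H.
  by rewrite /clamp; case: (leP s) => s1; [|case: (leP _ s) => s2]; lra.
have cl2 : 0 <= clamp z' - clamp z <= z' - z.
  by rewrite /clamp; case: (leP z) => s1; case: (leP z') => s2;
    try case: (leP (- H) z) => s3; try case: (leP (- H) z') => s4; lra.
have /andP[a1 a2] := cl1 z; have /andP[b1 b2] := cl1 z'; have /andP[c1 c2] := cl2.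
apply: (@le_trans _ _ (C * (clamp z' - clamp z))); last by rewrite ler_pM2l.
have [->|ne] := eqVneq (clamp z') (clamp z); first by rewrite !subrr normr0 mulr0.
have lt : clamp z < clamp z' by rewrite lt_neqAle eq_sym ne -subr_ge0.
have [xi /andP[x1 x2] ->] := increment Dx a1 lt b2.
rewrite normrM (ger0_norm c1) ler_wpM2r// cC//; apply/layerP; rewrite init_pt final_pt; split => //.
by apply/andP; split; lra.
Qed.

Let B_le y : `|B y| <= C.
Proof.
have [Qy|nQ] := pselect (Q y); last by rewrite /B restrict_out// normr0 ltW.
have /layerP[Dy /andP[y1 y2]] := Qy.
have := @B_lip (init y) (final y) (- H) (ltW y2); rewrite pt_init_final (_ : B (pt _ _) = 0); last first.
  by rewrite /B restrict_out// => /layerP[_]; rewrite final_pt; lra.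
rewrite sub0r normrN => /le_trans; apply; rewrite -[leRHS]mulr1 ler_pM2l//; lra.
Qed.

Let mB : measurable_fun setT B.
Proof. by apply/(measurable_restrictT _ mQ); exact: within_continuous_measurable. Qed.

Let mc : measurable_fun Q c. Proof. exact: within_continuous_measurable. Qed.

Let mcQ : measurable_fun setT (c \_ Q).
Proof. exact/(measurable_restrictT _ mQ). Qed.

Let cQ_le y : `|(c \_ Q) y| <= C.
Proof.
by have [Qy|nQ] := pselect (Q y); [rewrite restrict_in// cC|rewrite restrict_out// normr0 ltW].
Qed.

Let near_c P e : Q P -> 0 < e -> exists2 r, 0 < r & forall z, ball P r z -> Q z /\ `|c z - c P| < e.
Proof.
move=> QP e0; have := (within_continuousP _ _).1 cc P QP _ (nbhsx_ballx (c P) e e0).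
move=> /nbhs_ballP[r /= r0 hr]; have /nbhs_ballP[r' /= r'0 hr'] := oQ QP.
exists (Num.min r r'); first by rewrite lt_min r0.
move=> z Pz; have Qz : Q z by apply: hr'; apply: le_ball Pz; rewrite ge_min lexx orbT.
split => //; rewrite distrC; apply: hr => //; apply: le_ball Pz.
by rewrite ge_min lexx.
Qed.

Let m : R := - H - 2^-1.

Section shrunk.
Variables (chi : 'rV[R]_n -> R) (lam : R).
Hypotheses (tchi : test_function D chi) (chi01 : forall x, 0 <= chi x <= 1) (lam1 : 1 < lam) (lam2 : lam <= 2).

(** Heights are dilated by [lam > 1] about the middle [m] of the layer, so [f] is a copy of the
    extended [beta] squeezed away from both faces, and cut off in [x] by [chi]. *)
Let sh y : 'rV[R]_(n + 1) := pt (init y) (m + lam * (final y - m)).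

Let f y : R := chi (init y) * B (sh y).
Definition shrunk_derivative y : R := lam * (chi (init y) * (c \_ Q) (sh y)).
Let g := shrunk_derivative.

Let sh_iz y t : sh (y + t *: e_ iz) = pt (init y) (final (sh y) + lam * t).
Proof. by rewrite /sh init_addr final_addr final_pt; congr pt; ring. Qed.

Let msh : measurable_fun setT sh.
Proof.
apply: (measurableT_comp (@measurable_pt R n) (f := fun p : 'rV[R]_n * R => pt p.1 p.2)
  (g := fun y => (init y, m + lam * (final y - m)))).
apply: measurable_fun_pair; first exact: measurable_init.
apply: measurable_funD; first exact: measurable_cst.
apply: measurable_funM; first exact: measurable_cst.
by apply: measurable_funB; [exact: measurable_final|exact: measurable_cst].
Qed.

Let mchi : measurable_fun setT (chi \o @init R n).
Proof. exact: measurableT_comp (test_function_measurable tchi) (@measurable_init R n). Qed.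

Let mf : measurable_fun setT f.
Proof. apply: measurable_funM; [exact: mchi|exact: measurableT_comp mB msh]. Qed.

Lemma shrunk_derivative_measurable : measurable_fun setT shrunk_derivative.
Proof.
apply: measurable_funM; first exact: measurable_cst.
by apply: measurable_funM; [exact: mchi|exact: measurableT_comp mcQ msh].
Qed.

Let chi_le x : `|chi x| <= 1. Proof. by have /andP[a b] := chi01 x; rewrite ger0_norm. Qed.

Let f_le y : `|f y| <= C.
Proof. by rewrite normrM -[leRHS]mul1r; apply: ler_pM => //; exact: B_le. Qed.

Lemma shrunk_derivative_le y : `|shrunk_derivative y| <= 2 * C.
Proof.
rewrite normrM; apply: ler_pM => //; first by rewrite ger0_norm// (le_trans ler01)// ltW.
by rewrite normrM -[leRHS]mul1r; apply: ler_pM => //; exact: cQ_le.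
Qed.

Let f_lip y t : 0 < t -> `|f (y + t *: e_ iz) - f y| <= 2 * C * t.
Proof.
move=> t0; rewrite /f init_addr sh_iz -mulrBr normrM.
have l0 : 0 <= lam * t by rewrite mulr_ge0 ?(ltW t0)// (le_trans ler01)// ltW.
have -> : sh y = pt (init y) (final (sh y)) by rewrite -{1}(pt_init_final (sh y)) /sh init_pt.
have := @B_lip (init y) (final (sh y)) (final (sh y) + lam * t).
rewrite lerDl => /(_ l0); rewrite final_pt (addrC _ (lam * t)) addrK => h1.
rewrite -[leRHS]mul1r; apply: ler_pM => //; apply: le_trans h1 _.
by rewrite (mulrC 2) -mulrA ler_pM2l// ler_pM2r.
Qed.

Let continuous_sh : continuous sh.
Proof.
move=> y; apply: continuous_pt; first exact: continuous_init.
have ca : continuous (fun s : R => m + lam * (s - m)).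
  move=> s; apply: cvgD; first exact: cvg_cst.
  by apply: cvgMr; apply: cvgB; [exact: cvg_id|exact: cvg_cst].
exact: (@continuous_comp _ _ _ (@final R n) (fun s : R => m + lam * (s - m)) y (@continuous_final _ _ y) (ca _)).
Qed.

(** The expansion has to hold at all base points [z] near [y] with the slope of [y], as
    [mollify_derive_near] averages over them. The two excluded heights are the kinks of [f], a null
    set. *)
Let f_near y e : D (init y) -> final (sh y) != - H -> final (sh y) != - H - 1 -> 0 < e ->
  exists2 r, 0 < r & forall z t, ball y r z -> 0 < t < r -> `|f (z + t *: e_ iz) - f z - t * g y| <= e * t.
Proof.
move=> Dy n1 n2 e0; have [Qy|nQ] := pselect (Q (sh y)); last first.
  have g0 : g y = 0 by rewrite /g /shrunk_derivative restrict_out// !mulr0.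
  pose U := [set s : R | s < - H - 1 \/ - H < s].
  have oU : open U by apply: openU; [exact: open_lt|exact: open_gt].
  have Uy : U (final (sh y)).
    apply: contrapT => /not_orP[/negP + /negP]; rewrite -!leNgt => a1 a2; apply: nQ; apply/layerP.
    by rewrite init_pt; split => //; rewrite !lt_neqAle a1 a2 n1 eq_sym n2.
  have cf : {for y, continuous (fun y => final (sh y))}.
    by apply: continuous_comp; [exact: continuous_sh|exact: continuous_final].
  have /nbhs_ballP[r /= r0 hr] := cf _ (oU _ Uy).
  have r2 : 0 < r / 2 by rewrite divr_gt0.
  have f0 z : ball y r z -> f z = 0.
    move=> /hr; rewrite /U /= => hz; rewrite /f /B restrict_out ?mulr0// => /layerP[_]; move: hz => [|]; lra.
  exists (r / 2) => // z t yz /andP[t0 tr].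
  rewrite g0 !f0 ?mulr0 ?subrr ?normr0 ?mulr_ge0 ?ltW//.
    by apply: le_ball yz; lra.
  rewrite (splitr r); apply: ball_triangle yz _; apply: ball_basis_vec; rewrite gtr0_norm//.
have eC : 0 < e / (4 * C) by rewrite divr_gt0// mulr_gt0.
have e4 : 0 < e / 4 by rewrite divr_gt0.
have [r1 r10 h1] := near_c Qy e4.
have /nbhs_ballP[r2 /= r20 h2] := continuous_sh (nbhsx_ballx (sh y) r1 r10).
have cchi : {for y, continuous (chi \o @init R n)}.
  by apply: continuous_comp; [exact: continuous_init|exact: test_function_continuous tchi _].
have /nbhs_ballP[r3 /= r30 h3] := cchi _ (nbhsx_ballx (chi (init y)) _ eC).
pose r := Num.min r2 r3; have r0 : 0 < r by rewrite lt_min r20.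
have rr2 : r <= r2 by rewrite ge_min lexx.
have rr3 : r <= r3 by rewrite ge_min lexx orbT.
have gn z : ball y r z -> Q (sh z) /\ `|g z - g y| <= e.
  move=> yz; have [Qz cz] := h1 _ (h2 _ (le_ball rr2 yz)); split => //.
  have hz := h3 _ (le_ball rr3 yz); rewrite /ball /= distrC in hz.
  rewrite /g /shrunk_derivative !restrict_in// -mulrBr normrM.
  have -> : chi (init z) * c (sh z) - chi (init y) * c (sh y) =
     chi (init z) * (c (sh z) - c (sh y)) + (chi (init z) - chi (init y)) * c (sh y) by ring.
  have b1 : `|chi (init z) * (c (sh z) - c (sh y))| <= e / 4.
    by rewrite normrM -[leRHS]mul1r; apply: ler_pM => //; exact: ltW.
  have b2 : `|(chi (init z) - chi (init y)) * c (sh y)| <= e / 4.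
    have -> : e / 4 = e / (4 * C) * C by field; rewrite gt_eqF.
    by rewrite normrM; apply: ler_pM => //; [exact: ltW|exact: cC].
  have -> : e = 2 * (e / 4 + e / 4) by field.
  apply: ler_pM => //; first by rewrite ger0_norm// (le_trans ler01)// ltW.
  by apply: le_trans (ler_normD _ _) _; exact: lerD.
have l0 : 0 < lam by rewrite (lt_trans ltr01).
exists (r / 2) => [|z t yz /andP[t0 tr]]; first by rewrite divr_gt0.
have bz s : 0 <= s <= t -> ball y r (z + s *: e_ iz).
  move=> /andP[s0 st]; rewrite (splitr r); apply: ball_triangle yz _; apply: ball_basis_vec.
  by rewrite ger0_norm//; lra.
have zt : (0 : R) <= 0 <= t by rewrite lexx ltW.
have tt : 0 <= t <= t by rewrite lexx ltW.
have [/layerP[Dz hz] _] := gn _ (bz 0 zt); have [/layerP[_ ht] _] := gn _ (bz t tt).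
rewrite scale0r addr0 in Dz hz; rewrite sh_iz final_pt in ht; rewrite init_pt in Dz.
set s := final (sh z) in hz ht.
have shz : sh z = pt (init z) s by rewrite -{1}(pt_init_final (sh z)) /sh init_pt.
have st : s < s + lam * t by rewrite ltrDl mulr_gt0.
have [xi /andP[x1 x2] E] : exists2 xi, s < xi < s + lam * t &
    beta (pt (init z) (s + lam * t)) - beta (pt (init z) s) = c (pt (init z) xi) * (s + lam * t - s).
  by apply: increment => //; lra.
have in_Q x : s <= x <= s + lam * t -> Q (pt (init z) x).
  by move=> hx; apply/layerP; rewrite init_pt final_pt; split => //; lra.
pose tau := (xi - s) / lam.
have tau_t : 0 <= tau <= t.
  rewrite divr_ge0 ?subr_ge0 ?(ltW x1) ?(ltW l0)//= ler_pdivrMr// mulrC lerBlDl; exact: ltW.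
have [_ gtau] := gn _ (bz tau tau_t).
have -> : f (z + t *: e_ iz) - f z - t * g y = t * (g (z + tau *: e_ iz) - g y).
  rewrite /f init_addr sh_iz shz -/s final_pt -mulrBr /B !restrict_in ?E; last 2 first.
  - by apply: in_Q; rewrite lexx ?andbT ltW.
  - by apply: in_Q; rewrite lexx ?andbT ltW.
  rewrite /g /shrunk_derivative init_addr sh_iz shz final_pt.
  have -> : s + lam * tau = xi by rewrite /tau; field; rewrite gt_eqF.
  rewrite [X in _ * (chi _ * X) - _]restrict_in; last by apply: in_Q; rewrite !ltW.
  by ring.
by rewrite normrM gtr0_norm// mulrC ler_wpM2r// ltW.
Qed.

Lemma shrunk_dense e : 0 < e -> exists b, test_function Q b /\
  rsq mu Q ('D_(e_ iz) b \- shrunk_derivative) < e.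
Proof.
move=> e0; have [_ [K [cK KD chi0]]] := tchi.
pose S := [set y : 'rV[R]_(n + 1) | K (init y) /\ lam * `|final y - m| <= 2^-1].
have l0 : 0 < lam by rewrite (lt_trans ltr01).
have f0 y : ~ S y -> f y = 0.
  move=> nS; rewrite /f; have [Ky|nK] := pselect (K (init y)); last by rewrite chi0// mul0r.
  rewrite /B restrict_out ?mulr0// => /layerP[_]; rewrite final_pt => hz; apply: nS; split => //.
  by rewrite -{1}(gtr0_norm l0) -normrM ler_norml; move: hz; rewrite /m; lra.
have SQ : S `<=` Q.
  move=> y [Ky hy]; apply/layerP; split; first exact: KD.
  have : `|final y - m| < 2^-1.
    have [->|ne] := eqVneq (final y - m) 0; first by rewrite normr0 invr_gt0.
    apply: lt_le_trans hy; rewrite ltr_pMl// normr_gt0//.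
  by rewrite ltr_norml /m; lra.
have cS : compact S.
  apply: (subclosed_compact _ (@compact_box _ _ L)); last by move=> y Sy i; apply: unit_layer_box; exact: SQ.
  have -> : S = (@init R n @^-1` K) `&` ((fun y => lam * `|final y - m|) @^-1` [set s | s <= 2^-1]) by [].
  apply: closedI; apply: closed_comp.
  - by move=> y _; exact: continuous_init.
  - exact: closed_compact_rV.
  - have ca : continuous (fun s : R => lam * `|s - m|).
      move=> s; apply: cvgMr; apply: cvg_norm.
      by apply: cvgB; [exact: cvg_id|exact: cvg_cst].
    move=> y _; exact: (@continuous_comp _ _ _ (@final R n) (fun s : R => lam * `|s - m|) y (@continuous_final _ _ y) (ca _)).
  - exact: closed_le.
have [rho rho0 hrho] := compact_open_ball cS oQ SQ.
pose d k : R := rho / 2 / k.+2%:R.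
have r2 : 0 < rho / 2 by rewrite divr_gt0.
have d0 k : 0 < d k by rewrite divr_gt0.
have drho k : 2 * d k <= rho.
  have : d k <= rho / 2 by rewrite ler_pdivrMr// ler_peMr ?ltW// ltr1n.
  by lra.
have dc : d k @[k --> \oo] --> 0 by exact: cvg_div_nat2.
pose b k := mollify (d k) f.
have tb k : test_function Q (b k).
  apply: (@test_function_mollify _ _ (d k) f C L S) => //.
  - by move=> y i Sy; apply: unit_layer_box; exact: SQ.
  - by move=> y Sy; apply: subset_trans (hrho _ Sy); apply: le_ball.
have db k y : derivable (b k) y (e_ iz) by have [Cb _] := tb k; exact: (Ck_derivable (Cb 1%N)).
have near_cube (y z : 'rV[R]_(n + 1)) k r : d k < r -> (forall l, 0 < z 0 l - y 0 l < d k) -> ball y r z.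
  move=> dr hz; apply/ball_rVE; first exact: lt_trans (d0 k) dr.
  by move=> l; rewrite distrC gtr0_norm; have := hz l; lra.
have mg : measurable_fun Q shrunk_derivative.
  by apply: measurable_funTS; exact: shrunk_derivative_measurable.
have cv : rsq mu Q ('D_(e_ iz) (b k) \- shrunk_derivative) @[k --> \oo] --> 0.
  apply: (rsq_dct mQ (g := cst (4 * C))) => [k||k y Qy|].
  - apply: measurable_funB => //.
    by apply: measurable_funTS; exact: test_function_measurable (test_function_derive iz (tb k)).
  - exact: sqint_cst.
  - have h1 : `|'D_(e_ iz) (b k) y| <= 2 * C.
      rewrite -[X in `|X|]subr0.
      apply: (mollify_derive_near (d0 k) (r := 1) mf f_le (db k y)) => // z hz t /andP[t0 _].
      by rewrite mulr0 subr0; exact: f_lip.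
    have C4 : 0 <= 4 * C by rewrite mulr_ge0// ltW.
    rewrite /= (ger0_norm C4); apply: le_trans (ler_normB _ _) _.
    have := shrunk_derivative_le y; lra.
  - have null (s : R) : {ae mu, forall y : 'rV[R]_(n + 1), final (sh y) != s}.
      exists [set y | final y = m + (s - m) / lam]; split.
      + have -> : [set y : 'rV[R]_(n + 1) | final y = m + (s - m) / lam] = @final R n @^-1` [set m + (s - m) / lam] by [].
        by rewrite -[X in measurable X]setTI; apply: measurable_final.
      + exact: leb_final_null.
      + move=> y /= /negP; rewrite negbK final_pt => /eqP <-.
        by field; rewrite gt_eqF.
    apply: filterS2 (null (- H)) (null (- H - 1)) => y n1 n2 Qy.
    have /layerP[Dy _] := Qy.
    apply/cvgrPdist_le => e1 e10.
    have [r r0 hr] := f_near Dy n1 n2 e10.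
    apply: filterS (cvg0_lt dc r0) => k dr; rewrite sub0r normrN.
    apply: (mollify_derive_near (d0 k) (r := r) mf f_le (db k y)) => // z hz t ht.
    by apply: hr => //; exact: near_cube dr hz.
have [k0 _ hk0] := cvg0_lt cv e0.
by exists (b k0); split => //; exact: (hk0 k0 (leqnn _)).
Qed.

End shrunk.

(* Cut off in [x] and shrunk towards the middle of the layer, the extension of [beta]
   by zero has compact support in the layer and can be mollified. *)
Lemma layer_dense e : 0 < e -> exists b, test_function Q b /\ rsq mu Q ('D_(e_ iz) b \- c) < e.
Proof.
move=> e0; have [chi [tchi chi01 chi1]] := test_function_cutoff oD.
pose lam k : R := 1 + k.+1%:R^-1.
have l1 k : 1 < lam k by rewrite ltrDl invr_gt0.
have l2 k : lam k <= 2.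
  have : k.+1%:R^-1 <= 1 :> R by rewrite invf_le1 ?ltr0n// ler1n.
  by rewrite /lam; move: (k.+1%:R^-1) => x; lra.
have lc : lam k @[k --> \oo] --> (1 : R).
  rewrite -[X in _ --> X]addr0; apply: cvgD; [exact: cvg_cst|exact: cvg_harmonic].
pose g k := shrunk_derivative (chi k) (lam k).
have mg k : measurable_fun Q (g k).
  by apply: measurable_funTS; exact: (shrunk_derivative_measurable _ (tchi k)).
have cv : rsq mu Q (c \- g k) @[k --> \oo] --> 0.
  apply: (rsq_dct mQ (g := cst (4 * C))) => [k||k y Qy|].
  - exact: measurable_funB.
  - exact: sqint_cst.
  - have C4 : 0 <= 4 * C by rewrite mulr_ge0// ltW.
    rewrite /= (ger0_norm C4); apply: le_trans (ler_normB _ _) _.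
    have := shrunk_derivative_le (chi01 k) (l1 k) (l2 k) y; have := cC Qy; rewrite /g; lra.
  - apply: aeW => y Qy; have /layerP[Dy hy] := Qy.
    have [K hK] := chi1 _ Dy.
    apply/cvgrPdist_lt => e1 e10.
    have e2 : 0 < e1 / 2 by rewrite divr_gt0.
    have [r r0 hr] := near_c Qy e2.
    have n1 : \forall k \near \oo, `|lam k - 1| < r.
      by have /cvgrPdist_lt/(_ _ r0) := lc; apply: filterS => k; rewrite distrC.
    have eC : 0 < e1 / (2 * C) by rewrite divr_gt0// mulr_gt0.
    have n2 : \forall k \near \oo, `|lam k - 1| < e1 / (2 * C).
      by have /cvgrPdist_lt/(_ _ eC) := lc; apply: filterS => k; rewrite distrC.
    have n3 : \forall k \near \oo, (K <= k)%N by exists K.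
    apply: filterS3 n1 n2 n3 => k k1 k2 k3.
    rewrite sub0r normrN /= /g /shrunk_derivative hK// mul1r.
    set y' := pt _ _.
    have yy' : ball y r y'.
      rewrite /y' -{1}(pt_init_final y); apply: ball_pt; first exact: ballxx.
      have -> : final y - (m + lam k * (final y - m)) = (lam k - 1) * (m - final y) by ring.
      rewrite normrM; apply: le_lt_trans k1; rewrite -[leRHS]mulr1 ler_wpM2l// ler_norml /m; lra.
    have [Qy' cy'] := hr _ yy'; rewrite restrict_in//.
    have -> : c y - lam k * c y' = (c y - c y') - (lam k - 1) * c y' by ring.
    apply: le_lt_trans (ler_normB _ _) _; rewrite distrC [ltRHS]splitr; apply: ltr_leD => //.
    have -> : e1 / 2 = e1 / (2 * C) * C by field; rewrite gt_eqF.
    by rewrite normrM; apply: ler_pM => //; [exact: ltW|exact: cC].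
have e8 : 0 < e / 8 by rewrite divr_gt0.
have [k _ /(_ k (leqnn _)) /= hk] := cvg0_lt cv e8.
have [b [tb hb]] := shrunk_dense (tchi k) (chi01 k) (l1 k) (l2 k) e8.
exists b; split => //.
have s1 : sqint mu Q ('D_(e_ iz) b).
  exact: test_function_sqint (test_function_derive iz tb).
have s2 : sqint mu Q (g k).
  apply: (@sqint_bounded _ _ _ _ _ mQ _ (2 * C)) => // y _.
  exact: (shrunk_derivative_le (chi01 k) (l1 k) (l2 k)).
have s3 : sqint mu Q c by apply: (@sqint_bounded _ _ _ _ _ mQ _ C).
have hb' : rsq mu Q (g k \- 'D_(e_ iz) b) <= e / 8 by rewrite rsqC ltW.
have hk' : rsq mu Q (g k \- c) <= e / 8 by rewrite rsqC ltW.
by apply: le_lt_trans (rsq_tri_le mQ s1 s3 s2 hb' hk') _; lra.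
Qed.

End layer_density.

Section within_algebra.
Context (R : realType) (N : nat).
Implicit Types (A : set 'rV[R]_N) (f g : 'rV[R]_N -> R).

Lemma continuous_within_add A f g : {within A, continuous f} -> {within A, continuous g} ->
  {within A, continuous (f \+ g)}.
Proof.
move=> cf cg; apply/within_continuousP => x Ax; apply: cvgD;
  [exact: (within_continuousP _ _).1 cf x Ax|exact: (within_continuousP _ _).1 cg x Ax].
Qed.

Lemma continuous_within_sub A f g : {within A, continuous f} -> {within A, continuous g} ->
  {within A, continuous (f \- g)}.
Proof.
move=> cf cg; apply/within_continuousP => x Ax; apply: cvgB;
  [exact: (within_continuousP _ _).1 cf x Ax|exact: (within_continuousP _ _).1 cg x Ax].
Qed.

Lemma continuous_within_mul A f g : {within A, continuous f} -> {within A, continuous g} ->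
  {within A, continuous (f \* g)}.
Proof.
move=> cf cg; apply/within_continuousP => x Ax; apply: cvgM;
  [exact: (within_continuousP _ _).1 cf x Ax|exact: (within_continuousP _ _).1 cg x Ax].
Qed.

Lemma test_function_grad_bounded A f : test_function A f ->
  exists2 K, 0 < K & forall y, `|f y| <= K /\ forall i, `|'D_(basis_vec R i) f y| <= K.
Proof.
move=> tf; have [K0 K00 h0] := test_function_bounded tf.
have /choice[K hK] : forall i, exists K, 0 < K /\ forall y, `|'D_(basis_vec R i) f y| <= K.
  by move=> i; have [K Kp hK] := test_function_bounded (test_function_derive i tf); exists K.
have S0 : 0 <= \sum_i K i by rewrite sumr_ge0// => i _; rewrite ltW//; case: (hK i).
exists (K0 + \sum_i K i) => [|y]; first by rewrite ltr_pwDl.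
split; first by rewrite (le_trans (h0 y))// lerDl.
move=> i; rewrite (le_trans ((hK i).2 y))// (bigD1 i)//= addrCA lerDl addr_ge0 ?(ltW K00)//.
by rewrite sumr_ge0// => k _; rewrite ltW//; case: (hK k).
Qed.

End within_algebra.

(** * Rescaling a layer to unit thickness *)

Section stretch.
Context (R : realType) (n : nat) (H : R).
Local Notation mu := (@leb R (n + 1)).
Local Notation e_ := (@basis_vec R (n + 1)).

Definition stretch (d : R) (y : 'rV[R]_(n + 1)) : 'rV[R]_(n + 1) := pt (init y) (- H + (final y + H) / d).

Definition stretch_factor (d : R) (i : 'I_(n + 1)) : R := if fintype.split i is inl _ then 1 else d^-1.

Lemma stretch_factor_l d j : stretch_factor d (lshift 1 j) = 1.
Proof. by rewrite /stretch_factor (unsplitK (inl j)). Qed.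

Lemma stretch_factor_r d : stretch_factor d (rshift n ord0) = d^-1.
Proof. by rewrite /stretch_factor (unsplitK (inr ord0)). Qed.

Lemma stretch_diag d : stretch d = diag_affine (stretch_factor d)
  (fun i => if fintype.split i is inl _ then 0 else - H + H / d).
Proof.
apply/funext => y; apply/rowP => i; rewrite [RHS]mxE /stretch_factor /stretch -[i]splitK.
case: (fintype.split i) => [j|k] /=.
  by rewrite (unsplitK (inl j)) pt_lshift mul1r addr0 mxE.
rewrite (ord1 k) (unsplitK (inr ord0)) pt_rshift mulrDl mulrC /final mxE.
by ring.
Qed.

Lemma Ck_stretch k d f : Ck k f -> Ck k (f \o stretch d).
Proof. by rewrite stretch_diag; exact: Ck_diag_affine. Qed.

Lemma is_derive_stretch d f y i : derivable f (stretch d y) (e_ i) ->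
  is_derive y (e_ i) (f \o stretch d) (stretch_factor d i * 'D_(e_ i) f (stretch d y)).
Proof. by rewrite stretch_diag => df; exact: is_derive_diag_affine. Qed.

Lemma continuous_stretch d : continuous (stretch d).
Proof. by rewrite stretch_diag; exact: continuous_diag_affine. Qed.

Lemma init_stretch d y : init (stretch d y) = init y. Proof. by rewrite init_pt. Qed.

Lemma layer_stretch (D : set 'rV[R]_n) d y : 0 < d -> layer D H d y <-> layer D H 1 (stretch d y).
Proof.
move=> d0; rewrite !layerP init_stretch final_pt.
have -> : (- H - 1 < - H + (final y + H) / d < - H) = (- H - d < final y < - H).
  rewrite ltrD2l ltr_pdivlMr// mulN1r gtrDl ltr_pdivrMr// mul0r.
  by congr andb; lra.
by [].
Qed.

Lemma rsq_stretch (D : set 'rV[R]_n) d f : open D -> 0 < d -> sqint mu (layer D H 1) f ->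
  sqint mu (layer D H d) (f \o stretch d) /\
  rsq mu (layer D H d) (f \o stretch d) = d * rsq mu (layer D H 1) f.
Proof.
move=> oD d0 fQ.
have ml r : measurable (layer D H r).
  by apply: open_measurable_rV; apply: Omega_open => //; apply: continuous_subspaceT; exact: cst_continuous.
pose F := f \_ (layer D H 1).
have FE : (f \o stretch d) \_ (layer D H d) = F \o stretch d.
  apply/funext => y; have [ly|nl] := pselect (layer D H d y).
    by rewrite restrict_in//= /F restrict_in//; exact/(layer_stretch _ _ d0).
  by rewrite restrict_out//= /F restrict_out// => /(layer_stretch _ _ d0).
have [mf foo] := fQ.
have mF : measurable_fun setT F by exact/(measurable_restrictT _ (ml 1)).
have mF2 : measurable_fun setT (fun y => (F y ^+ 2)%:E).
  exact: measurable_sqr.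
have ms : measurable_fun setT (stretch d).
  apply: (measurableT_comp (@measurable_pt R n) (f := fun p : 'rV[R]_n * R => pt p.1 p.2)
    (g := fun y => (init y, - H + (final y + H) / d))).
  apply: measurable_fun_pair; first exact: measurable_init.
  apply: measurable_funD; first exact: measurable_cst.
  apply: measurable_funM; last exact: measurable_cst.
  by apply: measurable_funD; [exact: measurable_final|exact: measurable_cst].
have mFs : measurable_fun setT (F \o stretch d) by exact: measurableT_comp.
have mFs2 : measurable_fun setT (fun y => ((F \o stretch d) y ^+ 2)%:E).
  exact: measurable_sqr.
have key : (\int[mu]_y ((F \o stretch d) y ^+ 2)%:E = d%:E * \int[mu]_y (F y ^+ 2)%:E)%E.
  rewrite (integral_leb_pt mFs2); last by move=> y; rewrite lee_fin sqr_ge0.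
  rewrite (integral_leb_pt mF2); last by move=> y; rewrite lee_fin sqr_ge0.
  have mG : measurable_fun setT (fun x => \int[@lebesgue_measure R]_z (F (pt x z) ^+ 2)%:E)%E.
    apply: (@measurable_fun_fubini_tonelli_F _ _ _ _ R (@lebesgue_measure R)
      (fun p : 'rV[R]_n * R => (F (pt p.1 p.2) ^+ 2)%:E)).
      by apply: measurable_sqr; exact: measurableT_comp mF (@measurable_pt R n).
    by move=> p; rewrite lee_fin sqr_ge0.
  rewrite -ge0_integralZl//; last 2 first.
  - by move=> x _; apply: integral_ge0 => z _; rewrite lee_fin sqr_ge0.
  - by rewrite lee_fin ltW.
  apply: eq_integral => x _ /=.
  have d1 : 0 < d^-1 by rewrite invr_gt0.
  have mx : measurable_fun setT (fun z : R => (F (pt x z) ^+ 2)%:E).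
    apply: measurable_sqr; apply: (measurableT_comp mF).
    apply: (measurableT_comp (@measurable_pt R n) (f := fun p : 'rV[R]_n * R => pt p.1 p.2) (g := fun z => (x, z))).
    by apply: measurable_fun_pair; [exact: measurable_cst|exact: measurable_id].
  have f0 : (forall z : R, 0 <= (F (pt x z) ^+ 2)%:E)%E by move=> z; rewrite lee_fin sqr_ge0.
  have := ge0_integral_affine (- H + H / d) d1 mx f0 => <-.
  rewrite muleA -EFinM divff ?gt_eqF// mul1e.
  apply: eq_integral => z _; congr ((F _ ^+ 2)%:E).
  by rewrite /stretch init_pt final_pt; congr pt; rewrite mulrDl; ring.
have Foo : (\int[mu]_y (F y ^+ 2)%:E < +oo)%E.
  by have [] := sqint_restrict (ml 1) fQ.
have mfs : measurable_fun (layer D H d) (f \o stretch d).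
  by apply/(measurable_restrictT _ (ml d)); rewrite FE.
have fs : sqint mu (layer D H d) (f \o stretch d).
  split => //.
  have -> : (\int[mu]_(y in layer D H d) ((f \o stretch d) y ^+ 2)%:E = \int[mu]_y ((F \o stretch d) y ^+ 2)%:E)%E.
    rewrite integral_mkcond -FE; apply: eq_integral => y _; rewrite !patchE.
    by case: ifP => // _; rewrite expr0n.
  by rewrite key lte_mul_pinfty// lee_fin ltW.
split => //.
rewrite -(rsq_restrict _ (ml d)) -(rsq_restrict _ (ml 1)) FE.
apply: EFin_inj; rewrite EFinM.
rewrite -(rsqE (sqint_restrict (ml 1) fQ)) -key.
by rewrite -rsqE// -FE; exact: sqint_restrict.
Qed.

End stretch.

Section smooth_step.
Context (R : realType) (n : nat) (H : R).
Local Notation e_ := (@basis_vec R (n + 1)).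

Let above : set 'rV[R]_(n + 1) := [set y | - H - 2^-1 < final y].

(** The one-sided mean at scale [1 / 4] of a jump at [- H - 1 / 2] places the transition between
    [- H - 3 / 4] and [- H - 1 / 2], inside the unit layer and away from both faces. *)
Definition smooth_step : 'rV[R]_(n + 1) -> R := mollify 4^-1 (\1_above).

Let mI : measurable_fun setT (\1_above : 'rV[R]_(n + 1) -> R).
Proof.
apply: measurable_indic; apply: open_measurable_rV; apply: (open_comp _ (@open_gt R (- H - 2^-1))) => y _.
exact: continuous_final.
Qed.

Let I1 y : `|\1_above y| <= 1 :> R.
Proof. by rewrite indicE; case: (_ \in _); rewrite ?normr1 ?normr0. Qed.

Let d0 : 0 < 4^-1 :> R. Proof. by rewrite invr_gt0. Qed.

Lemma Ck_smooth_step k : Ck k smooth_step.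
Proof. exact: Ck_mollify d0 _ _ mI I1 k. Qed.

Lemma smooth_step_le y : `|smooth_step y| <= 1.
Proof. by rewrite /smooth_step; exact: (mollify_le d0 mI I1). Qed.

Let final_cube (y z : 'rV[R]_(n + 1)) : (forall i, 0 < z 0 i - y 0 i < 4^-1) -> 0 < final z - final y < 4^-1.
Proof. by move=> /(_ (rshift n ord0)); rewrite /final !mxE. Qed.

Lemma smooth_step1 y : - H - 2^-1 <= final y -> smooth_step y = 1.
Proof.
move=> hy; apply/eqP; rewrite -subr_eq0 -normr_eq0 eq_le normr_ge0 andbT.
apply: (mollify_near d0 mI I1) => z /final_cube hz.
by rewrite indicE mem_set ?subrr ?normr0//= /above /=; lra.
Qed.

Lemma smooth_step0 y : final y <= - H - 3 / 4 -> smooth_step y = 0.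
Proof.
move=> hy; apply/eqP; rewrite -normr_eq0 eq_le normr_ge0 andbT -[X in `|X|]subr0.
apply: (mollify_near d0 mI I1) => z /final_cube hz.
by rewrite indicE memNset ?subrr ?normr0//= /above /=; lra.
Qed.

Lemma smooth_step_derivable y i : derivable smooth_step y (e_ i).
Proof. exact: (Ck_derivable (Ck_smooth_step 1)). Qed.

Lemma smooth_step_dx y j : 'D_(e_ (lshift 1 j)) smooth_step y = 0.
Proof.
apply/eqP; rewrite -normr_eq0 eq_le normr_ge0 andbT -[X in `|X|]subr0.
have dy : derivable (mollify 4^-1 (\1_above)) y (e_ (lshift 1 j)) by exact: smooth_step_derivable.
apply: (mollify_derive_near d0 (r := 1) mI I1 dy) => // z _ t _.
rewrite !indicE (_ : (z + t *: e_ (lshift 1 j) \in above) = (z \in above)).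
  by rewrite subrr mulr0 subr0 normr0 mul0r.
by apply/idP/idP => /set_mem hz; apply/mem_set; move: hz; rewrite /above /= final_addl.
Qed.

Lemma smooth_step_dz_continuous i : continuous ('D_(e_ i) smooth_step).
Proof. exact: (Ck_continuous (Ck_derive (Ck_smooth_step 1) i)). Qed.

Lemma smooth_step_dz_bounded (L : R) : exists2 K, 0 < K & forall y : 'rV[R]_(n + 1),
  (forall i, `|y 0 i| <= L) -> `|'D_(e_ (rshift n ord0)) smooth_step y| <= K.
Proof.
have c : {within closure setT, continuous ('D_(e_ (rshift n ord0)) smooth_step)}.
  by apply: continuous_subspaceT; exact: smooth_step_dz_continuous.
have [K K0 hK] := within_closure_bounded L c.
by exists K => // y hy; apply: hK => //; exact: subset_closure.
Qed.

End smooth_step.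

(** * Working criteria for the two Gamma-limits *)

Section gamma_bounds.
Context (R : realType) (X : Type) (N : X -> set_system X).
Implicit Types (F : R -> X -> \bar R) (x : X).

Lemma lee_of_lt (x y : \bar R) : (forall c : R, (y < c%:E)%E -> (x <= c%:E)%E) -> (x <= y)%E.
Proof.
move=> hyp; case: y hyp => [r| |] hyp; last 2 first.
- exact: leey.
- case: x hyp => [r| |] hyp //.
    by exfalso; have := hyp (r - 1)%R (ltNyr _); rewrite lee_fin; lra.
  by have := hyp 0 (ltNyr _).
by apply/lee_addgt0Pr => e e0; apply: hyp; rewrite lte_fin ltrDl.
Qed.

Lemma gamma_liminf_le_limsup F x : (gamma_liminf N F x <= gamma_limsup N F x)%E.
Proof.
apply: ge_ereal_sup => _ [U NU <-]; apply: le_ereal_sup_tmp.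
exists (limf_esup (fun d : R => ereal_inf (F d @` U)) (0 : R)^'+); first by exists U.
rewrite limf_einfE limf_esupE; apply: ge_ereal_sup => _ [V FV <-].
apply: le_ereal_inf_tmp => _ [W FW <-].
have [d [Vd Wd]] := @filter_ex _ _ (at_right_proper_filter (0 : R)) _ (filterI FV FW).
apply: (@le_trans _ _ (ereal_inf (F d @` U))).
  by apply: ereal_inf_lbound; exists d.
by apply: ereal_sup_ubound; exists d.
Qed.

(** A quantifier form of the lower bound that extracts no sequence: values below [c] occur for
    arbitrarily small parameters in every neighbourhood. *)
Lemma le_gamma_liminf F x (y : \bar R) :
  (forall c : R, (forall U r, N x U -> 0 < r -> exists d g, [/\ 0 < d < r, U g & (F d g < c%:E)%E]) ->
    (y <= c%:E)%E) -> (y <= gamma_liminf N F x)%E.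
Proof.
move=> hyp; apply: lee_of_lt => c lc; apply: hyp => U r NU r0.
have : (limf_einf (fun d : R => ereal_inf (F d @` U)) (0 : R)^'+ < c%:E)%E.
  by apply: le_lt_trans lc; apply: ereal_sup_ubound; exists U.
rewrite limf_einfE => h1.
pose V := [set d : R | 0 < d < r].
have FV : (0 : R)^'+ V.
  have h2 := nbhs_right_gt (0 : R); have h3 := nbhs_right_lt r0.
  by apply: filterS2 h2 h3 => d d0 dr; rewrite /V /= d0.
have : (ereal_inf ((fun d : R => ereal_inf (F d @` U)) @` V) < c%:E)%E.
  by apply: le_lt_trans h1; apply: ereal_sup_ubound; exists V.
move=> /ereal_inf_lt[_ [d Vd <-] /ereal_inf_lt[_ [g Ug <-] hg]].
by exists d, g.
Qed.

Lemma gamma_limsup_le F x (y : \bar R) :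
  (forall U, N x U -> forall c : R, (y < c%:E)%E ->
    exists2 r, 0 < r & forall d, 0 < d < r -> exists2 g, U g & (F d g <= c%:E)%E) ->
  (gamma_limsup N F x <= y)%E.
Proof.
move=> hyp; apply: ge_ereal_sup => _ [U NU <-]; apply: lee_of_lt => c yc.
have [r r0 hr] := hyp U NU c yc; rewrite limf_esupE.
pose V := [set d : R | 0 < d < r].
have FV : (0 : R)^'+ V.
  have h2 := nbhs_right_gt (0 : R); have h3 := nbhs_right_lt r0.
  by apply: filterS2 h2 h3 => d d0 dr; rewrite /V /= d0.
apply: ge_ereal_inf; exists (ereal_sup ((fun d : R => ereal_inf (F d @` U)) @` V)); first by exists V.
apply: ge_ereal_sup => _ [d Vd <-]; have [g Ug hg] := hr d Vd.
by apply: ge_ereal_inf; exists (F d g) => //; exists g.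
Qed.

End gamma_bounds.

(** Squared, the left side is [(1 + k) * d]. It keeps the remainder in [vertical_energy] bounded. *)
Lemma sqrt_ratio_le (R : rcfType) (k d : R) : 0 < k -> k <= 1 -> 0 < d -> d <= 1 ->
  Num.sqrt ((1 + k) / d) * d <= 2.
Proof.
move=> k0 k1 d0 d1.
rewrite -(@ler_pXn2r _ 2) ?nnegrE ?mulr_ge0 ?sqrtr_ge0 ?(ltW d0)// exprMn sqr_sqrtr; last first.
  by rewrite divr_ge0 ?(ltW d0)// addr_ge0// ltW.
have -> : (1 + k) / d * d ^+ 2 = (1 + k) * d by field; rewrite gt_eqF.
have : (1 + k) * d <= 2 * 1 by apply: ler_pM => //; lra.
by rewrite expr2; lra.
Qed.

(** Bookkeeping for the upper bound: [X] is the trace energy of the approximant, [W] the slope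
    energy in the unit layer, [E1] the energy in [O], [E] the target, [K] the error of order [d] and
    [T] the total for the recovery function. *)
Lemma energy_budget (R : realFieldType) (e k X W E E1 T K : R) : 0 < e -> 0 < k <= 1 ->
  k * X <= e / 16 -> 0 <= W -> W <= (1 + k) * X + e / 16 -> E1 + X < E + e / 2 -> K < e / 4 ->
  T <= E1 + (1 + k) ^+ 2 * W + K -> 2^-1 * T <= 2^-1 * E + e.
Proof.
move=> e0 /andP[k0 k1] kX W0 hW hE hK hT.
have k2 : k * (e / 16) <= e / 16 by rewrite ger_pMl// divr_gt0.
have W1 : k * W <= 3 * (e / 16).
  have h1 := ler_wpM2l (ltW k0) hW; have h2 := ler_wpM2l (ltW k0) kX.
  by apply: le_trans h1 _; rewrite mulrDr mulrDl mul1r mulrDr; lra.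
have W2 : k * (k * W) <= k * W by rewrite ler_piMl// mulr_ge0// ltW.
have E2 : (1 + k) ^+ 2 * W = W + 2 * (k * W) + k * (k * W) by ring.
by move: hT hW; rewrite E2 mulrDl mul1r; lra.
Qed.

(** * Bounds for the Gamma-limit *)

Section fixed_data.
Context (R : realType) (n : nat) (D : set 'rV[R]_n) (H M L s0 : R) (u : 'rV[R]_n -> R).
Context (sigma : 'rV[R]_(n + 1) -> R) (hb h : 'rV[R]_(n + 1 + 1) -> R).
Context (Gb Gh : 'I_(n + 1 + 1) -> 'rV[R]_(n + 1 + 1) -> R) (pu : 'I_n -> 'rV[R]_n -> R).
Hypothesis S : setting D H M L s0 u sigma hb h Gb Gh pu.
Local Notation O := (@Omega R n D H u).
Local Notation Omd := (@Omega_ R n D H u).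
Local Notation mu := (@leb R (n + 1)).
Local Notation nu := (@leb R n).
Local Notation e_ := (@basis_vec R (n + 1)).
Local Notation iz := (rshift n (@ord0 0)).
Local Notation grad f := (fun i => 'D_(basis_vec R i) f).
Local Notation bot := (@bottom_value R n H).
Local Notation OM := (@Omega_M R n D H M).
Local Notation layer := (layer D H).
Local Notation Q := (layer 1).
Local Notation phat := (@smooth_step R n H).
Local Notation stretch := (@stretch R n H).
Local Notation Gd := (@G_ R n D H u sigma hb h M).
Local Notation G0 := (@G R n D H u sigma hb h M).
Implicit Types (theta phi g : 'rV[R]_(n + 1) -> R) (p : 'I_(n + 1) -> 'rV[R]_(n + 1) -> R)
  (t : 'rV[R]_n -> R).

Let oD := st_open S. Let DL := st_box S. Let H0 := st_H S. Let cu := st_cu S.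
Let uH := st_uH S. Let uM := st_uM S. Let HL := st_HL S. Let ML := st_ML S.
Let mD : measurable D. Proof. exact: open_measurable_rV. Qed.
Let cGb i : {within closure (dom_hb D H), continuous (Gb i)}. Proof. exact: (st_cGb S). Qed.
Let Doo : (nu D < +oo)%E. Proof. exact: (base_lty oD DL). Qed.
Let mO : measurable O. Proof. exact: Omega_measurable. Qed.
Let oO : open O. Proof. exact: Omega_open. Qed.
Let Ooo : (mu O < +oo)%E. Proof. exact: (Omega_lty oD DL H0 cu uM HL ML). Qed.

Definition hu_grad (d : R) (i : 'I_(n + 1)) (y : 'rV[R]_(n + 1)) : R :=
  match fintype.split i with
  | inl j => layered_dx H u d Gb Gh pu j y
  | inr _ => layered H u d (fun P => d^-1 * Gb (idx_z n) P) (Gh (idx_z n)) y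
  end.

Lemma hu_grad_l d j y : hu_grad d (lshift 1 j) y = layered_dx H u d Gb Gh pu j y.
Proof. by rewrite /hu_grad (unsplitK (inl j)). Qed.

Lemma hu_grad_r d y :
  hu_grad d iz y = layered H u d (fun P => d^-1 * Gb (idx_z n) P) (Gh (idx_z n)) y.
Proof. by rewrite /hu_grad (unsplitK (inr ord0)). Qed.

(** Above the interface nothing depends on the thickness, so [hu_grad 1] serves as the gradient of
    [hu] on [O]. *)
Lemma hu_grad_main d i y : - H <= final y -> hu_grad d i y = hu_grad 1 i y.
Proof.
move=> yH; rewrite -[i]splitK; case: (fintype.split i) => [j|k] /=.
  by rewrite !hu_grad_l /layered_dx /layered ltNge yH.
by rewrite (ord1 k) !hu_grad_r /layered ltNge yH.
Qed.

Section fixed_delta.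
Variable d : R.
Hypotheses (d0 : 0 < d) (d1 : d <= 1).

Let oOd : open (Omd d). Proof. exact: open_Omega_. Qed.
Let mOd : measurable (Omd d). Proof. exact: open_measurable_rV. Qed.
Let Odoo : (mu (Omd d) < +oo)%E. Proof. exact: (Omega_finite oD DL H0 cu uM HL ML). Qed.

Lemma hu_in_H1 : in_H1 (Omd d) (hu_ H u hb h d) (hu_grad d).
Proof.
rewrite hu_layered; split.
  exact: (layered_sqint oD DL H0 cu uH uM HL ML d0 d1 (st_chb S) (st_ch S)).
move=> i; have -> : hu_grad d i = fun y => hu_grad d i y by [].
rewrite -[i]splitK; case: (fintype.split i) => [j|k] /=.
  have -> : (fun y => hu_grad d (lshift 1 j) y) = layered_dx H u d Gb Gh pu j.
    by apply/funext => y; rewrite hu_grad_l.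
  exact: (is_weak_pderiv_layered_x oD DL H0 cu uH uM HL ML d0 d1 (st_chb S) (st_ch S)
    (st_cGb S) (st_cGh S) (st_dGb S) (st_dGh S) (st_up S)).
rewrite (ord1 k).
have -> : (fun y => hu_grad d iz y) = layered H u d (fun P => d^-1 * Gb (idx_z n) P) (Gh (idx_z n)).
  by apply/funext => y; rewrite hu_grad_r.
exact: (is_weak_pderiv_layered_z oD DL H0 cu uH uM HL ML d0 d1 (st_chb S) (st_ch S)
    (st_cGb S) (st_cGh S) (st_dGb S) (st_dGh S) (st_hbh S)).
Qed.

End fixed_delta.

Lemma hu_main y : O y -> hu u h y = hu_ H u hb h 1 y.
Proof.
move=> [_ /andP[yH _]]; rewrite hu_layered /layered ltNge (ltW yH) /=.
by rewrite /hu /main_pt.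
Qed.

Lemma hu_in_H1_main : in_H1 O (hu u h) (hu_grad 1).
Proof.
have oO1 : open (Omd 1) by exact: open_Omega_.
have [h1 h2] := in_H1S oO1 oO (Omega_sub ler01) (hu_in_H1 ltr01 (lexx 1)).
split; first by apply: eq_sqint h1 => y Oy; rewrite hu_main.
by move=> i; apply: is_weak_pderiv_eq (h2 i) => y Oy; rewrite hu_main.
Qed.

(** Since the two data agree at [z = - H], this is also the increment of [hu_] across the layer, for
    every thickness. *)
Definition contact_gap (x : 'rV[R]_n) : R := hu u h (pt x (- H)) - frak_hu H u hb x.
Definition sqrt_sigma (x : 'rV[R]_n) : R := Num.sqrt (sigma (pt x (- H))).
Local Notation a := contact_gap.
Local Notation w := sqrt_sigma.

Lemma closure_dom_hb_le x (z v : R) : D x -> - H - 1 <= z <= - H -> - H <= v ->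
  closure (dom_hb D H) (pt (pt x z) v).
Proof.
move=> Dx /andP[z1 z2] v1; have [zH|zH] := ltP (- H - 1) z.
  by apply: closure_dom_hb => //; rewrite zH.
have -> : z = - H - 1 by apply/eqP; rewrite eq_le zH z1.
rewrite ((closure_id _).1 (@closed_closure _ (dom_hb D H))).
apply: (@closure_ray _ _ _ _ (pt (pt 0 1) 0) 1) => // s /andP[s0' s1].
rewrite 2!pt_addZ !scaler0 addr0 mulr0 addr0 mulr1.
by apply: closure_dom_hb => //; lra.
Qed.

Lemma trace_measurable (F : 'rV[R]_(n + 1 + 1) -> R) (B : set 'rV[R]_(n + 1 + 1)) (z : R) :
  {within closure B, continuous F} -> (forall x, D x -> closure B (pt (pt x z) (u x))) ->
  - H - 1 <= z <= M -> sqint nu D (fun x => F (pt (pt x z) (u x))).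
Proof.
move=> cF DB hz; have [C C0 hC] := within_closure_bounded L cF.
apply: (@sqint_bounded _ _ _ _ _ mD _ C) => //.
  apply: within_continuous_measurable => //; apply/within_continuousP => x Dx V /nbhs_ballP[e /= e0 eV].
  have [r r0 hr] := within_closure_near cF (DB _ Dx) e0.
  have /nbhs_ballP[r' /= r'0 h'] := continuous_at_u oD cu Dx (nbhsx_ballx (u x) r r0).
  apply/nbhs_ballP; exists (Num.min r r'); first by rewrite /= lt_min r0.
  move=> x' xx' Dx'; apply: eV; rewrite /ball /= distrC; apply: hr; first exact: DB.
  apply: ball_pt; last by apply: h'; apply: le_ball xx'; rewrite ge_min lexx orbT.
  apply: ball_pt; last by rewrite subrr normr0.
  by apply: le_ball xx'; rewrite ge_min lexx.
move=> x Dx; apply: hC; first exact: DB.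
apply: (pt_box DL H0 HL ML) => //; rewrite uH//=; apply: le_trans (uM Dx) _.
by rewrite gerBl ltW.
Qed.

Lemma M_ge : D !=set0 -> 0 <= M.
Proof. by move=> [x Dx]; have := uH Dx; have := uM Dx; lra. Qed.

Lemma contact_gap_sqint : sqint nu D a.
Proof.
have [Dn|/set0P/negP/negPn/eqP D0] := pselect (D !=set0); last first.
  apply: (@sqint_bounded _ _ _ _ _ mD _ 0) => //; first by rewrite D0; exact: measurable_fun_set0.
  by move=> x; rewrite D0.
have M0 := M_ge Dn; move: H0 => h0.
have -> : a = (fun x => h (pt (pt x (- H)) (u x))) \- (fun x => hb (pt (pt x (- H - 1)) (u x))).
  by apply/funext => x; rewrite /a /hu /frak_hu init_pt.
apply: sqintB => //.
  apply: (trace_measurable (st_ch S)) => [x Dx|]; last by lra.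
  by apply: closure_dom_h => //; exact: uH.
apply: (trace_measurable (st_chb S)) => [x Dx|]; last by lra.
by apply: closure_dom_hb_le; rewrite ?uH//; lra.
Qed.

Lemma layer_closed_closed : closed (layer_closed D H).
Proof.
have -> : layer_closed D H = (@init R n @^-1` closure D) `&` (@final R n @^-1` `[- H - 1, - H]).
  by apply/seteqP; split => y /=; rewrite in_itv.
apply: closedI; apply: closed_comp => //.
- by move=> y _; exact: continuous_init.
- exact: closed_closure.
- by move=> y _; exact: continuous_final.
- exact: itv_closed.
Qed.

Lemma layer_closed_box y i : layer_closed D H y -> `|y 0 i| <= L.
Proof.
move=> [cy hz]; rewrite -(pt_init_final y); apply: norm_pt_le.
  move=> j; have cB : closed [set x : 'rV[R]_n | forall i, `|x 0 i| <= L].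
    by apply: closed_compact_rV; exact: compact_box.
  have DB : D `<=` [set x : 'rV[R]_n | forall i, `|x 0 i| <= L] by move=> x Dx k; exact: DL.
  by have := cB _ (closure_subset DB cy).
by move: H0 HL => h1 h2; rewrite ler_norml; lra.
Qed.

Lemma sigma_bounded : exists2 C, 1 <= C & forall y, layer_closed D H y -> 0 <= sigma y <= C.
Proof.
have cs : {within closure (layer_closed D H), continuous sigma}.
  by rewrite -((closure_id _).1 layer_closed_closed); exact: (st_csigma S).
have [C C0 hC] := within_closure_bounded L cs.
exists (Num.max 1 C) => [|y ly]; first by rewrite le_max lexx.
rewrite (le_trans (ltW (st_s0 S)) (st_sigma S ly)) le_max; apply/orP; right.
rewrite (le_trans (ler_norm _))// hC//; first exact: subset_closure.
by move=> i; exact: layer_closed_box.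
Qed.

Lemma layer_closed_pt x (z : R) : D x -> - H - 1 <= z <= - H -> layer_closed D H (pt x z).
Proof. by move=> Dx hz; split; rewrite ?init_pt ?final_pt//; exact: subset_closure. Qed.

(** Uniformity in [x] comes from compactness of [closure D]; it is what lets [sigma] in the layer be
    replaced by its value at the interface. *)
Lemma sigma_near eta : 0 < eta -> exists2 r, 0 < r <= 1 & forall x (z : R), D x -> - H - r <= z <= - H ->
  `|sigma (pt x z) - sigma (pt x (- H))| <= eta.
Proof.
move=> eta0; have cK : compact (closure D).
  apply: (subclosed_compact _ (@compact_box _ _ L)); first exact: closed_closure.
  have cB : closed [set x : 'rV[R]_n | forall i, `|x 0 i| <= L].
    by apply: closed_compact_rV; exact: compact_box.
  have DB : D `<=` [set x : 'rV[R]_n | forall i, `|x 0 i| <= L] by move=> x Dx k; exact: DL.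
  by move=> x cx; have := cB _ (closure_subset DB cx).
have cs : {within closure (layer_closed D H), continuous sigma}.
  by rewrite -((closure_id _).1 layer_closed_closed); exact: (st_csigma S).
pose P (r : R) (x : 'rV[R]_n) := closure D x ->
  forall z, - H - r <= z <= - H -> `|sigma (pt x z) - sigma (pt x (- H))| <= eta.
have := (compact_near_coveringP (closure D)).1 cK R (0 : R)^'+ P _.
have cl x (z : R) : closure D x -> - H - 1 <= z <= - H -> layer_closed D H (pt x z).
  by move=> cx hz; split; rewrite ?init_pt ?final_pt.
have cov x : closure D x -> \forall x' \near x & i \near (0 : R)^'+, P i x'.
  move=> cx; have e2 : 0 < eta / 2 by rewrite divr_gt0.
  have lx : closure (layer_closed D H) (pt x (- H)).
    by apply: subset_closure; apply: cl => //; lra.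
  have [r r0 hr] := within_closure_near cs lx e2.
  exists (ball x r, [set i : R | i < Num.min r 1]).
    split => /=; first exact: nbhsx_ballx.
    by apply: nbhs_right_lt; rewrite lt_min r0 ltr01.
  move=> [x' i] [/= bx]; rewrite lt_min => /andP[ir i1] cx' z /andP[z1 z2].
  have hz : - H - 1 <= z <= - H by rewrite z2 andbT; lra.
  have h1 : `|sigma (pt x' z) - sigma (pt x (- H))| < eta / 2.
    apply: hr; first by apply: subset_closure; exact: cl.
    by apply: ball_pt => //; rewrite ger0_norm; lra.
  have h2 : `|sigma (pt x' (- H)) - sigma (pt x (- H))| < eta / 2.
    apply: hr; first by apply: subset_closure; apply: cl => //; lra.
    by apply: ball_pt => //; rewrite subrr normr0.
  by move: h1 h2; rewrite !ltr_norml ler_norml; lra.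
move=> /(_ _ cov) h1; have h2 := nbhs_right_lt (@ltr01 R); have h3 := nbhs_right_gt (0 : R).
have [r [hr [r1 r0]]] := @filter_ex _ _ (at_right_proper_filter (0 : R)) _ (filterI h1 (filterI h2 h3)).
exists r; first by rewrite r0 ltW.
by move=> x z Dx hz; apply: hr => //; exact: subset_closure.
Qed.

Lemma sigma_E d y : sigma_ H sigma d y = if final y < - H then d * sigma y else 1.
Proof. by []. Qed.

Lemma layer_in_closed d y : d <= 1 -> Omd d y -> final y < - H -> layer_closed D H y.
Proof.
move=> d1 [Dy /andP[y1 y2]] yH; split; first exact: subset_closure.
by apply/andP; split; lra.
Qed.

(** Twice [Gd] for a function with gradient [p]; see [integral_layer_energy]. *)
Definition layer_energy d p : R :=
  \sum_i rsq mu (Omd d) (fun y => Num.sqrt (sigma_ H sigma d y) * (p i y + hu_grad d i y)).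

Lemma layer_energy_ge0 d p : 0 <= layer_energy d p.
Proof. by apply: sumr_ge0 => i _; exact: rsq_ge0. Qed.

Section weights.
Variable d : R.
Hypotheses (d0 : 0 < d) (d1 : d <= 1).

Let oOd : open (Omd d). Proof. exact: open_Omega_. Qed.
Let mOd : measurable (Omd d). Proof. exact: open_measurable_rV. Qed.
Let Odoo : (mu (Omd d) < +oo)%E. Proof. exact: (Omega_finite oD DL H0 cu uM HL ML). Qed.

Lemma sigma__bounded : exists2 C, 0 < C & forall y, Omd d y -> 0 <= sigma_ H sigma d y <= C.
Proof.
have [C C1 hC] := sigma_bounded; exists C; first exact: lt_le_trans C1.
move=> y Oy; rewrite sigma_E; case: ltP => yH; last by rewrite ler01.
have /andP[s1 s2] := hC _ (layer_in_closed d1 Oy yH).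
by rewrite mulr_ge0 ?(ltW d0)//= (le_trans _ s2)// ler_piMl.
Qed.

Lemma sigma__measurable : measurable_fun (Omd d) (sigma_ H sigma d).
Proof.
pose B := [set y : 'rV[R]_(n + 1) | final y < - H].
have mB : measurable B.
  apply: open_measurable_rV; apply: (open_comp _ (@open_lt R (- H))) => y _.
  exact: continuous_final.
have mB' : measurable (~` B) by exact: measurableC.
rewrite (_ : Omd d = (Omd d `&` B) `|` (Omd d `&` ~` B)); last by rewrite -setIUr setUv setIT.
have m1 : measurable (Omd d `&` B) by exact: measurableI.
have m2 : measurable (Omd d `&` ~` B) by exact: measurableI.
apply/measurable_funU => //; split.
  apply: (@eq_measurable_fun _ _ _ _ _ (fun y => d * sigma y)).
    by move=> y /set_mem[_ yB]; rewrite sigma_E yB.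
  apply: measurable_funM => //; apply: within_continuous_measurable => //.
  by apply: continuous_subspaceW (st_csigma S) => y [Oy yB]; exact: layer_in_closed Oy yB.
apply: (@eq_measurable_fun _ _ _ _ _ (cst (1 : R))); last exact: measurable_cst.
by move=> y /set_mem[_ yB]; rewrite sigma_E ifN//; exact/negP.
Qed.

Lemma integral_layer_energy theta p : in_H1 (Omd d) theta p ->
  (\int[mu]_(y in Omd d) (sigma_ H sigma d y * grad_sq (Omd d) (theta \+ hu_ H u hb h d)%R y)%:E =
   (layer_energy d p)%:E)%E.
Proof.
move=> tp; have [C C0 hC] := sigma__bounded.
have [_ hw] := in_H1D mOd tp (hu_in_H1 d0 d1).
exact: (integral_grad_sq oOd Odoo sigma__measurable hC hw).
Qed.

Lemma weighted_sqint g : sqint mu (Omd d) g ->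
  sqint mu (Omd d) (fun y => Num.sqrt (sigma_ H sigma d y) * g y).
Proof. by move=> gO; have [C C0 hC] := sigma__bounded; exact: (sqint_weight mOd sigma__measurable hC gO). Qed.

Lemma weighted_rsq C g : 0 <= C -> (forall y, Omd d y -> 0 <= sigma_ H sigma d y <= C) -> sqint mu (Omd d) g ->
  rsq mu (Omd d) (fun y => Num.sqrt (sigma_ H sigma d y) * g y) <= C * rsq mu (Omd d) g.
Proof.
move=> C0 hC gO; have [w1 _] := weighted_sqint gO.
rewrite -{1}(sqr_sqrtr C0) -rsqZ//; apply: (le_rsq mOd w1) => [|y Oy]; first exact: sqintZ.
have /andP[s1 s2] := hC y Oy.
by rewrite !exprMn !sqr_sqrtr// ler_wpM2r// sqr_ge0.
Qed.

(** The weight [k] of Young's inequality is fixed first, so that [k * E] costs at most half of [e];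
    the test function is then taken close enough for the term multiplied by [1 + k^-1]. *)
Lemma layer_energy_approx theta p e : H10_data (Omd d) theta p -> 0 < e ->
  exists phi, [/\ test_function (Omd d) phi, rsq mu (Omd d) (theta \- phi) < e &
    layer_energy d (grad phi) < layer_energy d p + e].
Proof.
move=> [tp happ] e0; have [C C0 hC] := sigma__bounded.
have E0 := layer_energy_ge0 d p; set E := layer_energy d p in E0 *.
pose k := e / 2 / (E + 1); have k0 : 0 < k by rewrite !divr_gt0// ltr_pwDr.
have kE : k * E < e / 2.
  rewrite /k -mulrA gtr_pMr ?divr_gt0// mulrC ltr_pdivrMr ?ltr_pwDr//; lra.
pose r := Num.min e (e / 2 / ((1 + k^-1) * C)).
have k1 : 0 < 1 + k^-1 by rewrite addr_gt0// invr_gt0.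
have r0 : 0 < r by rewrite lt_min e0 !divr_gt0// mulr_gt0.
have [phi [tphi hphi]] := happ r r0; exists phi.
have hp i := in_H1P tp mOd i.
have hg i : sqint mu (Omd d) ('D_(e_ i) phi).
  exact: (in_H1P (in_H1_test oOd Odoo tphi) mOd i).
have hq i := in_H1P (hu_in_H1 d0 d1) mOd i.
split => //.
  apply: (@le_lt_trans _ _ (H1dist (Omd d) theta p phi (grad phi))).
    by rewrite /H1dist lerDl sumr_ge0// => i _; exact: rsq_ge0.
  by apply: lt_le_trans hphi _; rewrite ge_min lexx.
have step i : rsq mu (Omd d) (fun y => Num.sqrt (sigma_ H sigma d y) * ('D_(e_ i) phi y + hu_grad d i y)) <=
    (1 + k) * rsq mu (Omd d) (fun y => Num.sqrt (sigma_ H sigma d y) * (p i y + hu_grad d i y)) +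
    (1 + k^-1) * C * rsq mu (Omd d) (p i \- 'D_(e_ i) phi).
  have w1 := weighted_sqint (sqintD mOd (hp i) (hq i)).
  have w2 := weighted_sqint (sqintB mOd (hg i) (hp i)).
  rewrite (@eq_rsq _ _ _ mu (Omd d) _
    ((fun y => Num.sqrt (sigma_ H sigma d y) * (p i y + hu_grad d i y)) \+
     (fun y => Num.sqrt (sigma_ H sigma d y) * ('D_(e_ i) phi y - p i y)))); last first.
    by move=> y _ /=; ring.
  apply: le_trans (rsqD_le mOd k0 w1 w2) _; rewrite lerD2l -mulrA ler_pM2l// rsqC.
  exact: (weighted_rsq (ltW C0) hC (sqintB mOd (hg i) (hp i))).
have : layer_energy d (grad phi) <= (1 + k) * E + (1 + k^-1) * C * \sum_i rsq mu (Omd d) (p i \- 'D_(e_ i) phi).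
  by rewrite /E /layer_energy !mulr_sumr -big_split /=; apply: ler_sum => i _; exact: step.
move/le_lt_trans; apply.
have sr : \sum_i rsq mu (Omd d) (p i \- 'D_(e_ i) phi) < r.
  by apply: le_lt_trans hphi; rewrite /H1dist lerDr rsq_ge0.
have : (1 + k^-1) * C * \sum_i rsq mu (Omd d) (p i \- 'D_(e_ i) phi) < e / 2.
  rewrite mulrC -ltr_pdivlMr ?mulr_gt0//; apply: lt_le_trans sr _.
  by rewrite ge_min lexx orbT.
by lra.
Qed.

End weights.

(** * Lower bound for the energy of the thin layer *)

Section layer.
Variable d : R.
Hypotheses (d0 : 0 < d) (d1 : d <= 1).

Let oOd : open (Omd d). Proof. exact: open_Omega_. Qed.
Let mOd : measurable (Omd d). Proof. exact: open_measurable_rV. Qed.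

Lemma layer_sub : layer d `<=` Omd d.
Proof.
move=> y /layerP[Dy /andP[y1 y2]]; split => //.
by rewrite y1 (lt_le_trans y2)// uH.
Qed.

Lemma open_layer : open (layer d).
Proof. by apply: Omega_open => //; exact: cst_continuous. Qed.

Lemma layer_disjoint : [disjoint O & layer d].
Proof.
apply/disj_setPS => y [[_ /andP[y1 _]] /layerP[_ /andP[_ y2]]].
by move: (lt_trans y1 y2); rewrite ltxx.
Qed.

Lemma layer_pt_line x (z : R) : layer_pt H u d (pt x z) = pt (pt x (- H + (z + H) / d)) (u x).
Proof. by rewrite /layer_pt init_pt final_pt. Qed.

Lemma is_derive_hb x (z : R) : D x -> - H - d < z < - H ->
  is_derive z (1 : R) (fun z => hb (layer_pt H u d (pt x z))) (d^-1 * Gb (idx_z n) (layer_pt H u d (pt x z))).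
Proof.
move=> Dx hz; have hl := layer_z d0 hz; set zz := - H + (z + H) / d in hl.
pose P := pt (pt x zz) (u x).
have dP : is_derive P (basis_vec R (idx_z n)) hb (Gb (idx_z n) P).
  pose r := Num.min (- H - zz) (zz + H + 1).
  have r0 : 0 < r by rewrite lt_min; apply/andP; split; lra.
  have rr1 : r <= - H - zz by rewrite ge_min lexx.
  have rr2 : r <= zz + H + 1 by rewrite ge_min lexx orbT.
  refine (@is_derive_boundary _ _ (dom_hb D H) hb (Gb (idx_z n)) P (basis_vec R (idx_z n)) (pt (pt 0 0) 1) r r0 (st_chb S) (cGb (i := idx_z n)) _ _ _).
  - by move=> y Dy; have [] := st_dGb S (idx_z n) Dy.
  - by move=> y Dy; have [_ ->] := st_dGb S (idx_z n) Dy.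
  move=> t s; rewrite ltr_norml => /andP[t1 t2] /andP[s1 s2].
  rewrite /P -move_z 2!pt_addZ scaler0 mulr0 !addr0 mulr1.
  split; rewrite /dom_hb /= ?init_pt ?final_pt//; first by lra.
  by have := uH Dx; lra.
have -> : (fun z => hb (layer_pt H u d (pt x z))) =
    (fun s => hb (pt (pt x (- H + H / d)) (u x) + s *: basis_vec R (idx_z n))) \o (fun z => d^-1 * z).
  apply/funext => s /=; rewrite layer_pt_line -move_z; congr (hb (pt (pt x _) _)).
  by rewrite mulrDl; ring.
have PE : P = pt (pt x (- H + H / d)) (u x) + (d^-1 * z) *: basis_vec R (idx_z n).
  by rewrite -move_z /P /zz; congr (pt (pt x _) _); rewrite mulrDl mulrC; ring.
have [dd dE] := dP.
rewrite layer_pt_line -/zz -/P -dE PE; rewrite PE in dd.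
have h1 := is_derive_line dd.
have h2 : is_derive z (1 : R) (fun z : R => d^-1 * z) d^-1.
  have := @is_deriveM R (R : normedModType R) (cst d^-1) id z 1 0 1 (is_derive_cst _ _ _) (is_derive_id _ _).
  by rewrite /= scaler0 addr0 /GRing.scale /= mulr1.
rewrite (mulrC d^-1).
exact: (@is_derive_comp_direction R (R : normedModType R) _ _ z 1 _ _ h2 h1).
Qed.

(* On each vertical segment of the layer the increment of [phi + hu_] is
   [bot phi + contact_gap]; Cauchy-Schwarz bounds it by the integral of the derivative. *)
Lemma layer_slice phi eta x : test_function (Omd d) phi -> D x -> eta <= 1 ->
  (forall z, - H - d < z < - H -> (1 - eta) * sigma (pt x (- H)) <= sigma (pt x z)) ->
  (((1 - eta) * (w x * (bot phi x + a x)) ^+ 2)%:E <=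
   \int[@lebesgue_measure R]_(z in `](- (H + d))%R, (- H)%R[)
     ((Num.sqrt (sigma_ H sigma d (pt x z)) *
       ('D_(e_ iz) phi (pt x z) + hu_grad d iz (pt x z))) ^+ 2)%:E)%E.
Proof.
move=> tphi Dx eta1 hs.
have [Cphi _] := tphi.
have ab : - (H + d) < - H by rewrite ltrN2 ltrDl.
pose F (z : R) : R := phi (pt x z) + hb (layer_pt H u d (pt x z)).
pose f (z : R) : R := 'D_(e_ iz) phi (pt x z) + d^-1 * Gb (idx_z n) (layer_pt H u d (pt x z)).
have zcl (z : R) : z \in `[(- (H + d)), (- H)] -> closure (dom_hb D H) (layer_pt H u d (pt x z)).
  rewrite in_itv /= layer_pt_line => /andP[z1 z2]; apply: closure_dom_hb_le; rewrite ?uH//.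
  apply/andP; split; last by rewrite gerDl ler_pdivrMr// mul0r; lra.
  by rewrite lerD2l ler_pdivlMr//; lra.
have clay : continuous (fun z : R => layer_pt H u d (pt x z)).
  move=> z; have -> : (fun z : R => layer_pt H u d (pt x z)) = fun z => pt (pt x (- H + (z + H) / d)) (u x).
    by apply/funext => s; rewrite layer_pt_line.
  have ca : {for z, continuous (fun z : R => - H + (z + H) / d)}.
    apply: cvgD; first exact: cvg_cst.
    by apply: cvgMl; apply: cvgD; [exact: cvg_id|exact: cvg_cst].
  have cx : {for z, continuous (fun=> x : 'rV[R]_n)} by exact: cvg_cst.
  have c1 := continuous_pt cx ca.
  have cw : {for z, continuous (fun=> u x : R)} by exact: cvg_cst.
  exact: continuous_pt c1 cw.
have within_hb (G : 'rV[R]_(n + 1 + 1) -> R) : {within closure (dom_hb D H), continuous G} ->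
    {within `[(- (H + d)), (- H)], continuous (fun z => G (layer_pt H u d (pt x z)))}.
  by move=> cG; apply: (@within_comp_line _ _ _ _ (fun z : R => layer_pt H u d (pt x z)) _ cG) => z hz; [exact: zcl|exact: clay].
have line (g : 'rV[R]_(n + 1) -> R) : continuous g -> {within `[(- (H + d)), (- H)], continuous (fun z => g (pt x z))}.
  move=> cg; apply: continuous_subspaceT => z; apply: continuous_comp; last exact: cg.
  exact: continuous_pt_line.
have cF : {within `[(- (H + d)), (- H)], continuous F}.
  move=> z; apply: cvgD; first exact: line (test_function_continuous tphi) z.
  exact: within_hb (st_chb S) z.
have cf : {within `[(- (H + d)), (- H)], continuous f}.
  move=> z; apply: cvgD; first exact: line (test_function_continuous (test_function_derive iz tphi)) z.
  apply: cvgMr; exact: within_hb (cGb (i := idx_z n)) z.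
have dF z : z \in `](- (H + d)), (- H)[ -> is_derive z (1 : R) F (f z).
  rewrite in_itv /= opprD => hz; apply: is_deriveD; last exact: is_derive_hb.
  have ptE s : pt x s = pt x 0 + s *: basis_vec R iz by rewrite -pt_addr add0r.
  have C1 : Ck 1 phi by exact: Cphi.
  have dz : derivable phi (pt x z) (e_ iz) := @Ck_derivable _ _ _ _ C1 iz (pt x z).
  have -> : (fun z => phi (pt x z)) = fun s => phi (pt x 0 + s *: basis_vec R iz).
    by apply/funext => s; rewrite ptE.
  by move: dz; rewrite (ptE z) => dz; exact: is_derive_line.
have := sqr_increment_le ab cf cF dF.
have -> : - H - - (H + d) = d by ring.
(* At the lower end [phi] vanishes, that point being outside [Omd d]; at the upper end [st_hbh]
   exchanges [hb] for [h]. *)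
have -> : F (- H) - F (- (H + d)) = bot phi x + a x.
  rewrite /F !layer_pt_line addNr mul0r addr0 /bottom_value /contact_gap /hu /frak_hu init_pt.
  rewrite (st_hbh S Dx (uH Dx)) (@test_function_out _ _ _ phi (pt x (- (H + d))) tphi); last first.
    by rewrite /Omega_ /= final_pt opprD => -[_ /andP[]]; rewrite ltxx.
  have -> : - (H + d) + H = - d by ring.
  by rewrite mulNr divff ?gt_eqF// add0r addrA.
move=> incr; have sf := within_sqint_itv cf.
have lc (z : R) : - (H + d) <= z -> z <= - H -> layer_closed D H (pt x z).
  by move: d1 => hd z1 z2; apply: layer_closed_pt => //; lra.
have s1 : 0 <= 1 - eta by rewrite subr_ge0.
have sH : 0 <= sigma (pt x (- H)).
  by apply: le_trans (ltW (st_s0 S)) (st_sigma S _); apply: layer_closed_pt => //; lra.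
have mf : measurable_fun `](- (H + d))%R, (- H)%R[ (fun z => (f z ^+ 2)%:E).
  apply: measurable_sqr; case: sf => mf _.
  by apply: measurable_funS mf => //; exact: subset_itv_oo_cc.
have sfE : (\int[@lebesgue_measure R]_(z in `](- (H + d))%R, (- H)%R[) (f z ^+ 2)%:E =
    (rsq (@lebesgue_measure R) `[(- (H + d)), (- H)]%classic f)%:E)%E.
  exact: (etrans (esym (@integral_itv_bndoo _ _ _ _ true false mf)) (rsqE sf)).
have c0 : 0 <= (1 - eta) * sigma (pt x (- H)) * d by rewrite !mulr_ge0// ltW.
(* The length [d] lost in Cauchy-Schwarz is returned by the weight [d * sigma]: this cancellation is
   why the trace term survives with coefficient [sigma] at the interface. *)
apply: (@le_trans _ _ (((1 - eta) * sigma (pt x (- H)) * d)%:E *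
    \int[@lebesgue_measure R]_(z in `](- (H + d))%R, (- H)%R[) (f z ^+ 2)%:E)%E).
  rewrite sfE -EFinM lee_fin exprMn /w sqr_sqrtr// -!mulrA ler_wpM2l// ler_wpM2l//.
have -> : (\int[@lebesgue_measure R]_(z in `](- (H + d))%R, (- H)%R[)
     ((Num.sqrt (sigma_ H sigma d (pt x z)) *
       ('D_(e_ iz) phi (pt x z) + hu_grad d iz (pt x z))) ^+ 2)%:E =
    \int[@lebesgue_measure R]_(z in `](- (H + d))%R, (- H)%R[) (d * sigma (pt x z) * f z ^+ 2)%:E)%E.
  apply: eq_integral => z /set_mem /=; rewrite in_itv /= opprD => hz.
  have [z1 z2] := andP hz.
  rewrite sigma_E final_pt z2 exprMn sqr_sqrtr; last first.
    rewrite mulr_ge0 ?(ltW d0)//; apply: le_trans (ltW (st_s0 S)) (st_sigma S _).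
    by apply: lc; rewrite ?opprD ltW.
  by rewrite hu_grad_r /layered final_pt z2.
rewrite -ge0_integralZl//; last by move=> z _; rewrite lee_fin sqr_ge0.
apply: ge0_le_integral => //.
- by move=> z _; rewrite mule_ge0// lee_fin ?sqr_ge0.
- exact: measurable_funeM.
- apply/measurable_EFinP; apply: measurable_funM; last exact/measurable_EFinP.
  apply: measurable_funM => //.
  apply: (@measurable_funS _ _ _ _ `[(- (H + d)), (- H)]%classic) => //; first exact: subset_itv_oo_cc.
  apply: subspace_continuous_measurable_fun => //.
  have cs : {within closure (layer_closed D H), continuous sigma}.
    by rewrite -((closure_id _).1 layer_closed_closed); exact: (st_csigma S).
  apply: (@within_comp_line _ _ _ _ (pt x) _ cs) => z hz; last exact: continuous_pt_line.
  by apply: subset_closure; move: hz; rewrite /= in_itv /= => /andP[z1 z2]; exact: lc.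
- move=> z /=; rewrite in_itv /= opprD => hz; rewrite lee_fin ler_wpM2r ?sqr_ge0//.
  by rewrite mulrC ler_wpM2l ?(ltW d0)// hs.
Qed.

End layer.
Local Notation energy := (energy D H u (hu_grad 1) a w).

Lemma sqrt_sigma_bounded : exists2 C, 0 < C & forall x, D x -> `|w x| <= C.
Proof.
have [C C1 hC] := sigma_bounded; exists (C + 1); first by rewrite ltr_pwDr// (le_trans ler01).
move=> x Dx; rewrite ger0_norm ?sqrtr_ge0//.
have /andP[s1 s2] : 0 <= sigma (pt x (- H)) <= C by apply: hC; apply: (layer_closed_pt Dx); lra.
rewrite -(@ler_pXn2r _ 2) ?nnegrE ?sqrtr_ge0//; last by rewrite addr_ge0// (le_trans ler01).
rewrite sqr_sqrtr//; apply: le_trans s2 _; rewrite expr2 -[leLHS]mulr1; apply: ler_pM => //; lra.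
Qed.

Lemma sqrt_sigma_measurable : measurable_fun D w.
Proof.
apply: (measurableT_comp (continuous_measurable_fun (@sqrt_continuous R))).
apply: within_continuous_measurable => //.
apply/within_continuousP => x Dx V Vx.
have lx : layer_closed D H (pt x (- H)) by apply: (layer_closed_pt Dx); lra.
have cs : {within closure (layer_closed D H), continuous sigma}.
  by rewrite -((closure_id _).1 layer_closed_closed); exact: (st_csigma S).
move: Vx => /nbhs_ballP[e /= e0 eV].
have [r r0 hr] := within_closure_near cs (subset_closure lx) e0.
apply/nbhs_ballP; exists r => // z xz Dz; apply: eV; rewrite /ball /= distrC; apply: hr.
  by apply: subset_closure; apply: (layer_closed_pt Dz); lra.
by apply: ball_pt => //; rewrite subrr normr0.
Qed.

Let aD : sqint nu D a. Proof. exact: contact_gap_sqint. Qed.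
Let qO i : sqint mu O (hu_grad 1 i). Proof. exact: in_H1P hu_in_H1_main mO i. Qed.

Lemma weighted_trace_sqint t : sqint nu D t -> sqint nu D (fun x => w x * (t x + a x)).
Proof.
move=> tD; have [C C0 hC] := sqrt_sigma_bounded.
by have [] := sqint_mul_bounded mD sqrt_sigma_measurable hC (sqintD mD tD aD).
Qed.

Section layer_inequality.
Variable d : R.
Hypotheses (d0 : 0 < d) (d1 : d <= 1).

Let oOd : open (Omd d). Proof. exact: open_Omega_. Qed.
Let mOd : measurable (Omd d). Proof. exact: open_measurable_rV. Qed.
Let Odoo : (mu (Omd d) < +oo)%E. Proof. exact: (Omega_finite oD DL H0 cu uM HL ML). Qed.
Let mlay : measurable (layer d). Proof. by apply: open_measurable_rV; exact: open_layer d. Qed.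

Lemma test_function_C1_B phi : test_function (Omd d) phi -> C1_B D H u phi.
Proof. move=> tphi; have sub y : Omd d y -> D (init y) /\ final y < u (init y) by move=> [Dy /andP[_ yu]].
exact (@C1_B_test R n D H u oD (Omd d) phi tphi sub). Qed.

Lemma layer_inequality phi eta : test_function (Omd d) phi -> eta <= 1 ->
  (forall x z, D x -> - H - d < z < - H -> (1 - eta) * sigma (pt x (- H)) <= sigma (pt x z)) ->
  (1 - eta) * rsq nu D (fun x => w x * (bot phi x + a x)) <=
  rsq mu (layer d) (fun y => Num.sqrt (sigma_ H sigma d y) * ('D_(e_ iz) phi y + hu_grad d iz y)).
Proof.
move=> tphi eta1 hs.
have bD : sqint nu D (bot phi).
  exact: (bottom_sqint oD DL H0 cu uH uM HL ML (test_function_C1_B tphi)).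
have wD := weighted_trace_sqint bD.
pose F y := Num.sqrt (sigma_ H sigma d y) * ('D_(e_ iz) phi y + hu_grad d iz y).
have FO : sqint mu (Omd d) F.
  apply: (weighted_sqint d0 d1); apply: sqintD => //.
    exact: (in_H1P (in_H1_test oOd Odoo tphi) mOd).
  exact: (in_H1P (hu_in_H1 d0 d1) mOd).
have Fl : sqint mu (layer d) F by apply: sqint_subset FO => //; exact: layer_sub d.
have cc : {within closure D, continuous (fun=> - H : R)}.
  by apply: continuous_subspaceT; exact: cst_continuous.
rewrite -lee_fin (rsq_Omega_fubini oD cc Fl) EFinM -rsqE//.
have s1 : 0 <= 1 - eta by rewrite subr_ge0.
have mw : measurable_fun D (fun x => ((w x * (bot phi x + a x)) ^+ 2)%:E).
  by apply: measurable_sqr; case: wD.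
rewrite -ge0_integralZl//; last by move=> x _; rewrite lee_fin sqr_ge0.
apply: ge0_le_integral => //.
- by move=> x _; rewrite mule_ge0// lee_fin ?sqr_ge0.
- exact: measurable_funeM.
- exact: (Omega_slice_measurable oD cc Fl).
move=> x Dx; rewrite -EFinM; apply: (layer_slice d0 d1 tphi Dx eta1) => z hz.
exact: hs.
Qed.

(** On [O] the weight is 1 and the two energies agree; in the layer only the vertical derivative is
    kept, the horizontal ones being nonnegative contributions. *)
Lemma energy_le_layer_energy phi eta : test_function (Omd d) phi -> 0 <= eta <= 1 ->
  (forall x z, D x -> - H - d < z < - H -> (1 - eta) * sigma (pt x (- H)) <= sigma (pt x z)) ->
  (1 - eta) * energy (grad phi) (bot phi) <= layer_energy d (grad phi).
Proof.
move=> tphi /andP[eta0 eta1] hs; have li := layer_inequality tphi eta1 hs.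
pose F i y := Num.sqrt (sigma_ H sigma d y) * ('D_(e_ i) phi y + hu_grad d i y).
have FO i : sqint mu (Omd d) (F i).
  apply: (weighted_sqint d0 d1); apply: sqintD => //.
    exact: (in_H1P (in_H1_test oOd Odoo tphi) mOd).
  exact: (in_H1P (hu_in_H1 d0 d1) mOd).
have FE i : rsq mu O ('D_(e_ i) phi \+ hu_grad 1 i) = rsq mu O (F i).
  apply: eq_rsq => y [Dy /andP[yH _]]; rewrite /F sigma_E ltNge (ltW yH) /= sqrtr1 mul1r.
  by congr (_ + _); apply/esym; apply: hu_grad_main; exact: ltW.
have sub : O `|` layer d `<=` Omd d.
  by move=> y [Oy|ly]; [exact: (Omega_sub (ltW d0))|exact: (layer_sub ly)].
have mOl : measurable (O `|` layer d) by exact: measurableU.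
have part i : rsq mu O (F i) + rsq mu (layer d) (F i) <= rsq mu (Omd d) (F i).
  rewrite -rsq_setU//; [exact: rsq_subset|exact: layer_disjoint|exact: sqint_subset sub (FO i)].
have le1 i : rsq mu O (F i) <= rsq mu (Omd d) (F i).
  by apply: le_trans (part i); rewrite lerDl rsq_ge0.
have : (1 - eta) * \sum_i rsq mu O ('D_(e_ i) phi \+ hu_grad 1 i) <= \sum_i rsq mu O (F i).
  rewrite (eq_bigr _ (fun i _ => FE i)) ler_piMl ?gerBl//.
  by rewrite sumr_ge0// => i _; exact: rsq_ge0.
have : \sum_i rsq mu O (F i) + rsq mu (layer d) (F iz) <= layer_energy d (grad phi).
  rewrite /layer_energy (bigD1 iz)//= [leRHS](bigD1 iz)//= addrAC; apply: lerD; first exact: part.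
  by apply: ler_sum => i _; exact: le1.
by rewrite /energy mulrDr; move: li; rewrite -/(F iz); lra.
Qed.

End layer_inequality.

Lemma energy_of_trace theta p t : trace_data D H u theta p t -> zero_off D H M O theta ->
  G0 theta = (2^-1 * energy p t)%:E.
Proof.
move=> td z0; have HB := trace_data_H1_B oD DL H0 cu uM HL ML td.
rewrite /G asboolT//; have [tp tD _] := td.
have [tr mtr] := trace_data_trace oD DL H0 cu uH uM HL ML td.
have hp i := in_H1P tp mO i.
have -> : (\int[mu]_(y in O) (grad_sq O (theta \+ hu u h)%R y)%:E =
    (\sum_i rsq mu O (p i \+ hu_grad 1 i))%:E)%E.
  have [_ hw] := in_H1D mO tp hu_in_H1_main.
  have m1 : measurable_fun O (cst (1 : R)) by exact: measurable_cst.
  have b1 y : O y -> 0 <= cst (1 : R) y <= 1 by move=> _; rewrite /= ler01 lexx.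
  have := integral_grad_sq oO Ooo m1 b1 hw.
  under eq_integral do rewrite /= mul1r.
  move=> ->; congr (_%:E); apply: eq_bigr => i _; apply: eq_rsq => y _.
  by rewrite /= sqrtr1 mul1r.
have -> : (\int[nu]_(x in D) (sigma (pt x (- H)) *
       `|trace D H u theta x + hu u h (pt x (- H)) - frak_hu H u hb x| ^+ 2)%:E =
    (rsq nu D (fun x => w x * (t x + a x)))%:E)%E.
  have wt := weighted_trace_sqint tD.
  have E x : D x -> sigma (pt x (- H)) * `|trace D H u theta x + hu u h (pt x (- H)) - frak_hu H u hb x| ^+ 2 =
      (w x * (trace D H u theta x + a x)) ^+ 2.
    move=> Dx; rewrite real_normK ?num_real// exprMn sqr_sqrtr; first by rewrite /contact_gap addrA.
    apply: le_trans (ltW (st_s0 S)) (st_sigma S _).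
    by apply: (layer_closed_pt Dx); lra.
  transitivity (\int[nu]_(x in D) ((w x * (trace D H u theta x + a x)) ^+ 2)%:E)%E.
    by apply: eq_integral => x /set_mem Dx; rewrite E.
  rewrite -(rsqE wt); apply: ae_eq_integral => //.
  - apply: measurable_sqr; apply: measurable_funM; first exact: sqrt_sigma_measurable.
    by apply: measurable_funD => //; case: aD.
  - by apply: measurable_sqr; case: wt.
  by apply: filterS tr => x hx Dx; rewrite hx.
by rewrite -!EFinM -EFinD /energy mulrDr.
Qed.

Lemma Omega_sub_M d : 0 < d -> d <= 1 -> Omd d `<=` OM.
Proof.
move=> d0 d1 y [Dy /andP[y1 y2]]; split => //.
have := uM Dy; move: H0 => h0; lra.
Qed.

Lemma Omega_M_open : open OM.
Proof.
have -> : OM = @Omega R n D (H + 1) (fun=> M).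
  by apply/seteqP; split => y; rewrite /Omega_M /Omega /= opprD.
by apply: Omega_open => //; apply: continuous_subspaceT; exact: cst_continuous.
Qed.

Let mOM : measurable OM. Proof. by apply: open_measurable_rV; exact: Omega_M_open. Qed.

Lemma Gd_finite d g c : 0 < d -> d <= 1 -> (Gd d g < c%:E)%E ->
  zero_off D H M (Omd d) g /\ exists p, H10_data (Omd d) g p /\ 2^-1 * layer_energy d p < c.
Proof.
move=> d0 d1; rewrite /G_; case: asboolP => [[Hg zg]|//]; split => //.
have oOd : open (Omd d) by exact: open_Omega_.
have Odoo : (mu (Omd d) < +oo)%E by exact: (Omega_finite oD DL H0 cu uM HL ML).
have [p hp] := H10_approx oOd Odoo Hg; exists p; split => //.
have := integral_layer_energy d0 d1 hp.1.
by move: H1; move=> + E; rewrite E -EFinM lte_fin.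
Qed.

Lemma G_lower_bound theta c : sqint mu OM theta ->
  (forall e r, 0 < e -> 0 < r -> exists d g, [/\ 0 < d < r, sqint mu OM g,
     rsq mu OM (g \- theta) < e & (Gd d g < c%:E)%E]) ->
  (G0 theta <= c%:E)%E.
Proof.
move=> tM hyp.
have O1 : O `<=` OM by move=> y Oy; apply: (@Omega_sub_M 1) => //; exact: Omega_sub.
have tO : sqint mu O theta by apply: sqint_subset tM.
have [C C0 hC] := sqrt_sigma_bounded.
have approx e : 0 < e -> exists phi, [/\ C1_B D H u phi, rsq mu O (theta \- phi) < e &
    energy (grad phi) (bot phi) < 2 * c + e].
  move=> e0.
  have c0 : 0 <= c.
    have [d [g [/andP[d0 d1] _ _ /Gd_finite]]] := hyp 1 1 ltr01 ltr01.
    move=> /(_ d0 (ltW d1))[_ [p [_ /ltW]]]; apply: le_trans.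
    by rewrite mulr_ge0// layer_energy_ge0.
  (* With [(1 - eta)] times the energy below [2 * c + e / 4], the bound [eta * (2 * c + e) <= e / 2]
     rules out an energy of [2 * c + e] or more. *)
  pose eta := Num.min 1 (e / (2 * (2 * c + e))).
  have ce : 0 < 2 * (2 * c + e) by rewrite mulr_gt0// ltr_wpDl// mulr_ge0.
  have eta0 : 0 < eta by rewrite lt_min ltr01 divr_gt0.
  have eta1 : eta <= 1 by rewrite ge_min lexx.
  have eta2 : eta * (2 * c + e) <= e / 2.
    have : eta <= e / (2 * (2 * c + e)) by rewrite ge_min lexx orbT.
    by rewrite ler_pdivlMr// => hh; lra.
  (* As [s0] bounds [sigma] from below, the absolute error [eta * s0] is a relative error of at most
     [eta]. *)
  have es0 : 0 < eta * s0 by rewrite mulr_gt0// (st_s0 S).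
  have [r /andP[r0 r1] hr] := sigma_near es0.
  have e4 : 0 < e / 4 by rewrite divr_gt0.
  have [d [g [/andP[d0 dr] gM gt Gg]]] := hyp (e / 4) r e4 r0.
  have d1 : d <= 1 by rewrite (le_trans (ltW dr)).
  have [zg [p [hp Ep]]] := Gd_finite d0 d1 Gg.
  have [phi [tphi gphi Ephi]] := layer_energy_approx d0 d1 hp e4.
  exists phi; have Cphi := test_function_C1_B tphi; split => //.
    have [phiO _] := C1_B_in_H1 oD DL H0 cu uM HL ML Cphi.
    have mOd : measurable (Omd d) by apply: open_measurable_rV; exact: open_Omega_.
    have gO : sqint mu O g by exact: sqint_subset gM.
    have sub : O `<=` Omd d by exact: Omega_sub (ltW d0).
    have gphiOd : sqint mu (Omd d) (g \- phi).
      apply: sqintB => //; first by case: hp => [[]].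
      exact: test_function_sqint tphi.
    have h1 : rsq mu O (g \- theta) <= e / 4.
      by apply: le_trans (ltW gt); apply: rsq_subset => //; exact: sqintB.
    have h2 : rsq mu O (g \- phi) < e / 4.
      by apply: le_lt_trans gphi; exact: rsq_subset.
    have := rsq_tri mO tO phiO gO; rewrite (rsqC _ _ theta g).
    by move: (rsq _ _ _) (rsq _ _ _) (rsq _ _ _) h1 h2 => x y z; lra.
  have et : 0 <= eta <= 1 by rewrite ltW.
  have key : (1 - eta) * energy (grad phi) (bot phi) <= layer_energy d (grad phi).
    apply: (energy_le_layer_energy d0 d1 tphi et) => x z Dx /andP[z1 z2].
    have : `|sigma (pt x z) - sigma (pt x (- H))| <= eta * s0.
      by apply: hr => //; apply/andP; split; lra.
    have : s0 <= sigma (pt x (- H)) by apply: (st_sigma S); apply: (layer_closed_pt Dx); lra.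
    move=> /(ler_wpM2l (ltW eta0)) h1; rewrite ler_norml => /andP[h2 _].
    by rewrite mulrBl mul1r; move: h1 h2; lra.
  rewrite ltNge; apply/negP => hE.
  have e1 : 0 <= 1 - eta by rewrite subr_ge0.
  have := ler_wpM2l e1 hE; move: key Ephi Ep eta2.
  move: (layer_energy _ _) (layer_energy _ _) (energy _ _) => x y z; lra.
have [p [t [td Et]]] := energy_lsc oD DL H0 cu uH uM HL ML qO aD sqrt_sigma_measurable hC tO approx.
rewrite (energy_of_trace td); first by rewrite lee_fin; lra.
(* The approximants vanish off [Omd d] with [d < r], so the limit vanishes off every [Omd r]. These
   sets shrink to [O] up to the null plane [final y = - H]. *)
have off r : 0 < r -> {ae mu, forall y, (OM `\` Omd r) y -> theta y = 0}.
  move=> r0; have mr : measurable (Omd r) by apply: open_measurable_rV; exact: open_Omega_.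
  have mOr : measurable (OM `\` Omd r) by exact: measurableD.
  apply: sqint_ae0 => //; first exact: sqint_subset tM.
  apply/eqP; rewrite eq_le rsq_ge0 andbT; apply/ler_addgt0Pl => e e0; rewrite addr0.
  have m0 : 0 < Num.min r 1 by rewrite lt_min r0 /=.
  have [d [g [/andP[d0 +] gM gt Gg]]] := hyp e _ e0 m0; rewrite lt_min => /andP[dr d1].
  have [zg _] := Gd_finite d0 (ltW d1) Gg.
  have tr : sqint mu (OM `\` Omd r) theta by exact: sqint_subset tM.
  have gr : sqint mu (OM `\` Omd r) g by exact: sqint_subset gM.
  have -> : rsq mu (OM `\` Omd r) theta = rsq mu (OM `\` Omd r) (g \- theta).
    rewrite rsqC; apply: ae_rsq => //; [|by case: tr|by have [] := sqintB mOr tr gr].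
    apply: filterS zg => y hy [My nr]; rewrite /= hy ?subr0//; split => // -[Dy /andP[y1 y2]].
    by apply: nr; split => //; rewrite y2 andbT; apply: le_lt_trans y1; lra.
  by apply: le_trans (ltW gt); apply: rsq_subset => //; exact: sqintB.
have offk : {ae mu, forall y, forall k : nat, (OM `\` Omd k.+1%:R^-1) y -> theta y = 0}.
  by apply: ae_foralln => k; apply: off; rewrite invr_gt0.
have nH : {ae mu, forall y : 'rV[R]_(n + 1), final y != - H}.
  exists [set y | final y = - H]; split.
  - have -> : [set y : 'rV[R]_(n + 1) | final y = - H] = @final R n @^-1` [set - H] by [].
    by rewrite -[X in measurable X]setTI; apply: measurable_final.
  - exact: leb_final_null.
  - by move=> y /= /negP; rewrite negbK => /eqP.
apply: filterS2 offk nH => y h1 h2 [My nO].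
have [[k nk]|] := pselect (exists k : nat, ~ Omd k.+1%:R^-1 y); first exact: (h1 k).
move=> /forallNP hk; have {}hk k : Omd k.+1%:R^-1 y by apply: contrapT; exact: hk.
exfalso; apply: nO; have [Dy /andP[_ yu]] := hk 0%N; split => //.
rewrite yu andbT lt_neqAle eq_sym h2 /=; apply/ler_addgt0Pr => e e0.
have [k _ hke] := cvg0_lt (@cvg_harmonic R) e0.
have [_ /andP[y1 _]] := hk k; have h3 : k.+1%:R^-1 < e := hke k (leqnn _).
by move: (k.+1%:R^-1) h3 y1 => r h3 y1; lra.
Qed.

(** * The optimal vertical profile in the unit layer *)

Section profile.
Variable Psi : 'rV[R]_(n + 1) -> R.
Hypothesis tPsi : test_function (below D u) Psi.

Definition profile (y : 'rV[R]_(n + 1)) : R :=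
  bot Psi (init y) * (1 + (final y + H) - phat y) + a (init y) * (1 + (final y + H)) +
  (frak_hu H u hb (init y) - hb (main_pt u y)).

Definition profile_dz (y : 'rV[R]_(n + 1)) : R :=
  bot Psi (init y) * (1 - 'D_(e_ iz) phat y) + a (init y) - Gb (idx_z n) (main_pt u y).

Lemma contact_gap_bounded : exists2 K, 0 < K & forall x, D x -> `|a x| <= K.
Proof.
have [K1 K10 h1] := within_closure_bounded L (st_ch S).
have [K2 K20 h2] := within_closure_bounded L (st_chb S).
exists (K1 + K2) => [|x Dx]; first exact: addr_gt0.
have u1 := uH Dx; have u2 := uM Dx; move: H0 => h0.
apply: le_trans (ler_normB _ _) _; apply: lerD.
  rewrite /hu init_pt; apply: h1; first exact: closure_dom_h.
  by apply: (pt_box DL H0 HL ML Dx); lra.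
apply: h2; first by apply: closure_dom_hb_le => //; lra.
by apply: (pt_box DL H0 HL ML Dx); lra.
Qed.

Let main_closure y : Q y -> closure (dom_hb D H) (main_pt u y) /\ forall i, `|main_pt u y 0 i| <= L.
Proof.
move=> /layerP[Dy /andP[y1 y2]]; have u1 := uH Dy; have u2 := uM Dy; move: H0 => h0.
rewrite main_ptE; split; first by apply: closure_dom_hb_le => //; lra.
by apply: (pt_box DL H0 HL ML Dy); lra.
Qed.

Let within_main (F : 'rV[R]_(n + 1 + 1) -> R) : {within closure (dom_hb D H), continuous F} ->
  {within Q, continuous (fun y => F (main_pt u y))}.
Proof.
move=> cF; apply: (within_comp_continuous cF) => y Qy; first by have [] := main_closure Qy.
by have /layerP[Dy _] := Qy; exact: (continuous_main_pt oD cu Dy).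
Qed.

Let within_slice (F : 'rV[R]_(n + 1 + 1) -> R) (B : set 'rV[R]_(n + 1 + 1)) (z : R) :
  {within closure B, continuous F} -> (forall x, D x -> closure B (pt (pt x z) (u x))) ->
  {within Q, continuous (fun y => F (pt (pt (init y) z) (u (init y))))}.
Proof.
move=> cF DB; apply: (within_comp_continuous cF) => y /layerP[Dy _]; first exact: DB.
apply: continuous_pt; last exact: (continuous_u_init oD cu Dy).
by apply: continuous_pt; [exact: continuous_init|exact: cst_continuous].
Qed.

Let cbot : continuous (bot Psi).
Proof.
move=> x; apply: continuous_comp; [exact: continuous_pt_slice|exact: test_function_continuous tPsi _].
Qed.

Let within_a : {within Q, continuous (fun y => a (init y))}.
Proof.
have -> : (fun y : 'rV[R]_(n + 1) => a (init y)) = (fun y => h (pt (pt (init y) (- H)) (u (init y)))) \-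
    (fun y => hb (pt (pt (init y) (- H - 1)) (u (init y)))).
  by apply/funext => y; rewrite /contact_gap /hu /frak_hu init_pt.
apply: continuous_within_sub.
  by apply: within_slice (st_ch S) _ => x Dx; apply: closure_dom_h => //; exact: uH.
apply: within_slice (st_chb S) _ => x Dx; apply: closure_dom_hb_le; rewrite ?uH//.
by apply/andP; split; lra.
Qed.

Let within_bot : {within Q, continuous (fun y => bot Psi (init y))}.
Proof.
apply: continuous_subspaceT => y; apply: continuous_comp; [exact: continuous_init|exact: cbot].
Qed.

Let within_lin : {within Q, continuous (fun y : 'rV[R]_(n + 1) => 1 + (final y + H))}.
Proof.
apply: continuous_subspaceT => y.
have ca : continuous (fun s : R => 1 + (s + H)).
  by move=> s; apply: cvgD; [exact: cvg_cst|apply: cvgD; [exact: cvg_id|exact: cvg_cst]].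
exact: (@continuous_comp _ _ _ (@final R n) (fun s : R => 1 + (s + H)) y (@continuous_final _ _ y) (ca _)).
Qed.

Lemma profile_continuous : {within Q, continuous profile}.
Proof.
apply: (@continuous_within_add _ _ Q ((fun y => bot Psi (init y) * (1 + (final y + H) - phat y)) \+
  (fun y => a (init y) * (1 + (final y + H)))) (fun y => frak_hu H u hb (init y) - hb (main_pt u y))).
  apply: continuous_within_add.
    apply: (@continuous_within_mul _ _ Q (fun y => bot Psi (init y)) _ within_bot).
    apply: (@continuous_within_sub _ _ Q (fun y => 1 + (final y + H)) phat within_lin).
    by apply: continuous_subspaceT; exact: (Ck_continuous (Ck_smooth_step n H 0)).
  exact: (@continuous_within_mul _ _ Q (fun y => a (init y)) _ within_a within_lin).
apply: (@continuous_within_sub _ _ Q (fun y => frak_hu H u hb (init y)) (fun y => hb (main_pt u y))).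
  apply: within_slice (st_chb S) _ => x Dx; apply: closure_dom_hb_le; rewrite ?uH//.
  by apply/andP; split; lra.
exact: within_main (st_chb S).
Qed.

Lemma profile_dz_continuous : {within Q, continuous profile_dz}.
Proof.
apply: (@continuous_within_sub _ _ Q ((fun y => bot Psi (init y) * (1 - 'D_(e_ iz) phat y)) \+
  (fun y => a (init y))) (fun y => Gb (idx_z n) (main_pt u y))); last exact: within_main (cGb (i := idx_z n)).
apply: continuous_within_add; last exact: within_a.
apply: (@continuous_within_mul _ _ Q (fun y => bot Psi (init y)) _ within_bot).
apply: (@continuous_within_sub _ _ Q (fun=> 1) ('D_(e_ iz) phat)).
  by apply: continuous_subspaceT; exact: cst_continuous.
by apply: continuous_subspaceT; exact: smooth_step_dz_continuous.
Qed.

Lemma profile_dz_bounded : exists2 K, 0 < K & forall y, Q y -> `|profile_dz y| <= K.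
Proof.
have [K1 K10 h1] := test_function_bounded tPsi.
have [K2 K20 h2] := @smooth_step_dz_bounded R n H L.
have [K3 K30 h3] := contact_gap_bounded.
have [K4 K40 h4] := within_closure_bounded L (cGb (i := idx_z n)).
exists (K1 * (1 + K2) + K3 + K4) => [|y Qy].
  by rewrite !addr_gt0// mulr_gt0// addr_gt0.
have [m1 m2] := main_closure Qy; have /layerP[Dy hy] := Qy.
apply: le_trans (ler_normB _ _) _; apply: lerD; last exact: h4.
apply: le_trans (ler_normD _ _) _; apply: lerD; last exact: h3.
rewrite normrM; apply: ler_pM => //; first exact: h1.
apply: le_trans (ler_normB _ _) _; rewrite normr1 lerD2l; apply: h2 => i.
have HL' : `|H| + 1 <= L by rewrite gtr0_norm.
exact: (@unit_layer_box R n D H L DL HL' y i Qy).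
Qed.

(* Along vertical lines [profile] vanishes at both ends of the layer, and with it
   [bot Psi * phat + profile + hb] is affine with slope [bot Psi + contact_gap]. *)
Lemma profile_dense e : 0 < e -> exists b, test_function Q b /\
  rsq mu Q ('D_(e_ iz) b \- profile_dz) < e.
Proof.
have [C C0 hC] := profile_dz_bounded.
have HL' : `|H| + 1 <= L by rewrite gtr0_norm.
have hu_at x : D x -> a x + frak_hu H u hb x = hb (pt (pt x (- H)) (u x)).
  by move=> Dx; rewrite /contact_gap subrK /hu init_pt (st_hbh S Dx (uH Dx)).
apply: (layer_dense oD DL HL' C0 profile_continuous profile_dz_continuous _ _ _ _ hC).
- move=> x Dx z.
  have cphat : {within `[(- H - 1), (- H)], continuous (fun z : R => phat (pt x z))}.
    apply: continuous_subspaceT => s; apply: continuous_comp; first exact: continuous_pt_line.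
    exact: (Ck_continuous (Ck_smooth_step n H 0)).
  have chb : {within `[(- H - 1), (- H)], continuous (fun z : R => hb (main_pt u (pt x z)))}.
    apply: (@within_comp_line _ _ _ hb (fun z : R => main_pt u (pt x z)) _ (st_chb S)) => s.
      rewrite /= in_itv /= => hs; rewrite main_ptE init_pt final_pt.
      by apply: closure_dom_hb_le => //; exact: uH.
    move=> _; have -> : (fun z : R => main_pt u (pt x z)) = (fun z => pt (pt x z) (u x)).
      by apply/funext => r; rewrite /main_pt init_pt.
    have cw : {for s, continuous (fun=> u x : R)} by exact: cvg_cst.
    by apply: (continuous_pt _ cw); exact: continuous_pt_line.
  have -> : (fun z0 : R => profile (pt x z0)) = (fun z =>
      bot Psi x * (1 + (z + H) - phat (pt x z)) + a x * (1 + (z + H)) +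
      (frak_hu H u hb x - hb (main_pt u (pt x z)))).
    by apply/funext => r; rewrite /profile init_pt final_pt.
  have clin : {within `[(- H - 1), (- H)], continuous (fun z : R => 1 + (z + H))}.
    apply: continuous_subspaceT => s.
    by apply: cvgD; [exact: cvg_cst|apply: cvgD; [exact: cvg_id|exact: cvg_cst]].
  apply: cvgD; last by apply: cvgB; [exact: cvg_cst|exact: chb].
  apply: cvgD; last by apply: cvgMr; exact: clin.
  by apply: cvgMr; apply: cvgB; [exact: clin|exact: cphat].
- move=> x z Dx hz.
  have -> : (fun z0 : R => profile (pt x z0)) = (fun z =>
      bot Psi x * (1 + (z + H) - phat (pt x z)) + a x * (1 + (z + H)) +
      (frak_hu H u hb x - hb (layer_pt H u 1 (pt x z)))).
    apply/funext => r; rewrite /profile init_pt final_pt layer_pt_line /main_pt init_pt.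
    have -> // : - H + (r + H) / 1 = r by rewrite divr1 addrC addrK.
  have ptE s : pt x s = pt x 0 + s *: basis_vec R iz by rewrite -pt_addr add0r.
  have d1 : is_derive z (1 : R) (fun z : R => phat (pt x z)) ('D_(e_ iz) phat (pt x z)).
    have dz := @smooth_step_derivable R n H (pt x z) iz.
    have -> : (fun z => phat (pt x z)) = fun s => phat (pt x 0 + s *: basis_vec R iz).
      by apply/funext => s; rewrite ptE.
    by move: dz; rewrite (ptE z) => dz; exact: is_derive_line.
  have d2 := is_derive_hb ltr01 Dx hz.
  have l1 : is_derive z (1 : R) (fun z : R => 1 + (z + H)) (0 + (1 + 0)).
    exact: is_deriveD (is_derive_cst _ _ _) (is_deriveD (is_derive_id _ _) (is_derive_cst _ _ _)).
  have t1 := is_deriveZ (bot Psi x) (is_deriveB l1 d1).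
  have t2 := is_deriveZ (a x) l1.
  have t3 := is_deriveB (is_derive_cst (frak_hu H u hb x : R) z (1 : R)) d2.
  have E := is_deriveD (is_deriveD t1 t2) t3.
  apply: (is_derive_eq E); rewrite /profile_dz init_pt layer_pt_line /main_pt init_pt /GRing.scale /= invr1.
  have -> : - H + (z + H) * 1 = z by rewrite mulr1 addrC addrK.
  by ring.
- move=> x Dx; rewrite /profile init_pt final_pt main_ptE init_pt final_pt.
  rewrite smooth_step1 ?final_pt; last by lra.
  by have := hu_at x Dx; move: (hb _) (frak_hu _ _ _ _) (a x) => r s t; lra.
- move=> x Dx; rewrite /profile init_pt final_pt main_ptE init_pt final_pt.
  rewrite smooth_step0 ?final_pt; last by lra.
  have -> : - H - 1 + H = -1 by ring.
  by rewrite subrr subr0 !mulr0 !add0r /frak_hu subrr.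
Qed.

End profile.

(** * The recovery family and its energy *)

Section recovery.
Variables (Psi b : 'rV[R]_(n + 1) -> R).
Hypotheses (tPsi : test_function (below D u) Psi) (tb : test_function (layer 1) b).
Local Notation profile_dz := (profile_dz Psi).

Let ol d : open (layer d). Proof. exact: open_layer d. Qed.
Let ml d : measurable (layer d). Proof. by apply: open_measurable_rV. Qed.

Definition recovery (d : R) : 'rV[R]_(n + 1) -> R := (Psi \* (phat \o stretch d)) \+ (b \o stretch d).

Let Ck_recovery k d : Ck k (recovery d).
Proof.
have [CP _] := tPsi; have [Cb _] := tb.
by apply: CkD; [apply: CkM => //; apply: Ck_stretch; exact: Ck_smooth_step|exact: Ck_stretch].
Qed.

Lemma recovery_test d : 0 < d -> d <= 1 -> test_function (Omd d) (recovery d).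
Proof.
move=> d0 d1; split => [k|]; first exact: Ck_recovery.
have [_ [K [cK KA K0]]] := tPsi; have [_ [K' [cK' KA' K'0]]] := tb.
(* The cut-off vanishes at depth [3 / 4 * d] and below, so the part coming from [Psi] keeps a
   distance to the lower face; the other part is the preimage of the support of [b]. *)
exists ((K `&` [set y | - H - 3 / 4 * d <= final y]) `|` (stretch d @^-1` K')).
have sub' : stretch d @^-1` K' `<=` layer d by move=> y Ky; apply/(@layer_stretch _ _ H D d y d0); exact: KA'.
split.
- apply: compactU.
    apply: (subclosed_compact _ cK); last by move=> y [].
    apply: closedI; first exact: closed_compact_rV.
    have -> : [set y : 'rV[R]_(n + 1) | - H - 3 / 4 * d <= final y] =
        @final R n @^-1` [set s | - H - 3 / 4 * d <= s] by [].
    by apply: closed_comp; [move=> y _; exact: continuous_final|exact: closed_ge].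
  apply: (subclosed_compact _ (@compact_box _ _ L)).
    apply: closed_comp; last exact: closed_compact_rV.
    by move=> y _; exact: continuous_stretch.
  move=> y Ky i; have Oy := layer_sub (sub' _ Ky).
  exact: (@Omega_box R n D H M L u DL H0 uM HL ML d y i d1 Oy).
- move=> y [[Ky /= hy]|/sub'/layer_sub//].
  have [Dy yu] := KA _ Ky; split => //; rewrite yu andbT; lra.
- move=> y nK; rewrite /recovery /= (K'0 (stretch d y)); last by move=> hK; apply: nK; right.
  rewrite addr0; have [Ky|nKy] := pselect (K y); last by rewrite K0// mul0r.
  rewrite (@smooth_step0 _ _ _ (stretch d y)) ?mulr0// final_pt.
  rewrite lerD2l -mulNr ler_pdivrMr//; apply: contrapT => hy.
  by apply: nK; left; split => //=; move/negP : hy; rewrite -ltNge; lra.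
Qed.

Lemma recovery_main d y : 0 < d -> - H <= final y -> recovery d y = Psi y.
Proof.
move=> d0 hy; have h1 : 0 <= (final y + H) / d by rewrite divr_ge0 ?(ltW d0)//; lra.
rewrite /recovery /= (@test_function_out _ _ _ b (stretch d y) tb).
  by rewrite smooth_step1 ?mulr1 ?addr0// final_pt; lra.
by move=> /layerP[_]; rewrite final_pt; lra.
Qed.

Lemma recovery_bounded : exists2 K, 0 < K & forall d y, `|recovery d y| <= K.
Proof.
have [K1 K10 h1] := test_function_bounded tPsi; have [K2 K20 h2] := test_function_bounded tb.
exists (K1 + K2) => [|d y]; first exact: addr_gt0.
apply: le_trans (ler_normD _ _) _; apply: lerD; last exact: h2.
by rewrite normrM -[leRHS]mulr1; apply: ler_pM => //; exact: smooth_step_le.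
Qed.

Lemma recovery_derive d i y : 'D_(e_ i) (recovery d) y =
  'D_(e_ i) Psi y * phat (stretch d y) + Psi y * (stretch_factor d i * 'D_(e_ i) phat (stretch d y)) +
  stretch_factor d i * 'D_(e_ i) b (stretch d y).
Proof.
have [CP _] := tPsi; have [Cb _] := tb.
have d1 : derivable Psi y (e_ i) by exact: (Ck_derivable (CP 1%N)).
have d2 : derivable phat (stretch d y) (e_ i) by exact: smooth_step_derivable.
have d3 : derivable b (stretch d y) (e_ i) by exact: (Ck_derivable (Cb 1%N)).
have d1' : is_derive y (e_ i) Psi ('D_(e_ i) Psi y) by exact: DeriveDef.
have [_ E] := is_deriveD (is_deriveM d1' (is_derive_stretch d2)) (is_derive_stretch d3).
have -> : recovery d = Psi * (phat \o stretch d) + (b \o stretch d) by apply/funext.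
by rewrite E /GRing.scale /=; ring.
Qed.

Lemma recovery_derive_main d i y : 0 < d -> O y -> 'D_(e_ i) (recovery d) y = 'D_(e_ i) Psi y.
Proof.
move=> d0 [Dy /andP[yH _]]; apply: near_eq_derive.
have /nbhs_ballP[r /= r0 hr] := continuous_final (x := y) (lt_nbhsr yH).
by apply/nbhs_ballP; exists r => // z /hr /= zH; rewrite recovery_main// ltW.
Qed.

Lemma layer_cst d A : 0 < d ->
  sqint mu (layer d) (cst A) /\ rsq mu (layer d) (cst A) = d * rsq nu D (cst A).
Proof.
move=> d0; have dH : - H - d <= - H by lra.
have := sqint_cylinder mD dH (sqint_cst mD A Doo).
have -> : [set y | D (init y) /\ - H - d < final y < - H] = layer d.
  by apply/seteqP; split => y /layerP.
by have -> : - H - (- H - d) = d by ring.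
Qed.

Lemma layer_init d (g : 'rV[R]_n -> R) : 0 < d -> sqint nu D g ->
  sqint mu (layer d) (g \o @init R n) /\ rsq mu (layer d) (g \o @init R n) = d * rsq nu D g.
Proof.
move=> d0 gD; have dH : - H - d <= - H by lra.
have := sqint_cylinder mD dH gD.
have -> : [set y | D (init y) /\ - H - d < final y < - H] = layer d.
  by apply/seteqP; split => y /layerP.
by have -> : - H - (- H - d) = d by ring.
Qed.

(** What [O] and the layer miss of [Omd d] lies in the plane [final y = - H], a null set. *)
Lemma layer_split d F : 0 < d -> d <= 1 -> sqint mu (Omd d) F ->
  rsq mu (Omd d) F = rsq mu O F + rsq mu (layer d) F.
Proof.
move=> d0 d1 FO; have mOd : measurable (Omd d) by apply: open_measurable_rV; exact: open_Omega_.
have sub : O `|` layer d `<=` Omd d.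
  by move=> y [Oy|ly]; [exact: (Omega_sub (ltW d0))|exact: (layer_sub ly)].
have mU : measurable (O `|` layer d) by exact: measurableU.
pose N := Omd d `\` (O `|` layer d); have mN : measurable N by exact: measurableD.
have -> : Omd d = (O `|` layer d) `|` N by rewrite setDUK.
have NF : sqint mu N F by apply: sqint_subset FO => //; exact: subDsetl.
have UF : sqint mu (O `|` layer d) F by exact: sqint_subset FO.
rewrite rsq_setU//; last 2 first.
- by apply/disj_setPS => y [Uy [_ nU]].
- exact: sqint_setU.
rewrite rsq_setU//; last exact: layer_disjoint.
rewrite (_ : rsq mu N F = 0) ?addr0//; apply: (ae_rsq0 mN); last by case: NF.
have nH : {ae mu, forall y : 'rV[R]_(n + 1), final y != - H}.
  exists [set y | final y = - H]; split.
  - have -> : [set y : 'rV[R]_(n + 1) | final y = - H] = @final R n @^-1` [set - H] by [].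
    by rewrite -[X in measurable X]setTI; apply: measurable_final.
  - exact: leb_final_null.
  - by move=> y /= /negP; rewrite negbK => /eqP.
apply: filterS nH => y nH [[Dy /andP[y1 y2]] nU]; exfalso; apply: nU.
have [yH|yH|yH] := ltgtP (final y) (- H).
- by right; apply/layerP; rewrite y1.
- by left; split => //; rewrite yH.
- by rewrite yH eqxx in nH.
Qed.

Let s_bound : exists2 C, 1 <= C & forall d y, 0 < d -> d <= 1 -> layer d y ->
  0 <= sigma_ H sigma d y <= C.
Proof.
have [C C1 hC] := sigma_bounded; exists C => // d y d0 d1 ly.
have /layerP[Dy /andP[y1 y2]] := ly.
have /andP[s1 s2] := hC _ (layer_in_closed d1 (layer_sub ly) y2).
by rewrite sigma_E y2 mulr_ge0 ?(ltW d0)//= (le_trans _ s2)// ler_piMl.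
Qed.

(* Horizontal derivatives of [recovery d + hu_] stay bounded in L^2-density, so the layer
   contributes only a term of the order of its thickness. *)
Lemma horizontal_energy : exists2 K, 0 <= K & forall d j, 0 < d -> d <= 1 ->
  rsq mu (layer d) (fun y => Num.sqrt (sigma_ H sigma d y) *
    ('D_(e_ (lshift 1 j)) (recovery d) y + hu_grad d (lshift 1 j) y)) <= K * d.
Proof.
have [C C1 hC] := s_bound; have C0 : 0 <= C by rewrite (le_trans ler01).
have [K1 K10 h1] := test_function_grad_bounded tPsi.
have [K2 K20 h2] := test_function_grad_bounded tb.
have /choice[KG hG] : forall i, exists K, 0 < K /\
    forall P, closure (dom_hb D H) P -> (forall k, `|P 0 k| <= L) -> `|Gb i P| <= K.
  by move=> i; have [K Kp hK] := within_closure_bounded L (cGb (i := i)); exists K.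
have up j : sqint nu D (pu j) by have [up _] := st_up S; exact: in_H1P up mD j.
pose A j := K1 + K2 + KG (lshift 1 (lshift 1 j)).
pose B := KG (rshift (n + 1) ord0).
pose Kj j := C * (2 * rsq nu D (cst (A j)) + 2 * (B ^+ 2 * rsq nu D (pu j))).
have Kj0 j : 0 <= Kj j.
  apply: mulr_ge0 => //; apply: addr_ge0; apply: mulr_ge0 => //; first exact: rsq_ge0.
  by apply: mulr_ge0; [exact: sqr_ge0|exact: rsq_ge0].
exists (\sum_j Kj j) => [|d j d0 d1]; first by rewrite sumr_ge0.
have [A1 A2] := layer_cst (A j) d0.
have [p1 p2] := layer_init d0 (up j).
pose F y := 'D_(e_ (lshift 1 j)) (recovery d) y + hu_grad d (lshift 1 j) y.
have oOd : open (Omd d) by exact: open_Omega_.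
have mOd : measurable (Omd d) by exact: open_measurable_rV.
have Odoo : (mu (Omd d) < +oo)%E by exact: (Omega_finite oD DL H0 cu uM HL ML).
have FO : sqint mu (Omd d) F.
  apply: sqintD => //; first exact: (in_H1P (in_H1_test oOd Odoo (recovery_test d0 d1)) mOd).
  exact: (in_H1P (hu_in_H1 d0 d1) mOd).
have [mwF _] := weighted_sqint d0 d1 FO.
have mwl : measurable_fun (layer d) (fun y => Num.sqrt (sigma_ H sigma d y) * F y).
  by apply: (measurable_funS mOd _ mwF); exact: layer_sub d.
pose g y := Num.sqrt C * (A j + B * `|pu j (init y)|).
have ap : sqint mu (layer d) (fun y => B * `|pu j (init y)|).
  apply: sqintZ => //; apply: (sqint_dom (ml d) _ p1); last by move=> y _; rewrite /= real_normK ?num_real.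
  by apply: (measurableT_comp (@normr_measurable R setT)); case: p1.
have gl : sqint mu (layer d) g by apply: sqintZ => //; exact: sqintD.
have Fle y : layer d y -> `|F y| <= A j + B * `|pu j (init y)|.
  move=> ly; have /layerP[Dy /andP[y1 y2]] := ly.
  rewrite /F recovery_derive stretch_factor_l smooth_step_dx !mulr0 addr0 mul1r hu_grad_l.
  have [l1 l2] := layer_pt_closure DL H0 uH uM HL ML d0 d1 (layer_sub ly) y2.
  rewrite /layered_dx /layered y2 addrA.
  apply: le_trans (ler_normD _ _) _; apply: lerD; last first.
    by rewrite normrM ler_wpM2r//; exact: (hG _).2.
  apply: le_trans (ler_normD _ _) _; apply: lerD; last exact: (hG _).2.
  apply: le_trans (ler_normD _ _) _; apply: lerD; last exact: (h2 _).2.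
  rewrite normrM -[leRHS]mulr1; apply: ler_pM => //; [exact: (h1 _).2|exact: smooth_step_le].
apply: (@le_trans _ _ (rsq mu (layer d) g)).
  apply: (le_rsq (ml d) mwl gl) => y ly.
  have /andP[s1 s2] := hC d y d0 d1 ly.
  rewrite !exprMn !sqr_sqrtr//; apply: ler_pM => //; first by rewrite sqr_ge0.
  rewrite -[leLHS]real_normK ?num_real//; rewrite ler_pXn2r ?nnegrE//; first exact: Fle.
  by apply: le_trans (Fle _ ly).
rewrite rsqZ//; last exact: sqintD.
rewrite sqr_sqrtr//.
apply: (@le_trans _ _ (Kj j * d)); last first.
  by rewrite ler_wpM2r ?(ltW d0)// (bigD1 j)//= lerDl sumr_ge0.
rewrite /Kj -mulrA ler_wpM2l//.
apply: le_trans (rsqD2 (ml d) A1 ap) _.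
rewrite A2 rsqZ//; last first.
  apply: (sqint_dom (ml d) _ p1); last by move=> y _; rewrite /= real_normK ?num_real.
  by apply: (measurableT_comp (@normr_measurable R setT)); case: p1.
rewrite (@eq_rsq _ _ _ _ (layer d) (fun y => `|pu j (init y)|) (fun y => `|(pu j \o @init R n) y|))//.
have -> : rsq mu (layer d) (fun y => `|(pu j \o @init R n) y|) = d * rsq nu D (pu j).
  rewrite -p2 /rsq; apply: eq_Rintegral => y _; by rewrite real_normK ?num_real.
by rewrite le_eqVlt; apply/orP; left; apply/eqP; ring.
Qed.

(** The bracket is the error made in approximating the profile by [b]; without it the slope does not
    depend on the height, the case of equality in Cauchy-Schwarz. *)
Definition layer_slope (y : 'rV[R]_(n + 1)) : R :=
  bot Psi (init y) + a (init y) + ('D_(e_ iz) b y - profile_dz y).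

Definition weighted_slope (y : 'rV[R]_(n + 1)) : R := w (init y) * layer_slope y.

Let bD : sqint nu D (bot Psi).
Proof. exact: (bottom_sqint oD DL H0 cu uH uM HL ML (@C1_B_test R n D H u oD (below D u) Psi tPsi (fun y hy => hy))). Qed.

Lemma weighted_slope_sqint : sqint mu Q weighted_slope /\ forall k C, 0 < k ->
  (forall x, D x -> `|w x| <= C) ->
  rsq mu Q weighted_slope <= (1 + k) * rsq nu D (fun x => w x * (bot Psi x + a x)) +
    (1 + k^-1) * (C ^+ 2 * rsq mu Q ('D_(e_ iz) b \- profile_dz)).
Proof.
have wt := weighted_trace_sqint bD.
have [w1 w2] := layer_init ltr01 wt; rewrite mul1r in w2.
have [Kp Kp0 hp] := profile_dz_bounded tPsi.
have Qoo : (mu Q < +oo)%E.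
  apply: (@leb_bounded_lty _ _ _ L) => // y i Qy.
  have HL' : `|H| + 1 <= L by rewrite gtr0_norm.
  exact: (@unit_layer_box R n D H L DL HL' y i Qy).
have s1 : sqint mu Q ('D_(e_ iz) b \- profile_dz).
  apply: sqintB => //; first exact: test_function_sqint (test_function_derive iz tb).
  apply: (@sqint_bounded _ _ _ _ _ (ml 1) _ Kp) => //.
  by apply: within_continuous_measurable => //; exact: profile_dz_continuous _ tPsi.
have [Cw Cw0 hw] := sqrt_sigma_bounded.
have mw : measurable_fun Q (fun y => w (init y)).
  have mwr : measurable_fun setT (w \_ D).
    by apply/(measurable_restrictT _ mD); exact: sqrt_sigma_measurable.
  apply: (@eq_measurable_fun _ _ _ _ _ ((w \_ D) \o @init R n)).
    by move=> y /set_mem/layerP[Dy _]; rewrite /= restrict_in.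
  by apply: measurable_funTS; exact: measurableT_comp mwr (@measurable_init R n).
have key C : (forall x, D x -> `|w x| <= C) ->
    sqint mu Q ((fun y => w (init y)) \* ('D_(e_ iz) b \- profile_dz)) /\
    rsq mu Q ((fun y => w (init y)) \* ('D_(e_ iz) b \- profile_dz)) <= C ^+ 2 * rsq mu Q ('D_(e_ iz) b \- profile_dz).
  move=> hC; apply: (sqint_mul_bounded (ml 1) mw _ s1) => y /layerP[Dy _]; exact: hC.
have E y : Q y -> (((fun x => w x * (bot Psi x + a x)) \o @init R n) \+
    ((fun y => w (init y)) \* ('D_(e_ iz) b \- profile_dz))) y = weighted_slope y.
  by move=> _; rewrite /weighted_slope /layer_slope /=; ring.
split.
  by apply: eq_sqint E _; apply: sqintD => //; have [] := key Cw hw.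
move=> k C k0 hC; have [k1 k2] := key C hC.
rewrite -(eq_rsq _ E); apply: le_trans (rsqD_le (ml 1) k0 w1 k1) _.
rewrite w2 lerD2l ler_pM2l// addr_gt0// invr_gt0//.
Qed.

(* In the layer the vertical derivative is [layer_slope / d], up to a bounded error. *)
Lemma vertical_energy k : 0 < k -> k <= 1 -> exists2 K, 0 <= K & exists2 r, 0 < r <= 1 &
  forall d, 0 < d -> d <= r ->
  rsq mu (layer d) (fun y => Num.sqrt (sigma_ H sigma d y) *
    ('D_(e_ iz) (recovery d) y + hu_grad d iz y)) <= (1 + k) ^+ 2 * rsq mu Q weighted_slope + K * d.
Proof.
move=> k0 k1.
have [Cw Cw0 hw] := sqrt_sigma_bounded.
have [K1 K10 h1] := test_function_grad_bounded tPsi.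
have [Kp Kp0 hp] := @smooth_step_dz_bounded R n H L.
have ks0 : 0 < k * s0 by rewrite mulr_gt0// (st_s0 S).
have [r r01 hr] := sigma_near ks0.
pose A := 2 * Cw * (K1 * Kp + K1).
have A0 : 0 <= A by rewrite !mulr_ge0 ?(ltW Cw0)// addr_ge0 ?mulr_ge0 ?(ltW K10) ?(ltW Kp0).
exists ((1 + k^-1) * rsq nu D (cst A)).
  by rewrite mulr_ge0 ?rsq_ge0// addr_ge0// invr_ge0 ltW.
exists r => // d d0 dr; have /andP[r0 r1] := r01; have d1 : d <= 1 by rewrite (le_trans dr).
(* A vertical derivative of the form slope over [d], squared with weight [d * sigma], gives
   [sigma / d] times the squared slope; [al ^+ 2] dominates this once [sigma] is replaced by its
   value at the interface, up to the factor [1 + k]. *)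
pose al := Num.sqrt ((1 + k) / d).
have al2 : al ^+ 2 = (1 + k) / d by rewrite sqr_sqrtr// divr_ge0 ?(ltW d0)// addr_ge0// ltW.
(* What is left after freezing [Psi] at its bottom value: both terms are of order [d], the first
   because the layer has thickness [d]. Multiplied by [al], of order one over the square root of
   [d], they stay bounded. *)
pose rem y := (Psi y - bot Psi (init y)) * 'D_(e_ iz) phat (stretch d y) +
  d * ('D_(e_ iz) Psi y * phat (stretch d y)).
pose G1 y := al * (weighted_slope (stretch d y)).
pose G2 y := al * (w (init y) * rem y).
have [wsQ _] := weighted_slope_sqint.
have [st1 st2] := rsq_stretch oD d0 wsQ.
have [c1 c2] := layer_cst A d0.
have remle y : layer d y -> `|rem y| <= (K1 * Kp + K1) * d.
  move=> ly; have /layerP[Dy /andP[y1 y2]] := ly.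
  have sQ : Q (stretch d y) by exact/(@layer_stretch _ _ H D d y d0).
  have HL' : `|H| + 1 <= L by rewrite gtr0_norm.
  rewrite mulrDl; apply: le_trans (ler_normD _ _) _; apply: lerD; rewrite normrM.
    rewrite mulrAC; apply: ler_pM => //; last first.
      by apply: hp => i; exact: (@unit_layer_box R n D H L DL HL' _ i sQ).
    have t0 : 0 <= - H - final y by rewrite subr_ge0 ltW.
    have [CP _] := tPsi.
    have dP s : 0 <= s <= - H - final y -> derivable Psi (y + s *: e_ iz) (e_ iz).
      by move=> _; exact: (Ck_derivable (CP 1%N)).
    have [s hs E] := mvt_line t0 dP.
    have yE : y + (- H - final y) *: e_ iz = pt (init y) (- H).
      by rewrite -{1}(pt_init_final y) -pt_addr addrC subrK.
    rewrite distrC /bottom_value -yE E normrM ger0_norm// mulrC.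
    apply: ler_pM => //; first exact: (h1 _).2.
    by rewrite lerBlDr addrC -lerBlDr ltW.
  rewrite (gtr0_norm d0) mulrC ler_pM2r// normrM -[leRHS]mulr1.
  by apply: ler_pM => //; [exact: (h1 _).2|exact: smooth_step_le].
have ald : al * d <= 2 by exact: sqrt_ratio_le.
have G2le y : layer d y -> `|G2 y| <= A.
  move=> ly; have /layerP[Dy _] := ly.
  rewrite /G2 !normrM (ger0_norm (sqrtr_ge0 _)) -/al.
  have e1 := remle _ ly; have e2 := hw _ Dy.
  apply: (@le_trans _ _ (al * (Cw * ((K1 * Kp + K1) * d)))).
    by rewrite ler_wpM2l ?sqrtr_ge0//; apply: ler_pM.
  have -> : al * (Cw * ((K1 * Kp + K1) * d)) = (al * d) * (Cw * (K1 * Kp + K1)) by ring.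
  have -> : A = 2 * (Cw * (K1 * Kp + K1)) by rewrite /A; ring.
  by apply: ler_wpM2r => //; rewrite mulr_ge0 ?(ltW Cw0)// addr_ge0 ?mulr_ge0 ?(ltW K10) ?(ltW Kp0).
pose F y := 'D_(e_ iz) (recovery d) y + hu_grad d iz y.
have oOd : open (Omd d) by exact: open_Omega_.
have mOd : measurable (Omd d) by exact: open_measurable_rV.
have Odoo : (mu (Omd d) < +oo)%E by exact: (Omega_finite oD DL H0 cu uM HL ML).
have FO : sqint mu (Omd d) F.
  apply: sqintD => //; first exact: (in_H1P (in_H1_test oOd Odoo (recovery_test d0 d1)) mOd).
  exact: (in_H1P (hu_in_H1 d0 d1) mOd).
have [mwF _] := weighted_sqint d0 d1 FO.
have mwl : measurable_fun (layer d) (fun y => Num.sqrt (sigma_ H sigma d y) * F y).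
  by apply: (measurable_funS mOd _ mwF); exact: layer_sub d.
have FE y : layer d y -> F y = d^-1 * (layer_slope (stretch d y) + rem y).
  move=> ly; have /layerP[Dy /andP[y1 y2]] := ly.
  rewrite /F recovery_derive stretch_factor_r hu_grad_r /layered y2.
  rewrite /layer_slope /profile_dz /rem init_stretch.
  have -> : main_pt u (stretch d y) = layer_pt H u d y by rewrite /main_pt /layer_pt init_stretch.
  by field; rewrite gt_eqF.
have mG2 : measurable_fun (layer d) G2.
  apply: measurable_funM => //.
  have mwi : measurable_fun (layer d) (fun y => w (init y)).
    have mwr : measurable_fun setT (w \_ D).
      by apply/(measurable_restrictT _ mD); exact: sqrt_sigma_measurable.
    apply: (@eq_measurable_fun _ _ _ _ _ ((w \_ D) \o @init R n)).
      by move=> y /set_mem/layerP[Dy' _]; rewrite /= restrict_in.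
    by apply: measurable_funTS; exact: measurableT_comp mwr (@measurable_init R n).
  apply: measurable_funM => //.
  have cbot : continuous (bot Psi).
    by move=> x; apply: continuous_comp; [exact: continuous_pt_slice|exact: test_function_continuous tPsi _].
  have cs : continuous (stretch d) by exact: continuous_stretch.
  have cphat : continuous phat by exact: (Ck_continuous (Ck_smooth_step n H 0)).
  have cdz : continuous ('D_(e_ iz) phat) by exact: smooth_step_dz_continuous.
  have m1 : measurable_fun setT (phat \o stretch d).
    by apply: continuous_measurable_rV => y; exact: (continuous_comp (cs y) (cphat _)).
  have m2 : measurable_fun setT ('D_(e_ iz) phat \o stretch d).
    by apply: continuous_measurable_rV => y; exact: (continuous_comp (cs y) (cdz _)).
  apply: measurable_funTS; apply: measurable_funD; apply: measurable_funM.
  - apply: measurable_funB; first exact: test_function_measurable tPsi.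
    exact: measurableT_comp (continuous_measurable_rV cbot) (@measurable_init R n).
  - exact: m2.
  - exact: measurable_cst.
  by apply: measurable_funM; [exact: test_function_measurable (test_function_derive iz tPsi)|exact: m1].
have G2l : sqint mu (layer d) G2.
  apply: (sqint_dom (ml d) mG2 c1) => y ly; rewrite /= -[leLHS]real_normK ?num_real//.
  by rewrite ler_pXn2r ?nnegrE//; exact: G2le.
have G1l : sqint mu (layer d) G1 by exact: sqintZ.
apply: (@le_trans _ _ (rsq mu (layer d) (G1 \+ G2))).
  apply: (le_rsq (ml d) mwl) => [|y ly]; first exact: sqintD.
  have /layerP[Dy /andP[y1 y2]] := ly.
  have hs := hr (init y) (final y) Dy; rewrite pt_init_final in hs.
  have {}hs : `|sigma y - sigma (pt (init y) (- H))| <= k * s0 by apply: hs; lra.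
  have sH : s0 <= sigma (pt (init y) (- H)).
    by apply: (st_sigma S); apply: (layer_closed_pt Dy); lra.
  have sy : s0 <= sigma y by apply: (st_sigma S); exact: layer_in_closed d1 (layer_sub ly) y2.
  have s00 := st_s0 S.
  have sle : sigma y <= (1 + k) * sigma (pt (init y) (- H)).
    have : k * s0 <= k * sigma (pt (init y) (- H)) by rewrite ler_pM2l.
    by move: hs; rewrite ler_norml mulrDl mul1r; lra.
  have -> : (G1 \+ G2) y = al * (w (init y) * (layer_slope (stretch d y) + rem y)).
    by rewrite /= /G1 /G2 /weighted_slope init_stretch; ring.
  rewrite FE// !exprMn al2 sigma_E y2 /sqrt_sigma !sqr_sqrtr; [|exact: le_trans (ltW s00) sH|].
    2: by rewrite mulr_ge0 ?(ltW d0)//; exact: le_trans (ltW s00) sy.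
  have -> : d * sigma y * (d^-1 ^+ 2 * (layer_slope (stretch d y) + rem y) ^+ 2) =
      d^-1 * sigma y * (layer_slope (stretch d y) + rem y) ^+ 2 by field; rewrite gt_eqF.
  have -> : (1 + k) / d * (sigma (pt (init y) (- H)) * (layer_slope (stretch d y) + rem y) ^+ 2) =
      d^-1 * ((1 + k) * sigma (pt (init y) (- H))) * (layer_slope (stretch d y) + rem y) ^+ 2.
    by field; rewrite gt_eqF.
  by rewrite ler_wpM2r ?sqr_ge0// ler_pM2l// invr_gt0.
apply: le_trans (rsqD_le (ml d) k0 G1l G2l) _.
rewrite rsqZ// st2 al2.
have -> : (1 + k) / d * (d * rsq mu Q weighted_slope) = (1 + k) * rsq mu Q weighted_slope.
  by field; rewrite gt_eqF.
rewrite mulrA -expr2 lerD2l -mulrA ler_pM2l ?addr_gt0 ?invr_gt0// (mulrC _ d) -c2.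
apply: (le_rsq (ml d) mG2 c1) => y ly; rewrite /= -[leLHS]real_normK ?num_real//.
by rewrite ler_pXn2r ?nnegrE//; exact: G2le.
Qed.

Lemma recovery_energy k : 0 < k -> k <= 1 -> exists2 K, 0 <= K & exists2 r, 0 < r <= 1 &
  forall d, 0 < d -> d <= r -> layer_energy d (grad (recovery d)) <=
    \sum_i rsq mu O ('D_(e_ i) Psi \+ hu_grad 1 i) + (1 + k) ^+ 2 * rsq mu Q weighted_slope + K * d.
Proof.
move=> k0 k1; have [Kh Kh0 hh] := horizontal_energy.
have [Kv Kv0 [r r01 hv]] := vertical_energy k0 k1.
exists (Kv + n%:R * Kh); first by rewrite addr_ge0// mulr_ge0.
exists r => // d d0 dr; have /andP[r0 r1] := r01; have d1 : d <= 1 by rewrite (le_trans dr).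
pose F i y := Num.sqrt (sigma_ H sigma d y) * ('D_(e_ i) (recovery d) y + hu_grad d i y).
have oOd : open (Omd d) by exact: open_Omega_.
have mOd : measurable (Omd d) by exact: open_measurable_rV.
have Odoo : (mu (Omd d) < +oo)%E by exact: (Omega_finite oD DL H0 cu uM HL ML).
have FO i : sqint mu (Omd d) (F i).
  apply: (weighted_sqint d0 d1); apply: sqintD => //.
    exact: (in_H1P (in_H1_test oOd Odoo (recovery_test d0 d1)) mOd).
  exact: (in_H1P (hu_in_H1 d0 d1) mOd).
have FE i : rsq mu O (F i) = rsq mu O ('D_(e_ i) Psi \+ hu_grad 1 i).
  apply: eq_rsq => y Oy; have [Dy /andP[yH _]] := Oy.
  rewrite /F sigma_E ltNge (ltW yH) /= sqrtr1 mul1r recovery_derive_main//.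
  by congr (_ + _); apply: hu_grad_main; exact: ltW.
have -> : layer_energy d (grad (recovery d)) =
    \sum_i rsq mu O ('D_(e_ i) Psi \+ hu_grad 1 i) + \sum_i rsq mu (layer d) (F i).
  by rewrite -big_split /=; apply: eq_bigr => i _; rewrite -FE; exact: (layer_split d0 d1 (FO i)).
rewrite -addrA lerD2l.
have -> : \sum_i rsq mu (layer d) (F i) =
    \sum_j rsq mu (layer d) (F (lshift 1 j)) + rsq mu (layer d) (F iz).
  by rewrite big_split_ord /= big_ord1.
have : \sum_j rsq mu (layer d) (F (lshift 1 j)) <= \sum_(j < n) Kh * d.
  by apply: ler_sum => j _; exact: hh.
rewrite sumr_const card_ord -[X in _ <= X]mulr_natl mulrA => hsum.
have := hv d d0 dr; rewrite -/(F iz) mulrDl; lra.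
Qed.

(** [recovery d] coincides with [Psi] on [O] and is bounded uniformly in [d] in the layer, whose
    measure is of order [d]. *)
Lemma recovery_dist theta : sqint mu OM theta -> zero_off D H M O theta ->
  exists2 K, 0 <= K & forall d, 0 < d -> d <= 1 ->
    rsq mu OM (recovery d \- theta) <= rsq mu O (theta \- Psi) + K * d /\ sqint mu OM (recovery d).
Proof.
move=> tM z0; have [K K0 hK] := recovery_bounded.
exists (rsq nu D (cst K)) => [|d d0 d1]; first exact: rsq_ge0.
have OdM : Omd d `<=` OM by exact: (Omega_sub_M d0 d1).
have trec := recovery_test d0 d1.
have rM : sqint mu OM (recovery d) by exact: test_function_sqint trec.
split => //; set f := recovery d \- theta; have fM : sqint mu OM f by exact: sqintB.
have oOd : open (Omd d) by exact: open_Omega_.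
have mOd : measurable (Omd d) by exact: open_measurable_rV.
have mN : measurable (OM `\` Omd d) by exact: measurableD.
have -> : OM = Omd d `|` (OM `\` Omd d) by rewrite setDUK.
have subO : O `<=` Omd d by exact: Omega_sub (ltW d0).
rewrite rsq_setU//; last 2 first.
- by apply/disj_setPS => y [Uy [_ nU]].
- by rewrite setDUK.
rewrite (_ : rsq mu (OM `\` Omd d) f = 0); last first.
  apply: (ae_rsq0 mN); last by have [] := sqint_subset mN mOM (@subDsetl _ _ _) fM.
  apply: filterS z0 => y hy [My nO]; rewrite /f /= (test_function_out trec nO) hy ?subr0//.
  by split => // /subO.
rewrite addr0 layer_split//; last exact: sqint_subset fM.
apply: lerD.
  rewrite (@eq_rsq _ _ _ mu O f (Psi \- theta)); first by rewrite rsqC.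
  by move=> y [_ /andP[yH _]]; rewrite /f /= recovery_main// ltW.
have [c1 c2] := layer_cst K d0; rewrite mulrC -c2.
have fl : sqint mu (layer d) f.
  by apply: sqint_subset fM => //; apply: subset_trans OdM; exact: layer_sub d.
have [mfl _] := fl.
have rl : sqint mu (layer d) (recovery d).
  by apply: sqint_subset rM => //; apply: subset_trans OdM; exact: layer_sub d.
have -> : rsq mu (layer d) f = rsq mu (layer d) (recovery d).
  apply: ae_rsq => //; last by case: rl.
  apply: filterS z0 => y hy ly; rewrite /f /= hy ?subr0//; split.
    by apply: OdM; exact: layer_sub d _ ly.
  by move=> [_ /andP[y1 _]]; have /layerP[_ /andP[_ y2]] := ly; move: (lt_trans y1 y2); rewrite ltxx.
apply: (le_rsq (ml d) _ c1) => [|y ly]; first by case: rl.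
rewrite /= -[leLHS]real_normK ?num_real//; rewrite ler_pXn2r ?nnegrE ?(ltW K0)//; exact: hK.
Qed.

End recovery.

Lemma test_function_energy_approx theta p t e : trace_data D H u theta p t -> 0 < e ->
  exists Psi, [/\ test_function (below D u) Psi, rsq mu O (theta \- Psi) < e &
    energy (grad Psi) (bot Psi) < energy p t + e].
Proof.
have arith (x1 x2 x3 x4 r : R) : x3 <= x4 -> x1 <= 2 * x2 + 2 * x3 -> x2 < r -> x4 < r -> x1 < 4 * r.
  by lra.
move=> [tp tD happ] e0; have [C C0 hC] := sqrt_sigma_bounded.
have E0 := @energy_ge0 R n D H u (hu_grad 1) a w p t; set E := energy p t in E0 *.
pose k := e / 2 / (E + 1); have k0 : 0 < k by rewrite !divr_gt0// ltr_pwDr.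
have kE : k * E < e / 2.
  rewrite /k -mulrA gtr_pMr ?divr_gt0// mulrC ltr_pdivrMr ?ltr_pwDr//; lra.
have k1 : 0 < 1 + k^-1 by rewrite addr_gt0// invr_gt0.
have C20 : 0 < 1 + C ^+ 2 by rewrite ltr_pwDl// sqr_ge0.
(* Passing through [phi] doubles each of two distances below [r], hence [4 * r]; the minimum bounds
   the distance to [theta] by [e] and the perturbation term by [e / 2]. *)
pose r := Num.min e (e / 2 / ((1 + k^-1) * (1 + C ^+ 2))) / 4.
have m0 : 0 < Num.min e (e / 2 / ((1 + k^-1) * (1 + C ^+ 2))).
  by rewrite lt_min e0 !divr_gt0// mulr_gt0.
have r0 : 0 < r by rewrite divr_gt0.
have [phi [Cphi dphi bphi]] := happ r r0.
have [Psi [tPsi dPsi]] := C1_B_dense oD DL H0 cu uM HL ML (st_u0 S) Cphi r0.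
have CPsi : C1_B D H u Psi := @C1_B_test R n D H u oD (below D u) Psi tPsi (fun y hy => hy).
have phiH := C1_B_in_H1 oD DL H0 cu uM HL ML Cphi.
have PsiH := C1_B_in_H1 oD DL H0 cu uM HL ML CPsi.
have d1 := H1dist_tri mO tp phiH PsiH.
have bD1 := bottom_sqint oD DL H0 cu uH uM HL ML Cphi.
have bD2 := bottom_sqint oD DL H0 cu uH uM HL ML CPsi.
have d2 := bottom_dist oD DL H0 cu uH uM HL ML Cphi CPsi.
have d3 : rsq nu D (t \- bot Psi) <= 2 * rsq nu D (t \- bot phi) + 2 * rsq nu D (bot phi \- bot Psi).
  exact (rsq_tri mD tD bD2 bD1).
have dist : H1dist O theta p Psi (grad Psi) < 4 * r.
  move: d1 dphi dPsi; move: (H1dist O theta p Psi _) (H1dist O theta p phi _) (H1dist O phi _ Psi _).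
  by move=> x1 x2 x3; lra.
have bdist : rsq nu D (t \- bot Psi) < 4 * r.
  move: d2 d3 bphi dPsi; move: (rsq nu D (t \- bot Psi)) (rsq nu D (t \- bot phi)) (rsq nu D (bot phi \- bot Psi)) (H1dist _ _ _ _ _).
  by move=> x1 x2 x3 x4; exact: arith.
have r4 : 4 * r = Num.min e (e / 2 / ((1 + k^-1) * (1 + C ^+ 2))) by rewrite /r; field.
exists Psi; split => //.
  apply: (@le_lt_trans _ _ (H1dist O theta p Psi (grad Psi))).
    by rewrite /H1dist lerDl sumr_ge0// => i _; exact: rsq_ge0.
  by apply: lt_le_trans dist _; rewrite r4 ge_min lexx.
have := energy_perturb oD cu qO aD sqrt_sigma_measurable hC k0 (in_H1P PsiH mO) bD2 (in_H1P tp mO) tD.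
move/le_lt_trans; apply; rewrite -/E.
have s1 : \sum_i rsq mu O ('D_(e_ i) Psi \- p i) < 4 * r.
  apply: le_lt_trans dist; rewrite /H1dist.
  under eq_bigr do rewrite rsqC.
  by rewrite lerDr rsq_ge0.
have s2 : rsq nu D (bot Psi \- t) < 4 * r by rewrite rsqC.
have s3 : C ^+ 2 * rsq nu D (bot Psi \- t) <= C ^+ 2 * (4 * r) by rewrite ler_wpM2l ?sqr_ge0// ltW.
have s4 : (1 + k^-1) * ((1 + C ^+ 2) * (4 * r)) <= e / 2.
  rewrite r4 mulrA mulrC -ler_pdivlMr ?mulr_gt0// ge_min lexx orbT//.
have s5 : (1 + k^-1) * (\sum_i rsq mu O ('D_(e_ i) Psi \- p i) + C ^+ 2 * rsq nu D (bot Psi \- t)) < e / 2.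
  by apply: lt_le_trans s4; rewrite ltr_pM2l// mulrDl mul1r; exact: ltr_leD.
by rewrite mulrDl mul1r -addrA ltrD2l [ltRHS]splitr; exact: ltrD.
Qed.

Lemma Gd_test_function d g : 0 < d -> d <= 1 -> test_function (Omd d) g ->
  Gd d g = (2^-1 * layer_energy d (grad g))%:E.
Proof.
move=> d0 d1 tg; have oOd : open (Omd d) by exact: open_Omega_.
have Odoo : (mu (Omd d) < +oo)%E by exact: (Omega_finite oD DL H0 cu uM HL ML).
rewrite /G_ asboolT; last first.
  split; first exact: H10_test.
  by apply: aeW => y [_ nO]; exact: test_function_out tg nO.
by rewrite (integral_layer_energy d0 d1 (in_H1_test oOd Odoo tg)).
Qed.

(** Order of the choices: [Psi] depends on [e], then [k] on [Psi], then [b] on [k], and the bound on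
    [d] comes last. The same [Psi] and [b] serve all small [d]. *)
Lemma G_upper_bound theta p t e : sqint mu OM theta -> trace_data D H u theta p t ->
  zero_off D H M O theta -> 0 < e ->
  exists2 r, 0 < r & forall d, 0 < d < r -> exists g, [/\ sqint mu OM g, rsq mu OM (g \- theta) < e &
    (Gd d g <= (2^-1 * energy p t + e)%:E)%E].
Proof.
move=> tM td z0 e0; have e2 : 0 < e / 2 by rewrite divr_gt0.
have [Psi [tPsi dPsi EPsi]] := test_function_energy_approx td e2.
have [C C0 hC] := sqrt_sigma_bounded.
set X := rsq nu D (fun x => w x * (bot Psi x + a x)).
have X0 : 0 <= X by exact: rsq_ge0.
(* Ensures [k * X <= e / 16], so that the factors [1 + k] in front of the trace energy are
   affordable. *)
pose k := Num.min 1 (e / (16 * (X + 1))).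
have k0 : 0 < k by rewrite lt_min ltr01 divr_gt0// mulr_gt0// ltr_pwDr.
have k1 : k <= 1 by rewrite ge_min lexx.
have kX : k * X <= e / 16.
  have : k <= e / (16 * (X + 1)) by rewrite ge_min lexx orbT.
  rewrite ler_pdivlMr ?mulr_gt0 ?ltr_pwDr// => hk; have : 0 <= k by exact: ltW.
  by move: hk; rewrite mulrDr mulr1; lra.
(* Accuracy of the profile for which its error, after Young's inequality, is at most [e / 16]. *)
pose z := e / (16 * ((1 + k^-1) * C ^+ 2)).
have k2 : 0 < 1 + k^-1 by rewrite addr_gt0// invr_gt0.
have C2 : 0 < C ^+ 2 by rewrite exprn_gt0.
have zz0 : 0 < z by rewrite divr_gt0// !mulr_gt0.
have [b [tb db]] := profile_dense tPsi zz0.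
have [_ ws] := weighted_slope_sqint tPsi tb.
have Y := ws k C k0 hC; rewrite -/X in Y.
have [K K0 [r /andP[r0 r1] hr]] := recovery_energy tPsi tb k0 k1.
have [K' K'0 hd] := recovery_dist tPsi tb tM z0.
pose r' := Num.min r (e / (4 * (K + K' + 1))).
have KK : 0 < 4 * (K + K' + 1) by rewrite mulr_gt0// ltr_pwDr// addr_ge0.
have r'0 : 0 < r' by rewrite lt_min r0 divr_gt0.
exists r' => // d /andP[d0]; rewrite lt_min => /andP[dr].
rewrite ltr_pdivlMr// => dK.
have d1 : d <= 1 by rewrite (le_trans (ltW dr)).
have dK1 : K * d < e / 4.
  rewrite ltr_pdivlMr//; apply: le_lt_trans dK; rewrite -mulrA mulrCA [K * 4]mulrC !ler_pM2l//.
  by rewrite -addrA lerDl addr_ge0.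
have dK2 : K' * d < e / 4.
  rewrite ltr_pdivlMr//; apply: le_lt_trans dK; rewrite -mulrA mulrCA [K' * 4]mulrC !ler_pM2l//.
  by rewrite addrAC lerDr addr_ge0.
exists (recovery Psi b d); have [dist gM] := hd d d0 d1; split => //.
  apply: le_lt_trans dist _; rewrite [ltRHS]splitr; apply: ltrD => //.
  by apply: lt_trans dK2 _; rewrite ltr_pM2l// ltf_pV2 ?posrE// ltr_nat.
rewrite (Gd_test_function d0 d1 (recovery_test tPsi tb d0 d1)) lee_fin.
have := hr d d0 (ltW dr).
set E1 := \sum_i _; set W := rsq mu (layer 1) _ in Y *.
have EE : energy (grad Psi) (bot Psi) = E1 + X by [].
rewrite EE in EPsi.
have Z : (1 + k^-1) * (C ^+ 2 * rsq mu (layer 1)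
    ('D_(e_ (rshift n ord0)) b \- profile_dz Psi)) <= e / 16.
  rewrite mulrA; apply: (@le_trans _ _ ((1 + k^-1) * C ^+ 2 * z)).
    by rewrite ler_pM2l ?mulr_gt0// ltW.
  have : 0 < (1 + k^-1) * C ^+ 2 by exact: mulr_gt0.
  rewrite /z; move: ((1 + k^-1) * _) => v v0; rewrite le_eqVlt; apply/orP; left; apply/eqP; field.
  by rewrite gt_eqF.
move=> hT; have Yk : W <= (1 + k) * X + e / 16 by apply: le_trans Y _; rewrite lerD2l.
have k01 : 0 < k <= 1 by rewrite k0.
exact: (energy_budget e0 k01 kX (rsq_ge0 _ _ _) Yk EPsi dK1 hT).
Qed.

Lemma gamma_limit : gamma_cvg (L2_nbhs OM) (L2 OM) Gd G0.
Proof.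
move=> theta /(L2P _ mOM) tM.
have lower : (G0 theta <= gamma_liminf (L2_nbhs OM) Gd theta)%E.
  apply: le_gamma_liminf => c hyp; apply: (G_lower_bound tM) => e r e0 r0.
  pose U := [set g | L2 OM g /\ (L2norm OM (g \- theta)%R < (Num.sqrt e)%:E)%E].
  have s0' : 0 < Num.sqrt e by rewrite sqrtr_gt0.
  have NU : L2_nbhs OM theta U by exists (Num.sqrt e).
  have [d [g [hd [/(L2P _ mOM) gM gt] hg]]] := hyp U r NU r0.
  exists d, g; split => //.
  by move: gt; rewrite L2norm_lt//; [rewrite sqr_sqrtr// ltW|exact: sqintB].
have upper : (gamma_limsup (L2_nbhs OM) Gd theta <= G0 theta)%E.
  apply: gamma_limsup_le => U [e e0 eU] c; rewrite {1}/G.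
  case: asboolP => [[HB z0]|//].
  have [p [t td]] := H1_B_trace_data oD DL H0 cu uH uM HL ML HB.
  have := energy_of_trace td z0; rewrite /G asboolT// => ->; rewrite lte_fin => Ec.
  pose e' := Num.min (e ^+ 2) (c - 2^-1 * energy p t).
  have e'0 : 0 < e' by rewrite lt_min exprn_gt0//= subr_gt0.
  have [r r0 hr] := G_upper_bound tM td z0 e'0.
  exists r => // d /hr[g [gM gt Gg]]; exists g.
    apply: eU; split; first exact/L2P.
    rewrite L2norm_lt//; last exact: sqintB.
    by apply: lt_le_trans gt _; rewrite ge_min lexx.
  apply: le_trans Gg _; rewrite lee_fin -lerBrDl.
  by rewrite ge_min lexx orbT.
have mid := gamma_liminf_le_limsup (L2_nbhs OM) Gd theta.
by split; apply/eqP; rewrite eq_le; apply/andP; split => //;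
  [exact: le_trans mid upper|exact: le_trans lower mid].
Qed.

End fixed_data.

Theorem theorem3p1 (R : realType) (n : nat) (D : set 'rV[R]_n) (H M : R)
    (u : 'rV[R]_n -> R) (sigma : 'rV[R]_(n + 1) -> R)
    (hb h : 'rV[R]_(n + 1 + 1) -> R) :
  (1 <= n)%N ->
  bounded_set D -> C2_domain D ->
  0 < H ->
  H10 D u -> {within closure D, continuous u} ->
  (forall x, D x -> - H <= u x) ->
  segment_property (Omega D H u) ->
  {within layer_closed D H, continuous sigma} ->
  (exists2 y0, layer_closed D H y0 &
     0 < sigma y0 /\ forall y, layer_closed D H y -> sigma y0 <= sigma y) ->
  Ck_closure 2 (dom_hb D H) hb ->
  Ck_closure 2 (dom_h D H) h ->
  (forall x w, D x -> - H <= w ->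
     hb (pt (pt x (- H)) w) = h (pt (pt x (- H)) w) /\
     sigma (pt x (- H)) *
       pderiv_closure (dom_hb D H) (idx_z n) hb (pt (pt x (- H)) w) =
     pderiv_closure (dom_h D H) (idx_z n) h (pt (pt x (- H)) w)) ->
  ('N[leb n]_(+oo)[EFin \o (u \_ D)] + H%:E <= M%:E)%E ->
  gamma_cvg (L2_nbhs (Omega_M D H M)) (L2 (Omega_M D H M))
    (G_ D H u sigma hb h M) (G D H u sigma hb h M).
Proof.
move=> _ [r [_ Dr]] C2 H0 Hu cu uH _ cs [y0 _ [s0 hs]] Chb Ch match_ uM.
have [oD _ _ _] := C2.
(* One size dominating the coordinates of [D] and all relevant heights, so that a single box serves
   in every boundedness argument. *)
pose L := `|r| + 1 + (H + 1) + `|M|.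
have Dr1 x i : D x -> `|x 0 i| <= r + 1.
  move=> Dx; have := Dr (r + 1); rewrite ltrDl => /(_ ltr01 x Dx); apply: le_trans.
  by rewrite [leRHS]/Num.norm /= mx_normrE; apply/bigmax_geP; right => /=; exists (ord0, i).
have DL x i : D x -> `|x 0 i| <= L.
  move=> Dx; apply: (le_trans (Dr1 x i Dx)); rewrite /L; have := normr_ge0 M; have := ler_norm r; lra.
have L0 : 0 <= L by rewrite /L; have := normr_ge0 M; have := normr_ge0 r; lra.
have HL : H + 1 <= L by rewrite /L; have := normr_ge0 M; have := normr_ge0 r; lra.
have ML : M <= L by rewrite /L; have := ler_norm M; have := normr_ge0 r; lra.
have Doo : (leb n D < +oo)%E by exact: (base_lty oD DL).
have uM' x : D x -> u x <= M - H.
  by apply: (le_Linfty_norm oD cu); rewrite EFinB leeBrDr.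
have u0 := H10_boundary0 oD Doo C2 Hu cu.
have [p up] := H10_approx oD Doo Hu.
have [chb [Gb hGb]] := Ck1_closureP (Ck_closureS Chb).
have [ch [Gh hGh]] := Ck1_closureP (Ck_closureS Ch).
have S : setting D H M L (sigma y0) u sigma hb h Gb Gh p.
  exact: (Setting oD DL H0 cu uH uM' HL ML u0 up chb ch (fun i => (hGb i).1) (fun i => (hGh i).1)
    (fun i => (hGb i).2) (fun i => (hGh i).2) (fun x w Dx hw => (match_ x w Dx hw).1) cs s0 hs).
exact: gamma_limit S.
Qed.
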